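(* Let $n\ge 2$, $p\in(1,+\infty)$, $p'=p/(p-1)$, and let $\Omega\subset\mathbb{R}^n$ be an open, bounded and Lipschitz set. Let $\Omega^\sharp$ be the ball centered at the origin with the same Lebesgue measure as $\Omega$. Let $f\in L^{p'}(\Omega)$ be a positive function with Schwarz rearrangement $f^\sharp$, and let $w$ and $z$ be weak solutions respectively to $$\begin{cases}-\operatorname{div}(|\nabla w|^{p-2}\nabla w)=f & \text{in }\Omega,\\ w=0 & \text{on }\partial\Omega,\end{cases}\qquad\begin{cases}-\operatorname{div}(|\nabla z|^{p-2}\nabla z)=f^\sharp & \text{in }\Omega^\sharp,\\ z=0 & \text{on }\partial\Omega^\sharp.\end{cases}$$ If $w^\sharp(x)=z(x)$ for all $x\in\Omega^\sharp$, then there exists $x_0\in\mathbb{R}^n$ such that $$\Omega=\Omega^\sharp+x_0,\qquad w(\cdot+x_0)=z(\cdot),\qquad f(\cdot+x_0)=f^\sharp(\cdot).$$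
   Context: Weak solution: $w\in W^{1,p}_0(\Omega)$ is a weak solution to the Dirichlet problem with datum $f$ if $\int_\Omega|\nabla w|^{p-2}\nabla w\cdot\nabla\varphi\,dx=\int_\Omega f\varphi\,dx$ for all $\varphi\in W^{1,p}_0(\Omega)$; similarly for $z$ in $\Omega^\sharp$ with datum $f^\sharp$. Rearrangements: for a measurable $h:\Omega\to\mathbb{R}$ the distribution function is $\mu_h(t)=|\{x\in\Omega:|h(x)|>t\}|$, $t\ge 0$; the decreasing rearrangement $h^*$ is the distribution function of $\mu_h$, i.e. $h^*(s)=|\{t\ge 0:\mu_h(t)>s\}|$ (the generalized inverse of $\mu_h$); the Schwarz rearrangement is $h^\sharp(x)=h^*(\omega_n|x|^n)$ for $x\in\Omega^\sharp$, where $\omega_n$ is the measure of the unit ball of $\mathbb{R}^n$. Equalities between functions in the conclusion are understood almost everywhere. *)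

(* Defs.v *)
From HB Require Import structures.
From mathcomp Require Import all_boot all_order all_algebra.
From mathcomp Require Import all_classical all_reals all_analysis.

Set Implicit Arguments.
Unset Strict Implicit.
Unset Printing Implicit Defensive.

Import Order.TTheory GRing.Theory Num.Theory.
Import numFieldNormedType.Exports.

Local Open Scope classical_set_scope.
Local Open Scope ring_scope.

(* R^n is 'rV[R]_n. Its library norm is the sup norm, which only serves for
   its topology; lengths are measured by the Euclidean norm enorm. *)
Definition dotv (R : realType) (n : nat) (x y : 'rV[R]_n) : R :=
  \sum_i x ord0 i * y ord0 i.

Definition enorm (R : realType) (n : nat) (x : 'rV[R]_n) : R :=
  Num.sqrt (dotv x x).

Definition eball (R : realType) (n : nat) (c : 'rV[R]_n) (r : R) :
    set 'rV[R]_n :=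
  [set x | enorm (x - c) < r].

(* Lebesgue outer measure: the infimum of the total volumes of countable covers
   by closed rectangles; None is an empty rectangle, so that finite covers
   are allowed even when n = 0. *)
Definition box (R : realType) (n : nat) (B : option ('rV[R]_n * 'rV[R]_n)) :
    set 'rV[R]_n :=
  if B is Some ab
  then [set x | forall i, ab.1 ord0 i <= x ord0 i <= ab.2 ord0 i] else set0.

Definition box_vol (R : realType) (n : nat)
    (B : option ('rV[R]_n * 'rV[R]_n)) : \bar R :=
  if B is Some ab
  then (\prod_i Num.max 0 (ab.2 ord0 i - ab.1 ord0 i))%:E else 0%E.

Definition box_cover (R : realType) (n : nat) (A : set 'rV[R]_n) :
    set (nat -> option ('rV[R]_n * 'rV[R]_n)) :=
  [set F | A `<=` \bigcup_k box (F k)].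

Definition lebesgue_outer (R : realType) (n : nat) (A : set 'rV[R]_n) :
    \bar R :=
  ereal_inf [set (\sum_(k <oo) box_vol (F k))%E | F in box_cover A].

Section lebesgue_outer_measure.
Local Open Scope ereal_scope.
Variables (R : realType) (n : nat).
Local Notation V := 'rV[R]_n.
Local Notation mu := (@lebesgue_outer R n).

Lemma box_vol_ge0 (B : option (V * V)) : 0 <= box_vol B.
Proof.
case: B => [ab|] //=; rewrite lee_fin; apply: prodr_ge0 => i _.
by rewrite le_max lexx.
Qed.

Lemma lebesgue_outer_ge0 (A : set V) : 0 <= mu A.
Proof.
apply: le_ereal_inf_tmp => x [F _ <-].
by apply: nneseries_ge0 => k _ _; exact: box_vol_ge0.
Qed.

Lemma lebesgue_outer0 : mu set0 = 0.
Proof.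
apply/eqP; rewrite eq_le lebesgue_outer_ge0 andbT.
apply: ereal_inf_lbound; exists (fun=> None); first by move=> x [].
by rewrite eseries0.
Qed.

Lemma le_lebesgue_outer : {homo mu : A B / A `<=` B >-> A <= B}.
Proof.
move=> A B AB; apply/ereal_inf_le_tmp => x [F BF <-].
by exists F => //; exact: subset_trans AB BF.
Qed.

Lemma lebesgue_outer_sigma_subadditive : sigma_subadditive mu.
Proof.
move=> A; have [[i ioo]|] := pselect (exists i, mu (A i) = +oo).
  rewrite (eseries_pinfty _ _ ioo) ?leey// => k _.
  by rewrite -ltNye (lt_le_trans _ (lebesgue_outer_ge0 _)).
rewrite -forallNE => Aoo.
suff add2e (e : {posnum R}) :
    mu (\bigcup_n A n) <= \sum_(i <oo) mu (A i) + e%:num%:E.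
  by apply/lee_addgt0Pr => _/posnumP[].
rewrite (le_trans _ (epsilon_trick _ _ _))//; last first.
  by move=> k; exact: lebesgue_outer_ge0.
pose P k F := box_cover (A k) F /\
  \sum_(j <oo) box_vol (F j) <= mu (A k) + (e%:num / (2 ^ k.+1)%:R)%:E.
have [G PG] : {G & forall k, P k (G k)}.
  apply: (@choice _ _ P) => k; rewrite /P /lebesgue_outer.
  set S := (X in ereal_inf X); move infS : (ereal_inf S) => iS.
  case: iS infS => [r Sr|Soo|Soo].
  - have en1 : (0 < e%:num / (2 ^ k.+1)%:R)%R by [].
    have /(lb_ereal_inf_adherent en1) : ereal_inf S \is a fin_num by rewrite Sr.
    move=> [x [F AF Fx] xS].
    by exists F; split => //; rewrite Fx -Sr; exact/ltW.
  - by have := Aoo k; rewrite /lebesgue_outer Soo.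
  - suff : lbound S 0 by move/le_ereal_inf_tmp; rewrite Soo.
    move=> /= _ [F _ <-].
    by apply: nneseries_ge0 => j _ _; exact: box_vol_ge0.
pose v (kj : nat * nat) := box_vol (G kj.1 kj.2).
have v_ge0 kj : 0 <= v kj by exact: box_vol_ge0.
apply: (@le_trans _ _ (\esum_(i in setT) v i)).
  apply: ereal_inf_lbound => /=.
  have /card_esym/ppcard_eqP[f] := card_nat2.
  exists (fun k => G (f k).1 (f k).2).
    move=> t [i _] /(PG i).1 [j _ Gij].
    by exists (f^-1%FUN (i, j)) => //=; rewrite invK ?inE.
  rewrite -[LHS]/(\sum_(k <oo) (v \o f) k).
  rewrite nneseries_esumT; last by move=> k; exact: v_ge0.
  rewrite [RHS](reindex_esum [set: nat] _ f)//.
rewrite (_ : esum _ _ = \sum_(i <oo) \sum_(j <oo) v (i, j)); last first.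
  rewrite nneseries_esumT; last by move=> i; apply: nneseries_ge0 => *; exact: v_ge0.
  under [RHS]eq_esum do
    (rewrite nneseries_esumT; last by move=> j; exact: v_ge0).
  rewrite esum_esum//; congr esum.
  by apply/seteqP; split=> // -[].
apply: lee_lim.
- apply: is_cvg_nneseries => k *.
  by apply: nneseries_ge0 => m *; exact: v_ge0.
- apply: is_cvg_nneseries => k *; apply: adde_ge0 => //.
  exact: lebesgue_outer_ge0.
- by apply: nearW => k; apply: lee_sum => i _; exact: (PG i).2.
Qed.

HB.instance Definition _ := isOuterMeasure.Build R V mu lebesgue_outer0
  lebesgue_outer_ge0 le_lebesgue_outer lebesgue_outer_sigma_subadditive.

End lebesgue_outer_measure.

(* The measurable sets of 'rV[R]_n are the Lebesgue measurable ones, as given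
   by Caratheodory's criterion. *)
HB.instance Definition _ (R : realType) (n : nat) :=
  Measurable.copy 'rV[R]_n (caratheodory_type (@lebesgue_outer R n)).

Definition lebesgue (R : realType) (n : nat) : set 'rV[R]_n -> \bar R :=
  @lebesgue_outer R n.
Arguments lebesgue {R n}.

HB.instance Definition _ (R : realType) (n : nat) :=
  isMeasure.Build _ 'rV[R]_n R (@lebesgue R n)
    (@caratheodory_measure0 R _ (@lebesgue_outer R n))
    (@caratheodory_measure_ge0 R _ (@lebesgue_outer R n))
    (@caratheodory_measure_sigma_additive R _ (@lebesgue_outer R n)).

(* In y = x Q coordinates, Omega is locally the strict epigraph, in the
   direction of the i-th axis, of a Lipschitz function of the n - 1 remaining
   coordinates. *)
Definition lipschitz_domain (R : realType) (n : nat) (Omega : set 'rV[R]_n) :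
    Prop :=
  forall x0, (closure Omega `\` interior Omega) x0 ->
  exists (r : R) (Q : 'M[R]_n) (i : 'I_n) (gamma : 'rV[R]_n.-1 -> R),
    [/\ 0 < r, Q *m Q^T = 1%:M,
        [lipschitz gamma y | y in [set: 'rV[R]_n.-1]] &
        forall x, eball x0 r x ->
          (Omega x <-> gamma (col' i (x *m Q)) < (x *m Q) ord0 i)].

Definition partial (R : realType) (n : nat) (i : 'I_n) (phi : 'rV[R]_n -> R) :
    'rV[R]_n -> R :=
  fun x => 'D_(delta_mx ord0 i) phi x.

Definition grad (R : realType) (n : nat) (phi : 'rV[R]_n -> R) (x : 'rV[R]_n) :
    'rV[R]_n :=
  \row_i partial i phi x.

Fixpoint Ck (R : realType) (n : nat) (k : nat) (phi : 'rV[R]_n -> R) : Prop :=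
  continuous phi /\
  if k is k'.+1 then
    forall i : 'I_n, (forall x, derivable phi x (delta_mx ord0 i)) /\
                     Ck k' (partial i phi)
  else True.

Definition test_function (R : realType) (n : nat) (Omega : set 'rV[R]_n)
    (phi : 'rV[R]_n -> R) : Prop :=
  [/\ forall k, Ck k phi, compact (closure [set x | phi x != 0]) &
      closure [set x | phi x != 0] `<=` Omega].

Definition Lp (R : realType) (n : nat) (Omega : set 'rV[R]_n) (p : R)
    (u : 'rV[R]_n -> R) : Prop :=
  measurable_fun Omega u /\
  (\int[lebesgue]_(x in Omega) (`|u x| `^ p)%:E < +oo)%E.

Definition weak_gradient (R : realType) (n : nat) (Omega : set 'rV[R]_n)
    (u : 'rV[R]_n -> R) (g : 'rV[R]_n -> 'rV[R]_n) : Prop :=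
  forall phi, test_function Omega phi -> forall i : 'I_n,
    \int[lebesgue]_(x in Omega) (u x * partial i phi x) =
    - \int[lebesgue]_(x in Omega) (g x ord0 i * phi x).

(* u is in W^{1,p}(Omega), and g is its (a.e. unique) weak gradient. *)
Definition W1p (R : realType) (n : nat) (Omega : set 'rV[R]_n) (p : R)
    (u : 'rV[R]_n -> R) (g : 'rV[R]_n -> 'rV[R]_n) : Prop :=
  [/\ Lp Omega p u, forall i : 'I_n, Lp Omega p (fun x => g x ord0 i) &
      weak_gradient Omega u g].

(* W^{1,p}_0(Omega) is the closure of the test functions in W^{1,p}(Omega). *)
Definition W1p0 (R : realType) (n : nat) (Omega : set 'rV[R]_n) (p : R)
    (u : 'rV[R]_n -> R) (g : 'rV[R]_n -> 'rV[R]_n) : Prop :=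
  W1p Omega p u g /\
  exists phi : nat -> 'rV[R]_n -> R,
    (forall k, test_function Omega (phi k)) /\
    (\int[lebesgue]_(x in Omega)
        (`|phi k x - u x| `^ p + enorm (grad (phi k) x - g x) `^ p)%:E)%E
      @[k --> \oo] --> 0%E.

(* When p < 2 and g x = 0, the integrand on the left vanishes because of the
   factor dotv (g x) (psi x). *)
Definition weak_solution (R : realType) (n : nat) (Omega : set 'rV[R]_n)
    (p : R) (f w : 'rV[R]_n -> R) : Prop :=
  exists2 g, W1p0 Omega p w g &
    forall phi psi, W1p0 Omega p phi psi ->
      \int[lebesgue]_(x in Omega)
        (enorm (g x) `^ (p - 2) * dotv (g x) (psi x)) =
      \int[lebesgue]_(x in Omega) (f x * phi x).

Definition distribution_fun (R : realType) (n : nat) (Omega : set 'rV[R]_n)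
    (h : 'rV[R]_n -> R) (t : R) : \bar R :=
  lebesgue (Omega `&` [set x | t < `|h x|]).

Definition decreasing_rearrangement (R : realType) (n : nat)
    (Omega : set 'rV[R]_n) (h : 'rV[R]_n -> R) (s : R) : \bar R :=
  lebesgue_measure [set t : R | 0 <= t /\ (s%:E < distribution_fun Omega h t)%E].

Definition unit_ball_volume (R : realType) (n : nat) : R :=
  fine (lebesgue (eball (0 : 'rV[R]_n) 1)).

(* If h is measurable and Omega has finite measure, only the value at 0 of the
   extended real rearrangement may be infinite; fine then makes it 0. *)
Definition schwarz (R : realType) (n : nat) (Omega : set 'rV[R]_n)
    (h : 'rV[R]_n -> R) (x : 'rV[R]_n) : R :=
  fine (decreasing_rearrangement Omega h
          (unit_ball_volume R n * enorm x ^+ n)).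

(* Main.v *)
Require Import Defs.
From HB Require Import structures.
From mathcomp Require Import all_boot all_order all_algebra.
From mathcomp Require Import all_classical all_reals all_analysis.
From mathcomp Require Import measurable_realfun.
From mathcomp Require Import ring lra.

(* Write Z for the radial profile of |w|^sharp = z, so that {Z b < |w| < Z a} is the
   band corresponding to the shell a < |x| < b, and M r for the integral of f^sharp
   on the ball of radius r; radially, n omega_n r^(n-1) |Z'|^(p-1) = M.  By
   Hardy-Littlewood, the integral of |grad w|^p, which is that of f w, is at most
   that of f^sharp z, which is that of |grad z|^p =: e.  Conversely, on each band
   the isoperimetric inequality (Brunn-Minkowski) bounds the integral of |grad w|
   from below by n omega_n a^(n-1) (Z a - Z b).  Comparing |grad w|^p with its
   tangent at the slope of Z, and summing over finer and finer bands, shows that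
   all these inequalities are equalities: the bands have the measures of the
   shells, and |grad w| is the slope of Z almost everywhere.  Then every
   truncation of |w| between two levels is Lipschitz with the slope of Z as
   constant, so that {|w| >= Z a} translated by less than b - a lies in
   {|w| >= Z b}.  The set {|w| >= Z r} having the measure of a ball of radius r
   for all r, a Steinhaus argument forces these sets to be concentric balls.  The
   equality in Hardy-Littlewood makes the superlevel sets of f nested with those
   of w, hence balls with the same center; f w = |f w| gives the sign of w.
   Finally, an open set with a Lipschitz boundary is determined by its class
   modulo null sets. *)

Set Implicit Arguments.
Unset Strict Implicit.
Unset Printing Implicit Defensive.

Import Order.TTheory GRing.Theory Num.Theory.
Import numFieldNormedType.Exports.

Local Open Scope classical_set_scope.
Local Open Scope ring_scope.

(** * Lebesgue measure of boxes and balls *)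

Section boxes.
Variables (R : realType) (n : nat).
Local Notation V := 'rV[R]_n.

(** The profile [Z] is only known to be nonincreasing, so it is never differentiated. On a shell its
    slope is enclosed between [kap] and [kmax], which depend on f only through [M] and whose ratio
    tends to 1 on short shells. The equation of z serves twice: tested with z it gives the total
    energy, tested with radial plateaus it bounds the energy of each shell from below
    ([flux_energy]). Perimeters enter through volumes of e-neighbourhoods of superlevel sets,
    compared with e times a gradient integral. This is done for test functions and then passed to
    the limit, so that single level sets of |w| are out of reach and equality has to be exploited
    through sums over bands. Rigidity then comes from two opposite estimates on short bands: |w|
    varies at rate at most [kmax], while [Z] drops at rate at least about [kap] ([drop_lo]).
    Positivity of f makes [M] and [kap] positive, which excludes plateaus of [Z]. The strict
    inequality between the length of a translation and the difference of radii leaves the room that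
    absorbs the ratio of [kmax] to [kap]. *)

Definition bvol (ab : V * V) : R :=
  \prod_i Num.max 0 (ab.2 ord0 i - ab.1 ord0 i).

Definition cut_lo (i : 'I_n) (c : R) (ab : V * V) : V * V :=
  (ab.1, \row_j if j == i then Num.min (ab.2 ord0 j) c else ab.2 ord0 j).

Definition cut_hi (i : 'I_n) (c : R) (ab : V * V) : V * V :=
  (\row_j if j == i then Num.max (ab.1 ord0 j) c else ab.1 ord0 j, ab.2).

Lemma bvol_ge0 ab : 0 <= bvol ab.
Proof. by apply: prodr_ge0 => i _; rewrite le_max lexx. Qed.

(** The maximum with 0 in [bvol] lets [c] be arbitrary: when the hyperplane misses the box, one
    piece is inverted and counts for 0. *)
Lemma bvol_cut i c ab : bvol (cut_lo i c ab) + bvol (cut_hi i c ab) = bvol ab.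
Proof.
rewrite /bvol (bigD1 i)//= [X in _ + X](bigD1 i)//= [RHS](bigD1 i)//=.
rewrite !mxE eqxx.
have -> : \prod_(j < n | j != i) Num.max 0
    ((\row_j0 (if j0 == i then Num.min (ab.2 ord0 j0) c else ab.2 ord0 j0))
       ord0 j - ab.1 ord0 j) =
  \prod_(j < n | j != i) Num.max 0 (ab.2 ord0 j - ab.1 ord0 j).
  by apply: eq_bigr => j /negbTE ji; rewrite mxE ji.
have -> : \prod_(j < n | j != i) Num.max 0 (ab.2 ord0 j -
    (\row_j0 (if j0 == i then Num.max (ab.1 ord0 j0) c else ab.1 ord0 j0))
       ord0 j) =
  \prod_(j < n | j != i) Num.max 0 (ab.2 ord0 j - ab.1 ord0 j).
  by apply: eq_bigr => j /negbTE ji; rewrite mxE ji.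
rewrite -mulrDl; congr (_ * _).
rewrite /Num.max /Num.min; do ![case: ifPn => //]; rewrite -?leNgt => *; lra.
Qed.

(** By Caratheodory's criterion this is a statement on covers: cutting every box of a cover of [X]
    along the hyperplane gives covers of the two parts of [X] with the same total volume. *)
Lemma measurable_halfspace (i : 'I_n) (c : R) :
  measurable [set x : V | x ord0 i <= c].
Proof.
apply: (@le_caratheodory_measurable _ _ (@lebesgue_outer R n)) => X.
apply: le_ereal_inf_tmp => _ [F XF <-].
pose F1 k := omap (cut_lo i c) (F k); pose F2 k := omap (cut_hi i c) (F k).
have bv k : box_vol (F k) = (box_vol (F1 k) + box_vol (F2 k))%E.
  rewrite /F1 /F2; case: (F k) => [ab|] /=; last by rewrite adde0.
  by rewrite -[X in X%:E = _]/(bvol ab) -(bvol_cut i c ab) EFinD.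
rewrite (eq_eseriesr (fun k _ => bv k)) nneseriesD; last 2 first.
  by move=> k _ _; exact: box_vol_ge0.
  by move=> k _ _; exact: box_vol_ge0.
apply: leeD; apply: ereal_inf_lbound; [exists F1 => //|exists F2 => //].
- move=> x [Xx /= xc]; have [k _] := XF _ Xx.
  rewrite /F1; move=> Fkx; exists k => //=.
  case: (F k) Fkx => //= ab h j; rewrite mxE; case: eqP => [->|_]; last exact: h.
  by case/andP: (h i) => -> /=; rewrite le_min xc andbT.
- move=> x [Xx /= /negP]; rewrite -ltNge => /ltW xc; have [k _] := XF _ Xx.
  move=> Fkx; exists k => //=; rewrite /F2.
  case: (F k) Fkx => //= ab h j; rewrite mxE; case: eqP => [->|_]; last exact: h.
  by case/andP: (h i) => + -> /=; rewrite andbT ge_max xc => ->.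
Qed.

End boxes.

Section box_lower_bound.
Variable R : realType.

Let tl n (x : 'rV[R]_n.+1) : 'rV[R]_n := \row_j x ord0 (lift ord0 j).
Let cons n (s : R) (y : 'rV[R]_n) : 'rV[R]_n.+1 :=
  \row_i if unlift ord0 i is Some j then y ord0 j else s.

(** Induction on the dimension by slicing along the first coordinate: each slice of the box is
    covered by the slices of the covering boxes, and the inequality between slices is integrated
    against the one-dimensional Lebesgue measure, the sum leaving the integral by monotone
    convergence. *)
Lemma box_vol_le_cover n (B : option ('rV[R]_n * 'rV[R]_n)) F :
  box B `<=` \bigcup_k box (F k) -> (box_vol B <= \sum_(k <oo) box_vol (F k))%E.
Proof.
elim: n B F => [|n IH] [[a b]|] F BF; last 2 first.
- have [ab|ba] := leP (a ord0 ord0) (b ord0 ord0); last first.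
    rewrite /= big_ord_recl max_l ?mul0r; last by rewrite subr_le0 ltW.
    by apply: nneseries_ge0 => k _ _; exact: box_vol_ge0.
  pose G (s : R) k := if F k is Some cd then
    if (cd.1 ord0 ord0 <= s <= cd.2 ord0 ord0) then Some (tl cd.1, tl cd.2)
    else None else None.
  have BG s : s \in `[a ord0 ord0, b ord0 ord0] ->
      (box_vol (Some (tl a, tl b)) <= \sum_(k <oo) box_vol (G s k))%E.
    rewrite in_itv/= => sab; apply: (IH (Some (tl a, tl b)) (G s)) => y yB.
    have : box (Some (a, b)) (cons s y).
      move=> i /=; rewrite mxE; case: unliftP => [j ->|->//].
      by have := yB j; rewrite /= !mxE.
    move=> /BF[k _ Fk]; exists k => //; rewrite /G.
    case: (F k) Fk => //= cd h; have := h ord0; rewrite mxE unlift_none => ->.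
    by move=> j; have := h (lift ord0 j); rewrite !mxE liftK.
  pose g k := if F k is Some cd then (bvol (tl cd.1, tl cd.2)) else 0.
  pose I k := if F k is Some cd then `[cd.1 ord0 ord0, cd.2 ord0 ord0]%classic
    else set0 : set R.
  have volG s k : box_vol (G s k) = ((g k)%:E * (\1_(I k) s)%:E)%E.
    rewrite /G /g /I; case: (F k) => [cd|] /=; last by rewrite mul0e.
    rewrite indicE; case: ifPn => h.
      by rewrite mem_set ?mule1//= in_itv.
    by rewrite memNset ?mule0//= in_itv/=; exact/negP.
  have mI k : measurable (I k) by rewrite /I; case: (F k).
  have g0 k : 0 <= g k by rewrite /g; case: (F k) => // cd; exact: bvol_ge0.
  have volcons (c d : 'rV[R]_n.+1) : bvol (c, d) =
      Num.max 0 (d ord0 ord0 - c ord0 ord0) * bvol (tl c, tl d).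
    rewrite /bvol big_ord_recl; congr (_ * _).
    by apply: eq_bigr => i _; rewrite /= !mxE.
  apply: (@le_trans _ _ (\int[lebesgue_measure]_(s in
      `[a ord0 ord0, b ord0 ord0]) box_vol (Some (tl a, tl b)))%E).
    rewrite integral_cst//= lebesgue_measure_itv/= lte_fin.
    rewrite -[X in (X%:E <= _)%E]/(bvol (a, b)) volcons.
    rewrite -[X in (_ <= X%:E * _)%E]/(bvol (tl a, tl b)) mulrC.
    case: ifPn => ab'; first by rewrite -EFinB -EFinM max_r// subr_ge0.
    have -> : a ord0 ord0 = b ord0 ord0.
      by apply/eqP; rewrite eq_le ab leNgt.
    by rewrite subrr maxxx mulr0 mule0.
  apply: (@le_trans _ _ (\int[lebesgue_measure]_(s in
      `[a ord0 ord0, b ord0 ord0]) \sum_(k <oo) ((g k)%:E * (\1_(I k) s)%:E))%E).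
    apply: ge0_le_integral => //.
    + by move=> s _; exact: box_vol_ge0.
    + apply: ge0_emeasurable_sum => // k.
      by move=> s _ _; rewrite mule_ge0 ?lee_fin.
      move=> _; apply/measurable_EFinP; apply: measurable_funM => //; exact: measurable_indic (mI k).
    + move=> s sab; apply: le_trans (BG s _) _ => //.
      by rewrite (eq_eseriesr (fun k _ => volG s k)).
  rewrite integral_nneseries//; last 2 first.
  + move=> k; apply/measurable_EFinP; apply: measurable_funM => //; exact: measurable_indic (mI k).
  + by move=> k s _; rewrite mule_ge0 ?lee_fin.
  apply: lee_nneseries => [k _ _|k _].
    by apply: integral_ge0 => s _; rewrite mule_ge0 ?lee_fin.
  rewrite ge0_integralZl_EFin//; last first.
    by apply/measurable_EFinP; exact: measurable_indic (mI k).
  have -> : (\int[lebesgue_measure]_(x in `[a ord0 ord0, b ord0 ord0]) (\1_(I k) x)%:E = lebesgue_measure (I k `&` `[a ord0 ord0, b ord0 ord0]))%E.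
    by rewrite integral_indic//; exact: mI.
  rewrite /g /I; case: (F k) => [[c d]|] /=; last first.
    by rewrite mul0e.
  rewrite -[X in (_ <= X%:E)%E]/(bvol (c, d)) volcons mulrC EFinM.
  apply: lee_wpmul2l; first by rewrite lee_fin bvol_ge0.
  apply: (@le_trans _ _ (lebesgue_measure `[c ord0 ord0, d ord0 ord0])).
    by apply: le_measure; rewrite ?inE//; first [exact: subIsetl|exact: measurableI].
  rewrite lebesgue_measure_itv/= lte_fin; case: ifPn => cd'.
    by rewrite -EFinB lee_fin le_max lexx orbT.
  by rewrite lee_fin le_max lexx.
- by apply: nneseries_ge0 => k _ _; exact: box_vol_ge0.
(* In dimension 0 a box is the single point, of volume 1 as an empty product, so one nonempty box in
   the cover is enough. *)
- have /BF[k _] : box (Some (a, b)) a by case.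
  case Fk : (F k) => [cd|]// _.
  apply: le_trans (nneseries_lim_ge k.+1 _); last first.
    by move=> j _ _; exact: box_vol_ge0.
  rewrite big_mkord big_ord_recr/= Fk /= !big_ord0 leeDr//.
  by apply: sume_ge0 => j _; exact: box_vol_ge0.
- by apply: nneseries_ge0 => k _ _; exact: box_vol_ge0.
Qed.

End box_lower_bound.

Section box_measure.
Variables (R : realType) (n : nat).
Local Notation V := 'rV[R]_n.
Local Notation mu := (@lebesgue R n).

Lemma lebesgue_box (a b : V) : mu (box (Some (a, b))) = (bvol (a, b))%:E.
Proof.
apply/eqP; rewrite eq_le; apply/andP; split.
  apply: ereal_inf_lbound.
  exists (fun k => if k == 0%N then Some (a, b) else None).
    by move=> x Bx; exists 0%N.
  rewrite (nneseriesD1 (n := 0%N))//=; last by move=> k _; exact: box_vol_ge0.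
  by rewrite eseries0 ?adde0// => -[].
by apply: le_ereal_inf_tmp => _ [F BF <-]; exact: (@box_vol_le_cover R n (Some (a, b)) F).
Qed.

Lemma measurable_coord (i : 'I_n) : measurable_fun setT (fun x : V => x ord0 i).
Proof.
apply: (measurability _ (RGenInftyO.measurableE R)) => //.
move=> _ [_ [c ->] <-].
rewrite setTI (_ : _ @^-1` _ = \bigcup_k [set x : V | x ord0 i <= c - k.+1%:R^-1]).
  by apply: bigcupT_measurable => k; exact: measurable_halfspace.
apply/seteqP; split => [x /=|x [k _] /=]; rewrite in_itv/=; last first.
  by move/le_lt_trans; apply; rewrite ltrBlDr ltrDl invr_gt0.
move=> xc; have : 0 < c - x ord0 i by rewrite subr_gt0.
move=> /ltr_add_invr[k].
by rewrite add0r => /ltW h; exists k => //=; rewrite lerBrDr addrC -lerBrDr.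
Qed.

Definition affine (l : R) (h : V) (x : V) : V := l *: x + h.

Lemma lebesgue_affine_le (l : R) (h : V) (A : set V) : 0 < l ->
  (mu (affine l h @` A) <= (l ^+ n)%:E * mu A)%E.
Proof.
move=> l0; have ln0 : 0 < l ^+ n by rewrite exprn_gt0.
rewrite -lee_pdivrMl//; apply: le_ereal_inf_tmp => _ [F AF <-].
rewrite lee_pdivrMl// -nneseriesZl; last by move=> k _; exact: box_vol_ge0.
have -> : (\sum_(k <oo) ((l ^+ n)%:E * box_vol (F k)) =
  \sum_(k <oo) box_vol (omap (fun ab => (affine l h ab.1, affine l h ab.2)) (F k)))%E.
  apply: eq_eseriesr => k _; case: (F k) => [[a b]|] /=; last by rewrite mule0.
  rewrite -EFinM; congr (_%:E); rewrite -[n in l ^+ n]card_ord -prodr_const.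
  rewrite -big_split/=; apply: eq_bigr => i _.
  rewrite /affine !mxE maxr_pMr ?ltW// mulr0; congr (Num.max _ _); ring.
apply: ereal_inf_lbound.
exists (fun k => omap (fun ab => (affine l h ab.1, affine l h ab.2)) (F k)) => //.
move=> _ [x Ax <-]; have [k _ Fk] := AF _ Ax; exists k => //.
case: (F k) Fk => // -[a b] /= ab i.
by rewrite !mxE !lerD2r !ler_pM2l.
Qed.

Lemma affineK (l : R) (h : V) : l != 0 -> cancel (affine l h) (affine l^-1 (- (l^-1 *: h))).
Proof.
by move=> l0 x; rewrite /affine scalerDr scalerA mulVf// scale1r addrK.
Qed.

Lemma affineVK (l : R) (h : V) : l != 0 -> cancel (affine l^-1 (- (l^-1 *: h))) (affine l h).
Proof.
by move=> l0 x; rewrite /affine scalerDr scalerN !scalerA divff// !scale1r subrK.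
Qed.

Lemma affine_image (l : R) (h : V) (A : set V) : l != 0 ->
  affine l h @` A = affine l^-1 (- (l^-1 *: h)) @^-1` A.
Proof.
move=> l0; apply/seteqP; split => [_ [x Ax <-] /=|x Ax]; first by rewrite affineK.
by exists (affine l^-1 (- (l^-1 *: h)) x) => //; rewrite affineVK.
Qed.

Lemma lebesgue_affine (l : R) (h : V) (A : set V) : 0 < l ->
  mu (affine l h @` A) = ((l ^+ n)%:E * mu A)%E.
Proof.
move=> l0; apply/eqP; rewrite eq_le lebesgue_affine_le//=.
have ln0 : 0 < l ^+ n by rewrite exprn_gt0.
have lN0 : l != 0 by rewrite gt_eqF.
rewrite -lee_pdivlMl//.
have {1}-> : A = affine l^-1 (- (l^-1 *: h)) @` (affine l h @` A).
  apply/seteqP; split => [x Ax|_ [_ [x Ax <-] <-]]; last by rewrite affineK.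
  by exists (affine l h x); [exists x|exact: affineK].
by rewrite -exprVn; apply: lebesgue_affine_le; rewrite invr_gt0.
Qed.

Lemma measurable_affine (l : R) (h : V) (A : set V) : 0 < l ->
  measurable A -> measurable (affine l h @` A).
Proof.
move=> l0 mA.
suff : caratheodory_measurable (@lebesgue_outer R n) (affine l h @` A) by [].
move=> X.
have lN0 : l != 0 by rewrite gt_eqF.
set g := affine l^-1 (- (l^-1 *: h)).
have XE : X = affine l h @` (g @` X).
  apply/seteqP; split => [x Ax|_ [_ [x Ax <-] <-]]; last by rewrite /g affineVK.
  by exists (g x); [exists x|exact: affineVK].
have inj : injective (affine l h) by exact: can_inj (affineK h lN0).
have E1 : X `&` affine l h @` A = affine l h @` (g @` X `&` A).
  rewrite {1}XE; apply/seteqP; split => [_ [[x gx <-] [y Ay /inj yx]]|_ [x [gx Ax] <-]].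
    by exists x => //; split => //; rewrite -yx.
  by split; exists x.
have E2 : X `&` ~` (affine l h @` A) = affine l h @` (g @` X `&` ~` A).
  rewrite {1}XE; apply/seteqP; split => [_ [[x gx <-] nA]|_ [x [gx Ax] <-]].
    by exists x => //; split => // Ax; apply: nA; exists x.
  by split; [exists x|move=> [y Ay /inj yx]; apply: Ax; rewrite -yx].
have -> : lebesgue_outer X = ((l ^+ n)%:E * mu (g @` X))%E.
  by rewrite {1}XE -[LHS]/(mu _) (lebesgue_affine h _ l0).
rewrite E1 E2 -![lebesgue_outer _]/(mu _) !(lebesgue_affine h _ l0).
rewrite -ge0_muleDr; last 2 first.
- exact: lebesgue_outer_ge0.
- exact: lebesgue_outer_ge0.
by congr (_ * _)%E; exact: mA.
Qed.

Lemma measurable_fun_affine (l : R) (h : V) : 0 < l ->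
  measurable_fun setT (affine l h).
Proof.
move=> l0 _ A mA; rewrite setTI.
have -> : affine l h @^-1` A = affine l^-1 (- (l^-1 *: h)) @` A.
  rewrite affine_image ?invr_eq0 ?gt_eqF// invrK scalerN opprK.
  by rewrite scalerA divff ?gt_eqF// scale1r.
by apply: measurable_affine => //; rewrite invr_gt0.
Qed.

End box_measure.

(** * Euclidean norm, and its comparison with the sup norm *)

Section euclidean.
Variables (R : realType) (n : nat).
Local Notation V := 'rV[R]_n.
Implicit Types x y z : V.

Lemma dotvC x y : dotv x y = dotv y x.
Proof. by apply: eq_bigr => i _; rewrite mulrC. Qed.

Lemma dotvDl x y z : dotv (x + y) z = dotv x z + dotv y z.
Proof. by rewrite -big_split; apply: eq_bigr => i _; rewrite !mxE mulrDl. Qed.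

Lemma dotvZl (a : R) x y : dotv (a *: x) y = a * dotv x y.
Proof. by rewrite mulr_sumr; apply: eq_bigr => i _; rewrite !mxE mulrA. Qed.

Lemma dotvDr x y z : dotv x (y + z) = dotv x y + dotv x z.
Proof. by rewrite dotvC dotvDl !(dotvC x). Qed.

Lemma dotvZr (a : R) x y : dotv x (a *: y) = a * dotv x y.
Proof. by rewrite dotvC dotvZl dotvC. Qed.

Lemma dotv_ge0 x : 0 <= dotv x x.
Proof. by apply: sumr_ge0 => i _; rewrite -expr2 sqr_ge0. Qed.

Lemma enorm_ge0 x : 0 <= enorm x.
Proof. exact: sqrtr_ge0. Qed.

Lemma sqr_enorm x : enorm x ^+ 2 = dotv x x.
Proof. by rewrite sqr_sqrtr // dotv_ge0. Qed.

Lemma coord_le_enorm x i : `|x ord0 i| <= enorm x.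
Proof.
rewrite -(@ler_pXn2r _ 2)// ?nnegrE ?enorm_ge0// sqr_enorm real_normK ?num_real//.
rewrite /dotv (bigD1 i)//= -expr2 lerDl.
by apply: sumr_ge0 => j _; rewrite -expr2 sqr_ge0.
Qed.

Lemma enorm0 : enorm (0 : V) = 0.
Proof. by rewrite /enorm /dotv big1 ?sqrtr0// => i _; rewrite mxE mul0r. Qed.

Lemma enorm0_eq0 x : enorm x = 0 -> x = 0.
Proof.
move=> x0; apply/rowP => i; apply/eqP; rewrite mxE -normr_le0 -x0.
exact: coord_le_enorm.
Qed.

Lemma enormZ (a : R) x : enorm (a *: x) = `|a| * enorm x.
Proof.
by rewrite /enorm dotvZl dotvZr mulrA -expr2 sqrtrM ?sqr_ge0// sqrtr_sqr.
Qed.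

Lemma enormN x : enorm (- x) = enorm x.
Proof. by rewrite -scaleN1r enormZ normrN1 mul1r. Qed.

Lemma enormBC x y : enorm (x - y) = enorm (y - x).
Proof. by rewrite -enormN opprB. Qed.

(** Cauchy-Schwarz, from the nonnegative square of |y|^2 x - (x.y) y, a multiple of the component of
    x orthogonal to y. *)
Lemma dotv_le_enorm x y : dotv x y <= enorm x * enorm y.
Proof.
have [/enorm0_eq0 ->|y0] := eqVneq (enorm y) 0.
  rewrite enorm0 mulr0 dotvC -(scale0r (0 : V)) dotvZl mul0r//.
have yp : 0 < enorm y by rewrite lt_def y0 enorm_ge0.
have := dotv_ge0 (enorm y ^+ 2 *: x + (- dotv x y) *: y).
rewrite !(dotvDl, dotvDr, dotvZl, dotvZr) -!sqr_enorm (dotvC y x).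
set a := enorm x; set b := enorm y; set c := dotv x y => h.
have {}h : 0 <= b ^+ 2 * ((a * b) ^+ 2 - c ^+ 2) by move: h; congr (_ <= _); ring.
have : 0 <= (a * b) ^+ 2 - c ^+ 2 by rewrite -(pmulr_rge0 _ (exprn_gt0 2 yp)).
rewrite subr_ge0 -[X in X <= _]real_normK ?num_real// ler_pXn2r// ?nnegrE ?mulr_ge0 ?enorm_ge0//.
exact: le_trans (ler_norm _).
Qed.

Lemma norm_dotv x y : `|dotv x y| <= enorm x * enorm y.
Proof.
rewrite ler_norml dotv_le_enorm andbT lerNl.
by rewrite -mulN1r -dotvZl scaleN1r -(enormN x) dotv_le_enorm.
Qed.

Lemma enormD x y : enorm (x + y) <= enorm x + enorm y.
Proof.
rewrite -(@ler_pXn2r _ 2)// ?nnegrE ?addr_ge0 ?enorm_ge0// sqr_enorm.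
rewrite dotvDl !dotvDr -!sqr_enorm (dotvC y x).
have := dotv_le_enorm x y; nra.
Qed.

Lemma enormB_le x y z : enorm (x - z) <= enorm (x - y) + enorm (y - z).
Proof. by rewrite -[x - z](_ : (x - y) + (y - z) = _) ?enormD// addrA subrK. Qed.

Lemma enormB_norm x y : `|enorm x - enorm y| <= enorm (x - y).
Proof.
rewrite ler_norml lerNl opprB !lerBlDr; apply/andP; split.
  by have := enormD (y - x) x; rewrite subrK enormBC.
by rewrite (le_trans _ (enormD _ _))// subrK.
Qed.

Lemma enorm_le_sum x : enorm x <= \sum_i `|x ord0 i|.
Proof.
rewrite -(@ler_pXn2r _ 2)// ?nnegrE ?enorm_ge0 ?sumr_ge0// sqr_enorm.
rewrite expr2 mulr_sumr; apply: ler_sum => i _.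
rewrite -expr2 -[X in X <= _]real_normK ?num_real// expr2 ler_wpM2r//.
by rewrite (bigD1 i)//= lerDl sumr_ge0.
Qed.

Lemma enorm_le_coord x (e : R) : (forall i, `|x ord0 i| <= e) ->
  enorm x <= n%:R * e.
Proof.
move=> h; apply: le_trans (enorm_le_sum x) _.
rewrite -[n in n%:R]card_ord -sum1_card natr_sum mulr_suml.
by apply: ler_sum => i _; rewrite mul1r.
Qed.

Lemma rV_ballP x (e : R) y : 0 < e ->
  ball x e y <-> forall i, `|x ord0 i - y ord0 i| < e.
Proof.
move=> e0; split => [[_ h] i|h]; first exact: h.
by split => // i j; rewrite ord1; exact: h.
Qed.

Lemma eball_sub_ball x (e : R) : 0 < e -> eball x e `<=` ball x e.
Proof.
move=> e0 y yx; apply/rV_ballP => // i; apply: le_lt_trans yx.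
by rewrite -enormN opprB -[X in `|X|](_ : (x - y) ord0 i = _) ?coord_le_enorm// !mxE.
Qed.

(** The Euclidean norm is at most n times the sup norm; dividing by [n.+1] keeps the inequality
    strict and also covers n = 0. *)
Lemma ball_sub_eball x (e : R) : 0 < e -> ball x (e / n.+1%:R) `<=` eball x e.
Proof.
move=> e0 y /rV_ballP h.
have en : 0 < e / n.+1%:R by rewrite divr_gt0.
have {}h := h en.
apply: (@le_lt_trans _ _ (n%:R * (e / n.+1%:R))).
  apply: enorm_le_coord => i; rewrite !mxE distrC; exact/ltW.
by rewrite mulrA ltr_pdivrMr// mulrC ltr_pM2l// ltr_nat.
Qed.

Lemma enorm_continuous : continuous (@enorm R n : V -> R).
Proof.
move=> x; apply/(@cvgrPdist_lt _ _ _ (nbhs (x : V))) => e e0.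
apply/nbhs_ballP; exists (e / n.+1%:R) => /=; first by rewrite divr_gt0.
move=> y /(ball_sub_eball e0); rewrite /eball/= => h.
by apply: le_lt_trans (enormB_norm _ _) _; rewrite enormBC.
Qed.

Lemma open_eball x (e : R) : open (eball x e).
Proof.
rewrite openE => y /= yx; apply/nbhs_ballP.
exists ((e - enorm (y - x)) / n.+1%:R) => /=.
  by rewrite divr_gt0// subr_gt0.
move=> z; have h : 0 < e - enorm (y - x) by rewrite subr_gt0.
move=> /(ball_sub_eball h); rewrite /eball/= ltrBrDr.
exact: le_lt_trans (enormB_le _ _ _).
Qed.

Lemma open_eballP (A : set V) : open A <->
  forall x, A x -> exists2 e, 0 < e & eball x e `<=` A.
Proof.
split => [oA x Ax|h].
  have /nbhs_ballP[e /= e0 eA] : nbhs x A by exact: open_nbhs_nbhs.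
  exists e => // y yx; apply: eA; exact: eball_sub_ball.
rewrite openE => x /h[e e0 eA].
apply/nbhs_ballP; exists (e / n.+1%:R) => /=; first by rewrite divr_gt0.
exact: subset_trans (ball_sub_eball e0) eA.
Qed.

Lemma eball_translate (c h : V) (r : R) :
  [set x + h | x in eball c r] = eball (c + h) r.
Proof.
apply/seteqP; split => [_ [x xc <-]|x xc].
  by rewrite /eball/= opprD addrACA subrr addr0.
exists (x - h); last by rewrite subrK.
by rewrite /eball/= -addrA -opprD (addrC h).
Qed.

End euclidean.

(** * Inner approximation of open sets by cells of a grid *)

Section grid.
Variables (R : realType) (n : nat).
Local Notation V := 'rV[R]_n.
Local Notation mu := (@lebesgue R n).

(** Stage [k] cuts the cube [-(k+1), k+1)^n into half-open cells of side 1/(k+1), hence 2 (k+1)^2 of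
    them along each axis: the cube grows while the mesh shrinks. *)
Definition gidx (k : nat) := {ffun 'I_n -> 'I_(2 * (k.+1 * k.+1))}.

Definition glo k (j : gidx k) : V :=
  \row_i ((j i)%:R / k.+1%:R - k.+1%:R).

Definition ghi k (j : gidx k) : V :=
  \row_i ((j i).+1%:R / k.+1%:R - k.+1%:R).

Definition gcell k (j : gidx k) : set V :=
  [set x | forall i, glo j ord0 i <= x ord0 i < ghi j ord0 i].

Lemma gcell_ex k (x : V) : (forall i, - k.+1%:R <= x ord0 i < k.+1%:R) ->
  exists j : gidx k, gcell j x.
Proof.
move=> h.
have K0 : 0 < k.+1%:R :> R by rewrite ltr0n.
have h1 i : 0 <= (x ord0 i + k.+1%:R) * k.+1%:R.
  by rewrite mulr_ge0// -lerBlDr sub0r; case/andP: (h i).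
have h2 i : (Num.truncn ((x ord0 i + k.+1%:R) * k.+1%:R) < 2 * (k.+1 * k.+1))%N.
  rewrite truncn_lt_nat// !natrM mulrA ltr_pM2r// mulr_natl mulr2n ltrD2r.
  by case/andP: (h i).
exists [ffun i => Ordinal (h2 i)] => i; rewrite !mxE !ffunE/=.
have /andP[t1 t2] := truncn_itv (h1 i).
by rewrite lerBlDr ltrBrDr ler_pdivrMr// ltr_pdivlMr// t1 t2.
Qed.

Lemma measurable_coord_lt (i : 'I_n) (c : R) : measurable [set x : V | x ord0 i < c].
Proof.
have := measurable_coord i measurableT (measurable_itv `]-oo, c[).
by rewrite setTI; congr (measurable _); apply/seteqP; split => x /=; rewrite in_itv.
Qed.

Lemma measurable_gcell k (j : gidx k) : measurable (gcell j).
Proof.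
rewrite (_ : gcell j = \bigcap_(i in [set: 'I_n])
  ([set x | x ord0 i < ghi j ord0 i] `\` [set x | x ord0 i < glo j ord0 i])).
  apply: fin_bigcap_measurable => // i _.
  by apply: measurableD; exact: measurable_coord_lt.
apply/seteqP; split => [x xj i _|x xj i].
  by have /andP[a b] := xj i; split => //=; apply/negP; rewrite -leNgt.
by have [a /negP b] := xj i I; rewrite leNgt b.
Qed.

Definition ginner (O : set V) k : set V :=
  \bigcup_(j in [set j : gidx k | gcell j `<=` O]) gcell j.

Lemma measurable_ginner O k : measurable (ginner O k).
Proof. by apply: fin_bigcup_measurable => [|j _]; [exact: finite_finset|exact: measurable_gcell]. Qed.

Lemma ginner_sub O k : ginner O k `<=` O.
Proof. by move=> x [j jO jx]; exact: jO. Qed.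

Lemma ginner_ex O x : open O -> O x ->
  exists k0, forall k, (k0 <= k)%N -> ginner O k x.
Proof.
move=> oO Ox.
have /nbhs_ballP[e /= e0 eO] : nbhs x O by exact: open_nbhs_nbhs.
have [k1 k1e] := ltr_add_invr e0; rewrite add0r in k1e.
pose B := \sum_i `|x ord0 i|.
exists (maxn k1 (Num.truncn B)) => k; rewrite geq_max => /andP[k1k Bk].
have K0 : 0 < k.+1%:R :> R by rewrite ltr0n.
have Bk' : B < k.+1%:R.
  apply: (lt_le_trans (truncnS_gt _)); by rewrite ler_nat.
have [|j jx] := @gcell_ex k x.
  move=> i; have : `|x ord0 i| < k.+1%:R.
    apply: le_lt_trans Bk'; rewrite /B (bigD1 i)//= lerDl; exact: sumr_ge0.
  by rewrite ltr_norml => /andP[/ltW -> ->].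
exists j => // y jy; apply: eO; apply/rV_ballP => // i.
apply: le_lt_trans k1e; apply: (@le_trans _ _ k.+1%:R^-1).
  have := jx i; have := jy i; rewrite !mxE -[in (j i).+1%:R]natr1 mulrDl mul1r.
  move: ((j i)%:R / k.+1%:R) => u; move: (k.+1%:R^-1 : R) => v.
  move: (k.+1%:R : R) => t.
  move=> /andP[a b] /andP[c d]; rewrite ler_norml; apply/andP; split; lra.
by rewrite lef_pV2 ?posrE ?ltr0n// ler_nat.
Qed.

Lemma ginner_bigcup O : open O -> O = \bigcup_k ginner O k.
Proof.
move=> oO; apply/seteqP; split => [x Ox|x [k _]]; last exact: ginner_sub.
by have [k /(_ k (leqnn k)) ?] := ginner_ex oO Ox; exists k.
Qed.

Lemma measurable_open (O : set V) : open O -> measurable O.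
Proof.
move=> oO; rewrite (ginner_bigcup oO).
by apply: bigcupT_measurable => k; exact: measurable_ginner.
Qed.

Lemma ginner_measure_gt (O : set V) (m : \bar R) : open O -> (m < mu O)%E ->
  exists k, (m < mu (ginner O k))%E.
Proof.
move=> oO mO.
(* The grids are not nested, so [ginner O k] need not increase with [k]; the intersections of its
   tails do, and they exhaust [O]. *)
pose W k := \bigcap_(j in [set j | (k <= j)%N]) ginner O j.
have mW k : measurable (W k).
  by apply: bigcap_measurable => [|j _]; [exists k => /=|exact: measurable_ginner].
have WO : O = \bigcup_k W k.
  apply/seteqP; split => [x Ox|x [k _ Wx]]; last exact: ginner_sub (Wx k (leqnn _)).
  by have [k h] := ginner_ex oO Ox; exists k => // j /= /h.
have ndW : nondecreasing_seq W.
  move=> k l kl; apply/subsetPset => x Wx j /= lj; apply: Wx => /=.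
  exact: leq_trans lj.
have := @nondecreasing_cvg_mu _ V R mu W mW (bigcupT_measurable W mW) ndW.
rewrite -WO => cvgW.
have [k h] : exists k, (m < mu (W k))%E.
  apply: contrapT => /forallNP h; move: mO; rewrite ltNge => /negP; apply.
  rewrite -(cvg_lim _ cvgW)//; apply: lime_le; first by apply/cvg_ex; exists (mu O).
  by apply: nearW => k /=; rewrite leNgt; apply/negP; exact: h.
exists k; apply: lt_le_trans h _.
apply: le_lebesgue_outer => x; apply; exact: leqnn.
Qed.

Lemma closed_measurable_rV (A : set V) : closed A -> measurable A.
Proof.
move=> cA; rewrite -[A]setCK; apply: measurableC; apply: measurable_open.
exact: closed_openC.
Qed.

Lemma continuous_measurable_rV (f : V -> R) : continuous f -> measurable_fun setT f.
Proof.
move=> cf; apply: (measurability _ (RGenOpens.measurableE R)) => //.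
move=> _ [_ [a [b ->] <-]]; rewrite setTI; apply: measurable_open.
by apply: open_comp => //; exact: interval_open.
Qed.

Lemma measurable_null (N : set V) : mu N = 0%E -> measurable N.
Proof.
move=> N0; apply: (@le_caratheodory_measurable _ _ (@lebesgue_outer R n)) => X.
have XN : (mu (X `&` N) <= 0)%E.
  by rewrite -N0; apply: le_lebesgue_outer; exact: subIsetr.
apply: le_trans (leeD XN (lexx _)) _; rewrite add0e.
by apply: le_lebesgue_outer; exact: subIsetl.
Qed.

Lemma negligible_null (N : set V) : (mu).-negligible N <-> mu N = 0%E.
Proof.
split => [[B [mB B0 NB]]|N0].
  by apply/eqP; rewrite eq_le lebesgue_outer_ge0 andbT -B0 le_lebesgue_outer.
by apply/negligibleP => //; exact: measurable_null.
Qed.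

End grid.

(** * Measure of balls and invariance under translation *)

Section balls.
Variables (R : realType) (n : nat).
Local Notation V := 'rV[R]_n.
Local Notation mu := (@lebesgue R n).

Lemma measurable_eball (c : V) (r : R) : measurable (eball c r).
Proof. by apply: measurable_open; exact: open_eball. Qed.

Lemma lebesgue_box_fin (a b : V) : (mu (box (Some (a, b))) < +oo)%E.
Proof. by rewrite lebesgue_box ltry. Qed.

Lemma eball_sub_box (c : V) (r : R) :
  eball c r `<=` box (Some (c - const_mx r, c + const_mx r)).
Proof.
move=> x xr i; rewrite !mxE; have := le_lt_trans (coord_le_enorm (x - c) i) xr.
rewrite !mxE ltr_norml => /andP[a b]; apply/andP; split; lra.
Qed.

Lemma box_sub_eball (c : V) (r : R) : 0 < r ->
  box (Some (c - const_mx (r / n.+1%:R), c + const_mx (r / n.+1%:R))) `<=` eball c r.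
Proof.
move=> r0 x xb; rewrite /eball/=.
apply: (@le_lt_trans _ _ (n%:R * (r / n.+1%:R))).
  apply: enorm_le_coord => i; have := xb i; rewrite !mxE ler_norml.
  by move: (r / _) => q /andP[a b]; apply/andP; split; lra.
by rewrite mulrA ltr_pdivrMr// mulrC ltr_pM2l// ltr_nat.
Qed.

Lemma lebesgue_eball_lty (c : V) (r : R) : (mu (eball c r) < +oo)%E.
Proof.
apply: le_lt_trans (lebesgue_box_fin (c - const_mx r) (c + const_mx r)).
by apply: le_lebesgue_outer; exact: eball_sub_box.
Qed.

Lemma lebesgue_eball_gt0 (c : V) (r : R) : 0 < r -> (0 < mu (eball c r))%E.
Proof.
move=> r0; apply: lt_le_trans (le_lebesgue_outer (box_sub_eball (c := c) r0)).
rewrite -[lebesgue_outer _]/(mu _) lebesgue_box lte_fin; apply: prodr_gt0 => i _.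
by rewrite !mxE lt_max; apply/orP; right; rewrite opprD opprK addrACA subrr add0r addr_gt0// divr_gt0.
Qed.

Lemma lebesgue_open_gt0 (O : set V) : open O -> O !=set0 -> (0 < mu O)%E.
Proof.
move=> /open_eballP oO [x /oO[e e0 eO]].
by apply: lt_le_trans (lebesgue_eball_gt0 x e0) _; exact: le_lebesgue_outer.
Qed.

Local Notation om := (unit_ball_volume R n).

Lemma unit_ball_volume_gt0 : 0 < om.
Proof.
rewrite /unit_ball_volume; apply: fine_gt0.
by rewrite lebesgue_eball_gt0// lebesgue_eball_lty.
Qed.

Lemma lebesgue_eball (c : V) (r : R) : 0 < r -> mu (eball c r) = (om * r ^+ n)%:E.
Proof.
move=> r0; have -> : eball c r = affine r c @` eball 0 1.
  apply/seteqP; split => [x xr|_ [x x1 <-]].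
    exists (r^-1 *: (x - c)).
      rewrite /eball/= subr0 enormZ gtr0_norm ?invr_gt0//.
      by rewrite -ltr_pdivlMl ?invr_gt0// invrK mulr1.
    by rewrite /affine scalerA divff ?gt_eqF// scale1r subrK.
  rewrite /eball/= /affine addrK enormZ gtr0_norm//.
  by rewrite -[ltRHS]mulr1 ltr_pM2l//; move: x1; rewrite /eball/= subr0.
rewrite lebesgue_affine// muleC EFinM; congr (_ * _)%E.
by rewrite fineK// ge0_fin_numE ?lebesgue_eball_lty// lebesgue_outer_ge0.
Qed.

Lemma lebesgue_sigma_finite : sigma_finite setT mu.
Proof.
exists (fun k => eball (0 : V) k.+1%:R).
  apply/seteqP; split => // x _; exists (Num.truncn (enorm x)) => //.
  by rewrite /eball/= subr0 truncnS_gt.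
by move=> k; split; [exact: measurable_eball|exact: lebesgue_eball_lty].
Qed.

HB.instance Definition _ :=
  @Measure_isSigmaFinite.Build _ V R mu lebesgue_sigma_finite.

Lemma lebesgue_translate (A : set V) (h : V) : mu [set x + h | x in A] = mu A.
Proof.
rewrite -[RHS]mul1e -(expr1n R n) -(lebesgue_affine h A ltr01); congr mu.
by apply: eq_imagel => x _; rewrite /affine scale1r.
Qed.

Lemma preimage_translate (A : set V) (h : V) :
  (fun x => x + h) @^-1` A = [set x - h | x in A].
Proof.
apply/seteqP; split => [x Ax|_ [x Ax <-]] /=; last by rewrite subrK.
by exists (x + h) => //; rewrite addrK.
Qed.

Lemma lebesgue_preimage_translate (A : set V) (h : V) : mu ((fun x => x + h) @^-1` A) = mu A.
Proof. by rewrite preimage_translate lebesgue_translate. Qed.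

Lemma measurable_fun_translate (h : V) : measurable_fun setT (fun x : V => x + h).
Proof.
rewrite [X in measurable_fun _ X](_ : _ = affine 1 h); first exact: measurable_fun_affine.
by apply/funext => x; rewrite /affine scale1r.
Qed.

Lemma ge0_integral_translate (f : V -> \bar R) (h : V) :
  measurable_fun setT f -> (forall x, 0 <= f x)%E ->
  (\int[mu]_x f (x + h)%R = \int[mu]_x f x)%E.
Proof.
move=> mf f0; have mh := measurable_fun_translate h.
have := ge0_integral_pushforward mh mu measurableT mf (fun y _ => f0 y).
rewrite preimage_setT => <-; apply: eq_measure_integral => A mA _.
exact: lebesgue_preimage_translate.
Qed.

Lemma ae_translate (P : V -> Prop) (h : V) : {ae mu, forall x, P x} ->
  {ae mu, forall x, P (x + h)}.
Proof.
move=> /negligible_null P0; apply/negligible_null.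
by rewrite -(lebesgue_preimage_translate _ h) in P0; exact: P0.
Qed.

End balls.

(** * The Brunn-Minkowski inequality *)

Section root.
Variables (R : realType) (n : nat).
Hypothesis n0 : (0 < n)%N.

Definition nroot (x : R) : R := x `^ n%:R^-1.

Lemma nroot_ge0 x : 0 <= nroot x.
Proof. exact: powR_ge0. Qed.

Lemma nroot_gt0 x : 0 < x -> 0 < nroot x.
Proof. exact: powR_gt0. Qed.

Lemma nrootK x : 0 <= x -> nroot x ^+ n = x.
Proof.
move=> x0; rewrite -powR_mulrn ?nroot_ge0// /nroot -powRrM mulVf ?powRr1//.
by rewrite pnatr_eq0 -lt0n.
Qed.

Lemma nrootX x : 0 <= x -> nroot (x ^+ n) = x.
Proof.
move=> x0; rewrite /nroot -powR_mulrn// -powRrM divff ?powRr1//.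
by rewrite pnatr_eq0 -lt0n.
Qed.

Lemma nrootM x y : 0 <= x -> 0 <= y -> nroot (x * y) = nroot x * nroot y.
Proof. by move=> *; rewrite /nroot powRM. Qed.

Lemma le_nroot x y : 0 <= x -> x <= y -> nroot x <= nroot y.
Proof.
move=> x0 xy; apply: ge0_ler_powR => //; rewrite ?nnegrE ?invr_ge0//.
exact: le_trans xy.
Qed.

(** Brunn-Minkowski for two boxes: the arithmetic-geometric mean inequality is applied to the ratios
    u/(u+v) and to the ratios v/(u+v), and the two arithmetic means add up to 1. *)
Lemma nroot_prod_le (u v : 'I_n -> R) :
  (forall i, 0 < u i) -> (forall i, 0 < v i) ->
  (nroot (\prod_i u i) + nroot (\prod_i v i)) ^+ n <= \prod_i (u i + v i).
Proof.
move=> u0 v0; have w0 i : 0 < u i + v i by rewrite addr_gt0.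
have key (t : 'I_n -> R) : (forall i, 0 < t i) ->
    nroot (\prod_i t i) <= nroot (\prod_i (u i + v i)) *
      ((\sum_i t i / (u i + v i)) / n%:R).
  move=> t0.
  have -> : \prod_i t i = \prod_i (u i + v i) * \prod_i (t i / (u i + v i)).
    by rewrite -big_split; apply: eq_bigr => i _ /=; rewrite mulrC divfK// gt_eqF.
  have q0 i : 0 <= t i / (u i + v i) by rewrite divr_ge0 ?ltW.
  rewrite nrootM; last 2 first.
  - by apply: prodr_ge0 => i _; exact/ltW.
  - by apply: prodr_ge0 => i _.
  rewrite ler_wpM2l ?nroot_ge0//.
  have := (leif_AGM (A := [set: 'I_n]%SET) (E := fun i => t i / (u i + v i))
    (fun i _ => q0 i)).1.
  rewrite cardsT card_ord.
  rewrite [in leLHS](eq_bigl predT) => [|i]; last by rewrite finset.in_setT.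
  rewrite [in leRHS](eq_bigl predT) => [|i]; last by rewrite finset.in_setT.
  move=> h; rewrite -[leRHS]nrootX; last first.
    by rewrite divr_ge0// sumr_ge0.
  by apply: le_nroot => //; apply: prodr_ge0.
apply: (@le_trans _ _ (nroot (\prod_i (u i + v i)) ^+ n)); last first.
  by rewrite nrootK// prodr_ge0// => i _; exact/ltW.
apply: lerXn2r; rewrite ?nnegrE ?addr_ge0 ?nroot_ge0//.
apply: le_trans (lerD (key u u0) (key v v0)) _.
rewrite -mulrDr -mulrDl -big_split/=.
have -> : \sum_i (u i / (u i + v i) + v i / (u i + v i)) = n%:R.
  rewrite (eq_bigr (fun=> 1)); first by rewrite sumr_const card_ord.
  by move=> i _; rewrite -mulrDl divff// gt_eqF.
by rewrite divff ?mulr1// pnatr_eq0 -lt0n.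
Qed.

End root.

Section brunn_minkowski.
Variables (R : realType) (n : nat).
Hypothesis n0 : (0 < n)%N.
Local Notation V := 'rV[R]_n.
Local Notation mu := (@lebesgue R n).
Implicit Types (p q : V * V) (s : seq (V * V)).

Definition obox p : set V :=
  [set x | forall i, p.1 ord0 i < x ord0 i < p.2 ord0 i].

Definition ndg p := [forall i, p.1 ord0 i < p.2 ord0 i].

Definition sep p q :=
  [exists i, (p.2 ord0 i <= q.1 ord0 i) || (q.2 ord0 i <= p.1 ord0 i)].

Definition oboxes s : set V := [set x | exists2 p, p \in s & obox p x].

Definition vol s : R := \sum_(p <- s) bvol p.

Definition cuts_lo i c s := [seq p <- map (cut_lo i c) s | ndg p].
Definition cuts_hi i c s := [seq p <- map (cut_hi i c) s | ndg p].

Lemma bvol_gt0 p : ndg p -> 0 < bvol p.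
Proof.
move=> /forallP h; apply: prodr_gt0 => i _.
by rewrite lt_max; apply/orP; right; rewrite subr_gt0.
Qed.

Lemma bvol_ndg0 p : ~~ ndg p -> bvol p = 0.
Proof.
move=> /forallPn[i]; rewrite -leNgt => h.
by rewrite /bvol (bigD1 i)//= max_l ?mul0r// subr_le0.
Qed.

Lemma vol_filter s : vol [seq p <- s | ndg p] = vol s.
Proof.
rewrite /vol big_filter [RHS](bigID (@ndg))/= [X in _ = _ + X]big1 ?addr0//.
by move=> p; exact: bvol_ndg0.
Qed.

Lemma vol_cuts i c s : vol (cuts_lo i c s) + vol (cuts_hi i c s) = vol s.
Proof.
rewrite !vol_filter /vol !big_map -big_split/=.
by apply: eq_bigr => p _; exact: bvol_cut.
Qed.

Lemma vol_ge0 s : 0 <= vol s.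
Proof. by apply: sumr_ge0 => p _; exact: bvol_ge0. Qed.

Lemma vol_gt0 s : all ndg s -> s != [::] -> 0 < vol s.
Proof.
case: s => //= p s /andP[pn _] _; rewrite /vol big_cons.
by rewrite ltr_pwDl ?bvol_gt0// vol_ge0.
Qed.

Lemma vol_gt0_neq0 s : 0 < vol s -> s != [::].
Proof. by apply: contraTneq => ->; rewrite /vol big_nil ltxx. Qed.

Lemma size_cuts_lo i c s p : p \in s -> c <= p.1 ord0 i ->
  (size (cuts_lo i c s) < size s)%N.
Proof.
move=> ps cp; rewrite size_filter -[ltnRHS](size_map (cut_lo i c)).
rewrite ltn_neqAle count_size andbT -all_count; apply/allPn.
exists (cut_lo i c p); first exact: map_f.
apply/forallPn; exists i; rewrite -leNgt /= mxE eqxx.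
by rewrite ge_min cp orbT.
Qed.

Lemma size_cuts_hi i c s p : p \in s -> p.2 ord0 i <= c ->
  (size (cuts_hi i c s) < size s)%N.
Proof.
move=> ps cp; rewrite size_filter -[ltnRHS](size_map (cut_hi i c)).
rewrite ltn_neqAle count_size andbT -all_count; apply/allPn.
exists (cut_hi i c p); first exact: map_f.
apply/forallPn; exists i; rewrite -leNgt /= mxE eqxx.
by rewrite le_max cp orbT.
Qed.

Lemma size_cuts_le i c s :
  (size (cuts_lo i c s) <= size s)%N /\ (size (cuts_hi i c s) <= size s)%N.
Proof.
by split; rewrite size_filter (leq_trans (count_size _ _))// size_map.
Qed.

Lemma cut_lo_neq0 i c s p : p \in s -> ndg p -> p.2 ord0 i <= c ->
  cuts_lo i c s != [::].
Proof.
move=> ps pn pc; suff : cut_lo i c p \in cuts_lo i c s by case: (cuts_lo i c s).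
rewrite mem_filter map_f// andbT; apply/forallP => j /=; rewrite mxE.
by have := forallP pn j; case: eqP => [->|//]; rewrite min_l.
Qed.

Lemma cut_hi_neq0 i c s p : p \in s -> ndg p -> c <= p.1 ord0 i ->
  cuts_hi i c s != [::].
Proof.
move=> ps pn pc; suff : cut_hi i c p \in cuts_hi i c s by case: (cuts_hi i c s).
rewrite mem_filter map_f// andbT; apply/forallP => j /=; rewrite mxE.
by have := forallP pn j; case: eqP => [->|//]; rewrite max_l.
Qed.

Lemma sep_sub p q p' q' :
  (forall i, p.1 ord0 i <= p'.1 ord0 i) -> (forall i, p'.2 ord0 i <= p.2 ord0 i) ->
  (forall i, q.1 ord0 i <= q'.1 ord0 i) -> (forall i, q'.2 ord0 i <= q.2 ord0 i) ->
  sep p q -> sep p' q'.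
Proof.
move=> a b c d /existsP[i /orP[h|h]]; apply/existsP; exists i.
  by rewrite (le_trans (b i))// (le_trans h).
by rewrite [X in _ || X](le_trans (d i))// ?orbT// (le_trans h).
Qed.

Lemma sep_cuts_lo i c s : pairwise sep s -> pairwise sep (cuts_lo i c s).
Proof.
move=> h; apply: pairwise_filter; rewrite pairwise_map.
apply: sub_pairwise h => p q; apply: sep_sub => //= j; rewrite mxE;
  by case: ifP => // _; rewrite ge_min lexx.
Qed.

Lemma sep_cuts_hi i c s : pairwise sep s -> pairwise sep (cuts_hi i c s).
Proof.
move=> h; apply: pairwise_filter; rewrite pairwise_map.
apply: sub_pairwise h => p q; apply: sep_sub => //= j; rewrite mxE;
  by case: ifP => // _; rewrite le_max lexx.
Qed.

Lemma oboxes_cuts_lo i c s x : oboxes (cuts_lo i c s) x -> oboxes s x /\ x ord0 i < c.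
Proof.
move=> [p]; rewrite mem_filter => /andP[_ /mapP[q qs ->]] h; split.
  exists q => // j; have := h j; rewrite /= mxE; case: ifP => // _.
  by rewrite lt_min => /andP[-> /andP[->]].
by have := h i; rewrite /= mxE eqxx lt_min => /andP[_ /andP[]].
Qed.

Lemma oboxes_cuts_hi i c s x : oboxes (cuts_hi i c s) x -> oboxes s x /\ c < x ord0 i.
Proof.
move=> [p]; rewrite mem_filter => /andP[_ /mapP[q qs ->]] h; split.
  exists q => // j; have := h j; rewrite /= mxE; case: ifP => // _.
  by rewrite gt_max => /andP[/andP[-> _] ->].
by have := h i; rewrite /= mxE eqxx gt_max => /andP[/andP[]].
Qed.

(** Intermediate value theorem: the volume on one side of the cut is continuous in its position, and
    the bounds [a] and [b] built from sums of absolute values lie below and above all the boxes. *)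
Lemma vol_cut_ivt i s (v : R) : 0 <= v <= vol s -> exists d, vol (cuts_lo i d s) = v.
Proof.
move=> v0.
pose g (d : R) := \sum_(p <- s) bvol (cut_lo i d p).
have gE d : vol (cuts_lo i d s) = g d by rewrite vol_filter /vol big_map.
have bE p d : bvol (cut_lo i d p) =
    Num.max 0 (Num.min (p.2 ord0 i) d - p.1 ord0 i) *
    \prod_(j < n | j != i) Num.max 0 (p.2 ord0 j - p.1 ord0 j).
  rewrite /bvol (bigD1 i)//= mxE eqxx; congr (_ * _).
  by apply: eq_bigr => j /negbTE ji; rewrite mxE ji.
have cg : continuous g.
  move=> d; rewrite /g; elim: s {v0 gE g} => [|p s IH].
    rewrite [X in continuous_at _ X](_ : _ = fun=> 0); first exact: cvg_cst.
    by apply/funext => ?; rewrite big_nil.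
  rewrite [X in continuous_at _ X](_ : _ = (fun d => bvol (cut_lo i d p)) \+
    (fun d => \sum_(p <- s) bvol (cut_lo i d p))); last first.
    by apply/funext => ?; rewrite big_cons.
  apply: (@continuousD R R^o) => //.
  rewrite [X in {for d, continuous X}](_ : _ =
    (fun d => Num.max 0 (Num.min (p.2 ord0 i) d - p.1 ord0 i)) \*
    (fun=> \prod_(j < n | j != i) Num.max 0 (p.2 ord0 j - p.1 ord0 j))); last first.
    by apply/funext => ?; rewrite bE.
  apply: (@continuousM R R) => //; last exact: cvg_cst.
  apply: (@continuous_max R R (fun=> 0)
    (fun d => Num.min (p.2 ord0 i) d - p.1 ord0 i)); first exact: cvg_cst.
  apply: (@continuousB R R^o); last exact: cvg_cst.
  apply: (@continuous_min R R (fun=> _) id); first exact: cvg_cst.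
  exact: cvg_id.
pose a := \sum_(p <- s) - `|p.1 ord0 i|.
pose b := \sum_(p <- s) `|p.2 ord0 i|.
have ap p : p \in s -> a <= p.1 ord0 i.
  move=> ps; rewrite /a (big_rem p)//= -[leRHS]addr0 lerD//.
    by rewrite lerNl -normrN ler_norm.
  by apply: sumr_le0 => ? _; rewrite oppr_le0.
have bp p : p \in s -> p.2 ord0 i <= b.
  move=> ps; rewrite /b (big_rem p)//= -[leLHS]addr0 lerD ?ler_norm//.
  by apply: sumr_ge0 => ? _.
have ga : g a = 0.
  rewrite /g big1_seq// => p /= ps; rewrite bE max_l ?mul0r//.
  by rewrite subr_le0 ge_min ap// orbT.
have gb : g b = vol s.
  rewrite /g /vol; apply: eq_big_seq => p ps; rewrite bE /bvol [RHS](bigD1 i)//=.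
  by rewrite min_l// bp.
have ab : a <= b.
  apply: (@le_trans _ _ 0); first by apply: sumr_le0 => ? _; rewrite oppr_le0.
  by apply: sumr_ge0 => ? _.
have [|d _ gd] := @IVT R g a b v ab (continuous_subspaceT cg).
  by rewrite ga gb min_l ?max_r// (le_trans _ (andP v0).2)//; case/andP: v0.
by exists d; rewrite gE.
Qed.

(** The closed box shrunk about its centre by a factor t < 1 lies in the open one and has volume t^n
    [bvol p]; then t tends to 1. *)
Lemma lebesgue_obox_ge p (C : set V) : ndg p -> obox p `<=` C ->
  ((bvol p)%:E <= mu C)%E.
Proof.
move=> /forallP pn pC.
have key (t : R) : 0 < t < 1 -> ((t ^+ n * bvol p)%:E <= mu C)%E.
  move=> /andP[t0 t1].
  pose m := 2^-1 *: (p.1 + p.2); pose w := 2^-1 *: (p.2 - p.1).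
  have -> : t ^+ n * bvol p = bvol (m - t *: w, m + t *: w).
    rewrite /bvol -[n in t ^+ n]card_ord -prodr_const -big_split/=.
    apply: eq_bigr => i _; rewrite !mxE maxr_pMr ?ltW// mulr0.
    by congr (Num.max _ _); field.
  rewrite -lebesgue_box; apply: le_lebesgue_outer => x xb; apply: pC => i.
  have := xb i; rewrite /= !mxE => /andP[a b]; have := pn i => pi.
  by apply/andP; split; nra.
apply/lee_addgt0Pr => e e0.
have B0 : 0 < bvol p by apply: bvol_gt0; exact/forallP.
have [t /andP[t0 t1] te] : exists2 t : R, 0 < t < 1 & bvol p - e <= t ^+ n * bvol p.
  have [eB|Be] := ltP e (bvol p); last first.
    exists 2^-1; first by apply/andP; split; lra.
    by rewrite (@le_trans _ _ 0)// ?subr_le0// mulr_ge0 ?ltW// exprn_ge0.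
  exists (nroot n (1 - e / bvol p)).
    have u1 : 0 < 1 - e / bvol p by rewrite subr_gt0 ltr_pdivrMr// mul1r.
    rewrite nroot_gt0//= -(ltr_pXn2r n0) ?nnegrE ?nroot_ge0// expr1n nrootK ?ltW//.
    by rewrite ltrBlDr ltrDl divr_gt0.
  rewrite nrootK// ?mulrBl ?mul1r ?divfK ?gt_eqF//.
  by rewrite subr_ge0 ler_pdivrMr// mul1r ltW.
have := key t; rewrite t0 t1 => /(_ isT) h.
apply: (@le_trans _ _ ((t ^+ n * bvol p)%:E + e%:E)%E); last exact: leeD2r.
by rewrite -EFinD lee_fin; lra.
Qed.

(** In each coordinate, z divides the interval of the sum in some ratio; x and z - x divide their
    own intervals in the same ratio. *)
Lemma obox_addP p q z : ndg p -> ndg q ->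
  obox (p.1 + q.1, p.2 + q.2) z -> exists2 x, obox p x & obox q (z - x).
Proof.
move=> /forallP pn /forallP qn zb.
pose t i := (z ord0 i - (p.1 ord0 i + q.1 ord0 i)) /
  (p.2 ord0 i - p.1 ord0 i + (q.2 ord0 i - q.1 ord0 i)).
have den i : 0 < p.2 ord0 i - p.1 ord0 i + (q.2 ord0 i - q.1 ord0 i).
  by rewrite addr_gt0// subr_gt0.
have tE i : z ord0 i = p.1 ord0 i + q.1 ord0 i +
    t i * (p.2 ord0 i - p.1 ord0 i + (q.2 ord0 i - q.1 ord0 i)).
  by rewrite /t divfK ?gt_eqF//; ring.
have t01 i : 0 < t i < 1.
  have := zb i; rewrite /= !mxE => /andP[a b].
  rewrite divr_gt0//= ?ltr_pdivrMr//; lra.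
exists (\row_i (p.1 ord0 i + t i * (p.2 ord0 i - p.1 ord0 i))) => i; rewrite !mxE.
  have /andP[a b] := t01 i; have := pn i => pi; apply/andP; split; nra.
have /andP[a b] := t01 i; have := qn i => qi; rewrite tE; apply/andP; split; nra.
Qed.

Definition bm_prop sA sB := forall C : set V,
  (forall x y, oboxes sA x -> oboxes sB y -> C (x + y)) ->
  (((nroot n (vol sA) + nroot n (vol sB)) ^+ n)%:E <= mu C)%E.

Lemma bm_propC sA sB : bm_prop sA sB -> bm_prop sB sA.
Proof.
by move=> h C AB; rewrite addrC; apply: h => x y Ax By; rewrite addrC; exact: AB.
Qed.

Definition bm_ok s := [/\ s != [::], all ndg s & pairwise sep s].

(* The two boxes of A are separated by a hyperplane; B is translated so that
   the hyperplane divides both sets in the same ratio. *)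
Lemma bm_step (N : nat) sA sB :
  (forall sA' sB', bm_ok sA' -> bm_ok sB' -> (size sA' + size sB' < N)%N ->
    bm_prop sA' sB') ->
  bm_ok sA -> bm_ok sB -> (size sA + size sB = N)%N -> (1 < size sA)%N ->
  bm_prop sA sB.
Proof.
move=> IH [A0 An As] [B0 Bn Bs] sN A1.
have [i [c [p [q [pA qA pc cq]]]]] : exists i c p q,
    [/\ p \in sA, q \in sA, p.2 ord0 i <= c & c <= q.1 ord0 i].
  case: sA A1 As {A0 An sN IH} => [|p [|q s]]//= _ /andP[/andP[+ _] _].
  move=> /existsP[i /orP[h|h]].
    by exists i, (p.2 ord0 i), p, q; rewrite !inE !eqxx orbT; split.
  by exists i, (q.2 ord0 i), q, p; rewrite !inE !eqxx orbT; split.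
have pn := allP An _ pA; have qn := allP An _ qA.
set A1' := cuts_lo i c sA; set A2' := cuts_hi i c sA.
have okA1 : bm_ok A1'.
  split; [exact: cut_lo_neq0 pA pn pc|exact: filter_all|exact: sep_cuts_lo].
have okA2 : bm_ok A2'.
  split; [exact: cut_hi_neq0 qA qn cq|exact: filter_all|exact: sep_cuts_hi].
have vA : 0 < vol sA by exact: vol_gt0.
have vB : 0 < vol sB by exact: vol_gt0.
have vA1 : 0 < vol A1' by case: okA1 => *; exact: vol_gt0.
have vA2 : 0 < vol A2' by case: okA2 => *; exact: vol_gt0.
have vAE : vol A1' + vol A2' = vol sA by exact: vol_cuts.
pose t := vol A1' / vol sA.
have t0 : 0 < t by exact: divr_gt0.
have t1 : t < 1 by rewrite ltr_pdivrMr// mul1r -vAE ltrDl.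
have vA1E : vol A1' = t * vol sA by rewrite /t divfK// gt_eqF.
clearbody t.
have [|d vB1] := @vol_cut_ivt i sB (t * vol sB).
  by rewrite mulr_ge0 ?(ltW t0) ?(ltW vB)//= ger_pMl// ltW.
set B1' := cuts_lo i d sB in vB1; set B2' := cuts_hi i d sB.
have vBE : vol B1' + vol B2' = vol sB by exact: vol_cuts.
have vB2 : vol B2' = (1 - t) * vol sB by rewrite mulrBl mul1r -vB1 -vBE addrC addKr.
have vA2E : vol A2' = (1 - t) * vol sA by rewrite mulrBl mul1r -vA1E -vAE addrC addKr.
have okB1 : bm_ok B1'.
  split; [apply: vol_gt0_neq0; rewrite vB1 mulr_gt0//|exact: filter_all|exact: sep_cuts_lo].
have okB2 : bm_ok B2'.
  split; [apply: vol_gt0_neq0; rewrite vB2 mulr_gt0// subr_gt0//|exact: filter_all|exact: sep_cuts_hi].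
move=> C AB.
have -> : mu C = (mu (C `&` [set x | (x ord0 i <= c + d)%R]) +
    mu (C `&` ~` [set x | (x ord0 i <= c + d)%R]))%E.
  exact: (measurable_halfspace i (c + d)).
have [sB1 sB2] := size_cuts_le i d sB.
(* Both unions are divided in the ratio t : 1 - t, so by homogeneity the bounds for the two halves
   are t and 1 - t times the bound for the whole. *)
apply: (@le_trans _ _ (((nroot n (vol A1') + nroot n (vol B1')) ^+ n)%:E +
   ((nroot n (vol A2') + nroot n (vol B2')) ^+ n)%:E)%E).
  rewrite vB1 vB2 vA1E vA2E !nrootM ?subr_ge0 ?(ltW t0) ?(ltW t1) ?(ltW vA) ?(ltW vB)//.
  rewrite -!mulrDr !exprMn !nrootK ?subr_ge0 ?(ltW t0) ?(ltW t1)//.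
  by rewrite -EFinD -mulrDl addrCA subrr addr0 mul1r.
(* Each half of A loses one of the two separated boxes and no half of B gains any, so the number of
   boxes decreases on both sides. *)
apply: leeD.
  apply: (IH A1' B1') => //.
    by rewrite -sN -addSn leq_add//; exact: size_cuts_lo qA cq.
  move=> x y /oboxes_cuts_lo[Ax xc] /oboxes_cuts_lo[By yd]; split; first exact: AB.
  by rewrite /= mxE; lra.
apply: (IH A2' B2') => //.
  by rewrite -sN -addSn leq_add//; exact: size_cuts_hi pA pc.
move=> x y /oboxes_cuts_hi[Ax xc] /oboxes_cuts_hi[By yd]; split; first exact: AB.
by rewrite /= mxE; apply/negP; rewrite -ltNge; lra.
Qed.

(** The Hadwiger-Ohmann argument: strong induction on the total number of boxes, dividing whichever
    union has at least two; a pair of single boxes is settled by [nroot_prod_le]. *)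
Lemma bm_boxes sA sB : bm_ok sA -> bm_ok sB -> bm_prop sA sB.
Proof.
have [N sN] := ubnPeq (size sA + size sB).
elim/ltn_ind: N sA sB sN => N IH sA sB /eqP sN okA okB.
have IH' sA' sB' : bm_ok sA' -> bm_ok sB' -> (size sA' + size sB' < N)%N ->
    bm_prop sA' sB'.
  by move=> oA oB h; exact: (IH _ h).
have [A1|] := ltnP 1 (size sA); first exact: (@bm_step N).
have [B1 _|] := ltnP 1 (size sB).
  apply: bm_propC; apply: (@bm_step N) => //; last by rewrite addnC.
case: okA okB => + + _ [+ + _].
case: sB sN => [|q [|]]//= _; case: sA => [|p [|]]//= _ /andP[pn _] _ /andP[qn _] _ _ C AB.
rewrite /vol !big_cons !big_nil !addr0.
apply: (@le_trans _ _ (bvol (p.1 + q.1, p.2 + q.2))%:E).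
  have E (r : V * V) : ndg r -> bvol r = \prod_i (r.2 ord0 i - r.1 ord0 i).
    move=> /forallP rn; apply: eq_bigr => i _; rewrite max_r// subr_ge0 ltW//.
  rewrite lee_fin !E//; last first.
    by apply/forallP => i; rewrite !mxE ltrD// (forallP pn, forallP qn).
  apply: le_trans (nroot_prod_le n0 _ _) _.
  - by move=> i; rewrite subr_gt0 (forallP pn).
  - by move=> i; rewrite subr_gt0 (forallP qn).
  by apply: ler_prod => i _; rewrite !mxE; apply/andP; split;
    [rewrite addr_ge0// subr_ge0 ltW// (forallP pn, forallP qn)|lra].
apply: lebesgue_obox_ge.
  by apply/forallP => i; rewrite !mxE ltrD// (forallP pn, forallP qn).
move=> z /obox_addP[]// x px qzx; rewrite -(subrK x z) addrC.
by apply: AB; [exists p; rewrite ?inE|exists q; rewrite ?inE].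
Qed.

Definition gridboxes (O : set V) k : seq (V * V) :=
  [seq (glo R j, ghi R j) | j <- enum {: gidx n k} & `[< gcell j `<=` O >]].

Lemma oboxes_gridboxes O k : oboxes (gridboxes O k) `<=` O.
Proof.
move=> x [p /mapP[j]]; rewrite mem_filter => /andP[/asboolP jO _] -> px.
by apply: jO => i; have /andP[/ltW -> ->] := px i.
Qed.

Lemma gridboxes_vol O k : (mu (ginner O k) <= (vol (gridboxes O k))%:E)%E.
Proof.
rewrite /gridboxes /vol big_map.
have -> : ginner O k = [set x | exists2 j, j \in [seq j <- enum {: gidx n k} |
    `[< gcell j `<=` O >]] & gcell j x].
  apply/seteqP; split => [x [j jO jx]|x [j]]; last first.
    by rewrite mem_filter => /andP[/asboolP jO _] jx; exists j.
  by exists j => //; rewrite mem_filter mem_enum andbT; apply/asboolP.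
elim: [seq j <- enum {: gidx n k} | _] => [|j s IH].
  rewrite big_nil [X in mu X](_ : _ = set0) ?measure0//.
  by apply/seteqP; split => // x [].
rewrite big_cons EFinD.
apply: (@le_trans _ _ (mu (gcell j) + mu [set x | exists2 j, j \in s & gcell j x])%E).
  apply: le_trans (outer_measureU2 (@lebesgue_outer R n) _ _).
  apply: le_lebesgue_outer => x [l]; rewrite inE => /orP[/eqP ->|ls] lx; first by left.
  by right; exists l.
apply: leeD => //; rewrite -lebesgue_box; apply: le_lebesgue_outer => x jx i.
by have /andP[-> /ltW ->] := jx i.
Qed.

Lemma gridboxes_ok O k : 0 < vol (gridboxes O k) -> bm_ok (gridboxes O k).
Proof.
move=> v0; split; first exact: vol_gt0_neq0.
  apply/allP => p /mapP[j _ ->]; apply/forallP => i; rewrite !mxE ltrD2r.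
  by rewrite ltr_pM2r ?invr_gt0// ltr_nat.
rewrite pairwise_map.
have := filter_uniq (fun j : gidx n k => `[< gcell j `<=` O >]) (enum_uniq {: gidx n k}).
rewrite uniq_pairwise; apply: sub_pairwise => j l /= jl.
have [i ji] : exists i, j i != l i.
  apply/existsP; rewrite -negb_forall; apply: contra jl => /forallP h.
  by apply/eqP/ffunP => i; exact/eqP.
have K0 : 0 < k.+1%:R :> R by rewrite ltr0n.
apply/existsP; exists i; rewrite !mxE !lerD2r !ler_pM2r ?invr_gt0// !ler_nat.
by move: ji; rewrite -val_eqE neq_ltn.
Qed.

(** Finitely many grid boxes inside [A] and [B] capture the volumes t a and t b for every t < 1; the
    bound is homogeneous of degree 1 in the volumes, so it only loses the factor t. The numbers [a]
    and [b] are lower bounds, so that infinite measures are allowed. *)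
Theorem brunn_minkowski (A B C : set V) (a b : R) : open A -> open B ->
  0 < a -> 0 < b -> (a%:E <= mu A)%E -> (b%:E <= mu B)%E ->
  (forall x y, A x -> B y -> C (x + y)) ->
  (((nroot n a + nroot n b) ^+ n)%:E <= mu C)%E.
Proof.
move=> oA oB a0 b0 aA bB AB.
have key (t : R) : 0 < t < 1 ->
    ((t * (nroot n a + nroot n b) ^+ n)%:E <= mu C)%E.
  move=> /andP[t0 t1].
  have lt1 (x : R) (E : set V) : 0 < x -> (x%:E <= mu E)%E -> ((t * x)%:E < mu E)%E.
    by move=> x0; apply: lt_le_trans; rewrite lte_fin gtr_pMl.
  have [k hk] := ginner_measure_gt oA (lt1 _ _ a0 aA).
  have [l hl] := ginner_measure_gt oB (lt1 _ _ b0 bB).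
  have {}hk := lt_le_trans hk (gridboxes_vol A k).
  have {}hl := lt_le_trans hl (gridboxes_vol B l).
  rewrite !lte_fin in hk hl.
  have ta : 0 < t * a by exact: mulr_gt0.
  have tb : 0 < t * b by exact: mulr_gt0.
  have := bm_boxes (gridboxes_ok (lt_trans ta hk)) (gridboxes_ok (lt_trans tb hl)).
  move=> h; apply: le_trans (h C _); last first.
    by move=> x y /oboxes_gridboxes Ax /oboxes_gridboxes By; exact: AB.
  have -> : t * (nroot n a + nroot n b) ^+ n = (nroot n (t * a) + nroot n (t * b)) ^+ n.
    rewrite (nrootM _ (ltW t0) (ltW a0)) (nrootM _ (ltW t0) (ltW b0)) -mulrDr.
    by rewrite exprMn (nrootK n0 (ltW t0)).
  rewrite lee_fin.
  by apply: lerXn2r; rewrite ?nnegrE ?addr_ge0 ?nroot_ge0// lerD//; apply: le_nroot; exact: ltW.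
set L := (_ + _) ^+ n in key *.
have L0 : 0 < L by rewrite exprn_gt0// addr_gt0// nroot_gt0.
rewrite leNgt; apply/negP => CL.
have Cf : mu C \is a fin_num by rewrite ge0_fin_numE ?lebesgue_outer_ge0// (lt_trans CL)// ltry.
rewrite -(fineK Cf) lte_fin in CL key *.
set c := fine _ in CL key.
have c0 : 0 <= c by rewrite fine_ge0// lebesgue_outer_ge0.
have := key ((c / L + 1) / 2).
have cL : c / L < 1 by rewrite ltr_pdivrMr// mul1r.
have cL0 : 0 <= c / L by rewrite divr_ge0// ltW.
have -> : 0 < (c / L + 1) / 2 < 1 by apply/andP; split; lra.
move=> /(_ isT); rewrite lee_fin => h.
have : c / L * L = c by rewrite divfK// gt_eqF.
move: (c / L) cL cL0 h => u; nra.
Qed.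

End brunn_minkowski.

(** * Layer cake formula *)

Section integration.
Context d (T : measurableType d) (R : realType).
Variable mu : {measure set T -> \bar R}.
Local Open Scope ereal_scope.

Lemma ge0_cvg0_le (a b c : R) (u : nat -> R) : (u @ \oo --> (0 : R))%R ->
  (forall k, a <= b + c * u k)%R -> (a <= b)%R.
Proof.
move=> u0 h; have cv : ((fun k => b + c * u k) @ \oo --> b)%R.
  rewrite -[X in _ --> X]addr0 -(mulr0 c).
  by apply: cvgD; [exact: cvg_cst|apply: cvgMr; exact: u0].
rewrite -(cvg_lim _ cv)//; apply: limr_ge; first by apply/cvg_ex; exists b.
exact: nearW.
Qed.

Lemma int_ge0 (D : set T) (f : T -> R) : (forall x, 0 <= f x)%R ->
  0 <= \int[mu]_(x in D) (f x)%:E.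
Proof. by move=> f0; apply: integral_ge0 => x _; rewrite lee_fin. Qed.

Lemma int_le (D : set T) (f g : T -> R) : measurable D ->
  measurable_fun setT f -> measurable_fun setT g ->
  (forall x, 0 <= f x)%R -> (forall x, D x -> f x <= g x)%R ->
  \int[mu]_(x in D) (f x)%:E <= \int[mu]_(x in D) (g x)%:E.
Proof.
move=> mD mf mg f0 fg; apply: ge0_le_integral => //.
- by move=> x _; rewrite lee_fin.
- by apply/measurable_EFinP; exact: measurable_funTS.
- by apply/measurable_EFinP; exact: measurable_funTS.
Qed.

Lemma int_ae_le (f g : T -> R) :
  measurable_fun setT f -> measurable_fun setT g ->
  (forall x, 0 <= f x)%R -> (forall x, 0 <= g x)%R ->
  {ae mu, forall x, f x <= g x}%R ->
  \int[mu]_x (f x)%:E <= \int[mu]_x (g x)%:E.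
Proof.
move=> mf mg f0 g0 fg; apply: ae_ge0_le_integral => //.
- by move=> x _; rewrite lee_fin.
- exact/measurable_EFinP.
- by move=> x _; rewrite lee_fin.
- exact/measurable_EFinP.
- by move: fg; apply: filterS => x fgx _; rewrite lee_fin.
Qed.

Lemma intD (D : set T) (f g : T -> R) : measurable D ->
  measurable_fun setT f -> measurable_fun setT g ->
  (forall x, 0 <= f x)%R -> (forall x, 0 <= g x)%R ->
  \int[mu]_(x in D) (f x + g x)%:E =
  \int[mu]_(x in D) (f x)%:E + \int[mu]_(x in D) (g x)%:E.
Proof.
move=> mD mf mg f0 g0; under eq_integral do rewrite EFinD.
rewrite ge0_integralD//.
- by move=> x _; rewrite lee_fin.
- by apply/measurable_EFinP; exact: measurable_funTS.
- by move=> x _; rewrite lee_fin.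
- by apply/measurable_EFinP; exact: measurable_funTS.
Qed.

Lemma intZ (D : set T) (c : R) (f : T -> R) : measurable D ->
  measurable_fun setT f -> (forall x, 0 <= f x)%R -> (0 <= c)%R ->
  \int[mu]_(x in D) (c * f x)%:E = c%:E * \int[mu]_(x in D) (f x)%:E.
Proof.
move=> mD mf f0 c0; under eq_integral do rewrite EFinM.
rewrite ge0_integralZl_EFin//; first by move=> x _; rewrite lee_fin.
by apply/measurable_EFinP; exact: measurable_funTS.
Qed.

Lemma int_indic (D A : set T) (f : T -> R) : measurable D ->
  \int[mu]_(x in A) (f x * \1_D x)%:E = \int[mu]_(x in A `&` D) (f x)%:E.
Proof.
move=> mD; rewrite integral_mkcond [RHS]integral_mkcond; apply: eq_integral => x _.
rewrite !patchE in_setI indicE; case: (x \in A) => //=.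
by case: (x \in D); rewrite ?mulr1 ?mulr0.
Qed.

Lemma int_cst_indic (D : set T) (c : R) : measurable D ->
  \int[mu]_x (c * \1_D x)%:E = c%:E * mu D.
Proof.
move=> mD; rewrite (int_indic setT (fun=> c))// setTI.
by rewrite -[LHS]/(\int[mu]_(x in D) cst c%:E x) integral_cst.
Qed.

Lemma integrable_cst_indic (D : set T) (c : R) : measurable D -> mu D < +oo ->
  mu.-integrable setT (EFin \o (fun x => c * \1_D x)%R).
Proof.
move=> mD Doo; apply: (eq_integrable measurableT (fun x => c%:E * (\1_D x)%:E)).
  by move=> x _; rewrite -EFinM.
apply: integrableZl => //; apply/integrableP; split.
  by apply/measurable_EFinP; exact: measurable_indic.
rewrite (eq_integral (fun x => (\1_D x)%:E)).
  by rewrite integral_indic// setIT.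
by move=> x _; rewrite gee0_abs// lee_fin.
Qed.

Lemma integrable_ge0 (f : T -> R) : measurable_fun setT f -> (forall x, 0 <= f x)%R ->
  \int[mu]_x (f x)%:E < +oo -> mu.-integrable setT (EFin \o f).
Proof.
move=> mf f0 foo; apply/integrableP; split; first exact/measurable_EFinP.
rewrite (eq_integral (fun x => (f x)%:E))// => x _.
by rewrite gee0_abs// lee_fin.
Qed.

Lemma int_diff (f g : T -> R) (c : R) : (0 < c)%R ->
  measurable_fun setT f -> measurable_fun setT g ->
  (forall x, 0 <= f x)%R -> (forall x, f x <= g x)%R ->
  \int[mu]_x (f x)%:E + c%:E * \int[mu]_x ((g x - f x) / c)%:E = \int[mu]_x (g x)%:E.
Proof.
move=> c0 mf mg f0 fg.
have mgf : measurable_fun setT (fun x => (g x - f x) / c)%R.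
  apply: measurable_funM; last exact: measurable_cst.
  exact: measurable_funB.
have gf0 x : (0 <= (g x - f x) / c)%R by rewrite divr_ge0 ?(ltW c0)// subr_ge0.
rewrite -intZ// ?ltW// -intD//; last 2 first.
- by apply: measurable_funM => //; exact: measurable_cst.
- by move=> x; rewrite mulr_ge0// ltW.
by apply: eq_integral => x _; rewrite mulrC divfK ?gt_eqF// addrC subrK.
Qed.

(** Reverse Fatou lemma with an error term [e k]: the maximum of [f k] and [F] converges to [F]
    almost everywhere and is dominated by g + F. *)
Lemma limsup_integral_ge (f : nat -> T -> R) (g F : T -> R) (c : R) (e : nat -> R) :
  (forall k, measurable_fun setT (f k)) -> measurable_fun setT F ->
  mu.-integrable setT (EFin \o g) ->
  (forall k x, 0 <= f k x <= g x)%R -> (forall x, 0 <= F x)%R ->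
  {ae mu, forall x, forall dl : R, (0 < dl)%R ->
     exists N, forall k, (N <= k)%N -> (f k x <= F x + dl)%R} ->
  (e @ \oo --> (0 : R))%R ->
  (forall k, c%:E <= \int[mu]_x (f k x)%:E + (e k)%:E) ->
  c%:E <= \int[mu]_x (F x)%:E.
Proof.
move=> mf mF ig fg F0 limf e0 h.
have [->|] := eqVneq (\int[mu]_x (F x)%:E) +oo; first by rewrite leey.
move=> Foo.
have F0' : 0 <= \int[mu]_x (F x)%:E.
  by apply: integral_ge0 => x _; rewrite lee_fin.
have iF : mu.-integrable setT (EFin \o F).
  apply/integrableP; split; first exact/measurable_EFinP.
  rewrite (_ : (fun x => _) = (fun x => (F x)%:E)) ?ltey//.
  by apply/funext => x /=; rewrite ger0_norm.
pose hk k x := Num.max (f k x) (F x).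
have mh k : measurable_fun setT (hk k) by exact: measurable_maxr.
have igF : mu.-integrable setT (fun x => (g x + F x)%:E).
  rewrite (_ : (fun x => _) = (EFin \o g) \+ (EFin \o F)); first exact: integrableD.
  by apply/funext => x; rewrite /= EFinD.
have cvh : {ae mu, forall x, setT x -> (hk k x)%:E @[k --> \oo] --> (F x)%:E}.
  move: limf; apply: filterS => x hx _; apply/fine_cvgP; split; first exact: nearW.
  apply/cvgrPdist_le => dl dl0; have [N HN] := hx (dl : R) dl0.
  exists N => // k /= Nk; have := HN _ Nk; rewrite ler_norml /hk.
  rewrite /Num.max; case: ifPn; rewrite -?leNgt => *; apply/andP; split; lra.
have hg : {ae mu, forall x, forall k, setT x -> `|(hk k x)%:E| <= (g x + F x)%:E}.
  apply/aeW => x k _ /=; rewrite lee_fin; have /andP[f0 fgx] := fg k x.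
  have := F0 x; rewrite /hk /Num.max; case: ifPn => *; rewrite ger0_norm//; lra.
have [_ _ cv] := dominated_convergence measurableT
  (fun k => (measurable_EFinP _ _).2 (mh k)) ((measurable_EFinP _ _).2 mF) cvh igF hg.
rewrite /comp /= in cv.
have h' k : c%:E <= \int[mu]_x (hk k x)%:E + (e k)%:E.
  apply: le_trans (h k) _; apply: leeD2r; apply: ge0_le_integral => //.
  - by move=> x _; rewrite lee_fin; case/andP: (fg k x).
  - by apply/measurable_EFinP; exact: mf.
  - by apply/measurable_EFinP; exact: mh.
  - by move=> x _; rewrite lee_fin le_max lexx.
have cv2 : (fun k => \int[mu]_x (hk k x)%:E + (e k)%:E) @ \oo --> \int[mu]_x (F x)%:E.
  rewrite -[X in _ --> X]adde0; apply: cvgeD => //.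
    by rewrite fin_num_adde_defl.
  by apply: cvg_comp e0 _; exact: cvg_id.
rewrite -(cvg_lim _ cv2)//; apply: lime_ge; first by apply/cvg_ex; eexists; exact: cv2.
exact: nearW.
Qed.

End integration.

Section layer_cake.
Context d (T : measurableType d) (R : realType).
Variable mu : {sigma_finite_measure set T -> \bar R}.
Local Open Scope ereal_scope.
Local Notation leb := (@lebesgue_measure R).

Lemma lebesgue_itv0 (r : R) : (0 <= r)%R -> leb `[0%R, r[%classic = r%:E.
Proof.
move=> r0; rewrite lebesgue_measure_itv/= lte_fin; case: ltP => [|r0'].
  by rewrite sube0.
by congr (_%:E); apply/eqP; rewrite eq_le r0.
Qed.

Lemma int_cst_itv0 (c r : R) : (0 <= r)%R ->
  \int[leb]_(t in `[0%R, +oo[) (c * \1_(`[0%R, r[%classic) t)%:E = (c * r)%:E.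
Proof.
move=> r0; rewrite (int_indic leb _ (fun=> c)); last exact: measurable_itv.
rewrite (_ : _ `&` _ = `[0%R, r[%classic); last first.
  apply/seteqP; split => t /=; rewrite !in_itv/= ?andbT; first by case.
  by move=> /andP[-> ->].
rewrite -[LHS]/(\int[leb]_(x in `[0%R, r[%classic) cst c%:E x) integral_cst//.
by rewrite EFinM; congr (_ * _); exact: lebesgue_itv0.
Qed.

(** Tonelli on the region 0 <= t < u x with density v x. *)
Lemma layer_cake_weighted (D : set T) (u v : T -> R) : measurable D ->
  measurable_fun setT u -> measurable_fun setT v ->
  (forall x, 0 <= u x)%R -> (forall x, 0 <= v x)%R ->
  \int[mu]_(x in D) (u x * v x)%:E =
  \int[leb]_(t in `[0%R, +oo[) \int[mu]_(x in D `&` [set x | (t < u x)%R]) (v x)%:E.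
Proof.
move=> mD mu_ mv u0 v0.
pose E := (D `*` `[0%R, +oo[%classic) `&` [set z : T * R | (0 < u z.1 - z.2)%R].
have mE : measurable E.
  apply: measurableI; first exact: measurableX.
  have : measurable_fun setT (fun z : T * R => u z.1 - z.2)%R.
    apply: measurable_funB; last exact: measurable_snd.
    exact: (measurableT_comp mu_ measurable_fst).
  move=> /(_ measurableT _ (measurable_itv `]0%R, +oo[)); rewrite setTI.
  by congr (measurable _); apply/seteqP; split => z /=; rewrite in_itv/= andbT.
pose f (z : T * R) := (v z.1 * \1_E z)%:E.
have mf : measurable_fun setT f.
  apply/measurable_EFinP; apply: measurable_funM.
    exact: (measurableT_comp mv measurable_fst).
  exact: measurable_indic.
have f0 z : 0 <= f z by rewrite lee_fin mulr_ge0.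
have := @fubini_tonelli _ _ _ _ _ mu leb f mf f0.
rewrite [LHS](_ : _ = \int[mu]_(x in D) (u x * v x)%:E).
  move=> ->; rewrite [RHS]integral_mkcond; apply: eq_integral => t _.
  rewrite patchE; case: ifPn => t0.
    rewrite integral_mkcond [RHS]integral_mkcond; apply: eq_integral => x _.
    rewrite !patchE in_setT /f /= indicE.
    have -> : ((x, t) \in E) = (x \in D `&` [set x | (t < u x)%R]).
      apply/idP/idP; rewrite !inE.
        by move=> [[Dx _] /=]; rewrite subr_gt0.
      move=> [Dx /= tu]; split => /=; last by rewrite subr_gt0.
      by split => //; rewrite inE in t0.
    by case: ifPn; rewrite ?mulr1 ?mulr0.
  rewrite integral0_eq// => x _; rewrite /f /= indicE memNset ?mulr0// => -[[_ /= h] _].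
  by move/negP: t0; apply; rewrite inE.
rewrite [RHS]integral_mkcond; apply: eq_integral => x _; rewrite patchE.
case: ifPn => xD.
  rewrite [LHS](_ : _ = (v x)%:E * \int[leb]_t (\1_(`[0%R, u x[%classic) t)%:E).
    have -> : \int[leb]_t (\1_(`[0%R, u x[%classic) t)%:E = (u x)%:E.
      by rewrite integral_indic// setIT; exact: lebesgue_itv0.
    by rewrite -EFinM mulrC.
  rewrite -ge0_integralZl_EFin//; last first.
    by apply/measurable_EFinP; exact: measurable_indic.
  apply: eq_integral => t _; rewrite /f /= EFinM; congr (_ * _%:E).
  rewrite !indicE; congr (_%:R); congr nat_of_bool; apply/idP/idP; rewrite !inE.
    by move=> [[_ /=]]; rewrite !in_itv/= andbT subr_gt0 => -> ->.
  rewrite /= in_itv/= => /andP[t0 tu]; split => /=; last by rewrite subr_gt0.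
  by split; [rewrite inE in xD|rewrite /= in_itv/= t0].
rewrite integral0_eq// => t _; rewrite /f /= indicE memNset ?mulr0// => -[[/= h _] _].
by move/negP: xD; apply; rewrite inE.
Qed.

Lemma layer_cake (D : set T) (u : T -> R) : measurable D ->
  measurable_fun setT u -> (forall x, 0 <= u x)%R ->
  \int[mu]_(x in D) (u x)%:E =
  \int[leb]_(t in `[0%R, +oo[) mu (D `&` [set x | (t < u x)%R]).
Proof.
move=> mD mu_ u0.
have := layer_cake_weighted mD mu_ (@measurable_cst _ _ _ _ setT (1 : R)%R) u0 (fun=> ler01).
under eq_integral do rewrite mulr1; move=> ->.
apply: eq_integral => t _.
rewrite -[LHS]/(\int[mu]_(x in _) (cst 1 x)) integral_cst ?mul1e//.
apply: measurableI => //; rewrite -[X in measurable X]setTI.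
have := mu_ measurableT _ (measurable_itv `]t, +oo[).
by congr (measurable (_ `&` _)); apply/seteqP; split => x /=; rewrite in_itv/= andbT.
Qed.

End layer_cake.

(** * The isoperimetric inequality for smooth functions *)

Section dilation.
Variables (R : realType) (n : nat).
Hypothesis n0 : (0 < n)%N.
Local Notation V := 'rV[R]_n.
Local Notation mu := (@lebesgue R n).
Local Notation om := (unit_ball_volume R n).

Lemma bernoulli_expr (r b : R) m : 0 <= r -> 0 <= b ->
  r ^+ m.+1 + m.+1%:R * r ^+ m * b <= (r + b) ^+ m.+1.
Proof.
move=> r0 b0; elim: m => [|m IH]; first by rewrite expr0 !expr1 mulr1 mul1r.
rewrite [leRHS]exprS; apply: le_trans (ler_wpM2l (addr_ge0 r0 b0) IH).
rewrite !exprS; have := exprn_ge0 m r0; set x := r ^+ m => x0.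
rewrite -(natr1 m.+1); set k := m.+1%:R; have k0 : 0 <= k :> R by rewrite ler0n.
rewrite -subr_ge0.
suff -> : (r + b) * (r * x + k * x * b) - (r * (r * x) + (k + 1) * (r * x) * b) =
  k * x * b * b by rewrite !mulr_ge0.
by ring.
Qed.

(** Brunn-Minkowski for [A] and a ball of radius e, with the n-th power expanded to first order in e
    by Bernoulli. The coefficient n om a^(n-1) is the area of the sphere of radius a, so this is the
    isoperimetric inequality in the form of Minkowski content. *)
Lemma lebesgue_dilate (A C : set V) (a e : R) : open A -> 0 < a -> 0 < e ->
  ((om * a ^+ n)%:E <= mu A)%E -> (mu A < +oo)%E ->
  (forall x h, A x -> enorm h < e -> C (x + h)) ->
  (mu A + (n%:R * om * a ^+ n.-1 * e)%:E <= mu C)%E.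
Proof.
move=> oA a0 e0 aA Aoo AC.
have om0 : 0 < om := unit_ball_volume_gt0 R n.
have Af : mu A \is a fin_num by rewrite ge0_fin_numE// lebesgue_outer_ge0.
rewrite -(fineK Af) in aA *; set m := fine (mu A) in aA *; rewrite lee_fin in aA.
have m0 : 0 < m by apply: lt_le_trans aA; rewrite mulr_gt0// exprn_gt0.
have oe0 : 0 < om * e ^+ n by rewrite mulr_gt0// exprn_gt0.
have bm : (((nroot n m + nroot n (om * e ^+ n)) ^+ n)%:E <= mu C)%E.
  apply: (@brunn_minkowski R n n0 A (eball 0 e)) => //.
  - exact: open_eball.
  - by rewrite fineK.
  - by rewrite lebesgue_eball.
  - by move=> x y Ax ye; apply: AC => //; move: ye; rewrite /eball/= subr0.
apply: le_trans bm; rewrite -EFinD lee_fin.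
have ro : 0 <= nroot n om by exact: nroot_ge0.
have ra : nroot n om * a <= nroot n m.
  have an0 : 0 <= a ^+ n by rewrite exprn_ge0 ?ltW.
  rewrite -[X in _ * X](nrootX n0 (ltW a0)) -(nrootM _ (ltW om0) an0).
  by apply: le_nroot => //; rewrite mulr_ge0// ltW.
have en0 : 0 <= e ^+ n by rewrite exprn_ge0// ltW.
rewrite (nrootM _ (ltW om0) en0) (nrootX n0 (ltW e0)).
have re0 := mulr_ge0 ro (ltW e0).
have := bernoulli_expr n.-1 (nroot_ge0 n m) re0.
rewrite prednK// (nrootK n0 (ltW m0)); apply: le_trans; rewrite lerD2l.
have omE : om = nroot n om * nroot n om ^+ n.-1.
  by rewrite -exprS prednK// (nrootK n0 (ltW om0)).
have -> : n%:R * om * a ^+ n.-1 * e =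
    n%:R * ((nroot n om * a) ^+ n.-1 * (nroot n om * e)).
  by rewrite exprMn {1}omE; ring.
rewrite -mulrA ler_wpM2l//; apply: ler_wpM2r => //.
by apply: lerXn2r ra; rewrite nnegrE; [exact: mulr_ge0 ro (ltW a0)|exact: nroot_ge0].
Qed.

End dilation.

Section clamp.
Variable R : realType.
Implicit Types s t y z : R.

(** Truncation between the levels s and t, shifted to take its values in [0, t - s]; its superlevel
    sets are those of y between the two levels. *)
Definition clamp s t y : R := Num.min (Num.max (y - s) 0) (t - s).

Lemma clamp_ge0 s t y : s <= t -> 0 <= clamp s t y.
Proof. by move=> st; rewrite /clamp le_min le_max lexx orbT subr_ge0 st. Qed.

Lemma clamp_le s t y : clamp s t y <= t - s.
Proof. by rewrite /clamp ge_min lexx orbT. Qed.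

Lemma le_clamp s t y z : y <= z -> clamp s t y <= clamp s t z.
Proof.
by move=> yz; rewrite /clamp /Num.min /Num.max; do ![case: ifPn => //];
  rewrite -?leNgt => *; lra.
Qed.

Lemma clamp_lip s t y z : `|clamp s t y - clamp s t z| <= `|y - z|.
Proof.
wlog yz : y z / y <= z.
  by move=> h; have [/h//|/ltW/h] := leP y z; rewrite distrC (distrC z).
rewrite distrC ger0_norm ?subr_ge0 ?le_clamp// distrC ger0_norm ?subr_ge0//.
by move: yz; rewrite /clamp /Num.min /Num.max; do ![case: ifPn => //];
  rewrite -?leNgt => *; lra.
Qed.

Lemma clamp_lo s t y : s <= t -> y <= s -> clamp s t y = 0.
Proof. by move=> st ys; rewrite /clamp max_r ?min_l// ?subr_ge0// subr_le0. Qed.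

Lemma clamp_hi s t y : s <= t -> t <= y -> clamp s t y = t - s.
Proof.
move=> st ty; rewrite /clamp max_l ?subr_ge0 ?(le_trans st)// min_r//.
by rewrite lerD2r.
Qed.

Lemma lt_clamp s t y r : 0 <= r -> (r < clamp s t y) = (r < t - s) && (r + s < y).
Proof.
move=> r0; rewrite /clamp lt_min lt_max andbC; congr (_ && _).
by rewrite ltrBrDr; case: (ltP r 0) => [|_]; [rewrite ltNge r0|rewrite orbF].
Qed.

Lemma measurable_clamp d (T : measurableType d) s t (u : T -> R) D :
  measurable_fun D u -> measurable_fun D (fun x => clamp s t (u x)).
Proof.
move=> mu; apply: measurable_minr; last exact: measurable_cst.
apply: measurable_maxr; last exact: measurable_cst.
by apply: measurable_funB => //; exact: measurable_cst.
Qed.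

End clamp.

Lemma nonincreasing_emeasurable (R : realType) (F : R -> \bar R) :
  (forall x y, x <= y -> (F y <= F x)%E) -> measurable_fun setT F.
Proof.
move=> niF; apply: (measurability _ (ErealGenOInfty.measurableE R)) => //.
move=> _ [_ [c ->] <-]; rewrite setTI; apply: is_interval_measurable.
move=> x y /=; rewrite !in_itv/= !andbT => xc yc z /andP[xz zy].
by rewrite /= in_itv/= andbT; apply: lt_le_trans yc _; exact: niF.
Qed.

Section tame.
Variables (R : realType) (n : nat).
Hypothesis n0 : (0 < n)%N.
Local Notation V := 'rV[R]_n.
Local Notation mu := (@lebesgue R n).
Local Notation om := (unit_ball_volume R n).

Definition diff_at (phi : V -> R) (x G : V) := forall dl : R, 0 < dl ->
  exists2 e, 0 < e & forall h, enorm h < e ->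
    `|phi (x + h) - phi x - dotv G h| <= dl * enorm h.

(** The regularity of test functions in the form in which it is used: a global Lipschitz constant
    [L] and a bounded support dominate the difference quotients, and differentiability gives their
    pointwise limit. *)
Definition tame (phi : V -> R) (G : V -> V) (L B : R) : Prop :=
  [/\ 0 <= L, forall x y, `|phi x - phi y| <= L * enorm (x - y),
      forall x, phi x != 0 -> enorm x < B,
      measurable_fun setT (fun x => enorm (G x)) &
      forall x, diff_at phi x (G x)].

Variables (phi : V -> R) (G : V -> V) (L B : R).
Hypothesis tphi : tame phi G L B.

Lemma tame_continuous : continuous (phi : V -> R).
Proof.
case: tphi => L0 lip _ _ _ x; apply/(@cvgrPdist_lt _ _ _ (nbhs (x : V))) => e e0.
have L1 : 0 < L + 1 by rewrite ltr_wpDl.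
apply/nbhs_ballP; exists (e / (L + 1) / n.+1%:R) => /=; first by rewrite !divr_gt0.
have e1 : 0 < e / (L + 1) by rewrite divr_gt0.
move=> y /(ball_sub_eball e1); rewrite /eball/= => h.
apply: le_lt_trans (lip _ _) _; rewrite enormBC.
apply: (@le_lt_trans _ _ ((L + 1) * enorm (y - x))).
  by rewrite ler_wpM2r ?enorm_ge0// lerDl.
by rewrite -ltr_pdivlMl// mulrC.
Qed.

Lemma measurable_tame : measurable_fun setT phi.
Proof. by apply: continuous_measurable_rV; exact: tame_continuous. Qed.

Lemma measurable_normtame : measurable_fun setT (fun x => `|phi x|).
Proof. exact: (measurableT_comp _ measurable_tame). Qed.

Lemma tame_near (x : V) (dl : R) : 0 < dl -> exists2 e, 0 < e & forall h, enorm h < e ->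
  `| `|phi (x + h)| - `|phi x| | <= (enorm (G x) + dl) * enorm h.
Proof.
move=> dl0; case: tphi => _ _ _ _ /(_ x dl dl0)[e e0 he]; exists e => // h /he.
move=> h1; apply: le_trans (ler_dist_dist _ _) _.
have := norm_dotv (G x) h.
have := ler_normD (phi (x + h) - phi x - dotv (G x) h) (dotv (G x) h).
rewrite subrK mulrDl; lra.
Qed.

Lemma open_superlevel (t : R) : open [set x : V | t < `|phi x|].
Proof.
rewrite (_ : [set _ | _] = (fun x => `|phi x|) @^-1` [set y | t < y]).
  apply: open_comp; last exact: open_gt.
  move=> x _; apply: (@continuous_comp V R R phi (fun y => `|y|)).
    exact: tame_continuous.
  exact: norm_continuous.
by apply/seteqP; split.
Qed.

Lemma superlevel_lty (t : R) : 0 <= t -> (mu [set x | (t < `|phi x|)%R] < +oo)%E.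
Proof.
move=> t0; apply: le_lt_trans (lebesgue_eball_lty (0 : V) B).
apply: le_lebesgue_outer => x /= tx; rewrite /eball/= subr0.
case: tphi => _ _ + _ _; apply; rewrite -normr_gt0; exact: le_lt_trans tx.
Qed.

(* [supn e] plays the role of the inf-convolution: its superlevel sets are the
   e-neighbourhoods of those of |phi|. *)
Definition supn (e : R) (x : V) : R := sup [set `|phi (x + h)| | h in eball (0 : V) e].

Let has_sup_supn e x : 0 < e -> has_sup [set `|phi (x + h)| | h in eball (0 : V) e].
Proof.
move=> e0; case: tphi => L0 lip _ _ _; split.
  by exists `|phi (x + 0)|; exists 0 => //; rewrite /eball/= subrr enorm0.
exists (`|phi x| + L * e) => _ [h he <-].
have := lip (x + h) x; rewrite addrAC subrr add0r => h1.
have : L * enorm h <= L * e.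
  by rewrite ler_wpM2l// ltW//; move: he; rewrite /eball/= subr0.
have := ler_normD (phi (x + h) - phi x) (phi x); rewrite subrK; lra.
Qed.

Lemma supn_gtP e x t : 0 < e ->
  t < supn e x <-> exists2 h, enorm h < e & t < `|phi (x + h)|.
Proof.
move=> e0; split => [|[h he tx]].
  move=> /(sup_gt (has_sup_supn x e0).1)[_ [h he <-] th]; exists h => //.
  by move: he; rewrite /eball/= subr0.
apply: (lt_le_trans tx); apply: sup_ubound; first exact: (has_sup_supn x e0).2.
by exists h => //; rewrite /eball/= subr0.
Qed.

Lemma supn_ge e x : 0 < e -> `|phi x| <= supn e x.
Proof.
move=> e0; apply: sup_ubound; first exact: (has_sup_supn x e0).2.
by exists 0; rewrite ?addr0// /eball/= subrr enorm0.
Qed.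

Lemma supn_le e x (M : R) : 0 < e ->
  (forall h, enorm h < e -> `|phi (x + h)| <= M) -> supn e x <= M.
Proof.
move=> e0 h; apply: ge_sup; first exact: (has_sup_supn x e0).1.
by move=> _ [y ye <-]; apply: h; move: ye; rewrite /eball/= subr0.
Qed.

Lemma measurable_supn e : 0 < e -> measurable_fun setT (supn e).
Proof.
move=> e0; apply: (measurability _ (RGenOInfty.measurableE R)) => //.
move=> _ [_ [c ->] <-]; rewrite setTI; apply: measurable_open.
rewrite (_ : _ @^-1` _ = \bigcup_(h in [set h | enorm h < e])
   (fun x => x + h) @^-1` [set x | c < `|phi x|]).
  apply: bigcup_open => h _; apply: open_comp; last exact: open_superlevel.
  by move=> x _; apply: (@cvgD R V _ (nbhs (x : V))); [exact: cvg_id|exact: cvg_cst].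
apply/seteqP; split => x /=; rewrite in_itv/= andbT.
  by move=> /(supn_gtP _ _ e0)[h he hx]; exists h.
by move=> [h /= he hx]; apply/(supn_gtP _ _ e0); exists h.
Qed.

Definition slab (s t : R) : set V := [set x | s <= `|phi x| <= t].

Lemma measurable_slab s t : measurable (slab s t).
Proof.
have := measurable_normtame measurableT (measurable_itv `[s, t]).
by rewrite setTI; congr measurable; apply/seteqP; split => x /=; rewrite in_itv.
Qed.

Lemma measurable_slabgrad (k s t : R) :
  measurable_fun setT (fun x => Num.max (enorm (G x) - k) 0 * \1_(slab s t) x).
Proof.
case: tphi => _ _ _ mG _; apply: measurable_funM; last first.
  exact: measurable_indic (measurable_slab s t).
apply: measurable_maxr; last exact: measurable_cst.
by apply: measurable_funB => //; exact: measurable_cst.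
Qed.

(** The superlevel sets of [supn e] are e-neighbourhoods of those of |phi|. Hence [lebesgue_dilate]
    at every level, integrated by the layer cake formula, shows that replacing |phi| by [supn e]
    raises the integral of the truncation by at least e (t - s) n om a^(n-1). Divided by e, this
    increase is dominated by [L] on a ball, and its pointwise limsup is at most |G| on the slab and
    0 elsewhere. *)
Lemma tame_isoperimetric (s t a : R) : 0 <= s -> s < t -> 0 < a ->
  (forall r, r < t -> ((om * a ^+ n)%:E <= mu [set x | (r < `|phi x|)%R])%E) ->
  (((t - s) * (n%:R * om * a ^+ n.-1))%:E <=
     \int[mu]_x (enorm (G x) * \1_(slab s t) x)%:E)%E.
Proof.
move=> s0 st a0 ha; have [L0 lip sup mG dif] := tphi.
pose ek (k : nat) : R := k.+1%:R^-1.
have ek0 k : 0 < ek k by rewrite invr_gt0 ltr0n.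
pose psi x := clamp s t `|phi x|.
pose psik k x := clamp s t (supn (ek k) x).
have mpsi : measurable_fun setT psi by apply: measurable_clamp; exact: measurable_normtame.
have mpsik k : measurable_fun setT (psik k).
  by apply: measurable_clamp; exact: measurable_supn.
have st' := ltW st.
have psi0 x : 0 <= psi x by exact: clamp_ge0.
have psik0 k x : 0 <= psik k x by exact: clamp_ge0.
have psile k x : psi x <= psik k x by apply: le_clamp; exact: supn_ge.
pose c := n%:R * om * a ^+ n.-1.
have c0 : 0 < c by rewrite /c !mulr_gt0 ?ltr0n ?unit_ball_volume_gt0 ?exprn_gt0.
pose f k x := (psik k x - psi x) / ek k.
have B0 k x : B + 1 <= enorm x -> psik k x = 0.
  move=> Bx; apply: clamp_lo => //; apply: le_trans s0.
  apply: supn_le => // h he; rewrite normr_le0; apply/negPn/negP => /sup hB.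
  have : enorm h < 1.
    apply: (lt_le_trans he); rewrite /ek invf_le1 ?ltr0n// ler1n//.
  have := enormD (x + h) (- h); rewrite addrK enormN; lra.
have fg k x : 0 <= f k x <= L * \1_(eball (0 : V) (B + 1)) x.
  have f0 : 0 <= f k x by rewrite divr_ge0 ?subr_ge0// ltW.
  rewrite f0/= indicE; have [xB|Bx] := ltP (enorm x) (B + 1).
    rewrite mem_set ?mulr1 ?ler_pdivrMr//; last by rewrite /eball/= subr0.
    apply: le_trans (ler_norm _) _; apply: le_trans (clamp_lip _ _ _ _) _.
    rewrite ger0_norm ?subr_ge0 ?supn_ge// lerBlDr.
    apply: supn_le => // h he; have := lip (x + h) x; rewrite addrAC subrr add0r.
    have : L * enorm h <= L * ek k by rewrite ler_wpM2l// ltW.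
    have := ler_normD (phi (x + h) - phi x) (phi x); rewrite subrK; lra.
  have := B0 k x Bx; have := psile k x; have := psi0 x; rewrite /f => a1 a2 a3.
  have -> : psik k x - psi x = 0 by lra.
  by rewrite mul0r mulr_ge0.
have mB : measurable (eball (0 : V) (B + 1)) by exact: measurable_eball.
have mBoo := lebesgue_eball_lty (0 : V) (B + 1).
have mf k : measurable_fun setT (f k).
  apply: measurable_funM; last exact: measurable_cst.
  exact: measurable_funB.
have mF : measurable_fun setT (fun x => enorm (G x) * \1_(slab s t) x).
  by apply: measurable_funM mG _; exact: measurable_indic (measurable_slab s t).
apply: (limsup_integral_ge mf mF (integrable_cst_indic L mB mBoo) fg (e := fun=> 0)).
- by move=> x; rewrite mulr_ge0 ?enorm_ge0.
- apply/aeW => x dl dl0.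
  have GI : 0 <= enorm (G x) * \1_(slab s t) x by rewrite mulr_ge0 ?enorm_ge0.
  have [e e0 he] := tame_near x dl0.
  (* Below the slab, the Lipschitz bound keeps the supremum over small balls under the level s; the
     factor L + 1 avoids a division by zero. *)
  have [e' e'0 he'] : exists2 e', 0 < e' & forall r, 0 < r -> r < e' ->
      (`|phi x| < s -> supn r x <= s) /\ (t < `|phi x| -> t <= `|phi x|).
    pose q := (s - `|phi x|) / (L + 1).
    have L1 : 0 < L + 1 by rewrite ltr_wpDl.
    exists (if `|phi x| < s then q else 1).
      by case: ifPn => // h; rewrite divr_gt0// subr_gt0.
    move=> r r0 rq; split; last by move/ltW.
    move=> xs; rewrite xs in rq; apply: supn_le => // h hr.
    have := lip (x + h) x; rewrite addrAC subrr add0r.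
    have : L * enorm h <= (L + 1) * q.
      apply: (@le_trans _ _ (L * q)); first by rewrite ler_wpM2l// ltW// (lt_trans hr).
      by rewrite ler_wpM2r ?lerDl// divr_ge0 ?ltW// subr_gt0.
    have -> : (L + 1) * q = s - `|phi x| by rewrite /q mulrC divfK// gt_eqF.
    have := ler_normD (phi (x + h) - phi x) (phi x); rewrite subrK; lra.
  have ee0 : 0 < Num.min e e' by rewrite lt_min e0.
  have [N] := ltr_add_invr ee0; rewrite add0r lt_min => /andP[Ne Ne'].
  exists N => k Nk.
  have kN : ek k <= N.+1%:R^-1 by rewrite lef_pV2 ?posrE ?ltr0n// ler_nat.
  have [h1 h2] := he' _ (ek0 k) (le_lt_trans kN Ne').
  rewrite /f ler_pdivrMr//.
  have [xs|sx] := ltP `|phi x| s.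
    rewrite /psik /psi (clamp_lo st' (h1 xs)) (clamp_lo st' (ltW xs)).
    by rewrite subrr mulr_ge0 ?addr_ge0// ltW.
  have [tx|xt] := ltP t `|phi x|.
    have := clamp_le s t (supn (ek k) x).
    rewrite /psik /psi (clamp_hi st' (ltW tx)) => a1.
    by rewrite (@le_trans _ _ 0)// ?subr_le0// mulr_ge0 ?addr_ge0// ltW.
  rewrite indicE mem_set ?mulr1; last by rewrite /slab/= sx.
  apply: le_trans (ler_norm _) _; apply: le_trans (clamp_lip _ _ _ _) _.
  rewrite ger0_norm ?subr_ge0 ?supn_ge// lerBlDr.
  apply: supn_le => // h hk.
  have := he h (lt_trans hk (le_lt_trans kN Ne)); rewrite ler_norml => /andP[_].
  have : (enorm (G x) + dl) * enorm h <= (enorm (G x) + dl) * ek k.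
    by rewrite ler_wpM2l ?(ltW hk)// addr_ge0 ?enorm_ge0// ltW.
  lra.
- exact: cvg_cst.
- move=> k; rewrite adde0.
  have key : (\int[mu]_x (psi x)%:E + ((t - s) * (c * ek k))%:E <= \int[mu]_x (psik k x)%:E)%E.
    rewrite (layer_cake _ measurableT mpsi psi0) (layer_cake _ measurableT (mpsik k) (psik0 k)).
    have ck : 0 < c * ek k by exact: mulr_gt0.
    have -> : ((t - s) * (c * ek k))%:E = (\int[lebesgue_measure]_(r in `[0%R, +oo[)
       ((c * ek k) * \1_(`[0%R, t - s[%classic) r)%:E)%E.
      by rewrite int_cst_itv0 ?subr_ge0// mulrC.
    have mlev (u : V -> R) : measurable_fun setT
        (fun r : R => mu (setT `&` [set x | (r < u x)%R])).
      apply: nonincreasing_emeasurable => x y xy; apply: le_lebesgue_outer.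
      by move=> z /= [_ yz]; split => //; exact: le_lt_trans yz.
    rewrite -ge0_integralD//; last 3 first.
    + exact: (measurable_funTS (mlev psi)).
    + by move=> r _; rewrite lee_fin mulr_ge0// ltW.
    + apply/measurable_EFinP; apply: measurable_funM; first exact: measurable_cst.
      exact: measurable_indic.
    apply: ge0_le_integral => //.
    + by move=> r _; rewrite adde_ge0 ?lebesgue_outer_ge0// lee_fin mulr_ge0// ltW.
    + apply: emeasurable_funD; first exact: (measurable_funTS (mlev psi)).
      apply/measurable_EFinP; apply: measurable_funM; first exact: measurable_cst.
      exact: measurable_indic.
    + exact: (measurable_funTS (mlev (psik k))).
    + move=> r; rewrite /= in_itv/= andbT => r0; rewrite !setTI indicE.
      have [rts|tsr] := ltP r (t - s); last first.
        rewrite memNset ?mulr0 ?adde0; last by rewrite /= in_itv/= r0/= ltNge tsr.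
        by apply: le_lebesgue_outer => x /= h; exact: (lt_le_trans h).
      rewrite mem_set ?mulr1; last by rewrite /= in_itv/= r0.
      have lev (u : V -> R) : [set x | r < clamp s t (u x)] = [set x | r + s < u x].
        by apply/seteqP; split => x /=; rewrite lt_clamp// rts.
      rewrite /psi /psik !lev; apply: lebesgue_dilate => //.
      * exact: open_superlevel.
      * by apply: ha; lra.
      * by apply: superlevel_lty; lra.
      * by move=> x h /= hx he; apply/supn_gtP => //; exists (- h); rewrite ?enormN// addrK.
  have psifin : (\int[mu]_x (psi x)%:E \is a fin_num)%E.
    rewrite ge0_fin_numE; last exact: int_ge0.
    apply: (@le_lt_trans _ _ (\int[mu]_x ((t - s) * \1_(eball (0 : V) B) x)%:E)%E).
      apply: int_le; [exact: measurableT|exact: mpsi| |exact: psi0|].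
        apply: measurable_funM; first exact: measurable_cst.
        exact: measurable_indic (measurable_eball _ _).
      move=> x _; rewrite indicE; have [xB|Bx] := ltP (enorm x) B.
        by rewrite mem_set ?mulr1 ?clamp_le//; rewrite /eball/= subr0.
      rewrite memNset ?mulr0; last by rewrite /eball/= subr0; apply/negP; rewrite -leNgt.
      rewrite /psi clamp_lo//; apply: le_trans s0; rewrite normr_le0.
      by apply/negPn/negP => /sup; rewrite ltNge Bx.
    rewrite int_cst_indic; last exact: measurable_eball.
    by rewrite lte_mul_pinfty ?lee_fin ?subr_ge0// lebesgue_eball_lty.
  rewrite -(int_diff mu (ek0 k) mpsi (mpsik k) psi0 (psile k)) in key.
  rewrite leeD2lE// in key.
  rewrite -(@lee_pmul2l _ (ek k)%:E)// ?lte_fin//; apply: le_trans key.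
  rewrite -EFinM lee_fin.
  by have -> : ek k * ((t - s) * (n%:R * om * a ^+ n.-1)) = (t - s) * (c * ek k) by rewrite /c; ring.
Qed.

End tame.

(** * Increments of truncated functions *)

Lemma lee_realP (R : realType) (a b : \bar R) : (0 <= b)%E ->
  (forall c : R, (c%:E <= a)%E -> (c%:E <= b)%E) -> (a <= b)%E.
Proof.
case: a => [r| |] b0 h; [exact: h| |exact: leNye].
case: b b0 h => [r| |]// _ h; have := h (r + 1) (leey _).
by rewrite lee_fin => h1; exfalso; lra.
Qed.

Section increments.
Variables (R : realType) (n : nat).
Hypothesis n0 : (0 < n)%N.
Local Notation V := 'rV[R]_n.
Local Notation mu := (@lebesgue R n).
Variables (phi : V -> R) (G : V -> V) (L B : R).
Hypothesis tphi : tame phi G L B.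

Section defect.
Variables (s t : R).
Hypothesis (s0 : 0 <= s) (st : s <= t).
Local Notation psi := (fun x => clamp s t `|phi x|).

Lemma max0_leD (a b c : R) : a <= b + c -> Num.max a 0 <= Num.max b 0 + Num.max c 0.
Proof.
move=> h; rewrite ge_max addr_ge0 ?le_max ?lexx ?orbT// andbT.
by apply: le_trans h _; rewrite lerD// le_max lexx.
Qed.

(** Excess of the increment of [u] along [h] over the one that a [k]-Lipschitz function may have.
    The Lipschitz bound for [h] holds almost everywhere when the integral of this excess
    vanishes. *)
Definition defect (u : V -> R) (k : R) (h x : V) : R :=
  Num.max (`|u (x + h) - u x| - k * enorm h) 0.

Lemma defect_ge0 u k h x : 0 <= defect u k h x.
Proof. by rewrite le_max lexx orbT. Qed.

Lemma measurable_defect (u : V -> R) (k : R) (h : V) : measurable_fun setT u -> measurable_fun setT (defect u k h).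
Proof.
move=> mu_; apply: measurable_maxr; last exact: measurable_cst.
apply: measurable_funB; last exact: measurable_cst.
apply: (measurableT_comp (@normr_measurable R setT)).
by apply: measurable_funB; [exact: (measurableT_comp mu_ (measurable_fun_translate h))|exact: mu_].
Qed.

Lemma defect_split (u : V -> R) (k : R) (N : nat) (h x : V) :
  defect u k (N%:R *: h) x <= \sum_(i < N) defect u k h (x + i%:R *: h).
Proof.
elim: N => [|N IH].
  by rewrite big_ord0 scale0r /defect addr0 subrr normr0 enorm0 mulr0 subrr maxxx.
rewrite big_ord_recr/=; apply: le_trans (lerD IH (lexx _)).
have xE : x + N.+1%:R *: h = x + N%:R *: h + h by rewrite -natr1 scalerDl scale1r addrA.
rewrite /defect xE !enormZ (ger0_norm (ler0n _ N)) (ger0_norm (ler0n _ N.+1)) -(natr1 N).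
set a := u (x + _ + h); set b := u x; set c := u (x + _).
have := ler_normD (a - c) (c - b); rewrite addrA subrK.
set m := N%:R; rewrite mulrDl mul1r mulrDr.
set p := k * _; set q := k * _ => h1; apply: max0_leD.
move: h1; move: `|_| `|_| `|_| (m * p) => *; lra.
Qed.

(** A long translation is split into N short ones; by translation invariance the N excesses have the
    same integral. *)
Lemma int_defect_split (u : V -> R) (k : R) (N : nat) (h : V) : measurable_fun setT u ->
  (\int[mu]_x (defect u k (N%:R *: h) x)%:E <=
   N%:R%:E * \int[mu]_x (defect u k h x)%:E)%E.
Proof.
move=> mu_.
have mD (i : R) : measurable_fun setT (fun x : V => defect u k h (x + i *: h)).
  exact: (measurableT_comp (measurable_defect k h mu_) (measurable_fun_translate _)).
have eqI (i : nat) : (\int[mu]_x (defect u k h (x + i%:R *: h))%:E =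
    \int[mu]_x (defect u k h x)%:E)%E.
  rewrite -[RHS](ge0_integral_translate (i%:R *: h)); first by [].
  - by apply/measurable_EFinP; exact: measurable_defect.
  - by move=> x; rewrite lee_fin defect_ge0.
apply: (@le_trans _ _ (\int[mu]_x (\sum_(i < N) defect u k h (x + i%:R *: h))%:E)%E).
  apply: int_le; [exact: measurableT|exact: measurable_defect| | |].
  - by apply: measurable_sum => i; exact: mD.
  - by move=> x; exact: defect_ge0.
  - by move=> x _; exact: defect_split.
elim: N => [|N IH].
  rewrite mul0e integral0_eq// => x _; by rewrite big_ord0.
under eq_integral do rewrite big_ord_recr/=.
rewrite intD; first last.
- by move=> x; exact: defect_ge0.
- by move=> x; apply: sumr_ge0 => i _; exact: defect_ge0.
- exact: mD.
- by apply: measurable_sum => i; exact: mD.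
- exact: measurableT.
rewrite eqI -natr1 EFinD ge0_muleDl ?lee_fin// mul1e; exact: leeD.
Qed.

Lemma clamp_norm_lip (h x : V) : `|clamp s t `|phi (x + h)| - clamp s t `|phi x| | <= L * enorm h.
Proof.
case: tphi => L0 lip _ _ _; apply: le_trans (clamp_lip _ _ _ _) _.
apply: le_trans (ler_dist_dist _ _) _.
by have := lip (x + h) x; rewrite addrAC subrr add0r.
Qed.

Lemma defect_limsup (k : R) (h x : V) (dl : R) : 0 <= k -> 0 < dl ->
  exists N, forall j, (N <= j)%N ->
    j.+1%:R * defect psi k (j.+1%:R^-1 *: h) x <=
    enorm h * (Num.max (enorm (G x) - k) 0 * \1_(slab phi s t) x) + dl.
Proof.
move=> k0 dl0; have [L0 lip sup mG dif] := tphi.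
have eh0 := enorm_ge0 h.
set F := Num.max _ 0; have F0 : 0 <= F by rewrite le_max lexx orbT.
have F1 : enorm (G x) - k <= F by rewrite le_max lexx.
pose d' := dl / (enorm h + 1).
have h1 : 0 < enorm h + 1 by rewrite ltr_wpDl.
have d'0 : 0 < d' by rewrite divr_gt0.
have [e e0 he] := tame_near tphi x d'0.
(* The three bounds on the step: differentiability at x applies; a point below the slab stays below
   it; a point above stays above. In the last two cases the truncation does not vary. *)
pose q := Num.min e (Num.min (if `|phi x| < s then (s - `|phi x|) / (L + 1) else 1)
  (if t < `|phi x| then (`|phi x| - t) / (L + 1) else 1)).
have L1 : 0 < L + 1 by rewrite ltr_wpDl.
have q0 : 0 < q.
  rewrite !lt_min e0/=; apply/andP; split; case: ifPn => // h';
    by rewrite divr_gt0// subr_gt0.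
have [N] := ltr_add_invr (divr_gt0 q0 h1); rewrite add0r => Nq.
exists N => j Nj; set h' := j.+1%:R^-1 *: h.
have j0 : 0 < j.+1%:R :> R by rewrite ltr0n.
have hE : enorm h = j.+1%:R * enorm h'.
  by rewrite /h' enormZ gtr0_norm ?invr_gt0// mulrA divff ?mul1r// gt_eqF.
have h'0 : 0 <= enorm h' by exact: enorm_ge0.
have h'q : enorm h' < q.
  rewrite /h' enormZ gtr0_norm ?invr_gt0//.
  apply: (@le_lt_trans _ _ (N.+1%:R^-1 * enorm h)).
    by rewrite ler_wpM2r// lef_pV2 ?posrE ?ltr0n// ler_nat.
  apply: (@lt_trans _ _ (N.+1%:R^-1 * (enorm h + 1))).
    by rewrite ltr_pM2l ?ltrDl// invr_gt0 ltr0n.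
  by rewrite -ltr_pdivlMr.
have R0 : 0 <= enorm h * (F * \1_(slab phi s t) x) + dl.
  by rewrite addr_ge0 ?mulr_ge0// ltW.
have zero : `|clamp s t `|phi (x + h')| - clamp s t `|phi x| | = 0 ->
    j.+1%:R * defect psi k h' x <= enorm h * (F * \1_(slab phi s t) x) + dl.
  move=> z; rewrite /defect z max_r ?mulr0//.
  by rewrite sub0r oppr_le0 mulr_ge0.
have lipx : `| `|phi (x + h')| - `|phi x| | <= L * enorm h'.
  apply: le_trans (ler_dist_dist _ _) _.
  by have := lip (x + h') x; rewrite addrAC subrr add0r.
have Lq : L * enorm h' <= (L + 1) * q.
  apply: (@le_trans _ _ (L * q)); first by rewrite ler_wpM2l// ltW.
  by rewrite ler_wpM2r ?lerDl// ltW.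
have [xs|sx] := ltP `|phi x| s.
  apply: zero; rewrite !clamp_lo ?subrr ?normr0// ?(ltW xs)//.
  have : (L + 1) * q <= s - `|phi x|.
    by rewrite mulrC -ler_pdivlMr// /q xs !ge_min lexx !orbT.
  move: lipx; rewrite ler_norml => /andP[_]; lra.
have [tx|xt] := ltP t `|phi x|.
  apply: zero; rewrite !clamp_hi ?subrr ?normr0// ?(ltW tx)//.
  have : (L + 1) * q <= `|phi x| - t.
    by rewrite mulrC -ler_pdivlMr//; rewrite /q tx !ge_min lexx !orbT.
  move: lipx; rewrite ler_norml => /andP[+ _]; lra.
rewrite indicE mem_set ?mulr1; last by rewrite /slab/= sx.
have qe : q <= e by rewrite /q ge_min lexx.
have he' := he h' (lt_le_trans h'q qe).
have c1 := clamp_lip s t `|phi (x + h')| `|phi x|.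
have : defect psi k h' x <= (F + d') * enorm h'.
  rewrite /defect ge_max mulr_ge0 ?addr_ge0 ?(ltW d'0)// andbT.
  have : (enorm (G x) + d' - k) * enorm h' <= (F + d') * enorm h'.
    by rewrite ler_wpM2r//; lra.
  rewrite mulrBl; lra.
rewrite -(ler_pM2l j0); move=> /le_trans; apply.
rewrite [enorm h]hE mulrCA -hE [(F + d') * _]mulrC [in leRHS]hE.
have d'h : d' * enorm h <= dl.
  rewrite /d' -mulrA -[leRHS]mulr1 ler_wpM2l ?(ltW dl0)// mulrC ler_pdivrMr//.
  by rewrite mul1r lerDl.
by move: d'h; rewrite hE; lra.
Qed.

(** By [int_defect_split] the translation [h] may be divided into arbitrarily many steps; the
    rescaled excess of one step then tends to at most |h| times the excess of |G| over k on the
    slab. *)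
Lemma tame_defect (k : R) (h : V) : 0 <= k ->
  (\int[mu]_x (defect psi k h x)%:E <=
   \int[mu]_x (enorm h * (Num.max (enorm (G x) - k) 0 * \1_(slab phi s t) x))%:E)%E.
Proof.
move=> k0; have [L0 lip sup mG dif] := tphi.
have mpsi : measurable_fun setT psi.
  by apply: measurable_clamp; exact: (measurable_normtame tphi).
have mF := measurable_slabgrad tphi k s t.
pose f (j : nat) x := j.+1%:R * defect psi k (j.+1%:R^-1 *: h) x.
have mf j : measurable_fun setT (f j).
  by apply: measurable_funM; [exact: measurable_cst|exact: measurable_defect].
have mBall : measurable (eball (0 : V) (B + enorm h)) by exact: measurable_eball.
have Boo := lebesgue_eball_lty (0 : V) (B + enorm h).
have fg j x : 0 <= f j x <= (L * enorm h) * \1_(eball (0 : V) (B + enorm h)) x.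
  have j0 : 0 < j.+1%:R :> R by rewrite ltr0n.
  have hE : j.+1%:R * enorm (j.+1%:R^-1 *: h) = enorm h.
    by rewrite enormZ gtr0_norm ?invr_gt0// mulrA divff ?mul1r// gt_eqF.
  have hle : enorm (j.+1%:R^-1 *: h) <= enorm h.
    rewrite -[leRHS]hE -[leLHS]mul1r ler_wpM2r ?enorm_ge0// ler1n//.
  rewrite /f mulr_ge0 ?defect_ge0//= indicE.
  have [xB|Bx] := ltP (enorm x) (B + enorm h).
    rewrite mem_set ?mulr1; last by rewrite /eball/= subr0.
    rewrite -hE mulrCA ler_pM2l// /defect ge_max mulr_ge0 ?enorm_ge0// andbT.
    have := clamp_norm_lip (j.+1%:R^-1 *: h) x.
    have : 0 <= k * enorm (j.+1%:R^-1 *: h) by rewrite mulr_ge0 ?enorm_ge0.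
    lra.
  rewrite memNset ?mulr0; last by rewrite /eball/= subr0; apply/negP; rewrite -leNgt.
  have z1 : phi x = 0.
    by apply/eqP/negPn/negP => /sup; have := enorm_ge0 h; lra.
  have z2 : phi (x + j.+1%:R^-1 *: h) = 0.
    apply/eqP/negPn/negP => /sup.
    by have := enormD (x + j.+1%:R^-1 *: h) (- (j.+1%:R^-1 *: h)); rewrite addrK enormN; lra.
  by rewrite /defect z1 z2 subrr normr0 sub0r max_r ?mulr0// oppr_le0 mulr_ge0 ?enorm_ge0.
apply: lee_realP.
  apply: int_ge0 => x; rewrite !mulr_ge0 ?enorm_ge0// le_max lexx orbT//.
move=> c hc.
apply: (limsup_integral_ge mf _ (integrable_cst_indic (L * enorm h) mBall Boo) fg (e := fun=> 0)).
- by apply: measurable_funM; [exact: measurable_cst|exact: mF].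
- move=> x; rewrite !mulr_ge0 ?enorm_ge0// le_max lexx orbT//.
- apply/aeW => x dl dl0; exact: defect_limsup.
- exact: cvg_cst.
- move=> j; rewrite adde0 /f intZ; first last.
  + by [].
  + by move=> x; exact: defect_ge0.
  + exact: measurable_defect.
  + exact: measurableT.
  apply: le_trans hc _.
  have := @int_defect_split psi k j.+1 (j.+1%:R^-1 *: h) mpsi.
  by rewrite scalerA divff ?scale1r// pnatr_eq0.
Qed.

End defect.

End increments.

(** * Test functions are tame *)

Section C1.
Variables (R : realType) (n : nat).
Local Notation V := 'rV[R]_n.
Local Notation mu := (@lebesgue R n).
Implicit Types (phi : V -> R) (x h q : V).

Local Notation e_ i := (delta_mx ord0 i : 'rV[R]_n).

Lemma measurable_enorm D (g : V -> V) : 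
  (forall i, measurable_fun D (fun x => g x ord0 i)) ->
  measurable_fun D (fun x => enorm (g x)).
Proof.
move=> mg; apply: (measurableT_comp (f := @Num.sqrt R)).
  by apply: continuous_measurable_fun; exact: sqrt_continuous.
by apply: measurable_sum => i; apply: measurable_funM; exact: mg.
Qed.

Lemma is_derive_line phi q (i : 'I_n) (s : R) : Ck 1 phi ->
  is_derive s 1 (fun s : R => phi (q + s *: e_ i)) (partial i phi (q + s *: e_ i)).
Proof.
move=> [_ /(_ i)[dphi _]].
have E : (fun h : R => h^-1 *: (((fun s : R => phi (q + s *: e_ i)) \o shift s) (h *: 1)
      - phi (q + s *: e_ i))) =
    (fun h : R => h^-1 *: ((phi \o shift (q + s *: e_ i)) (h *: e_ i) - phi (q + s *: e_ i))).
  apply/funext => h /=; rewrite [h%:A]mulr1 scalerDl.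
  by rewrite addrCA.
split; first by rewrite /derivable E; exact: dphi.
by rewrite /derive E.
Qed.

Lemma line_mvt phi q (i : 'I_n) (s : R) : Ck 1 phi -> exists2 c : R, `|c| <= `|s| &
  phi (q + s *: e_ i) - phi q = s * partial i phi (q + c *: e_ i).
Proof.
move=> C1; pose g (s : R) := phi (q + s *: e_ i).
have dg (a b c : R) : c \in `]a, b[ -> is_derive c 1 g (partial i phi (q + c *: e_ i)).
  by move=> _; exact: is_derive_line.
have cg (a b : R) : {within `[a, b], continuous g}.
  apply: derivable_within_continuous => c _.
  by have [] := is_derive_line q i c C1.
have g0 : g 0 = phi q by rewrite /g scale0r addr0.
have [s0|s0] := leP 0 s.
  have [c] := MVT_segment s0 (dg 0 s) (cg 0 s).
  rewrite in_itv/= => /andP[c0 cs]; rewrite g0 subr0 mulrC => gE.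
  by exists c => //; rewrite !ger0_norm.
have [c] := MVT_segment (ltW s0) (dg s 0) (cg s 0).
rewrite in_itv/= => /andP[sc c0]; rewrite g0 sub0r => gE.
exists c; first by rewrite !ler0_norm ?lerN2// ltW.
by rewrite -opprB gE mulrN opprK mulrC.
Qed.

(** From x to x + h one coordinate is changed at a time, with the mean value theorem on each edge of
    the path. *)
Lemma path_mvt phi x h : Ck 1 phi -> exists2 y : 'I_n -> V,
  forall i, enorm (y i - x) <= n%:R * enorm h &
  phi (x + h) - phi x = \sum_i h ord0 i * partial i phi (y i).
Proof.
move=> C1.
pose p (k : nat) : V := \row_j (x ord0 j + if (j < k)%N then h ord0 j else 0).
have pS (i : 'I_n) : p i.+1 = p i + h ord0 i *: e_ i.
  apply/rowP => j; rewrite !mxE eqxx/= ltnS leq_eqVlt [j == i]eq_sym.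
  have [->|/= ij] := eqVneq i j; first by rewrite eqxx ltnn /= addr0 mulr1.
  by rewrite -val_eqE eq_sym in ij; rewrite (negbTE ij)/= mulr0 addr0.
have /choice[c cE] : forall i : 'I_n, exists c : R, `|c| <= `|h ord0 i| /\
    phi (p i.+1) - phi (p i) = h ord0 i * partial i phi (p i + c *: e_ i).
  by move=> i; have [c c1 c2] := line_mvt (p i) i (h ord0 i) C1; exists c; rewrite pS.
exists (fun i : 'I_n => p i + c i *: e_ i) => [i|].
  apply: enorm_le_coord => j; apply: le_trans (coord_le_enorm h j).
  rewrite !mxE eqxx/=; have [->|ij] := eqVneq j i.
    rewrite ltnn addr0 mulr1 addrAC subrr add0r; exact: (cE i).1.
  rewrite mulr0 addr0 addrAC subrr add0r.
  by case: ifP => // _; rewrite normr0.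
under eq_bigr do rewrite -(cE _).2.
rewrite -(big_mkord predT (fun i => phi (p i.+1) - phi (p i))).
rewrite telescope_sumr//; congr (phi _ - phi _); apply/rowP => j; rewrite !mxE.
  by rewrite ltn_ord.
by rewrite ltn0 addr0.
Qed.

Lemma C1_partial_continuous phi i : Ck 1 phi -> continuous (partial i phi : V -> R).
Proof. by move=> [_ /(_ i)[_ []]]. Qed.

Lemma C1_diff_at phi x : Ck 1 phi -> diff_at phi x (grad phi x).
Proof.
move=> C1 dl dl0; pose d' := dl / n.+1%:R.
have d'0 : 0 < d' by rewrite divr_gt0.
have he' (i : 'I_n) : exists e, 0 < e /\
    forall y, enorm (y - x) < e -> `|partial i phi x - partial i phi y| <= d'.
  have /(@cvgrPdist_le _ _ _ (nbhs (x : V)))/(_ _ d'0)/nbhs_ballP[e /= e0 he] :=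
    @C1_partial_continuous phi i C1 x.
  by exists e; split => // y yx; apply: he; exact: eball_sub_ball.
have /choice[r hr] := he'.
(* The inverse of [S] is positive and below every radius [r i], also when there is no index at
   all. *)
pose S := \sum_i (r i)^-1 + 1.
have S0 : 0 < S.
  by rewrite ltr_wpDl// sumr_ge0// => i _; rewrite invr_ge0 ltW//; case: (hr i).
have rS i : S^-1 <= r i.
  have [ri _] := hr i.
  rewrite -[r i]invrK lef_pV2 ?posrE ?invr_gt0// /S (bigD1 i)//= -addrA lerDl.
  rewrite addr_ge0// sumr_ge0// => l _; rewrite invr_ge0 ltW//; case: (hr l) => //.
exists (S^-1 / n.+1%:R); first by rewrite divr_gt0// invr_gt0.
move=> h hn; have [y yx ->] := path_mvt x h C1.
rewrite /dotv -sumrB; apply: le_trans (ler_norm_sum _ _ _) _.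
apply: (@le_trans _ _ (\sum_(i < n) d' * enorm h)).
  apply: ler_sum => i _; rewrite mxE [in X in _ - X]mulrC -mulrBr normrM mulrC.
  apply: ler_pM => //; last exact: coord_le_enorm.
  rewrite distrC; apply: (hr i).2; apply: lt_le_trans (rS i).
  apply: le_lt_trans (yx i) _; apply: (@le_lt_trans _ _ (n.+1%:R * enorm h)).
    by rewrite ler_wpM2r ?enorm_ge0// ler_nat.
  by rewrite mulrC -ltr_pdivlMr.
rewrite sumr_const card_ord -mulr_natr mulrAC ler_wpM2r ?enorm_ge0//.
by rewrite /d' mulrAC ler_pdivrMr// ler_wpM2l ?(ltW dl0)// ler_nat.
Qed.

Lemma compact_bounded_fun (f : V -> R) (K : set V) : continuous f -> compact K ->
  exists2 M, 0 <= M & forall x, K x -> `|f x| <= M.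
Proof.
move=> cf cK; have := @compact_bounded R R^o _ (continuous_compact (continuous_subspaceT cf) cK).
move=> [M [_ hM]]; exists (`|M| + 1) => // x Kx.
by apply: hM; [rewrite ltr_pwDr// ler_norm|exists x].
Qed.

Variables (Omega : set V) (phi : V -> R).
Hypothesis tf : test_function Omega phi.
Local Notation K := (closure [set x | phi x != 0]).

Lemma test_C1 : Ck 1 phi. Proof. by case: tf => /(_ 1%N). Qed.

Lemma test_partial0 i x : ~ K x -> partial i phi x = 0.
Proof.
move=> nK; rewrite /partial (@near_eq_derive _ _ _ _ (cst 0)) ?derive_cst//.
have : nbhs (x : V) (~` K).
  by apply: open_nbhs_nbhs; split => //; apply: closed_openC; exact: closed_closure.
apply: filterS => y nKy; apply/eqP/negPn/negP => py.
by apply: nKy; exact: subset_closure.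
Qed.

Lemma test_supp x : phi x != 0 -> K x.
Proof. by move=> ?; exact: subset_closure. Qed.

Lemma test_grad0 x : ~ K x -> grad phi x = 0.
Proof. by move=> nK; apply/rowP => i; rewrite !mxE test_partial0. Qed.

Lemma test_tame : exists L B, tame phi (grad phi) L B.
Proof.
have C1 := test_C1; case: tf => _ cK _.
have [B B0 hB] := compact_bounded_fun (@enorm_continuous R n) cK.
have hM' (i : 'I_n) : exists M, 0 <= M /\ forall x, `|partial i phi x| <= M.
  have [M M0 hM] := compact_bounded_fun (C1_partial_continuous (i := i) C1) cK.
  exists M; split => // x; have [/hM//|nK] := pselect (K x).
  by rewrite test_partial0 ?normr0.
have /choice[M hM] := hM'.
exists (\sum_i M i), (B + 1); split.
- by apply: sumr_ge0 => i _; case: (hM i).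
- move=> x y; rewrite distrC enormBC; have [z _ E] := path_mvt x (y - x) C1.
  have xy : x + (y - x) = y by rewrite addrC subrK.
  rewrite xy in E; rewrite E; apply: le_trans (ler_norm_sum _ _ _) _.
  rewrite mulr_suml; apply: ler_sum => i _; rewrite normrM mulrC.
  by apply: ler_pM => //; [case: (hM i)|exact: coord_le_enorm].
- move=> x /test_supp /hB; rewrite ger0_norm ?enorm_ge0// => h.
  by rewrite (le_lt_trans h)// ltrDl.
- apply: measurable_enorm => i; apply: continuous_measurable_rV.
  rewrite (_ : (fun x => _) = partial i phi); first exact: C1_partial_continuous.
  by apply/funext => x; rewrite mxE.
- by move=> x; exact: C1_diff_at.
Qed.

End C1.

Section divergence.
Variables (R : realType) (n : nat).
Hypothesis n0 : (0 < n)%N.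
Local Notation V := 'rV[R]_n.
Local Notation mu := (@lebesgue R n).

Lemma integral_translate (f : V -> \bar R) (h : V) : measurable_fun setT f ->
  (\int[mu]_x f (x + h)%R = \int[mu]_x f x)%E.
Proof.
move=> mf; rewrite integralE [RHS]integralE; congr (_ - _)%E.
  transitivity (\int[mu]_x (f^\+ (x + h)%R))%E.
    by apply: eq_integral => x _; rewrite !funeposE.
  by apply: ge0_integral_translate; [exact: measurable_funepos|exact: funepos_ge0].
transitivity (\int[mu]_x (f^\- (x + h)%R))%E.
  by apply: eq_integral => x _; rewrite !funenegE.
by apply: ge0_integral_translate; [exact: measurable_funeneg|exact: funeneg_ge0].
Qed.

Lemma tame_integrable (phi : V -> R) (G : V -> V) (L B : R) : tame phi G L B ->
  mu.-integrable setT (EFin \o phi).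
Proof.
move=> tphi; have [L0 lip sup _ _] := tphi.
have B0 : 0 <= `|B| + 1 by rewrite addr_ge0.
pose M := `|phi 0| + L * `|B|.
apply: (@le_integrable _ _ _ mu setT measurableT _
   (EFin \o (fun x => M * \1_(eball (0 : V) B) x))).
- by apply/measurable_EFinP; exact: measurable_tame tphi.
- move=> x _ /=; rewrite lee_fin indicE.
  have [p0|/sup xB] := eqVneq (phi x) 0; first by rewrite p0 normr0 normr_ge0.
  rewrite mem_set ?mulr1; last by rewrite /eball/= subr0.
  rewrite [leRHS]ger0_norm; last by rewrite addr_ge0 ?mulr_ge0.
  have := lip x 0; rewrite subr0; have : L * enorm x <= L * `|B|.
    by rewrite ler_wpM2l// ltW// (lt_le_trans xB)// ler_norm.
  by have := ler_normD (phi x - phi 0) (phi 0); rewrite subrK /M; lra.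
- apply: integrable_cst_indic; [exact: measurable_eball|exact: lebesgue_eball_lty].
Qed.

(** Difference quotients have integral 0 by translation invariance, and they converge dominatedly to
    the partial derivative. Applied to a product, this is integration by parts. *)
Lemma tame_integral_partial (phi : V -> R) (G : V -> V) (L B : R) (i : 'I_n) :
  tame phi G L B -> measurable_fun setT (fun x => G x ord0 i) ->
  (\int[mu]_x (G x ord0 i)%:E = 0)%E.
Proof.
move=> tphi mG; have [L0 lip sup _ dif] := tphi.
pose h k : V := k.+1%:R^-1 *: delta_mx ord0 i.
have he1 : enorm (delta_mx ord0 i : V) = 1.
  rewrite /enorm /dotv (bigD1 i)//= big1 ?addr0.
    by rewrite mxE !eqxx mulr1 sqrtr1.
  by move=> j ji; rewrite mxE (negbTE ji) andbF mulr0.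
have he k : enorm (h k) = k.+1%:R^-1 by rewrite enormZ he1 mulr1 ger0_norm.
pose f k x := k.+1%:R * (phi (x + h k) - phi x).
have mphi := measurable_tame tphi.
have mf k : measurable_fun setT (EFin \o f k).
  apply/measurable_EFinP; apply: measurable_funM; first exact: measurable_cst.
  apply: measurable_funB; last exact: mphi.
  exact: (measurableT_comp mphi (measurable_fun_translate (h k))).
have iphi := tame_integrable tphi.
have If k : (\int[mu]_x (EFin \o f k) x = 0)%E.
  have itr : mu.-integrable setT (fun x => (phi (x + h k))%:E).
    apply/integrableP; split.
      by apply/measurable_EFinP; exact: (measurableT_comp mphi (measurable_fun_translate (h k))).
    have /integrableP[mE] := iphi; apply: le_lt_trans.
    have := ge0_integral_translate (h k) (measurableT_comp (@abse_measurable R setT) mE)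
      (fun x => abse_ge0 _).
    by move=> E; rewrite -E.
  have -> : (\int[mu]_x (EFin \o f k) x = \int[mu]_x (k.+1%:R%:E * ((phi (x + h k))%:E - (phi x)%:E)))%E.
    by apply: eq_integral => x _; rewrite /= EFinM EFinB.
  rewrite integralZl//; last exact: integrableB.
  rewrite integralB//.
  have -> : (\int[mu]_x (phi (x + h k))%:E = \int[mu]_x (phi x)%:E)%E.
    by apply: (integral_translate (f := EFin \o phi)); exact/measurable_EFinP.
  rewrite subee ?mule0//; exact: integrable_fin_num iphi.
have B1 := lebesgue_eball_lty (0 : V) (B + 1).
have iB := integrable_cst_indic L (measurable_eball (0 : V) (B + 1)) B1.
have cvf : {ae mu, forall x, setT x -> (EFin \o f k) x @[k --> \oo] --> (G x ord0 i)%:E}.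
  apply/aeW => x _; apply/fine_cvgP; split; first exact: nearW.
  apply/cvgrPdist_le => dl dl0; have [e e0 hx] := dif x dl dl0.
  have [N] := ltr_add_invr e0; rewrite add0r => Ne.
  exists N => // k /= Nk; have k0 : 0 < k.+1%:R :> R by rewrite ltr0n.
  have : enorm (h k) < e.
    by rewrite he (le_lt_trans _ Ne)// lef_pV2 ?posrE ?ltr0n// ler_nat.
  move=> /hx; rewrite he.
  have -> : dotv (G x) (h k) = k.+1%:R^-1 * G x ord0 i.
    rewrite /h dotvZr; congr (_ * _); rewrite /dotv (bigD1 i)//= big1 ?addr0.
      by rewrite mxE !eqxx mulr1.
    by move=> j ji; rewrite mxE (negbTE ji) andbF mulr0.
  rewrite -(ler_pM2l k0) -[X in X * _ <= _](ger0_norm (ltW k0)) -normrM.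
  rewrite mulrBr mulrA divff ?gt_eqF// mul1r mulrCA divff ?gt_eqF// mulr1.
  by rewrite distrC.
have fB : {ae mu, forall x, forall k, setT x -> (`|(EFin \o f k) x| <= (EFin \o (fun x => L * \1_(eball (0 : V) (B + 1)) x)%R) x)%E}.
  apply/aeW => x k _ /=; rewrite lee_fin indicE.
  have k0 : 0 < k.+1%:R :> R by rewrite ltr0n.
  have [xB|Bx] := ltP (enorm x) (B + 1).
    rewrite mem_set ?mulr1; last by rewrite /eball/= subr0.
    rewrite /f normrM (ger0_norm (ltW k0)).
    have := lip (x + h k) x; rewrite addrAC subrr add0r he => h1.
    by rewrite -ler_pdivlMl// mulrC.
  rewrite memNset ?mulr0; last by rewrite /eball/= subr0; apply/negP; rewrite -leNgt.
  have z1 : phi x = 0 by apply/eqP/negPn/negP => /sup; lra.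
  have z2 : phi (x + h k) = 0.
    apply/eqP/negPn/negP => /sup.
    have := enormD (x + h k) (- h k); rewrite addrK enormN he.
    have : k.+1%:R^-1 <= 1 :> R by rewrite invf_le1// ler1n.
    by move: (k.+1%:R^-1 : R) => u; lra.
  by rewrite /f z1 z2 subrr mulr0 normr0.
have [_ _] := dominated_convergence measurableT mf ((measurable_EFinP _ _).2 mG) cvf iB fB.
move=> /cvg_lim <- //; under eq_fun do rewrite If; exact: lim_cst.
Qed.

End divergence.

(** * Passage to the limit in the Sobolev space *)

(** Above eta, y = y^(1-p) y^p and y^(1-p) <= eta^(1-p). Integrated over a set of finite measure,
    this turns smallness of the p-th power into smallness in L^1. *)
Lemma le_add_powR (R : realType) (p y eta : R) : 1 < p -> 0 <= y -> 0 < eta ->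
  y <= eta + eta `^ (1 - p) * y `^ p.
Proof.
move=> p1 y0 e0; have [ye|ey] := leP y eta.
  by rewrite -[leLHS]addr0 lerD// mulr_ge0// powR_ge0.
have y1 : 0 < y by exact: lt_trans ey.
rewrite -[leLHS]add0r lerD ?(ltW e0)//.
have {1}-> : y = y `^ (1 - p) * y `^ p.
  by rewrite -powRD ?(gt_eqF y1) ?implybT// subrK powRr1 ?(ltW y1).
rewrite ler_wpM2r ?powR_ge0//.
rewrite -[1 - p]opprB !powRN lef_pV2 ?posrE ?powR_gt0//.
by rewrite ge0_ler_powR ?nnegrE ?(ltW ey) ?(ltW e0) ?(ltW y1)// subr_ge0 ltW.
Qed.

Lemma cvg_eventually (R : realType) (u : nat -> R) (l e : R) : u @ \oo --> l -> 0 < e ->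
  exists N, forall k, (N <= k)%N -> `|l - u k| < e.
Proof. by move=> /cvgrPdist_lt h /h[N _ hN]; exists N => k /hN. Qed.

Lemma lee_eq (R : realType) (a b : \bar R) : a = b -> (a <= b)%E.
Proof. by move->. Qed.

Section limits.
Context d (T : measurableType d) (R : realType).
Variable mu : {measure set T -> \bar R}.
Local Open Scope ereal_scope.

(** Fatou's lemma as a statement on all large indices, from dominated convergence of the minimum of
    [f k] and [F]. *)
Lemma int_liminf_gt (f : nat -> T -> R) (F : T -> R) (c : R) :
  (forall k, measurable_fun setT (f k)) -> measurable_fun setT F ->
  (forall k x, 0 <= f k x)%R -> (forall x, 0 <= F x)%R ->
  \int[mu]_x (F x)%:E < +oo ->
  {ae mu, forall x, forall dl : R, (0 < dl)%R ->
     exists N, forall k, (N <= k)%N -> (F x <= f k x + dl)%R} ->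
  c%:E < \int[mu]_x (F x)%:E ->
  exists N, forall k, (N <= k)%N -> c%:E < \int[mu]_x (f k x)%:E.
Proof.
move=> mf mF f0 F0 Foo limf cF.
have iF := integrable_ge0 mF F0 Foo.
pose hk k x := Num.min (f k x) (F x).
have mh k : measurable_fun setT (hk k) by exact: measurable_minr.
have h0 k x : (0 <= hk k x)%R by rewrite le_min f0 F0.
have cvh : {ae mu, forall x, setT x -> (hk k x)%:E @[k --> \oo] --> (F x)%:E}.
  move: limf; apply: filterS => x hx _; apply/fine_cvgP; split; first exact: nearW.
  apply/cvgrPdist_le => dl dl0; have [N HN] := hx (dl : R) dl0.
  exists N => // k /= Nk; have := HN _ Nk; rewrite ler_norml /hk.
  rewrite /Num.min; case: ifPn; rewrite -?leNgt => *; apply/andP; split; lra.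
have hg : {ae mu, forall x, forall k, setT x -> `|(hk k x)%:E| <= (EFin \o F) x}.
  apply/aeW => x k _ /=; rewrite lee_fin ger0_norm// /hk.
  by rewrite ge_min lexx orbT.
have [_ _ cv] := dominated_convergence measurableT
  (fun k => (measurable_EFinP _ _).2 (mh k)) ((measurable_EFinP _ _).2 mF) cvh iF hg.
have [N _ hN] : \forall k \near \oo, c%:E < \int[mu]_x (hk k x)%:E.
  apply: contrapT => nn; move: cF; rewrite ltNge => /negP; apply.
  have Ff : \int[mu]_x (F x)%:E \is a fin_num.
    by rewrite ge0_fin_numE//; apply: int_ge0.
  have e0 : (0 < fine (\int[mu]_x (F x)%:E) - c)%R \/ ~ (0 < fine (\int[mu]_x (F x)%:E) - c)%R.
    exact: lem.
  case: e0 => e0; last first.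
    by rewrite -(fineK Ff) lee_fin; move/negP: e0; rewrite -leNgt subr_le0.
  exfalso; apply: nn.
  have /fine_cvgP[finh] : (fun k => \int[mu]_x (hk k x)%:E) @ \oo -->
      (fine (\int[mu]_x (F x)%:E))%:E by rewrite fineK.
  move=> /cvgrPdist_lt/(_ _ e0); apply: filterS2 finh => k fk /=.
  rewrite ltr_norml => /andP[_ h]; rewrite -(fineK fk) lte_fin; lra.
exists N => k /hN hc; apply: lt_le_trans hc _.
apply: int_le => //.
by move=> x _; rewrite /hk ge_min lexx.
Qed.

(** The sum of the [f k] has a finite integral, so it is finite almost everywhere and its terms tend
    to 0 there. *)
Lemma ae_subseq_cvg0 (f : nat -> T -> R) : (forall k, measurable_fun setT (f k)) ->
  (forall k x, 0 <= f k x)%R ->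
  (forall k, \int[mu]_x (f k x)%:E <= ((2^-1) ^+ k)%:E) ->
  {ae mu, forall x, (f k x @[k --> \oo] --> (0 : R))%R}.
Proof.
move=> mf f0 fk.
pose S x := \sum_(k <oo) (f k x)%:E.
have mS : measurable_fun setT S.
  apply: ge0_emeasurable_sum => [k x _ _|k _]; first by rewrite lee_fin.
  exact/measurable_EFinP.
have S0 x : 0 <= S x by apply: nneseries_ge0 => k _ _; rewrite lee_fin.
have Soo : \int[mu]_x S x < +oo.
  rewrite integral_nneseries//; last 2 first.
  - by move=> k; exact/measurable_EFinP.
  - by move=> k x _; rewrite lee_fin.
  apply: (@le_lt_trans _ _ (\sum_(k <oo) ((2^-1) ^+ k)%:E)).
    by apply: lee_nneseries => [k _ _|k _]; [exact: int_ge0|exact: fk].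
  have g1 : (`|2^-1 : R| < 1)%R by rewrite ger0_norm ?invr_ge0// invf_lt1 ?ltr1n.
  have := @cvg_geometric_series R 1 (2^-1) g1.
  rewrite (_ : geometric 1 2^-1 = (fun k => (2^-1) ^+ k))%R; last first.
    by apply/funext => k; rewrite /geometric /= mul1r.
  move=> gc.
  have -> : \sum_(k <oo) ((2^-1) ^+ k)%:E = (1 / (1 - 2^-1))%:E :> \bar R.
    apply: cvg_lim => //.
    rewrite (_ : (fun n => _) = EFin \o series (fun k => (2^-1 : R) ^+ k)%R).
      by apply: cvg_comp gc _; exact: cvg_id.
    by apply/funext => n; rewrite /= /series/= sumEFin.
  exact: ltry.
have iS : mu.-integrable setT S.
  apply/integrableP; split => //.
  by rewrite (eq_integral S)// => x _; rewrite gee0_abs.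
have := integrable_ae measurableT iS.
apply: filterS => x /(_ I) Sx.
apply: cvg_series_cvg_0; apply: nondecreasing_is_cvgn.
  by apply/nondecreasing_series => k _ _.
exists (fine (S x)) => _ [k _ <-].
rewrite -lee_fin fineK// /series/= -sumEFin.
by apply: nneseries_lim_ge => j _; rewrite lee_fin.
Qed.

Lemma measurable_powRf (D : set T) (u : T -> R) (p : R) : measurable_fun D u ->
  measurable_fun D (fun x => u x `^ p)%R.
Proof. by move=> mu'; exact: (measurableT_comp (measurable_powR p) mu'). Qed.

Lemma measurable_normf (D : set T) (u : T -> R) : measurable_fun D u ->
  measurable_fun D (fun x => `|u x|)%R.
Proof. by move=> mu'; exact: measurableT_comp. Qed.

Lemma measurable_distf (D : set T) (u v : T -> R) : measurable_fun D u ->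
  measurable_fun D v -> measurable_fun D (fun x => `|u x - v x|)%R.
Proof. by move=> mu' mv; apply: measurable_normf; exact: measurable_funB. Qed.

Lemma measurable_restrictf (D : set T) (u : T -> R) : measurable D ->
  measurable_fun D u -> measurable_fun setT (u \_ D).
Proof. by move=> mD; exact: (measurable_restrictT _ mD).1. Qed.

Lemma int_restrict (D : set T) (u : T -> R) :
  \int[mu]_(x in D) (u x)%:E = \int[mu]_x ((u \_ D) x)%:E.
Proof.
by rewrite integral_mkcond; apply: eq_integral => x _; rewrite (restrict_EFin u).
Qed.

Lemma int_sum_lty (D : set T) (n : nat) (F : 'I_n -> T -> R) (c : R) (v : T -> R) :
  measurable D -> (0 <= c)%R ->
  (forall i, measurable_fun D (F i)) -> (forall i x, 0 <= F i x)%R ->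
  (forall i, \int[mu]_(x in D) (F i x)%:E < +oo) ->
  measurable_fun D v -> (forall x, 0 <= v x <= c * \sum_i F i x)%R ->
  \int[mu]_(x in D) (v x)%:E < +oo.
Proof.
move=> mD c0 mF F0 Foo mv hv.
have mS : measurable_fun D (fun x => \sum_(i < n) F i x)%R by exact: measurable_sum.
apply: (@le_lt_trans _ _ (\int[mu]_(x in D) (c%:E * \sum_(i < n) (F i x)%:E))); last first.
  rewrite ge0_integralZl//; last 2 first.
  - by apply: emeasurable_sum => i; exact/measurable_EFinP.
  - by move=> x _; apply: sume_ge0 => i _; rewrite lee_fin.
  rewrite ge0_integral_sum//; last 2 first.
  - by move=> i; exact/measurable_EFinP.
  - by move=> i x _; rewrite lee_fin.
  by apply: lte_mul_pinfty => //; apply/lte_sum_pinfty => i _.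
apply: ge0_le_integral => //.
- by move=> x _; rewrite lee_fin; case/andP: (hv x).
- exact/measurable_EFinP.
- under eq_fun do rewrite sumEFin -EFinM.
  by apply/measurable_EFinP; exact: measurable_funM.
by move=> x _; rewrite sumEFin -EFinM lee_fin; case/andP: (hv x).
Qed.

Lemma int_le_powR (D : set T) (v : T -> R) (p eta : R) (c : \bar R) : measurable D ->
  (1 < p)%R -> (0 < eta)%R -> measurable_fun D v -> (forall x, 0 <= v x)%R ->
  \int[mu]_(x in D) (v x `^ p)%:E <= c ->
  \int[mu]_(x in D) (v x)%:E <= eta%:E * mu D + (eta `^ (1 - p))%:E * c.
Proof.
move=> mD p1 e0 mv v0 hc.
apply: (@le_trans _ _ (\int[mu]_(x in D) (eta%:E + (eta `^ (1 - p))%:E * (v x `^ p)%:E))).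
  apply: ge0_le_integral => //.
  - by move=> x _; rewrite lee_fin.
  - exact/measurable_EFinP.
  - apply/measurable_EFinP/measurable_funD => //; apply: measurable_funM => //.
    exact: measurable_powRf.
  - by move=> x _; rewrite -EFinM -EFinD lee_fin; apply: le_add_powR.
have mp : measurable_fun D (fun x => (v x `^ p)%:E).
  by apply/measurable_EFinP; exact: measurable_powRf.
rewrite ge0_integralD//; last 3 first.
- by move=> x _; rewrite lee_fin ltW.
- by move=> x _; rewrite -EFinM lee_fin mulr_ge0 ?powR_ge0.
- by apply: measurable_funeM.
rewrite integral_cst// leeD2l// ge0_integralZl//; last 2 first.
- by move=> x _; rewrite lee_fin powR_ge0.
- by rewrite lee_fin powR_ge0.
by apply: lee_pmul => //; [rewrite lee_fin powR_ge0|apply: integral_ge0 => x _; rewrite lee_fin powR_ge0].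
Qed.

Lemma int0_ae (f : T -> R) : measurable_fun setT f -> (forall x, 0 <= f x)%R ->
  \int[mu]_x (f x)%:E <= 0 -> {ae mu, forall x, f x = 0%R}.
Proof.
move=> mf f0 hf.
have mfE : measurable_fun setT (EFin \o f) by exact/measurable_EFinP.
have : \int[mu]_x `|(EFin \o f) x| = 0.
  apply/eqP; rewrite eq_le; apply/andP; split; last exact: integral_ge0.
  by under eq_integral => x _ do rewrite gee0_abs ?lee_fin ?f0//.
by move/(ae_eq_integral_abs _ measurableT mfE); apply: filterS => x /(_ I)[].
Qed.

End limits.

Lemma powR_cvg0 (R : realType) (p : R) (u : nat -> R) : 0 < p -> (forall k, 0 <= u k) ->
  (u k `^ p @[k --> \oo] --> (0 : R)) -> u @ \oo --> (0 : R).
Proof.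
move=> p0 u0 /cvgrPdist_lt h; apply/cvgrPdist_lt => e e0.
have ep : 0 < e `^ p by rewrite powR_gt0.
apply: filterS (h _ ep) => k; rewrite !sub0r !normrN !ger0_norm ?powR_ge0// => ue.
rewrite ltNge; apply/negP => eu; move: ue; rewrite ltNge => /negP; apply.
by rewrite ge0_ler_powR ?nnegrE ?(ltW e0) ?(ltW p0).
Qed.

Lemma bernoulli1 (R : realType) (m : nat) (u : R) : 0 <= u -> u <= 1 ->
  1 - m%:R * u <= (1 - u) ^+ m.
Proof.
move=> u0 u1; elim: m => [|m ih]; first by rewrite mul0r subr0 expr0.
rewrite exprS; apply: le_trans (ler_wpM2l _ ih); last by rewrite subr_ge0.
rewrite -natr1; have : 0 <= m%:R * u * u by rewrite !mulr_ge0.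
by move: (m%:R : R) => v; lra.
Qed.

(** * Isoperimetric inequality and increments for functions of W^{1,p}_0 *)

Section sobolev.
Context (R : realType) (n : nat).
Hypothesis n0 : (0 < n)%N.
Local Notation V := 'rV[R]_n.
Local Notation mu := (@lebesgue R n).
Local Notation om := (unit_ball_volume R n).

(* W and G play the roles of |w| and |grad w| extended by zero. *)
Definition sobolev_limit (D : set V) (W G : V -> R) : Prop :=
  [/\ measurable D /\ (mu D < +oo)%E,
      (measurable_fun setT W /\ forall x, 0 <= W x) /\ (forall x, ~ D x -> W x = 0),
      (measurable_fun setT G /\ forall x, 0 <= G x) /\ (\int[mu]_x (G x)%:E < +oo)%E &
      exists phi Gp (e : nat -> R),
      [/\ forall k, exists L B, tame (phi k) (Gp k) L B,
          e @ \oo --> (0 : R),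
          forall k, (\int[mu]_x `|enorm (Gp k x) - G x|%:E <= (e k)%:E)%E &
          {ae mu, forall x, `|phi k x| @[k --> \oo] --> W x}]].

Lemma bounded_lty (Omega : set V) : bounded_set Omega -> (mu Omega < +oo)%E.
Proof.
move=> [M [_ HM]].
apply: le_lt_trans (lebesgue_box_fin (const_mx (- (M + 1))) (const_mx (M + 1))).
apply: le_lebesgue_outer => x Ox /= i; rewrite !mxE -ler_norml.
have M1 : M < M + 1 by rewrite ltrDl.
apply: le_trans (HM _ M1 _ Ox).
rewrite [leRHS]mx_normrE.
exact: (le_bigmax _ (fun ij : 'I_1 * 'I_n => `|x ij.1 ij.2|) (ord0, i)).
Qed.

Lemma Lp_enorm (Omega : set V) (p : R) (g : V -> V) : 0 < p -> measurable Omega ->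
  (forall i, Lp Omega p (fun x => g x ord0 i)) ->
  (\int[mu]_(x in Omega) (enorm (g x) `^ p)%:E < +oo)%E.
Proof.
move=> p0 mO Lg.
have mg : measurable_fun Omega (fun x => enorm (g x)).
  by apply: measurable_enorm => i; case: (Lg i).
have mgi i : measurable_fun Omega (fun x => (`|g x ord0 i| `^ p)).
  apply: measurable_powRf; apply: measurable_normf.
  by case: (Lg i).
apply: (int_sum_lty mO (powR_ge0 n%:R p) mgi).
- by move=> i x; exact: powR_ge0.
- by move=> i; case: (Lg i).
- exact: measurable_powRf mg.
move=> x; rewrite powR_ge0/=.
set S := \sum_(i < n) _.
have S0 : 0 <= S by apply: sumr_ge0 => i _; exact: powR_ge0.
have h : enorm (g x) <= n%:R * S `^ p^-1.
  apply: enorm_le_coord => i.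
  rewrite -[leLHS]powRr1// -(mulfV (lt0r_neq0 p0)) powRrM.
  rewrite ge0_ler_powR ?nnegrE ?invr_ge0 ?(ltW p0) ?powR_ge0//.
  rewrite /S (bigD1 i)//= lerDl.
  by apply: sumr_ge0 => j _; exact: powR_ge0.
apply: le_trans (ge0_ler_powR (ltW p0) _ _ h) _; rewrite ?nnegrE ?enorm_ge0//.
  by rewrite mulr_ge0 ?powR_ge0.
by rewrite powRM ?powR_ge0// -powRrM mulVf ?gt_eqF// powRr1.
Qed.

(** A rapidly converging subsequence of the approximating test functions converges almost
    everywhere, with gradients converging in L^1. Outside [Omega] the test functions and their
    gradients vanish, which matches the extension by zero. *)
Lemma W1p0_sobolev_limit (Omega : set V) (p : R) (w : V -> R) (g : V -> V) :
  1 < p -> open Omega -> bounded_set Omega -> W1p0 Omega p w g ->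
  sobolev_limit Omega ((fun x => `|w x|) \_ Omega) ((fun x => enorm (g x)) \_ Omega).
Proof.
move=> p1 oO bO [[[mw _] Lg _] [phi [tphi cphi]]].
have p0 : 0 < p by lra.
have mO := measurable_open oO.
have Ofin := bounded_lty bO.
have mg : measurable_fun Omega (fun x => enorm (g x)).
  by apply: measurable_enorm => i; case: (Lg i).
have mphi k : measurable_fun setT (phi k).
  by case: (test_tame (tphi k)) => L [B tm]; exact: (measurable_tame tm).
have mgr k i : measurable_fun setT (fun x => grad (phi k) x ord0 i).
  rewrite (_ : (fun x => _) = partial i (phi k)); last by apply/funext => x; rewrite mxE.
  by apply: continuous_measurable_rV; apply: C1_partial_continuous; case: (tphi k) => /(_ 1%N).
pose dg k x := enorm (grad (phi k) x - g x).
have mdg k : measurable_fun Omega (dg k).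
  apply: measurable_enorm => i.
  rewrite (_ : (fun x => _) = (fun x => grad (phi k) x ord0 i) \- (fun x => g x ord0 i)); last first.
    by apply/funext => x; rewrite [LHS]mxE [X in _ + X]mxE.
  apply: measurable_funB; first exact: measurable_funTS.
  by case: (Lg i).
pose E k x := `|phi k x - w x| `^ p + dg k x `^ p.
have E0 k x : 0 <= E k x by rewrite addr_ge0 ?powR_ge0.
have mE k : measurable_fun Omega (E k).
  apply: measurable_funD; last exact: measurable_powRf (mdg k).
  apply: measurable_powRf.
  by apply: measurable_distf; [apply: measurable_funTS; exact: mphi|exact: mw].
pose eta j : R := j.+1%:R^-1.
have eta0 j : 0 < eta j by rewrite invr_gt0.
(* The power of 1/2 gives convergence almost everywhere by [ae_subseq_cvg0]; the power of [eta j] is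
   the one for which [int_le_powR] leaves an L^1 error of [eta j] times |Omega| + 1. *)
pose del j : R := Num.min (2^-1 ^+ j) (eta j `^ p).
have del0 j : 0 < del j by rewrite lt_min powR_gt0// andbT exprn_gt0.
have [k Hk] : {k : nat -> nat & forall j,
    (\int[mu]_(x in Omega) (E (k j) x)%:E <= (del j)%:E)%E}.
  apply: (@choice _ _ (fun j k => (\int[mu]_(x in Omega) (E k x)%:E <= (del j)%:E)%E)) => j.
  have /fine_cvgP[fin /cvgrPdist_lt/(_ _ (del0 j))] := cphi.
  move=> /(filterI fin)[N _ /(_ N (leqnn N))[fN]] /= h; exists N.
  rewrite -(fineK fN) lee_fin ltW//; apply: le_lt_trans h.
  by rewrite sub0r normrN ler_norm.
have Gfin : (\int[mu]_x (((fun x => enorm (g x)) \_ Omega) x)%:E < +oo)%E.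
  rewrite -int_restrict.
  apply: le_lt_trans (int_le_powR mO p1 ltr01 mg (fun x => enorm_ge0 _) (lexx _)) _.
  by rewrite mul1e powR1 mul1e lte_add_pinfty//; exact: Lp_enorm.
split; first by split.
- split; first split.
  + by apply: measurable_restrictf mO _; exact: measurable_normf.
  + by move=> x; rewrite patchE; case: ifP => //= _; exact: normr_ge0.
  + by move=> x nO; rewrite patchE memNset.
- split; last exact: Gfin.
  split; first exact: measurable_restrictf mO mg.
  by move=> x; rewrite patchE; case: ifP => //= _; exact: enorm_ge0.
exists (phi \o k), (fun j => grad (phi (k j))), (fun j => eta j * (fine (mu Omega) + 1)); split.
- by move=> j; exact: (test_tame (tphi (k j))).
- rewrite -[X in _ --> X](mul0r (fine (mu Omega) + 1)); apply: cvgMl.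
  exact: cvg_harmonic.
- move=> j.
  have h : (\int[mu]_(x in Omega) (dg (k j) x `^ p)%:E <= (del j)%:E)%E.
    apply: le_trans (Hk j); apply: ge0_le_integral; first exact: mO.
    - by move=> x _; rewrite lee_fin powR_ge0.
    - by apply/measurable_EFinP; exact: measurable_powRf (mdg _).
    - by apply/measurable_EFinP; exact: mE.
    - by move=> x _; rewrite lee_fin lerDr powR_ge0.
  have h2 := int_le_powR mO p1 (eta0 j) (mdg (k j)) (fun x => enorm_ge0 _) h.
  apply: (@le_trans _ _ (\int[mu]_x ((dg (k j) \_ Omega) x)%:E)%E); last first.
    rewrite -int_restrict; apply: le_trans h2 _.
    have mfin : mu Omega = (fine (mu Omega))%:E by rewrite fineK// ge0_fin_numE.
    apply: (@le_trans _ _ ((eta j)%:E * (fine (mu Omega))%:E +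
        (eta j `^ (1 - p))%:E * (del j)%:E)%E); first by rewrite -mfin.
    rewrite -EFinM -EFinM -EFinD lee_fin mulrDr.
    rewrite lerD2l mulr1.
    have {2}-> : eta j = eta j `^ (1 - p) * eta j `^ p.
      by rewrite -powRD ?(gt_eqF (eta0 j)) ?implybT// subrK powRr1 ?(ltW (eta0 j)).
    by rewrite ler_wpM2l ?powR_ge0// ge_min lexx orbT.
  apply: ge0_le_integral; first exact: measurableT.
  - by move=> x _; rewrite lee_fin.
  - apply/measurable_EFinP; apply: measurable_distf; last exact: measurable_restrictf.
    by apply: measurable_enorm => i; exact: mgr.
  - by apply/measurable_EFinP; exact: measurable_restrictf mO (mdg _).
  move=> x _; rewrite lee_fin.
  rewrite !patchE; case: ifP => [_|/negbT]; first exact: enormB_norm.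
  move=> nO; have -> : (point : R) = 0 by [].
  have -> : grad (phi (k j)) x = 0; last by rewrite enorm0 subr0 normr0.
  apply: test_grad0 => Kx; move/negP: nO; apply; apply: mem_set.
  by case: (tphi (k j)) => _ _; exact.
have cE : {ae mu, forall x, ((E (k j) \_ Omega) x @[j --> \oo] --> (0 : R))}.
  apply: ae_subseq_cvg0 => [j|j x|j].
  - exact: measurable_restrictf mO (mE _).
  - by rewrite patchE; case: ifP.
  - by rewrite -int_restrict; apply: (le_trans (Hk j)); rewrite lee_fin ge_min lexx.
move: cE; apply: filterS => x hx.
case: (pselect (Omega x)) => Ox; last first.
  rewrite patchE memNset// (_ : (fun _ => _) = fun=> 0); first exact: cvg_cst.
  apply/funext => j /=; apply/eqP; rewrite normr_eq0; apply/eqP.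
  apply: contrapT => /eqP ne; apply: Ox; case: (tphi (k j)) => _ _; apply.
  exact: subset_closure.
rewrite patchE mem_set//=.
suff : (phi (k j) x - w x) @[j --> \oo] --> (0 : R).
  move=> h; apply: cvg_norm; have h2 := cvgD h (cvg_cst (w x)); rewrite add0r in h2.
  rewrite (_ : (fun _ => _) = (fun j : nat => phi (k j) x - w x) + (fun=> w x)); first exact: h2.
  by apply/funext => j; rewrite /GRing.add/= subrK.
apply/norm_cvg0P; apply: (@powR_cvg0 _ p) => //.
apply: (squeeze_cvgr _ (cvg_cst 0) hx).
by apply: nearW => j; rewrite patchE mem_set// powR_ge0 /= lerDl powR_ge0.
Qed.

Section limit_slabs.
Variables (D : set V) (W G : V -> R).
Hypothesis WG : sobolev_limit D W G.

Lemma measurable_band (s t : R) : measurable [set x | s <= W x <= t].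
Proof.
have [_ [[mW _] _] _ _] := WG.
rewrite (_ : mkset _ = W @^-1` `[s, t]); last by apply/seteqP; split => x /=; rewrite in_itv.
by rewrite -[X in measurable X]setTI; apply: mW.
Qed.

Lemma measurable_upper (s : R) : measurable [set x | s < W x].
Proof.
have [_ [[mW _] _] _ _] := WG.
rewrite (_ : mkset _ = W @^-1` `]s, +oo[); last first.
  by apply/seteqP; split => x /=; rewrite in_itv/= andbT.
by rewrite -[X in measurable X]setTI; apply: mW.
Qed.

Lemma upper_lty (s : R) : 0 <= s -> (mu [set x | (s < W x)%R] < +oo)%E.
Proof.
have [[mD Dfin] [_ W0] _ _] := WG => s0; apply: le_lt_trans Dfin.
apply: le_lebesgue_outer => x /= sW; apply: contrapT => /W0 Wx.
by move: sW; rewrite Wx ltNge s0.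
Qed.

Lemma int_tame_near (f g h : V -> R) (e : R) :
  measurable_fun setT f -> measurable_fun setT g -> measurable_fun setT h ->
  (forall x, 0 <= f x) -> (forall x, 0 <= g x) ->
  (forall x, f x <= g x + `|h x - G x|) ->
  (\int[mu]_x `|h x - G x|%:E <= e%:E)%E ->
  (\int[mu]_x (f x)%:E <= \int[mu]_x (g x)%:E + e%:E)%E.
Proof.
have [_ _ [[mG _] _] _] := WG => mf mg mh f0 g0 fgh he.
have md : measurable_fun setT (fun x => `|h x - G x|) by exact: measurable_distf.
apply: (@le_trans _ _ (\int[mu]_x (g x + `|h x - G x|)%:E)%E).
  apply: int_le; [exact: measurableT|exact: mf|exact: measurable_funD mg md|exact: f0|].
  by move=> x _; exact: fgh.
by rewrite intD// leeD2l.
Qed.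

(** Convergence almost everywhere transfers the bound on superlevel sets only with a loss: for u < 1
    the approximants satisfy it up to the level t' and with the radius u a. The resulting factor is
    u^n, one u from t' - s and n - 1 from the radius, and u tends to 1. *)
Lemma limit_isoperimetric (s t a : R) : 0 <= s -> s < t -> 0 < a ->
  (forall r, r < t -> ((om * a ^+ n)%:E <= mu [set x | (r < W x)%R])%E) ->
  (((t - s) * (n%:R * om * a ^+ n.-1))%:E <=
     \int[mu]_x (G x * \1_[set x | s <= W x <= t] x)%:E)%E.
Proof.
move=> s0 st a0 hr.
have [[mD Dfin] [[mW W0] WD] [[mG G0] Gfin] [phi [Gp [e [tm e0 he cv]]]]] := WG.
have mF s' t' : measurable_fun setT (fun x => G x * \1_[set x | s' <= W x <= t'] x).
  by apply: measurable_funM mG _; apply: measurable_indic; exact: measurable_band.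
have Ffin : (\int[mu]_x (G x * \1_[set x | s <= W x <= t] x)%:E < +oo)%E.
  apply: le_lt_trans Gfin; apply: int_le; [exact: measurableT|exact: mF|exact: mG| |].
    by move=> x; rewrite mulr_ge0.
  by move=> x _; rewrite indicE; case: (_ \in _); rewrite ?mulr1 ?mulr0.
set I := (\int[mu]_x _)%E in Ffin *.
have I0 : (0 <= I)%E by apply: int_ge0 => x; rewrite mulr_ge0.
rewrite -(@fineK _ I) ?ge0_fin_numE// lee_fin.
set c := (t - s) * _.
have om0 := unit_ball_volume_gt0 R n.
have c0 : 0 < c by rewrite /c !mulr_gt0 ?subr_gt0 ?ltr0n ?exprn_gt0.
suff th (u : R) : 0 < u < 1 -> c * u ^+ n <= fine I.
  have cb j : c <= fine I + c * n%:R * (j.+2%:R^-1).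
    have u0 : 0 < j.+2%:R^-1 :> R by rewrite invr_gt0.
    have u1 : j.+2%:R^-1 < 1 :> R by rewrite invf_lt1 ?ltr1n.
    move: (j.+2%:R^-1 : R) u0 u1 => u u0 u1.
    have := th (1 - u); rewrite subr_gt0 u1 ltrBlDr ltrDl u0 => /(_ erefl) h.
    have := ler_wpM2l (ltW c0) (bernoulli1 n (ltW u0) (ltW u1)); rewrite mulrBr mulr1 mulrA; lra.
  apply: ge0_cvg0_le cb.
  by have := @cvg_harmonic R; rewrite -(cvg_shiftS (harmonic : nat -> R)).
move=> /andP[u0 u1].
pose t' := s + u * (t - s).
have st' : s < t' by rewrite ltrDl mulr_gt0// subr_gt0.
have t't : t' < t by rewrite /t' -ltrBrDl -[ltRHS]mul1r ltr_pM2r// subr_gt0.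
pose a' := u * a.
have a'0 : 0 < a' by exact: mulr_gt0.
have a'a : om * a' ^+ n < om * a ^+ n.
  by rewrite ltr_pM2l// ltrXn2r ?gt_eqF ?(ltW a'0) ?(ltW a0)//= /a' gtr_pMl.
rewrite -lee_fin fineK ?ge0_fin_numE//.
have -> : c * u ^+ n = (t' - s) * (n%:R * om * a' ^+ n.-1).
  have un : u ^+ n = u * u ^+ n.-1 by rewrite -exprS prednK.
  by rewrite /c /a' /t' addrAC subrr add0r exprMn un; ring.
pose F := fun x => G x * \1_[set x | s <= W x <= t'] x.
have step2 : (\int[mu]_x (F x)%:E <= I)%E.
  apply: int_le; [exact: measurableT|exact: mF|exact: mF| |move=> x _].
    by move=> x; rewrite /F mulr_ge0.
  rewrite ler_wpM2l// !indicE; case: (boolP (x \in [set x | s <= W x <= t'])) => //.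
  move/set_mem => /= /andP[h1 h]; rewrite mem_set//=.
  by rewrite h1 (le_trans h (ltW t't)).
apply: le_trans step2.
have [N HN] : exists N, forall k, (N <= k)%N ->
    ((om * a' ^+ n)%:E < mu [set x | (t' < `|phi k x|)%R])%E.
  have mk k : measurable [set x : V | t' < `|phi k x|].
    by have [L [B tk]] := tm k; apply: measurable_open; exact: (open_superlevel tk).
  have [N HN] : exists N, forall k, (N <= k)%N ->
      ((om * a' ^+ n)%:E < \int[mu]_x (\1_[set x | (t' < `|phi k x|)%R] x)%:E)%E.
    apply: (@int_liminf_gt _ _ _ _ _ (\1_[set x | t' < W x])).
    - by move=> k; exact: measurable_indic.
    - by apply: measurable_indic; exact: measurable_upper.
    - by move=> k x; rewrite indicE.
    - by move=> x; rewrite indicE.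
    - rewrite integral_indic//; last exact: measurable_upper.
      by rewrite setIT; apply: upper_lty; exact: le_trans s0 (ltW st').
    - move: cv; apply: filterS => x hx dl dl0.
      have [tW|Wt] := ltP t' (W x); last first.
        exists 0%N => k _; rewrite indicE memNset ?addr_ge0 ?(ltW dl0)//=.
        by apply/negP; rewrite -leNgt.
      have d0 : 0 < W x - t' by rewrite subr_gt0.
      have [N hN] := cvg_eventually hx d0.
      exists N => k /hN /=; rewrite ltr_norml => /andP[_ h].
      have -> : \1_[set x | t' < `|phi k x|] x = 1 :> R.
        by rewrite indicE mem_set//=; lra.
      by rewrite indicE mem_set// lerDl ltW.
    - rewrite integral_indic//; last exact: measurable_upper.
      rewrite setIT; apply: lt_le_trans (hr _ t't); by rewrite lte_fin.
  exists N => k /HN; rewrite integral_indic ?setIT//.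
have meG k : measurable_fun setT (fun x => enorm (Gp k x)).
  by have [L [B []]] := tm k.
(* The gradient of the approximant is replaced by [G] at the cost of the L^1 error [e]; the slabs of
   the approximants have their limsup in the slab of [W] because slabs are closed. *)
apply: (@limsup_integral_ge _ _ _ _
  (fun k x => G x * \1_(slab (phi (k + N)%N) s t') x) G F _ (fun k => e (k + N)%N)).
- move=> k; have [L [B tk]] := tm (k + N)%N.
  by apply: measurable_funM mG _; apply: measurable_indic; exact: (measurable_slab tk).
- exact: mF.
- exact: integrable_ge0.
- move=> k x; rewrite indicE; case: (_ \in _); by rewrite ?mulr1 ?mulr0 ?G0 ?lexx.
- by move=> x; rewrite /F mulr_ge0.
- move: cv; apply: filterS => x hx dl dl0.
  case: (boolP (s <= W x <= t')) => [sWt|].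
    exists 0%N => k _; rewrite /F [\1_[set _ | _] x]indicE mem_set// mulr1 indicE.
    by case: (_ \in _); rewrite ?mulr1 ?mulr0 ?addr_ge0 ?lerDl ?(ltW dl0)//.
  move=> nW; have [eta eta0 heta] : exists2 eta, 0 < eta & forall y, `|W x - y| < eta -> ~ (s <= y <= t').
    move: nW; rewrite negb_and -!ltNge => /orP[h|h].
    - by exists (s - W x); [rewrite subr_gt0|move=> y; rewrite ltr_norml => ? ?; lra].
    - by exists (W x - t'); [rewrite subr_gt0|move=> y; rewrite ltr_norml => ? ?; lra].
  have [M hM] := cvg_eventually hx eta0.
  exists M => k Mk; rewrite indicE memNset ?mulr0 ?addr_ge0 ?mulr_ge0 ?(ltW dl0)//.
  by apply: heta; apply: hM; rewrite /= (leq_trans Mk)// leq_addr.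
- by move: e0; rewrite -(cvg_shiftn N).
- move=> k; have [L [B tk]] := tm (k + N)%N.
  have h := tame_isoperimetric n0 tk s0 st' a'0.
  apply: le_trans (h _) _.
    move=> r rt; apply: (le_trans (ltW (HN (k + N)%N (leq_addl _ _)))).
    by apply: le_lebesgue_outer => x /=; exact: lt_trans.
  have ms : measurable_fun setT (\1_(slab (phi (k + N)%N) s t') : V -> R).
    by apply: measurable_indic; exact: (measurable_slab tk).
  apply: (@int_tame_near _ _ (fun x => enorm (Gp (k + N)%N x))).
  + by apply: measurable_funM ms; exact: meG.
  + exact: measurable_funM mG ms.
  + exact: meG.
  + by move=> x; rewrite mulr_ge0 ?enorm_ge0.
  + by move=> x; rewrite mulr_ge0.
  + move=> x; rewrite indicE; case: (_ \in _); rewrite ?mulr1 ?mulr0 ?add0r//.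
    by rewrite -lerBlDl ler_norm.
  + exact: he.
Qed.

(** If the excess of the truncation of [W] had a positive integral c, the approximants would
    eventually have one above c / 2. By [tame_defect] theirs is at most |h| times the integral of
    the excess of [G] over k on their slabs plus an L^1 error, and both tend to 0. *)
Lemma limit_defect (s t k : R) (h : V) : 0 <= s -> s < t -> 0 <= k ->
  {ae mu, forall x, s <= W x <= t -> G x <= k} ->
  {ae mu, forall x, `|clamp s t (W (x + h)) - clamp s t (W x)| <= k * enorm h}.
Proof.
move=> s0 st k0 Gk.
have [[mD Dfin] [[mW W0] WD] [[mG G0] Gfin] [phi [Gp [e [tm e0 he cv]]]]] := WG.
pose u x := clamp s t (W x).
pose uj j x := clamp s t `|phi j x|.
have mu_ : measurable_fun setT u by exact: measurable_clamp.
have muj j : measurable_fun setT (uj j).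
  by have [L [B tk]] := tm j; apply: measurable_clamp; exact: (measurable_normtame tk).
have mdf := measurable_defect k h.
suff d0 : (\int[mu]_x (defect u k h x)%:E <= 0)%E.
  apply: filterS (int0_ae (mdf _ mu_) (defect_ge0 u k h) d0) => x dx.
  by rewrite -subr_le0 -dx /defect le_max lexx.
have u_ge0 x : 0 <= u x by apply: clamp_ge0; exact: ltW.
have intu : (\int[mu]_x (u x)%:E < +oo)%E.
  apply: (@le_lt_trans _ _ (\int[mu]_x ((t - s) * \1_D x)%:E)%E).
    apply: int_le; [exact: measurableT|exact: mu_| |exact: u_ge0|move=> x _].
      by apply: measurable_funM; [exact: measurable_cst|exact: measurable_indic].
    rewrite indicE; case: (boolP (x \in D)) => xD; first by rewrite mulr1; exact: clamp_le.
    move: xD; rewrite notin_setE => /WD Wx.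
    by rewrite mulr0 /u Wx clamp_lo// ltW.
  by rewrite int_cst_indic//; apply: lte_mul_pinfty; rewrite ?lee_fin ?subr_ge0 ?(ltW st).
have mT : measurable_fun setT (fun x : V => u (x + h)).
  by apply: measurableT_comp mu_ _; exact: measurable_fun_translate.
apply: lee_realP => // c hc; rewrite leNgt lte_fin; apply/negP => c0.
have [N HN] : exists N, forall j, (N <= j)%N ->
    ((c / 2)%:E < \int[mu]_x (defect (uj j) k h x)%:E)%E.
  apply: (@int_liminf_gt _ _ _ _ _ (defect u k h)).
  - by move=> j; exact: mdf.
  - exact: mdf.
  - by move=> j x; exact: defect_ge0.
  - exact: defect_ge0.
  - apply: (@le_lt_trans _ _ (\int[mu]_x (u (x + h) + u x)%:E)%E).
      apply: int_le; [exact: measurableT|exact: mdf|exact: measurable_funD|exact: defect_ge0|].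
      move=> x _; rewrite /defect ge_max; apply/andP; split; last by rewrite addr_ge0.
      apply: (@le_trans _ _ `|u (x + h) - u x|); first by rewrite gerBl mulr_ge0 ?enorm_ge0.
      apply: le_trans (ler_normB _ _) _; by rewrite !ger0_norm.
    rewrite intD//.
    apply: lte_add_pinfty => //.
    have -> // : (\int[mu]_x (u (x + h))%:E = \int[mu]_x (u x)%:E)%E.
    apply: (@ge0_integral_translate R n (EFin \o u) h); first exact/measurable_EFinP.
    by move=> x; rewrite lee_fin.
  - have cvh : {ae mu, forall x, `|phi j (x + h)| @[j --> \oo] --> W (x + h)}.
      exact: (ae_translate h cv).
    apply: filterS2 cv cvh => x hx hxh dl dl0.
    have d2 : 0 < dl / 2 by rewrite divr_gt0.
    have [N1 hN1] := cvg_eventually hx d2.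
    have [N2 hN2] := cvg_eventually hxh d2.
    exists (maxn N1 N2) => j; rewrite geq_max => /andP[/hN1 /= h1 /hN2 /= h2].
    have := le_lt_trans (clamp_lip s t _ _) h1.
    have := le_lt_trans (clamp_lip s t _ _) h2.
    rewrite -/(u x) -/(u (x + h)) -/(uj j x) -/(uj j (x + h)) /defect.
    move: (u x) (u (x + h)) (uj j x) (uj j (x + h)) => a b a' b'.
    move: (k * enorm h) => q; rewrite !ltr_norml => /andP[? ?] /andP[? ?].
    have hab : `|b - a| <= `|b' - a'| + dl.
      by have := ler_norm (b' - a'); have := lerNnormlW (lexx `|b' - a'|);
        rewrite ler_norml => ? ?; lra.
    have dl0' := ltW dl0; rewrite -[dl in leRHS](max_l dl0'); apply: max0_leD; lra.
  - by apply: lt_le_trans hc; rewrite lte_fin; lra.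
have meG j : measurable_fun setT (fun x => enorm (Gp j x)).
  by have [L [B []]] := tm j.
have ms j : measurable_fun setT (\1_(slab (phi j) s t) : V -> R).
  have [L [B tk]] := tm j.
  by apply: measurable_indic; exact: (measurable_slab tk).
pose ex (q : V -> R) j x := Num.max (q x - k) 0 * \1_(slab (phi j) s t) x.
have mex q j : measurable_fun setT q -> measurable_fun setT (ex q j).
  move=> mq; apply: measurable_funM (ms j); apply: measurable_maxr; last exact: measurable_cst.
  by apply: measurable_funB mq _; exact: measurable_cst.
have ex0 q j x : 0 <= ex q j x by rewrite mulr_ge0// le_max lexx orbT.
have mhex q j : measurable_fun setT q -> measurable_fun setT (fun x => enorm h * ex q j x).
  by move=> mq; apply: measurable_funM; [exact: measurable_cst|exact: mex].
suff : ((c / 2)%:E <= \int[mu]_x (0 : R)%:E)%E by rewrite integral0 lee_fin; lra.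
apply: (@limsup_integral_ge _ _ _ _ (fun j x => enorm h * ex G (j + N)%N x)
  (fun x => enorm h * G x) (fun=> 0) _ (fun j => enorm h * e (j + N)%N)).
- by move=> j; exact: mhex.
- exact: measurable_cst.
- apply: integrable_ge0.
  + by apply: measurable_funM mG; exact: measurable_cst.
  + by move=> x; rewrite mulr_ge0 ?enorm_ge0.
  + by rewrite intZ ?enorm_ge0//; apply: lte_mul_pinfty; rewrite ?lee_fin ?enorm_ge0.
- move=> j x; rewrite mulr_ge0 ?enorm_ge0 ?ex0//= ler_wpM2l ?enorm_ge0// /ex.
  rewrite indicE; case: (_ \in _); rewrite ?mulr1 ?mulr0 ?G0//.
  by rewrite ge_max G0 gerBl k0.
- by [].
- apply: filterS2 Gk cv => x Gkx hx dl dl0.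
  case: (boolP (s <= W x <= t)) => [sWt|].
    exists 0%N => j _; rewrite /ex max_r ?subr_le0 ?Gkx// mul0r mulr0 add0r ltW//.
  move=> nW; have [eta eta0 heta] : exists2 eta, 0 < eta & forall y, `|W x - y| < eta -> ~ (s <= y <= t).
    move: nW; rewrite negb_and -!ltNge => /orP[hh|hh].
    - by exists (s - W x); [rewrite subr_gt0|move=> y; rewrite ltr_norml => ? ?; lra].
    - by exists (W x - t); [rewrite subr_gt0|move=> y; rewrite ltr_norml => ? ?; lra].
  have [M hM] := cvg_eventually hx eta0.
  exists M => j Mj; rewrite /ex indicE memNset ?mulr0 ?addr_ge0 ?(ltW dl0)//.
  by apply: heta; apply: hM; rewrite /= (leq_trans Mj)// leq_addr.
- rewrite -[X in _ --> X](mulr0 (enorm h)); apply: cvgMr.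
  by move: e0; rewrite -(cvg_shiftn N).
- move=> j; have [L [B tk]] := tm (j + N)%N.
  apply: (le_trans (ltW (HN (j + N)%N (leq_addl _ _)))).
  apply: le_trans (tame_defect tk (ltW st) h k0) _.
  apply: (le_trans (lee_eq (intZ mu measurableT
    (mex (fun x => enorm (Gp (j + N)%N x)) (j + N)%N (meG _)) (ex0 _ _) (enorm_ge0 h)))).
  apply: (@le_trans _ _ ((enorm h)%:E * \int[mu]_x (ex G (j + N)%N x)%:E +
    (enorm h * e (j + N)%N)%:E)%E); last first.
    apply: leeD2r; apply: lee_eq; apply: esym; apply: intZ.
    + exact: measurableT.
    + exact: mex.
    + exact: ex0.
    + exact: enorm_ge0.
  rewrite EFinM -ge0_muleDr; last 2 first.
  + by apply: int_ge0; exact: ex0.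
  + by apply: le_trans (he (j + N)%N); apply: int_ge0 => x.
  apply: lee_wpmul2l; first by rewrite lee_fin enorm_ge0.
  apply: (@int_tame_near _ _ (fun x => enorm (Gp (j + N)%N x))).
  + exact: mex (meG _).
  + exact: mex.
  + exact: meG.
  + by move=> x; exact: (ex0 (fun x => enorm (Gp (j + N)%N x))).
  + exact: ex0.
  + move=> x; rewrite /ex indicE; case: (_ \in _); rewrite ?mulr1 ?mulr0 ?add0r//.
    move: (enorm _) (G x) => a b; have ? := ler_norm (a - b).
    rewrite -[in leRHS](max_l (normr_ge0 (a - b))); apply: max0_leD; lra.
  + exact: he.
Qed.
End limit_slabs.

End sobolev.

(** * Radial test functions *)

Section Ck_closure.
Variables (R : realType) (n : nat).
Local Notation V := 'rV[R]_n.
Local Notation e_ i := (delta_mx ord0 i : 'rV[R]_n).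
Implicit Types (u v : V -> R) (f : R -> R).

Lemma Ck_pred k u : Ck k.+1 u -> Ck k u.
Proof.
elim: k u => [|k ih] u; first by case.
by move=> [cu h]; split => // i; have [du /ih] := h i.
Qed.

Lemma Ck_cst k (c : R) : Ck k ((fun=> c) : V -> R).
Proof.
elim: k c => [|k ih] c; (split; first exact: cst_continuous) => // i.
split; first by move=> x; exact: derivable_cst.
rewrite (_ : partial _ _ = fun=> 0)//.
by apply/funext => x; exact: derive_cst.
Qed.

Lemma CkD k u v : Ck k u -> Ck k v -> Ck k (fun x => u x + v x).
Proof.
elim: k u v => [|k ih] u v [cu hu] [cv hv].
  by split => // x; exact: (cvgD (cu x) (cv x)).
split; first by move=> x; exact: (cvgD (cu x) (cv x)).
move=> i; have [du Cu] := hu i; have [dv Cv] := hv i.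
split; first by move=> x; exact: derivableD.
rewrite (_ : partial _ _ = (fun x => partial i u x + partial i v x)); first exact: ih.
by apply/funext => x; exact: deriveD.
Qed.

Lemma CkM k u v : Ck k u -> Ck k v -> Ck k (fun x => u x * v x).
Proof.
elim: k u v => [|k ih] u v Ku Kv; have [cu hu] := Ku; have [cv hv] := Kv.
  by split => // x; exact: (cvgM (cu x) (cv x)).
split; first by move=> x; exact: (cvgM (cu x) (cv x)).
move=> i; have [du Cu] := hu i; have [dv Cv] := hv i.
split; first by move=> x; exact: derivableM.
rewrite (_ : partial _ _ = (fun x => u x * partial i v x + v x * partial i u x)).
  by apply: CkD; apply: ih => //; exact: Ck_pred.
by apply/funext => x; exact: deriveM.
Qed.

Lemma Ck_coord k j : Ck k (fun x : V => x ord0 j).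
Proof.
have E x i : (fun h : R => h^-1 *: (((fun x : V => x ord0 j) \o shift x) (h *: e_ i) - x ord0 j))
    @ 0^' --> ((e_ i) ord0 j : R).
  apply: (@cvg_near_cst _ _ _ _ _).
  near=> h; rewrite /= !mxE addrK -[_ *: _]/(_ * _) mulrA mulVf ?mul1r//.
  by near: h; exact: nbhs_dnbhs_neq.
case: k => [|k]; (split; first exact: coord_continuous) => // i; split.
  by move=> x; apply/cvg_ex; exists ((e_ i) ord0 j); exact: E.
rewrite (_ : partial _ _ = fun=> (e_ i) ord0 j); first exact: Ck_cst.
by apply/funext => x; apply: cvg_lim => //; exact: E.
Unshelve. all: by end_near.
Qed.

Lemma Ck_sum k m (F : 'I_m -> V -> R) : (forall i, Ck k (F i)) ->
  Ck k (fun x => \sum_i F i x).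
Proof.
move=> CF; elim: m F CF => [|m ih] F CF.
  rewrite (_ : (fun x => _) = fun=> 0); first exact: Ck_cst.
  by apply/funext => x; rewrite big_ord0.
rewrite (_ : (fun x => _) = fun x => F ord0 x + \sum_(i < m) F (lift ord0 i) x).
  by apply: CkD => //; apply: ih.
by apply/funext => x; rewrite big_ord_recl.
Qed.

Fixpoint smooth k f : Prop := continuous f /\
  if k is k'.+1 then exists2 f' : R -> R, (forall x : R, is_derive x 1 f (f' x)) & smooth k' f' else True.

Lemma is_derive_comp_partial i f (f' : R) u (x : V) : derivable u x (e_ i) ->
  is_derive (u x) 1 f f' -> is_derive x (e_ i) (f \o u) (f' * partial i u x).
Proof.
move=> du df.
pose g (h : R) := u (h *: e_ i + x).
have g0 : g 0 = u x by rewrite /g scale0r add0r.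
have E (w : V -> R) : (fun h : R => h^-1 *: ((w \o shift x) (h *: e_ i) - w x)) =
   (fun h : R => h^-1 *: (((fun h : R => w (h *: e_ i + x)) \o shift (0:R)) (h *: 1) -
     (fun h : R => w (h *: e_ i + x)) 0)).
  by apply/funext => h /=; rewrite addr0 [h *: 1]mulr1 scale0r add0r.
have dg : is_derive (0 : R) 1 g (partial i u x).
  by split; [rewrite /derivable -E; exact: du|rewrite /derive -E].
have df' : is_derive (g 0) 1 f f' by rewrite g0.
have [h1 h2] := is_derive1_comp df' dg.
split; first by rewrite /derivable E; exact: h1.
by rewrite /derive E -[LHS]/('D_1 (f \o g) 0) h2 mulrC.
Qed.

Lemma Ck_comp k f u : smooth k f -> Ck k u -> Ck k (f \o u).
Proof.
elim: k f u => [|k ih] f u Sf Cu.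
  by case: Sf Cu => cf _ [cu _]; split => // x; exact: continuous_comp (cu x) (cf _).
have [cf [f' df Sf']] := Sf; have [cu hu] := Cu.
split; first by move=> x; exact: continuous_comp (cu x) (cf _).
move=> i; have [du Ciu] := hu i.
have h x := is_derive_comp_partial (du x) (df (u x)).
split; first by move=> x; have [] := h x.
rewrite (_ : partial _ _ = (fun x => (f' \o u) x * partial i u x)).
  by apply: CkM => //; apply: ih => //; exact: Ck_pred.
by apply/funext => x; have [] := h x.
Qed.

Lemma is_derive_continuous f (f' : R -> R) : (forall x : R, is_derive x 1 f (f' x)) -> continuous f.
Proof.
move=> df x; apply: differentiable_continuous; apply/derivable1_diffP.
by have [] := df x.
Qed.

Lemma smoothD k f g : smooth k f -> smooth k g -> smooth k (fun x => f x + g x).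
Proof.
elim: k f g => [|k ih] f g [cf hf] [cg hg].
  by split => // x; exact: (cvgD (cf x) (cg x)).
split; first by move=> x; exact: (cvgD (cf x) (cg x)).
have [f' df Sf] := hf; have [g' dg Sg] := hg.
by exists (fun x => f' x + g' x); [move=> x; exact: is_deriveD|exact: ih].
Qed.

Lemma smoothZ k f (c : R) : smooth k f -> smooth k (fun x => c * f x).
Proof.
elim: k f => [|k ih] f [cf hf].
  by split => // x; exact: (cvgM (cvg_cst c) (cf x)).
split; first by move=> x; exact: (cvgM (cvg_cst c) (cf x)).
have [f' df Sf] := hf.
by exists (fun x => c * f' x); [move=> x; exact: is_deriveZ|exact: ih].
Qed.

End Ck_closure.

(** * A smooth approximation of the positive part *)

Section flat.
Variables (R : realType) (eps : R).
Hypothesis eps0 : 0 < eps.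

(* All functions x^-N exp (- eps / x), extended by 0, are flat at 0. *)
Definition flat (N : nat) (x : R) : R :=
  if 0 < x then x^-1 ^+ N * expR (- (eps * x^-1)) else 0.

(** Smooth substitute for the positive part, from which it differs by at most [eps]; its derivative
    stays in [0, 1]. *)
Definition ramp (x : R) : R := if 0 < x then x * expR (- (eps * x^-1)) else 0.

(** With y = 1/x, the exponential of eps y is at least (eps y)^(N+1) / (N+1)!, which beats y^N for y
    > 1; for y <= 1 the product is at most 1. *)
Lemma flat_bound N : exists2 K, 0 <= K & forall x, 0 < x -> x^-1 ^+ N * expR (- (eps * x^-1)) <= K.
Proof.
exists ((N.+1)`!%:R / eps ^+ N.+1 + 1) => [|x x0].
  by rewrite addr_ge0// divr_ge0// exprn_ge0// ltW.
set y := x^-1; have y0 : 0 < y by rewrite invr_gt0.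
have ey0 : 0 < expR (- (eps * y)) by exact: expR_gt0.
have [y1|y1] := leP y 1.
  rewrite -[leLHS]add0r lerD// ?divr_ge0 ?exprn_ge0 ?(ltW eps0)//.
  rewrite mulr_ile1 ?exprn_ge0 ?(ltW y0) ?(ltW ey0)// ?exprn_ile1 ?(ltW y0)//.
  by rewrite expR_le1 oppr_le0 mulr_ge0 ?(ltW eps0) ?(ltW y0).
have ey : 0 <= eps * y by rewrite mulr_ge0 ?(ltW eps0) ?(ltW y0).
have h : (eps * y) ^+ N.+1 / (N.+1)`!%:R <= expR (eps * y).
  by apply: le_trans (expR_ge1Dxn N ey); rewrite lerDr.
apply: (@le_trans _ _ ((N.+1)`!%:R / eps ^+ N.+1)); last by rewrite lerDl.
apply: (@le_trans _ _ (y ^+ N.+1 * expR (- (eps * y)))).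
  by rewrite ler_pM2r// exprS -[leLHS]mul1r ler_pM2r ?exprn_gt0// ltW.
rewrite expRN ler_pdivrMr ?expR_gt0//.
have F0 : 0 < (N.+1)`!%:R :> R by rewrite ltr0n fact_gt0.
have e1 : 0 < eps ^+ N.+1 by exact: exprn_gt0.
have c0 : 0 <= (N.+1)`!%:R / eps ^+ N.+1 by rewrite divr_ge0 ?(ltW F0) ?(ltW e1).
apply: le_trans (ler_wpM2l c0 h); rewrite exprMn.
by rewrite le_eqVlt; apply/orP; left; apply/eqP; field; rewrite ?gt_eqF.
Qed.

Lemma is_derive_flat0 (f : R -> R) (K : R) : (forall x, `|f x| <= K * x ^+ 2) ->
  is_derive (0 : R) 1 f 0.
Proof.
move=> hf; have f0 : f 0 = 0.
  by apply/eqP; rewrite -normr_le0; have := hf 0; rewrite expr0n mulr0.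
have cv : h^-1 *: ((f \o shift 0) (h *: 1) - f 0) @[h --> (0 : R)^'] --> (0 : R).
  have lim : K * `|h| @[h --> (0 : R)^'] --> (0 : R).
    rewrite -[X in _ --> X](mulr0 K); apply: cvgMr.
    rewrite -[X in _ --> X](@normr0 _ R); apply: cvg_norm.
    apply: (@cvg_trans _ ((0 : R)^')); [exact: cvg_id|exact: cvg_within].
  apply/norm_cvg0P; apply: (squeeze_cvgr _ (cvg_cst 0) lim).
  near=> h; rewrite normr_ge0 /= f0 subr0 addr0 [h *: 1]mulr1 normrM normfV.
  have h0 : 0 < `|h| by rewrite normr_gt0; near: h; exact: nbhs_dnbhs_neq.
  rewrite mulrC ler_pdivrMr//; apply: le_trans (hf h) _.
  by rewrite -mulrA -expr2 real_normK// num_real.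
split; first by apply/cvg_ex; exists 0; exact: cv.
exact: cvg_lim.
Unshelve. all: by end_near.
Qed.

Lemma is_derive_flat N (x : R) : is_derive x 1 (flat N) (- N%:R * flat N.+1 x + eps * flat N.+2 x).
Proof.
have [x0|x0|->] := ltgtP x 0.
- have -> : - N%:R * flat N.+1 x + eps * flat N.+2 x = 0.
    by rewrite /flat ltNge (ltW x0) /= !mulr0 addr0.
  apply: (@near_eq_is_derive _ _ _ (cst 0)).
  by near=> y; rewrite /flat ltNge ltW//=; near: y; exact: lt_nbhsl.
- rewrite /flat x0.
  have xn0 : x != 0 by rewrite gt_eqF.
  apply: (@near_eq_is_derive R R R (fun y : R => y^-1 ^+ N * expR (- (eps * y^-1)))).
    by near=> y; rewrite ifT//; near: y; exact: lt_nbhsr.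
  have dV : is_derive x 1 (fun y : R => y^-1) (- x^-1 ^+ 2).
    have := @is_deriveV R id x 1 1 xn0 (is_derive_id _ _).
    by rewrite [_ *: 1]mulr1 exprVn.
  have dP := @is_deriveX R R id N x^-1 1 1 (is_derive_id _ _).
  have dZ := @is_deriveZ R R R id (- eps) x^-1 1 1 (is_derive_id _ _).
  have dC := is_derive1_comp (is_deriveM dP (is_derive1_comp (is_derive_expR _) dZ)) dV.
  rewrite (_ : (fun y => _) =
      ((id ^+ N) * (expR \o (- eps \*: (id : R -> R)))) \o (fun y => y^-1)); last first.
    apply/funext => y; transitivity ((id ^+ N) y^-1 * expR (- eps * y^-1)) => //.
    by rewrite exprfctE mulNr.
  apply: is_derive_eq; rewrite /= exprfctE !mulNr.
  rewrite [_ *: 1]mulr1 [_ *: 1]mulr1 /GRing.scale/= ?mulNr.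
  move: (expR _) => E; case: N {dP dC} => [|N].
    by rewrite !expr0; ring.
  by rewrite !exprS/=; ring.
- have -> : - N%:R * flat N.+1 0 + eps * flat N.+2 0 = 0 :> R.
    by rewrite /flat ltxx !mulr0 addr0.
  have [K K0 hK] := flat_bound N.+2.
  apply: (@is_derive_flat0 _ K) => x'; rewrite /flat; case: ifPn => x'0; last first.
    by rewrite normr0 mulr_ge0// sqr_ge0.
  rewrite ger0_norm ?mulr_ge0 ?exprn_ge0 ?invr_ge0 ?(ltW x'0) ?expR_ge0//.
  rewrite -ler_pdivrMr ?exprn_gt0//; apply: le_trans (hK _ x'0).
  rewrite mulrAC -exprVn -exprD addn2; exact: lexx.
Unshelve. all: by end_near.
Qed.

(** The derivative of a member of the family is a linear combination of two others, so the induction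
    on [k] runs over all [N] at once. *)
Lemma smooth_flat k N : smooth k (flat N).
Proof.
have cf M := is_derive_continuous (@is_derive_flat M).
elim: k N => [|k ih] N; (split; first exact: cf) => //.
exists (fun x => - N%:R * flat N.+1 x + eps * flat N.+2 x); first exact: is_derive_flat.
by apply: smoothD; apply: smoothZ.
Qed.

Definition dramp (x : R) : R := flat 0 x + eps * flat 1 x.

Lemma is_derive_ramp (x : R) : is_derive x 1 ramp (dramp x).
Proof.
have -> : ramp = id * flat 0.
  apply/funext => y; rewrite /ramp /GRing.mul/= /flat expr0 mul1r.
  by case: ifP => //; rewrite mulr0.
apply: is_derive_eq (is_deriveM (is_derive_id x 1) (is_derive_flat 0 x)) _.
rewrite /dramp oppr0 mul0r add0r [_ *: 1]mulr1 addrC; congr +%R.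
rewrite [LHS]mulrCA; congr *%R; rewrite /flat; case: ifPn => x0; last by rewrite mulr0.
by rewrite exprS expr1 mulrA mulrA mulfV ?mul1r// gt_eqF.
Qed.

Lemma smooth_ramp k : smooth k ramp.
Proof.
have cr := is_derive_continuous is_derive_ramp.
case: k => [|k]; split => //; exists dramp; first exact: is_derive_ramp.
by apply: smoothD; [|apply: smoothZ]; exact: smooth_flat.
Qed.

Lemma dramp_ge0 x : 0 <= dramp x.
Proof.
rewrite /dramp /flat; case: ifPn => x0; last by rewrite mulr0 addr0.
by rewrite addr_ge0 ?mulr_ge0 ?exprn_ge0 ?invr_ge0 ?expR_ge0 ?(ltW x0) ?(ltW eps0).
Qed.

Lemma dramp_le1 x : dramp x <= 1.
Proof.
rewrite /dramp /flat; case: ifPn => x0; last by rewrite mulr0 addr0.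
rewrite expr0 expr1 mul1r mulrA -{1}[expR _]mul1r -mulrDl.
by rewrite expRN ler_pdivrMr ?expR_gt0// mul1r expR_ge1Dx.
Qed.

Lemma dramp0 x : x <= 0 -> dramp x = 0.
Proof. by move=> x0; rewrite /dramp /flat ltNge x0 /= mulr0 addr0. Qed.

Lemma ramp0 x : x <= 0 -> ramp x = 0.
Proof. by move=> x0; rewrite /ramp ltNge x0. Qed.

Lemma ramp_ge0 x : 0 <= ramp x.
Proof. by rewrite /ramp; case: ifPn => // x0; rewrite mulr_ge0 ?expR_ge0// ltW. Qed.

Lemma ramp_le x : 0 <= x -> ramp x <= x.
Proof.
rewrite /ramp; case: ifPn => // x0 _; rewrite -[leRHS]mulr1 ler_pM2l// expR_le1.
by rewrite oppr_le0 mulr_ge0 ?invr_ge0 ?(ltW x0) ?(ltW eps0).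
Qed.

Lemma ramp_ge x : x - eps <= ramp x.
Proof.
rewrite /ramp; case: ifPn => [x0|]; last by rewrite -leNgt => x0; have := eps0; lra.
apply: (@le_trans _ _ (x * (1 - eps * x^-1))).
  by rewrite mulrBr mulr1 mulrCA mulfV ?mulr1// gt_eqF.
by rewrite ler_pM2l// expR_ge1Dx.
Qed.

End flat.

Lemma int_supp d (T : measurableType d) (R : realType) (m : {measure set T -> \bar R})
    (D : set T) (u : T -> R) : (forall x, u x != 0 -> D x) ->
  (\int[m]_(x in D) (u x)%:E = \int[m]_x (u x)%:E)%E.
Proof.
move=> uD; rewrite int_restrict; congr integral; apply/funext => x; rewrite patchE.
case: ifPn => // xD; congr EFin; apply/esym; apply: contraNeq xD => /uD.
exact: mem_set.
Qed.

Section integrals_on.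
Context d (T : measurableType d) (R : realType).
Variable m : {measure set T -> \bar R}.
Local Open Scope ereal_scope.

Lemma int_leD (D : set T) (f g : T -> R) : measurable D ->
  measurable_fun D f -> measurable_fun D g ->
  (forall x, 0 <= f x)%R -> (forall x, D x -> f x <= g x)%R ->
  \int[m]_(x in D) (f x)%:E <= \int[m]_(x in D) (g x)%:E.
Proof.
move=> mD mf mg f0 fg; apply: ge0_le_integral => //.
- by move=> x _; rewrite lee_fin.
- exact/measurable_EFinP.
- exact/measurable_EFinP.
Qed.

Lemma intZD (D : set T) (c : R) (f : T -> R) : measurable D ->
  measurable_fun D f -> (forall x, 0 <= f x)%R -> (0 <= c)%R ->
  \int[m]_(x in D) (c * f x)%:E = c%:E * \int[m]_(x in D) (f x)%:E.
Proof.
move=> mD mf f0 c0; rewrite -ge0_integralZl//.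
- exact/measurable_EFinP.
- by move=> x _; rewrite lee_fin.
Qed.

Lemma intDD (D : set T) (f g : T -> R) : measurable D ->
  measurable_fun D f -> measurable_fun D g ->
  (forall x, 0 <= f x)%R -> (forall x, 0 <= g x)%R ->
  \int[m]_(x in D) (f x + g x)%:E =
  \int[m]_(x in D) (f x)%:E + \int[m]_(x in D) (g x)%:E.
Proof.
move=> mD mf mg f0 g0; rewrite -ge0_integralD//.
- by move=> x _; rewrite lee_fin.
- exact/measurable_EFinP.
- by move=> x _; rewrite lee_fin.
- exact/measurable_EFinP.
Qed.

Lemma int_subset (A D : set T) (f : T -> R) : measurable A -> measurable D -> A `<=` D ->
  measurable_fun D f -> (forall x, 0 <= f x)%R ->
  \int[m]_(x in A) (f x)%:E <= \int[m]_(x in D) (f x)%:E.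
Proof.
move=> mA mD AD mf f0; apply: ge0_subset_integral => //.
  exact/measurable_EFinP.
by move=> x _; rewrite lee_fin.
Qed.

Lemma fine_int_le_norm (D : set T) (f : T -> R) (c : R) : measurable D -> measurable_fun D f ->
  \int[m]_(x in D) `|f x|%:E <= c%:E -> (fine (\int[m]_(x in D) (f x)%:E) <= c)%R.
Proof.
move=> mD mf fc; have intf : m.-integrable D (EFin \o f).
  apply/integrableP; split; first exact/measurable_EFinP.
  exact: le_lt_trans fc (ltry _).
rewrite -lee_fin fineK; last exact: integrable_fin_num.
apply: le_trans fc; apply: le_trans (lee_abs _) _.
by apply: le_trans (le_abse_integral _ _ _) _ => //; exact/measurable_EFinP.
Qed.

Lemma int_indicD (D A : set T) (f : T -> R) : measurable A -> A `<=` D ->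
  \int[m]_(x in D) (f x * \1_A x)%:E = \int[m]_(x in A) (f x)%:E.
Proof. by move=> mA AD; rewrite int_indic// setIidr. Qed.

End integrals_on.

Section test_functions.
Context (R : realType) (n : nat).
Hypothesis n0 : (0 < n)%N.
Local Notation V := 'rV[R]_n.
Local Notation mu := (@lebesgue R n).

Lemma test_mul (Omega : set V) (u v : V -> R) : test_function Omega u ->
  test_function Omega v -> test_function Omega (fun x => u x * v x).
Proof.
move=> [Cu Ku uO] [Cv Kv vO].
have sub : closure [set x | u x * v x != 0] `<=` closure [set x | u x != 0].
  by apply: closure_subset => x /=; rewrite mulf_eq0 negb_or => /andP[].
split; first by move=> k; exact: CkM.
  by apply: subclosed_compact sub => //; exact: closed_closure.
exact: subset_trans sub uO.
Qed.

Lemma supp_integrable (u : V -> R) (K : set V) : continuous u -> compact K ->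
  (forall x, u x != 0 -> K x) -> mu.-integrable setT (EFin \o u).
Proof.
move=> cu cK uK; have [M M0 hM] := compact_bounded_fun cu cK.
have mK : measurable K by apply: closed_measurable_rV; exact: compact_closed.
have Kfin : (mu K < +oo)%E by apply: bounded_lty; exact: compact_bounded.
have mu_ := continuous_measurable_rV cu.
apply: le_integrable (integrable_cst_indic M mK Kfin).
- exact: measurableT.
- exact/measurable_EFinP.
move=> x _; rewrite /= lee_fin indicE.
have [->|ux] := eqVneq (u x) 0; first by rewrite normr0 normr_ge0.
by rewrite mem_set ?mulr1; [rewrite (ger0_norm M0); exact/hM/uK|exact: uK].
Qed.

(** The classical gradient is the weak one: the product of two test functions is a test function,
    and the integral of its partial derivative is 0 by [tame_integral_partial]. *)
Lemma test_W1p0 (Omega : set V) (p : R) (phi : V -> R) : 1 < p -> open Omega ->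
  bounded_set Omega -> test_function Omega phi -> W1p0 Omega p phi (grad phi).
Proof.
move=> p1 oO bO tphi.
have mO := measurable_open oO.
have Ofin := bounded_lty bO.
have Lpb (u : V -> R) : continuous u -> (forall x, u x != 0 -> closure [set x | phi x != 0] x) ->
    Lp Omega p u.
  move=> cu uK; have mu_ := continuous_measurable_rV cu.
  split; first exact: measurable_funTS.
  have [M M0 hM] := compact_bounded_fun cu (let: And3 _ K _ := tphi in K).
  apply: (@le_lt_trans _ _ (\int[mu]_(x in Omega) (M `^ p)%:E)%E); last first.
    by rewrite integral_cst//; apply: lte_mul_pinfty; rewrite ?lee_fin ?powR_ge0.
  apply: int_le.
  - exact: mO.
  - by apply: measurable_powRf; exact: measurable_normf.
  - exact: measurable_cst.
  - by move=> x; exact: powR_ge0.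
  move=> x _; apply: ge0_ler_powR; rewrite ?nnegrE//; first lra.
  have [->|ux] := eqVneq (u x) 0; first by rewrite normr0.
  by apply: hM; exact: uK.
have par0 x i : partial i phi x != 0 -> closure [set x | phi x != 0] x.
  by move=> h; apply: contrapT => nK; move/eqP: h; apply; exact: test_partial0.
have gE i : (fun x => grad phi x ord0 i) = partial i phi.
  by apply/funext => x; rewrite mxE.
split; last first.
  exists (fun=> phi); split => //.
  rewrite (_ : (fun _ => _) = fun=> 0%E); first exact: cvg_cst.
  apply/funext => k; apply: integral0_eq => x _.
  by rewrite !subrr normr0 enorm0 powR0 ?gt_eqF ?addr0//; lra.
split.
- by apply: Lpb; [case: tphi => /(_ 0%N)[]|move=> x h; exact: subset_closure].
- move=> i; rewrite gE; apply: Lpb; last by move=> x; exact: par0.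
  exact: C1_partial_continuous (test_C1 tphi).
move=> psi tpsi i.
have cphi : continuous phi by case: tphi => /(_ 0%N)[].
have cpsi : continuous psi by case: tpsi => /(_ 0%N)[].
have cdphi := C1_partial_continuous (i := i) (test_C1 tphi).
have cdpsi := C1_partial_continuous (i := i) (test_C1 tpsi).
have [_ K KO] := tphi.
rewrite /Rintegral; under [in RHS]eq_integral => x _ do rewrite mxE.
have e1 : (\int[mu]_(x in Omega) (phi x * partial i psi x)%:E =
    \int[mu]_x (phi x * partial i psi x)%:E)%E.
  apply: int_supp => x; rewrite mulf_eq0 negb_or => /andP[px _].
  by apply: KO; exact: subset_closure.
have e2 : (\int[mu]_(x in Omega) (partial i phi x * psi x)%:E =
    \int[mu]_x (partial i phi x * psi x)%:E)%E.
  by apply: int_supp => x; rewrite mulf_eq0 negb_or => /andP[/par0 + _]; exact: KO.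
rewrite e1 e2.
have i1 : mu.-integrable setT (EFin \o (fun x => phi x * partial i psi x)).
  apply: supp_integrable K _.
    by move=> x; exact: (cvgM (cphi x) (cdpsi x)).
  by move=> x; rewrite mulf_eq0 negb_or => /andP[px _]; exact: subset_closure.
have i2 : mu.-integrable setT (EFin \o (fun x => partial i phi x * psi x)).
  apply: supp_integrable K _.
    by move=> x; exact: (cvgM (cdphi x) (cpsi x)).
  by move=> x; rewrite mulf_eq0 negb_or => /andP[/par0].
have [L [B tm]] := test_tame (test_mul tphi tpsi).
have gM : (fun x => grad (fun y => phi y * psi y) x ord0 i) =
    (fun x => phi x * partial i psi x + partial i phi x * psi x).
  apply/funext => x; rewrite mxE [RHS]addrC.
  have [_ /(_ i)[d1 _]] := test_C1 tphi; have [_ /(_ i)[d2 _]] := test_C1 tpsi.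
  apply: (etrans (deriveM (d1 x) (d2 x))).
  by rewrite addrC; congr (_ + _); exact: mulrC.
have mg : measurable_fun setT (fun x => grad (fun y => phi y * psi y) x ord0 i).
  rewrite gM; apply: continuous_measurable_rV => x.
  exact: (cvgD (cvgM (cphi x) (cdpsi x)) (cvgM (cdphi x) (cpsi x))).
have T0 := tame_integral_partial tm mg.
have /eqP : (\int[mu]_x (phi x * partial i psi x)%:E +
    \int[mu]_x (partial i phi x * psi x)%:E = 0)%E.
  rewrite -T0 -integralD//; apply: eq_integral => x _.
  by rewrite -EFinD -(congr1 (@^~ x) gM).
rewrite -(fineK (integrable_fin_num measurableT i1)) -(fineK (integrable_fin_num measurableT i2)).
by rewrite -EFinD eqe addr_eq0 => /eqP.
Qed.

End test_functions.

Section radial.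
Context (R : realType) (n : nat).
Hypothesis n0 : (0 < n)%N.
Local Notation V := 'rV[R]_n.
Local Notation mu := (@lebesgue R n).

Section radial_test.
Variables (eps b c : R).
Hypotheses (eps0 : 0 < eps) (b0 : 0 < b) (c0 : 0 < c).

Let u (x : V) : R := b ^+ 2 - dotv x x.

(* min (b^2 - |x|^2)^+ c, smoothed by the ramp. *)
Definition radial (x : V) : R := ramp eps c - ramp eps (c - ramp eps (u x)).

(** Derivative of [radial] with respect to b^2 - |x|^2, whose gradient is -2x. *)
Definition dradial (x : V) : R := dramp eps (c - ramp eps (u x)) * dramp eps (u x).

Lemma le_ramp x y : x <= y -> ramp eps x <= ramp eps y.
Proof.
move=> xy; have [x0|x0] := leP x 0; first by rewrite ramp0// ramp_ge0.
have y0 := lt_le_trans x0 xy; rewrite /ramp x0 y0.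
apply: ler_pM; rewrite ?(ltW x0) ?expR_ge0//.
by rewrite ler_expR lerN2 ler_pM2l// lef_pV2.
Qed.

Lemma radial_ge0 x : 0 <= radial x.
Proof. by rewrite subr_ge0 le_ramp// gerBl ramp_ge0. Qed.

Lemma radial_le x : radial x <= c.
Proof.
apply: (@le_trans _ _ (ramp eps c)); first by rewrite gerBl ramp_ge0.
by rewrite ramp_le// ltW.
Qed.

Lemma radial_supp x : radial x != 0 -> enorm x < b.
Proof.
move=> h; rewrite ltNge; apply: contra_neqN h => bx.
rewrite /radial (@ramp0 _ _ (u x)) ?subr0 ?subrr// /u subr_le0 -sqr_enorm.
by rewrite ler_pXn2r ?nnegrE ?enorm_ge0 ?(ltW b0).
Qed.

(** Inside radius a, b^2 - |x|^2 exceeds c by at least [eps], the error of the inner ramp; the outer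
    ramp is then saturated and the function sits on its plateau. *)
Lemma radial_ge (a : R) x : 0 <= a -> c + eps <= b ^+ 2 - a ^+ 2 -> enorm x < a -> c - eps <= radial x.
Proof.
move=> a0 cab xa; rewrite /radial (@ramp0 _ _ (c - _)) ?subr0 ?ramp_ge//.
rewrite subr_le0; apply: le_trans (ramp_ge eps0 _).
rewrite lerBrDr; apply: le_trans cab _; rewrite /u lerD2l lerN2 -sqr_enorm.
by rewrite ler_pXn2r ?nnegrE ?enorm_ge0 ?(ltW xa).
Qed.

Lemma dradial_itv x : 0 <= dradial x <= 1.
Proof.
rewrite mulr_ge0 ?dramp_ge0//= mulr_ile1 ?dramp_ge0 ?dramp_le1//.
Qed.

Lemma dradial_out x : b <= enorm x -> dradial x = 0.
Proof.
move=> bx; rewrite /dradial (@dramp0 _ _ (u x)) ?mulr0// /u subr_le0 -sqr_enorm.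
by rewrite ler_pXn2r ?nnegrE ?enorm_ge0 ?(ltW b0).
Qed.

Lemma dradial_in (a : R) x : 0 <= a -> c + eps <= b ^+ 2 - a ^+ 2 -> enorm x < a -> dradial x = 0.
Proof.
move=> a0 cab xa; rewrite /dradial (@dramp0 _ _ (c - _)) ?mul0r//.
rewrite subr_le0; apply: le_trans (ramp_ge eps0 _).
rewrite lerBrDr; apply: le_trans cab _; rewrite /u lerD2l lerN2 -sqr_enorm.
by rewrite ler_pXn2r ?nnegrE ?enorm_ge0 ?(ltW xa).
Qed.

Let Cu k : Ck k u.
Proof.
rewrite (_ : u = fun x => b ^+ 2 + (-1) * dotv x x); last by apply/funext => x; rewrite mulN1r.
apply: CkD; first exact: Ck_cst.
apply: CkM; first exact: Ck_cst.
by apply: (@Ck_sum _ _ k _ (fun i x => x ord0 i * x ord0 i)) => i; apply: CkM; exact: Ck_coord.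
Qed.

Let radialE : radial = fun x => ramp eps c + (-1) *
  (ramp eps \o (fun x => c + (-1) * (ramp eps \o u) x)) x.
Proof. by apply/funext => x; rewrite /radial /= !mulN1r. Qed.

Lemma Ck_radial k : Ck k radial.
Proof.
rewrite radialE; apply: CkD; first exact: Ck_cst.
apply: CkM; first exact: Ck_cst.
apply: Ck_comp; first exact: smooth_ramp.
apply: CkD; first exact: Ck_cst.
apply: CkM; first exact: Ck_cst.
by apply: Ck_comp (Cu k); exact: smooth_ramp.
Qed.

Lemma grad_radial x : grad radial x = (- (2 * dradial x)) *: x.
Proof.
apply/rowP => i; rewrite !mxE.
have du : is_derive x (delta_mx ord0 i) u (- (2 * x ord0 i)).
  have cv : h^-1 *: ((u \o shift x) (h *: delta_mx ord0 i) - u x) @[h --> (0 : R)^'] -->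
      - (2 * x ord0 i).
    have lim : - (h + 2 * x ord0 i) @[h --> (0 : R)^'] --> - (2 * x ord0 i).
      rewrite -[X in _ --> - X]add0r; apply: cvgN; apply: cvgD; last exact: cvg_cst.
      by apply: (@cvg_trans _ ((0 : R)^')); [exact: cvg_id|exact: cvg_within].
    apply: cvg_trans lim; apply: near_eq_cvg; near=> h.
    have h0 : h != 0 by near: h; exact: nbhs_dnbhs_neq.
    have de : dotv (delta_mx ord0 i) x = x ord0 i.
      rewrite /dotv (bigD1 i)//= big1 ?addr0; first by rewrite mxE !eqxx mul1r.
      by move=> k ki; rewrite mxE (negbTE ki) andbF mul0r.
    have dee : dotv (delta_mx ord0 i) (delta_mx ord0 i) = 1 :> R.
      rewrite /dotv (bigD1 i)//= big1 ?addr0; first by rewrite mxE !eqxx mul1r.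
      by move=> k ki; rewrite mxE (negbTE ki) andbF mul0r.
    rewrite /= /u dotvDl !dotvDr !dotvZl !dotvZr (dotvC x) de dee.
    by rewrite /GRing.scale/=; field.
  by split; [apply/cvg_ex; exists (- (2 * x ord0 i)); exact: cv|exact: cvg_lim].
have dF := is_deriveB (is_derive_cst (ramp eps c) (u x) 1) (is_derive1_comp
  (is_derive_ramp eps0 _) (is_deriveB (is_derive_cst c (u x) 1) (is_derive_ramp eps0 (u x)))).
have [d1 d2] := du.
have [_] := is_derive_comp_partial d1 dF.
rewrite -[LHS]/(partial i radial x) => ->; rewrite /partial d2 /dradial.
rewrite -[(cst c - ramp eps) (u x)]/(c - ramp eps (u x)); ring.
Unshelve. all: by end_near.
Qed.

Lemma test_radial (rho : R) : b < rho -> test_function (eball (0 : V) rho) radial.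
Proof.
move=> brho.
have cl : closed [set x : V | enorm x <= b].
  exact: (@closed_comp V R (@enorm R n) [set y | y <= b]
    (fun x _ => @enorm_continuous R n x) (@closed_le R b)).
have sub : closure [set x | radial x != 0] `<=` [set x : V | enorm x <= b].
  rewrite (closure_id [set x : V | enorm x <= b]).1.
    by apply: closure_subset => x /= /radial_supp/ltW.
  exact: cl.
split; first exact: Ck_radial.
- apply: subclosed_compact sub; first exact: closed_closure.
  apply: bounded_closed_compact; last first.
    exact: cl.
  exists b; split; first exact: num_real.
  move=> M bM x /= xb; rewrite [leLHS]mx_normrE; apply/bigmax_leP; split => [|[k i] _ /=].
    by rewrite (ltW (lt_trans b0 bM)).
  by rewrite (ord1 k) (le_trans (coord_le_enorm x i))// (le_trans xb) ?ltW.
- by move=> x /sub /= xb; rewrite /eball /= subr0; exact: le_lt_trans brho.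
Qed.

End radial_test.

Definition shell (a b : R) : set V := eball 0 b `\` eball 0 a.

Lemma measurable_shell a b : measurable (shell a b).
Proof. by apply: measurableD; exact: measurable_eball. Qed.

Lemma shell_sub a b rho : b <= rho -> shell a b `<=` eball 0 rho.
Proof. by move=> br x [xb _]; exact: lt_le_trans xb br. Qed.

(** * Flux and energy of the radial problem in a shell *)

Section flux.
Variables (rho p : R) (g : V -> V) (F : V -> R).
Local Notation B := (eball (0 : V) rho).
Hypotheses (p1 : 1 < p) (Lg : forall i, Lp B p (fun x => g x ord0 i)).
Hypotheses (mF : measurable_fun B F) (F0 : forall x, 0 <= F x)
  (Ffin : (\int[mu]_(x in B) (F x)%:E < +oo)%E).
Hypothesis weak : forall phi, test_function B phi ->
  \int[mu]_(x in B) (enorm (g x) `^ (p - 2) * dotv (g x) (grad phi x)) =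
  \int[mu]_(x in B) (F x * phi x).

Let M a := fine (\int[mu]_(x in eball 0 a) (F x)%:E).

Let mB : measurable B := @measurable_eball R n 0 rho.

Let mg : measurable_fun B (fun x => enorm (g x)).
Proof. by apply: measurable_enorm => i; case: (Lg i). Qed.

Lemma measurable_gpow r : measurable_fun B (fun x => enorm (g x) `^ r).
Proof. exact: measurable_powRf. Qed.

Lemma int_gpow_lty : (\int[mu]_(x in B) (enorm (g x) `^ (p - 1))%:E < +oo)%E.
Proof.
have gp : (\int[mu]_(x in B) (enorm (g x) `^ p)%:E < +oo)%E.
  by apply: Lp_enorm => //; apply: lt_trans p1.
apply: (@le_lt_trans _ _ (\int[mu]_(x in B) (1 + enorm (g x) `^ p)%:E)%E).
  apply: int_leD.
  - exact: mB.
  - exact: measurable_gpow.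
  - by apply: measurable_funD; [exact: measurable_cst|exact: measurable_gpow].
  - by move=> x; exact: powR_ge0.
  move=> x _; have [g1|g1] := leP (enorm (g x)) 1.
    apply: (@le_trans _ _ 1); last by rewrite lerDl powR_ge0.
    apply: (@le_trans _ _ (1 `^ (p - 1))); last by rewrite powR1.
    by apply: ge0_ler_powR; rewrite ?nnegrE ?enorm_ge0 ?subr_ge0 ?(ltW p1).
  apply: (@le_trans _ _ (enorm (g x) `^ p)); last by rewrite lerDr.
  by apply: ler_powR; lra.
under eq_integral do rewrite EFinD.
rewrite ge0_integralD; [|exact: mB|by []|exact: measurable_cst|by move=> x _; rewrite lee_fin powR_ge0|
  by apply/measurable_EFinP; exact: measurable_gpow].
apply: lte_add_pinfty => //; rewrite integral_cst// mul1e.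
exact: lebesgue_eball_lty.
Qed.

Let mpair phi : test_function B phi ->
  measurable_fun B (fun x => enorm (g x) `^ (p - 2) * dotv (g x) (grad phi x)).
Proof.
move=> tphi; apply: measurable_funM; first exact: measurable_gpow.
apply: measurable_sum => i; apply: measurable_funM; first by case: (Lg i).
apply: measurable_funTS; rewrite (_ : (fun x => _) = partial i phi).
  by apply: continuous_measurable_rV; apply: C1_partial_continuous; exact: test_C1 tphi.
by apply/funext => x; rewrite mxE.
Qed.

(** The equation is tested with a radial plateau: on the side of [F] it is at least c - eps on the
    ball of radius a, and on the other side its gradient is supported in the shell and bounded by
    2b. *)
Lemma flux_ramp (a b c eps : R) : 0 <= a -> a < b -> b < rho -> 0 < eps -> eps < c ->
  c + eps <= b ^+ 2 - a ^+ 2 ->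
  (((c - eps) * M a)%:E <= (2 * b)%:E * \int[mu]_(x in shell a b) (enorm (g x) `^ (p - 1))%:E)%E.
Proof.
move=> a0 ab brho eps0 epsc cab.
have b0 : 0 < b by exact: le_lt_trans ab.
have c0 : 0 < c by exact: lt_trans epsc.
pose phi := radial eps b c : V -> R.
have tphi : test_function B phi by exact: test_radial.
have SB : shell a b `<=` B by apply: shell_sub; exact: ltW.
have mS := measurable_shell a b.
have gp0 x : 0 <= enorm (g x) `^ (p - 1) by exact: powR_ge0.
have mgp := measurable_gpow (p - 1).
set I := (\int[mu]_(x in shell a b) _)%E.
have Ifin : (I < +oo)%E.
  by apply: le_lt_trans int_gpow_lty; exact: (int_subset mu mS mB SB mgp gp0).
have I0 : (0 <= I)%E by apply: int_ge0 => x; exact: powR_ge0.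
have IE : I = (fine I)%:E by rewrite fineK// ge0_fin_numE.
rewrite IE -EFinM lee_fin.
have mphi : measurable_fun B phi.
  by apply: measurable_funTS; apply: continuous_measurable_rV; case: (tphi) => /(_ 0%N)[].
have mFphi : measurable_fun B (fun x => F x * phi x) by exact: measurable_funM.
have Fphi0 x : 0 <= F x * phi x by rewrite mulr_ge0// radial_ge0.
have aB : eball (0 : V) a `<=` B by move=> x xa; apply: lt_trans (lt_trans xa ab) brho.
have ma : measurable (eball (0 : V) a) by exact: measurable_eball.
have mcst (r : R) : measurable_fun B (fun=> r) by exact: measurable_cst.
have Fphi : (\int[mu]_(x in B) (F x * phi x)%:E < +oo)%E.
  apply: (@le_lt_trans _ _ (\int[mu]_(x in B) (c * F x)%:E)%E).
    apply: (int_leD mu mB mFphi (measurable_funM (mcst c) mF) Fphi0) => x _.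
    by rewrite mulrC ler_wpM2r// radial_le.
  rewrite (intZD mu mB mF F0 (ltW c0)).
  by apply: lte_mul_pinfty; rewrite ?lee_fin ?(ltW c0).
apply: (@le_trans _ _ (fine (\int[mu]_(x in B) (F x * phi x)%:E))).
  have Ma : (\int[mu]_(x in eball 0 a) (F x)%:E < +oo)%E.
    by apply: le_lt_trans Ffin; exact: (int_subset mu ma mB aB mF F0).
  rewrite -lee_fin fineK; last by rewrite ge0_fin_numE//; exact: int_ge0.
  rewrite EFinM /M fineK; last by rewrite ge0_fin_numE//; exact: int_ge0.
  rewrite -(int_indicD mu F ma aB).
  have mFa : measurable_fun B (fun x => F x * \1_(eball (0 : V) a) x).
    by apply: measurable_funM mF _; exact: measurable_indic.
  have Fa0 x : 0 <= F x * \1_(eball (0 : V) a) x by rewrite mulr_ge0.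
  have ce : 0 <= c - eps by rewrite subr_ge0 ltW.
  rewrite -(intZD mu mB mFa Fa0 ce).
  apply: (int_leD mu mB (measurable_funM (mcst _) mFa) mFphi).
    by move=> x; rewrite mulr_ge0.
  move=> x _ /=; rewrite mulrCA ler_wpM2l// indicE.
  case: (boolP (x \in _)) => xa; last by rewrite mulr0 radial_ge0.
  rewrite mulr1; move/set_mem : xa; rewrite /eball /= subr0 => xa.
  exact: radial_ge cab xa.
have := weak tphi; rewrite /Rintegral => <-.
apply: (fine_int_le_norm mB (mpair tphi)).
rewrite EFinM -IE /I -(int_indicD mu _ mS SB).
have mgS : measurable_fun B (fun x => enorm (g x) `^ (p - 1) * \1_(shell a b) x).
  by apply: measurable_funM mgp _; exact: measurable_indic.
have gS0 x : 0 <= enorm (g x) `^ (p - 1) * \1_(shell a b) x by rewrite mulr_ge0.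
have b2 : 0 <= 2 * b by rewrite mulr_ge0// ltW.
rewrite -(intZD mu mB mgS gS0 b2).
apply: (int_leD mu mB (measurable_normf (mpair tphi)) (measurable_funM (mcst _) mgS)).
  by move=> x; exact: normr_ge0.
move=> x _; rewrite normrM (ger0_norm (powR_ge0 _ _)).
rewrite /phi grad_radial// dotvZr normrM normrN.
have /andP[d0 d1] : 0 <= dradial eps b c x <= 1 by exact: dradial_itv.
have d2 : 0 <= 2 * dradial eps b c x by rewrite mulr_ge0.
rewrite (ger0_norm d2) /=.
rewrite indicE; case: (boolP (x \in shell a b)) => xS; last first.
  have -> : dradial eps b c x = 0; last by rewrite !(mulr0, mul0r).
  move: xS; rewrite notin_setE /shell /eball /= !subr0 => /not_andP[/negP|/contrapT xa].
    by rewrite -leNgt => bx; exact: dradial_out bx.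
  exact: dradial_in cab xa.
rewrite mulr1; move/set_mem : xS; rewrite /shell /eball /= !subr0 => -[xb _].
have hp : enorm (g x) `^ (p - 2) * enorm (g x) = enorm (g x) `^ (p - 1).
  have := @mulr_powRB1 _ (enorm (g x)) (p - 1) (enorm_ge0 _).
  rewrite subr_gt0 p1 (_ : p - 1 - 1 = p - 2); last by lra.
  by move=> /(_ erefl) <-; rewrite mulrC.
apply: (@le_trans _ _ (enorm (g x) `^ (p - 2) * (2 * (enorm (g x) * enorm x)))).
  rewrite ler_wpM2l ?powR_ge0//.
  apply: (@le_trans _ _ (2 * `|dotv (g x) x|)); last by rewrite ler_pM2l// norm_dotv.
  by rewrite ler_wpM2r// -[leRHS]mulr1 ler_pM2l.
rewrite -hp [leLHS](_ : _ = 2 * (enorm (g x) `^ (p - 2) * enorm (g x)) * enorm x); last by ring.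
rewrite [leRHS](_ : _ = 2 * (enorm (g x) `^ (p - 2) * enorm (g x)) * b); last by ring.
by rewrite ler_wpM2l ?mulr_ge0 ?powR_ge0 ?enorm_ge0// ltW.
Qed.

(** Smoothed form of the divergence theorem: the mass [M a] inside radius a has to flow out through
    the shell. It is [flux_ramp] with the smoothing removed. *)
Lemma flux (a b : R) : 0 <= a -> a < b -> b <= rho ->
  (((b ^+ 2 - a ^+ 2) * M a)%:E <=
   (2 * b)%:E * \int[mu]_(x in shell a b) (enorm (g x) `^ (p - 1))%:E)%E.
Proof.
move=> a0 ab brho; have b0 : 0 < b by exact: le_lt_trans ab.
have SB : shell a b `<=` B by exact: shell_sub.
have mS := measurable_shell a b.
have gp0 x : 0 <= enorm (g x) `^ (p - 1) by exact: powR_ge0.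
have mgp := measurable_gpow (p - 1).
set I := (\int[mu]_(x in shell a b) _)%E.
have Ifin : (I < +oo)%E.
  by apply: le_lt_trans int_gpow_lty; exact: (int_subset mu mS mB SB mgp gp0).
have I0 : (0 <= I)%E by apply: int_ge0 => x; exact: powR_ge0.
have IE : I = (fine I)%:E by rewrite fineK// ge0_fin_numE.
rewrite IE -EFinM lee_fin.
have M0 : 0 <= M a by apply: fine_ge0; exact: int_ge0.
have ab2 : a ^+ 2 < b ^+ 2 by rewrite ltr_pXn2r ?nnegrE ?(ltW b0).
have key eta : 0 < eta -> eta < b ^+ 2 - a ^+ 2 ->
    (b ^+ 2 - a ^+ 2 - eta) * M a <= 2 * b * fine I.
  (* The loss eta is shared: eta / 2 to make the support compact in the ball even when b = rho, and
     twice eta / 4 for the error of the ramp, once in c and once in c - eps. *)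
  move=> e0 eab; pose b1 := Num.sqrt (b ^+ 2 - eta / 2).
  have pos : 0 <= b ^+ 2 - eta / 2 by have := sqr_ge0 a; lra.
  have b1sq : b1 ^+ 2 = b ^+ 2 - eta / 2 by rewrite sqr_sqrtr.
  have b1_0 : 0 <= b1 by exact: sqrtr_ge0.
  have b1b : b1 < b by rewrite -(@ltr_pXn2r _ 2) ?nnegrE ?(ltW b0)// b1sq; lra.
  have ab1 : a < b1 by rewrite -(@ltr_pXn2r _ 2) ?nnegrE// b1sq; lra.
  have h : (((b1 ^+ 2 - a ^+ 2 - eta / 4 - eta / 4) * M a)%:E <=
    (2 * b1)%:E * \int[mu]_(x in shell a b1) (enorm (g x) `^ (p - 1))%:E)%E.
    apply: flux_ramp; rewrite ?b1sq//; [exact: lt_le_trans b1b brho|lra|lra|lra].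
  rewrite -lee_fin EFinM [leRHS]EFinM -IE -EFinM.
  have -> : b ^+ 2 - a ^+ 2 - eta = b1 ^+ 2 - a ^+ 2 - eta / 4 - eta / 4 by rewrite b1sq; lra.
  apply: le_trans h _; apply: lee_pmul.
  - by rewrite lee_fin mulr_ge0.
  - by apply: int_ge0.
  - by rewrite lee_fin ler_pM2l// ltW.
  - have S1 : shell a b1 `<=` shell a b.
      by move=> x [xb xa]; split => //; exact: lt_trans xb b1b.
    apply: (int_subset mu (measurable_shell a b1) mS S1 _ gp0).
    exact: (measurable_funS mB SB mgp).
apply/ler_addgt0Pr => e e0.
have M1 : 0 < M a + 1 by rewrite ltr_wpDl.
pose eta := Num.min (e / (M a + 1)) ((b ^+ 2 - a ^+ 2) / 2).
have eta0 : 0 < eta by rewrite lt_min !divr_gt0// subr_gt0.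
have eta1 : eta <= e / (M a + 1) by rewrite ge_min lexx.
have eta2 : eta < b ^+ 2 - a ^+ 2.
  by apply: (@le_lt_trans _ _ ((b ^+ 2 - a ^+ 2) / 2)); [rewrite ge_min lexx orbT|lra].
have := key eta eta0 eta2; rewrite mulrBl.
have : eta * M a <= e.
  apply: (@le_trans _ _ (e / (M a + 1) * (M a + 1))); last by rewrite mulfVK ?gt_eqF.
  by apply: ler_pM; rewrite ?(ltW eta0)// lerDl.
lra.
Qed.

Lemma pow_diff_le (a b : R) (m : nat) : 0 <= a -> a <= b ->
  b ^+ m - a ^+ m <= m%:R * b ^+ m.-1 * (b - a).
Proof.
move=> a0 ab; have b0 := le_trans a0 ab.
rewrite subrXX mulrC ler_wpM2r ?subr_ge0//.
apply: (@le_trans _ _ (\sum_(i < m) b ^+ m.-1)); last by rewrite sumr_const card_ord mulr_natl.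
apply: ler_sum => i _.
have -> : b ^+ m.-1 = b ^+ (m.-1 - i) * b ^+ i by rewrite -exprD subnK// -ltnS (ltn_predK (ltn_ord i)).
by rewrite ler_wpM2l ?exprn_ge0// lerXn2r ?nnegrE.
Qed.

Lemma young_powR (y k : R) : 0 <= y -> 0 <= k ->
  p * (y `^ (p - 1) * k) <= (p - 1) * y `^ p + k `^ p.
Proof.
move=> y0 k0; have p0 : 0 < p by exact: lt_trans p1.
have q0 : 0 < p / (p - 1) by rewrite divr_gt0// subr_gt0.
have pn : p != 0 by rewrite gt_eqF.
have pn1 : p - 1 != 0 by rewrite subr_eq0 gt_eqF.
have := @conjugate_powR _ (y `^ (p - 1)) k (p / (p - 1)) p (powR_ge0 _ _) k0 q0 p0.
rewrite -powRrM (_ : (p - 1) * (p / (p - 1)) = p); last by field.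
have -> : (p / (p - 1))^-1 + p^-1 = 1 by field; rewrite pn.
move=> /(_ erefl) h; have := ler_wpM2l (ltW p0) h.
move: (y `^ p) (k `^ p) => Y K.
have -> : p * (Y / (p / (p - 1)) + K / p) = (p - 1) * Y + K by field; rewrite pn1 pn.
by [].
Qed.

(** By Young, p kap |g|^(p-1) <= (p-1) |g|^p + kap^p. The hypothesis on kap and the flux make the
    integral of |g|^(p-1) over the shell at least kap^(p-1) times its volume, and integrating
    Young's inequality gives the energy. *)
Lemma flux_energy (a b kap : R) : 0 < a -> a < b -> b <= rho -> 0 <= kap ->
  kap `^ (p - 1) * (n%:R * unit_ball_volume R n * b ^+ n) <= M a * a ->
  ((unit_ball_volume R n * (b ^+ n - a ^+ n) * kap `^ p)%:E <=
   \int[mu]_(x in shell a b) (enorm (g x) `^ p)%:E)%E.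
Proof.
move=> a0 ab brho k0 hk.
have b0 : 0 < b by exact: lt_trans ab.
have SB : shell a b `<=` B by exact: shell_sub.
have mS := measurable_shell a b.
have om0 := unit_ball_volume_gt0 R n.
set om := unit_ball_volume R n in hk om0 *.
have mgS r : measurable_fun (shell a b) (fun x => enorm (g x) `^ r).
  exact: (measurable_funS mB SB (measurable_gpow r)).
have gr0 r x : 0 <= enorm (g x) `^ r by exact: powR_ge0.
set J := (\int[mu]_(x in shell a b) (enorm (g x) `^ p)%:E)%E.
have J0 : (0 <= J)%E by apply: int_ge0.
have [Joo|] := eqVneq J +oo%E; first by rewrite Joo leey.
rewrite -ltey => Jfin; have JE : J = (fine J)%:E by rewrite fineK// ge0_fin_numE.
have := flux (ltW a0) ab brho.
set I := (\int[mu]_(x in shell a b) _)%E => hI.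
have I0 : (0 <= I)%E by apply: int_ge0.
have Ifin : (I < +oo)%E.
  by apply: le_lt_trans int_gpow_lty; exact: (int_subset mu mS mB SB (measurable_gpow _) (gr0 _)).
have IE : I = (fine I)%:E by rewrite fineK// ge0_fin_numE.
rewrite IE -EFinM lee_fin in hI.
rewrite JE lee_fin.
have vS : mu (shell a b) = (om * (b ^+ n - a ^+ n))%:E.
  rewrite /shell measureD; [|exact: measurable_eball|exact: measurable_eball|exact: lebesgue_eball_lty].
  rewrite setIidr; last by move=> x xa; exact: lt_trans xa ab.
  rewrite mulrBr EFinB; congr (_ - _)%E; exact: lebesgue_eball.
set V := om * _ in vS *.
have V0 : 0 <= V by rewrite /V mulr_ge0 ?(ltW om0)// subr_ge0 lerXn2r ?nnegrE ?(ltW a0) ?(ltW b0) ?(ltW ab).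
have p0 : 0 < p by exact: lt_trans p1.
have YI : p * (fine I * kap) <= (p - 1) * fine J + kap `^ p * V.
  have c1 : 0 <= p * kap by rewrite mulr_ge0// ltW.
  have c2 : 0 <= p - 1 by rewrite subr_ge0 ltW.
  have mcst (r : R) : measurable_fun (shell a b) (fun=> r) by exact: measurable_cst.
  have mp1 := measurable_funM (mcst (p - 1)) (mgS p).
  have e1 := intZD mu mS (mgS (p - 1)) (gr0 (p - 1)) c1.
  have e2 := intZD mu mS (mgS p) (gr0 p) c2.
  have e3 := intDD mu mS mp1 (mcst (kap `^ p)) (fun x => mulr_ge0 c2 (gr0 p x)) (fun=> powR_ge0 kap p).
  have le := int_leD mu mS (measurable_funM (mcst (p * kap)) (mgS (p - 1)))
    (measurable_funD mp1 (mcst (kap `^ p))).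
  rewrite -lee_fin EFinD.
  have -> : (p * (fine I * kap))%:E = (\int[mu]_(x in shell a b) (p * kap * enorm (g x) `^ (p - 1))%:E)%E.
    by rewrite e1 -/I IE -EFinM; congr EFin; ring.
  have -> : (((p - 1) * fine J)%:E + (kap `^ p * V)%:E = \int[mu]_(x in shell a b) ((p - 1) * enorm (g x) `^ p + kap `^ p)%:E)%E.
    rewrite e3 e2 -/J JE; congr (_ + _)%E; rewrite integral_cst; last exact: mS.
    by rewrite EFinM -vS.
  apply: le => [x|x _ /=]; first by rewrite mulr_ge0.
  have := young_powR (enorm_ge0 (g x)) k0; rewrite mulrA; lra.
have n1 : 1 <= n%:R :> R by rewrite ler1n.
have M0 : 0 <= M a by apply: fine_ge0; exact: int_ge0.
(* The volume of the shell is at most om n b^(n-1) (b - a), and 2a <= a + b is what remains after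
   dividing b^2 - a^2 by b - a. *)
have kV : kap `^ (p - 1) * V <= fine I.
  have b2 : 0 < 2 * b by rewrite mulr_gt0.
  rewrite -(ler_pM2l b2); apply: le_trans hI.
  have Vle : V <= om * (n%:R * b ^+ n.-1 * (b - a)).
    by rewrite ler_pM2l// pow_diff_le// ltW.
  apply: (@le_trans _ _ (2 * b * (kap `^ (p - 1) * (om * (n%:R * b ^+ n.-1 * (b - a)))))).
    by rewrite ler_pM2l// ler_wpM2l ?powR_ge0.
  have bn : b ^+ n = b * b ^+ n.-1 by rewrite -exprS prednK.
  rewrite [leLHS](_ : _ = 2 * (b - a) * (kap `^ (p - 1) * (n%:R * om * b ^+ n))); last by rewrite bn; ring.
  apply: (@le_trans _ _ (2 * (b - a) * (M a * a))).
    by rewrite ler_wpM2l// mulr_ge0// subr_ge0 ltW.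
  rewrite [leLHS](_ : _ = (b - a) * M a * (a + a)); last by ring.
  rewrite [leRHS](_ : _ = (b - a) * M a * (b + a)); last by ring.
  by rewrite ler_wpM2l ?lerD2r ?(ltW ab)// mulr_ge0// subr_ge0 ltW.
have kp : kap `^ p = kap * kap `^ (p - 1) by rewrite mulr_powRB1.
have h1 : kap `^ p * V <= fine I * kap.
  by rewrite kp -mulrA mulrC ler_wpM2r.
have p10 : 0 < p - 1 by rewrite subr_gt0.
rewrite mulrC -(ler_pM2l p10).
have := ler_wpM2l (ltW p0) h1; move: h1 => _; lra.
Qed.

End flux.
End radial.

(** * Rearrangements *)

Section squeeze.
Context d (T : measurableType d) (R : realType) (mu : {measure set T -> \bar R}).
Local Open Scope ereal_scope.

Lemma ae_eq_of_integral_le (D : set T) (f g : T -> \bar R) : measurable D ->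
  measurable_fun D f -> measurable_fun D g ->
  (forall x, 0 <= f x) -> (forall x, D x -> f x <= g x) ->
  \int[mu]_(x in D) g x <= \int[mu]_(x in D) f x -> \int[mu]_(x in D) g x < +oo ->
  {ae mu, forall x, D x -> f x = g x}.
Proof.
move=> mD mf mg f0 fg gf gfin.
have g0 x : D x -> 0 <= g x by move=> Dx; exact: le_trans (fg x Dx).
have ig : mu.-integrable D g.
  apply/integrableP; split=> //; rewrite (eq_integral g)// => x /set_mem Dx.
  by rewrite gee0_abs// g0.
have if_ : mu.-integrable D f.
  apply: le_integrable ig => // x Dx.
  by rewrite !gee0_abs// ?fg// g0.
have gf0 : \int[mu]_(x in D) `|(g \- f) x| = 0.
  rewrite (ae_eq_integral (g \- f))//; first last.
  - have := integrable_ae mD if_; apply: filterS => x fx Dx.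
    by rewrite gee0_abs//= sube_ge0 ?fx// fg.
  - exact: emeasurable_funB.
  - by apply: measurableT_comp => //; exact: emeasurable_funB.
  rewrite integralB//; apply/eqP; rewrite eq_le; apply/andP; split.
    by rewrite leeBlDr ?add0e//; exact: integrable_fin_num.
  rewrite sube_ge0; first exact: ge0_le_integral.
  by apply/orP; left; exact: integrable_fin_num.
have mgf : measurable_fun D (g \- f) by exact: emeasurable_funB.
move/(ae_eq_integral_abs _ mD mgf): gf0 => h.
have := integrable_ae mD if_.
move: h; apply: filterS2 => x h1 h2 Dx.
have e := h1 Dx; rewrite -[RHS](@subeK _ _ (f x)); last exact: h2.
by rewrite (_ : g x - f x = 0) ?add0e//; exact: e.
Qed.

End squeeze.

Section rearrangement.
Context (R : realType) (n : nat).
Hypothesis n0 : (0 < n)%N.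
Local Notation V := 'rV[R]_n.
Local Notation mu := (@lebesgue R n).
Local Notation om := (unit_ball_volume R n).
Local Notation leb := (@lebesgue_measure R).

Definition dist (U : V -> R) (t : R) : \bar R := mu [set x | t < U x].

(* The decreasing rearrangement of U >= 0, as a function of the radius. *)
Definition prof (U : V -> R) (r : R) : R :=
  fine (leb [set t : R | 0 <= t /\ ((om * r ^+ n)%:E < dist U t)%E]).

Lemma schwarzE (D : set V) (h : V -> R) (x : V) :
  schwarz D h x = prof ((fun x => `|h x|) \_ D) (enorm x).
Proof.
rewrite /schwarz /prof /decreasing_rearrangement; congr (fine (leb _)).
apply/funext => t; apply/propext; split => -[t0 ht]; split => //.
  apply: lt_le_trans ht _; apply: le_lebesgue_outer => y [Dy /= ty].
  by rewrite patchE mem_set.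
apply: lt_le_trans ht _; apply: le_lebesgue_outer => y /=; rewrite patchE.
case: ifPn => [/set_mem Dy ty|_]; first by split.
by rewrite ltNge t0.
Qed.

Lemma lebesgue_point (x : V) : mu [set x] = 0%E.
Proof.
rewrite (_ : [set x] = box (Some (x, x))); last first.
  apply/seteqP; split => [y -> i /=|y h /=]; first by rewrite !lexx.
  by apply/rowP => i; apply/le_anti; rewrite andbC h.
rewrite lebesgue_box// /bvol; congr EFin; apply/eqP; rewrite prodf_seq_eq0.
apply/hasP; exists (Ordinal n0); first exact: mem_index_enum.
by rewrite /= subrr maxxx.
Qed.

Section prof.
Variables (D : set V) (U : V -> R).
Hypotheses (mD : measurable D) (Dfin : (mu D < +oo)%E).
Hypotheses (mU : measurable_fun setT U) (U0 : forall x, 0 <= U x).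
Hypothesis UD : forall x, ~ D x -> U x = 0.

Lemma measurable_gt t : measurable [set x | t < U x].
Proof.
rewrite (_ : mkset _ = U @^-1` `]t, +oo[); last first.
  by apply/seteqP; split => x /=; rewrite in_itv/= andbT.
by rewrite -[X in measurable X]setTI; apply: mU.
Qed.

Lemma dist_noninc s t : s <= t -> (dist U t <= dist U s)%E.
Proof. by move=> st; apply: le_lebesgue_outer => x /=; exact: le_lt_trans. Qed.

Lemma gt_subD t x : 0 <= t -> t < U x -> D x.
Proof. by move=> t0 tU; apply: contrapT => /UD h; move: tU; rewrite h ltNge t0. Qed.

Lemma dist_leD t : 0 <= t -> (dist U t <= mu D)%E.
Proof. by move=> t0; apply: le_lebesgue_outer => x /(gt_subD t0). Qed.

Lemma dist_lty t : 0 <= t -> (dist U t < +oo)%E.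
Proof. by move=> t0; exact: le_lt_trans (dist_leD t0) Dfin. Qed.

Lemma dist_rcont (t : R) (m : \bar R) : (m < dist U t)%E ->
  exists2 t', t < t' & (m < dist U t')%E.
Proof.
move=> mt; apply: contrapT => nex.
pose E k := [set x | t + k.+1%:R^-1 < U x].
have EU : [set x | t < U x] = \bigcup_k E k.
  apply/seteqP; split => [x /= tx|x [k _]]; last first.
    by apply: lt_trans; rewrite ltrDl invr_gt0.
  have := ltr_add_invr (tx : t < U x) => -[k hk].
  by exists k.
have ndE : nondecreasing_seq E.
  move=> i j ij; apply/subsetPset => x; apply: le_lt_trans.
  by rewrite lerD2l lef_pV2 ?posrE// ler_nat.
have mE k : measurable (E k) by exact: measurable_gt.
have mUE : measurable (\bigcup_k E k) by exact: bigcup_measurable.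
have cv : (fun k => mu (E k)) @ \oo --> mu (\bigcup_k E k).
  exact: (nondecreasing_cvg_mu mE mUE ndE).
move: mt; rewrite /dist EU ltNge => /negP; apply.
apply: (cvge_le _ cv); apply: nearW => k /=; rewrite leNgt; apply/negP => h.
by apply: nex; exists (t + k.+1%:R^-1); rewrite ?ltrDl ?invr_gt0.
Qed.

Lemma dist_vanish (e : R) : 0 < e -> exists2 t, 0 < t & (dist U t < e%:E)%E.
Proof.
move=> e0; pose E (k : nat) := [set x | k.+1%:R < U x].
have mE k : measurable (E k) by exact: measurable_gt.
have E0 : \bigcap_k E k = set0.
  apply/seteqP; split => // x h; have := h (Num.truncn (U x)) I.
  by rewrite /E /= ltNge ltW// truncnS_gt.
have niE : nonincreasing_seq E.
  move=> i j ij; apply/subsetPset => x; apply: le_lt_trans.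
  by rewrite ler_nat.
have mIE : measurable (\bigcap_k E k) by exact: bigcap_measurable.
have E0fin : (mu (E 0%N) < +oo)%E by exact: dist_lty.
have cv := nonincreasing_cvg_mu E0fin mE mIE niE.
rewrite E0 measure0 in cv.
have [k hk] : exists k, (mu (E k) < e%:E)%E.
  apply: contrapT => nex; have : (e%:E <= 0)%E; last by rewrite lee_fin leNgt e0.
  apply: (cvge_ge _ cv); apply: nearW => k /=; rewrite leNgt; apply/negP => h.
  by apply: nex; exists k.
by exists k.+1%:R.
Qed.

Lemma prof_ge0 r : 0 <= prof U r.
Proof. by apply: fine_ge0; exact: measure_ge0. Qed.

Lemma prof_set_itv r : is_interval [set t : R | 0 <= t /\ ((om * r ^+ n)%:E < dist U t)%E].
Proof.
move=> x y [x0 hx] [y0 hy] t /andP[xt ty]; split; first exact: le_trans xt.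
exact: lt_le_trans hy (dist_noninc ty).
Qed.

(** Galois connection between the profile and the distribution function. The levels counted by
    [prof] form an interval starting at 0, bounded since [dist U] vanishes at infinity, and open on
    the right since [dist U] is right-continuous. *)
Lemma profP r t : 0 < r -> 0 <= t -> (t < prof U r) = ((om * r ^+ n)%:E < dist U t)%E.
Proof.
move=> r0 t0; pose E := [set t : R | 0 <= t /\ ((om * r ^+ n)%:E < dist U t)%E].
have pE : prof U r = fine (leb E) by [].
rewrite pE.
have mE : measurable E.
  by apply: is_interval_measurable; exact: prof_set_itv.
have orn : 0 < om * r ^+ n by rewrite mulr_gt0 ?exprn_gt0// unit_ball_volume_gt0.
have [s s0 hs] := dist_vanish orn.
have sub u : 0 <= u -> ~ ((om * r ^+ n)%:E < dist U u)%E ->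
    (leb E <= u%:E)%E.
  move=> u0 hu; rewrite -(lebesgue_itv0 u0); apply: le_measure; rewrite ?inE//.
  move=> v [v0 hv]; rewrite /= in_itv/= v0 ltNge; apply/negP => uv; apply: hu.
  exact: lt_le_trans hv (dist_noninc uv).
have fin : leb E \is a fin_num.
  rewrite ge0_fin_numE//; apply: (le_lt_trans (sub _ (ltW s0) _) (ltry _)).
  by move=> h; have := lt_trans h hs; rewrite ltxx.
apply/idP/idP => [tp|h].
  apply: contraT => /negP nh; exfalso; move: tp; rewrite ltNge => /negP; apply.
  by rewrite -lee_fin fineK//; exact: sub.
have [t' tt' ht'] := dist_rcont h.
apply: (lt_le_trans tt'); rewrite -lee_fin fineK//.
have t'0 : 0 <= t' by exact: le_trans t0 (ltW tt').
rewrite -(lebesgue_itv0 t'0); apply: le_measure; rewrite ?inE//.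
move=> v; rewrite /= in_itv/= => /andP[v0 vt']; split => //.
exact: lt_le_trans ht' (dist_noninc (ltW vt')).
Qed.

Lemma dist_prof r : 0 < r -> (dist U (prof U r) <= (om * r ^+ n)%:E)%E.
Proof. by move=> r0; rewrite leNgt -profP ?prof_ge0// ltxx. Qed.

Lemma prof_dist r t : 0 < r -> 0 < prof U r -> t < prof U r ->
  ((om * r ^+ n)%:E <= dist U t)%E.
Proof.
move=> r0 p0 tp; have [t0|t0] := leP 0 t; first by rewrite ltW// -profP.
by apply: le_trans (dist_noninc (ltW t0)); rewrite ltW// -profP.
Qed.

Lemma prof_noninc r r' : 0 < r -> r <= r' -> prof U r' <= prof U r.
Proof.
move=> r0 rr'; rewrite leNgt; apply/negP; rewrite profP ?prof_ge0 ?(lt_le_trans r0)// => h.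
suff : prof U r < prof U r by rewrite ltxx.
rewrite {2}[prof U r]/prof -/(prof U r) profP ?prof_ge0//; apply: le_lt_trans h.
by rewrite lee_fin ler_pM2l ?unit_ball_volume_gt0// lerXn2r ?nnegrE ?(ltW r0) ?(le_trans (ltW r0)).
Qed.

Lemma prof_eq0 r : 0 < r -> (mu D <= (om * r ^+ n)%:E)%E -> prof U r = 0.
Proof.
move=> r0 Dr; apply/eqP; rewrite eq_le prof_ge0 andbT leNgt profP//.
by rewrite -leNgt; apply: le_trans Dr; exact: dist_leD.
Qed.

(** Radius of the ball with the measure of {t < U}; by [prof_rad] it is the generalized inverse of
    the profile. *)
Definition rad (t : R) : R := nroot n (fine (dist U t) / om).

Lemma rad_ge0 t : 0 <= rad t. Proof. exact: nroot_ge0. Qed.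

Lemma radE t : 0 <= t -> dist U t = (om * rad t ^+ n)%:E.
Proof.
move=> t0; have om0 := unit_ball_volume_gt0 R n.
rewrite /rad nrootK//; last by rewrite divr_ge0 ?(ltW om0)// fine_ge0// measure_ge0.
by rewrite mulrC divfK ?gt_eqF// fineK// ge0_fin_numE ?dist_lty// measure_ge0.
Qed.

Lemma prof_rad t r : 0 <= t -> 0 < r -> (t < prof U r) = (r < rad t).
Proof.
move=> t0 r0; rewrite profP// radE// lte_fin ltr_pM2l ?unit_ball_volume_gt0//.
by rewrite ltr_pXn2r// nnegrE ?rad_ge0// ltW.
Qed.

Lemma rad_le t rho : 0 <= t -> 0 <= rho -> (mu D <= (om * rho ^+ n)%:E)%E -> rad t <= rho.
Proof.
move=> t0 rho0 Dr; have := le_trans (dist_leD t0) Dr.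
rewrite radE// lee_fin ler_pM2l ?unit_ball_volume_gt0//.
by rewrite ler_pXn2r// nnegrE ?rad_ge0.
Qed.

Lemma measurable_prof : measurable_fun setT (fun x : V => prof U (enorm x)).
Proof.
apply: (measurability _ (RGenOInfty.measurableE R)) => // _ [_ [y ->] <-].
rewrite setTI; have [y0|y0] := ltP y 0.
  rewrite (_ : _ @^-1` _ = setT); first exact: measurableT.
  by apply/seteqP; split => x //= _; rewrite in_itv/= andbT (lt_le_trans y0)// prof_ge0.
have null : mu [set 0 : V] = 0%E by exact: lebesgue_point.
(* The origin is set apart: [prof_rad] says nothing there, and [fine] turns a possibly infinite
   value into 0. *)
rewrite (_ : _ @^-1` _ = (eball 0 (rad y) `\` [set 0]) `|`
    ([set 0] `&` [set x : V | y < prof U (enorm x)])).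
  apply: measurableU.
    apply: measurableD; first exact: measurable_eball.
    exact: measurable_null.
  apply: measurable_null; apply/eqP; rewrite eq_le lebesgue_outer_ge0 andbT -null.
  by apply: le_lebesgue_outer => x [].
apply/seteqP; split => x /=; rewrite in_itv/= andbT.
  move=> yx; have [x0|x0] := pselect (x = 0); [by right|left; split => //].
  rewrite /eball /= subr0 -prof_rad// lt_neqAle enorm_ge0 andbT eq_sym.
  by apply/eqP => /enorm0_eq0.
case=> [[]|[]//]; rewrite /eball /= subr0 => xr x0; rewrite prof_rad//.
by rewrite lt_neqAle enorm_ge0 andbT eq_sym; apply/eqP => /enorm0_eq0.
Qed.

End prof.

Lemma le_mu_null (A B N : set V) : mu N = 0%E -> A `<=` B `|` N -> (mu A <= mu B)%E.
Proof.
move=> N0 AB; apply: (@le_trans _ _ (mu (B `|` N))); first exact: le_lebesgue_outer.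
apply: le_trans (outer_measureU2 (@lebesgue_outer R n) B N) _.
by rewrite [X in (_ + X)%E]N0 adde0.
Qed.

Lemma lebesgue_eball_ge0 (r : R) : 0 <= r -> mu (eball (0 : V) r) = (om * r ^+ n)%:E.
Proof.
rewrite le_eqVlt => /predU1P[<-|]; last exact: lebesgue_eball.
rewrite (_ : eball _ _ = set0) ?measure0 ?expr0n ?gtn_eqF ?mulr0//.
by apply/seteqP; split => // x; rewrite /eball /= ltNge enorm_ge0.
Qed.

Lemma gt_enorm (x : V) : x != 0 -> 0 < enorm x.
Proof.
by move=> x0; rewrite lt_neqAle enorm_ge0 andbT eq_sym; apply: contra_neqN x0 => /eqP/enorm0_eq0.
Qed.

(** * The Hardy-Littlewood inequality and its equality case *)

Section hardy_littlewood.
Variables (D : set V) (rho : R).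
Hypotheses (mD : measurable D) (rho0 : 0 <= rho) (Drho : mu D = (om * rho ^+ n)%:E).
Local Notation B := (eball (0 : V) rho).

Definition profile_ok (U : V -> R) := [/\ measurable_fun setT U, forall x, 0 <= U x &
  forall x, ~ D x -> U x = 0].

Let Dfin : (mu D < +oo)%E. Proof. by rewrite Drho ltry. Qed.

Let Dle : (mu D <= (om * rho ^+ n)%:E)%E. Proof. by rewrite Drho. Qed.

Let mB : measurable B. Proof. exact: measurable_eball. Qed.

Lemma superlevel_ball (U : V -> R) (r t : R) : profile_ok U -> 0 <= r -> 0 <= t ->
  mu (eball (0 : V) r `&` [set x | t < prof U (enorm x)]) =
  (om * Num.min r (rad U t) ^+ n)%:E.
Proof.
move=> [mU U0 UD] r0 t0.
have m0 : 0 <= Num.min r (rad U t) by rewrite le_min r0 rad_ge0.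
have null : mu [set 0 : V] = 0%E by exact: lebesgue_point.
rewrite -(lebesgue_eball_ge0 m0); apply/eqP; rewrite eq_le; apply/andP; split.
  apply: (le_mu_null null) => x []; rewrite /eball /= !subr0 => xr tx.
  have [->|x0] := eqVneq x 0; [by right|left].
  by rewrite lt_min xr/= -(prof_rad Dfin mU UD)// gt_enorm.
apply: (le_mu_null null) => x; rewrite /eball /= !subr0 lt_min => /andP[xr tx].
have [->|x0] := eqVneq x 0; [by right|left]; split; rewrite /= ?subr0//.
by rewrite (prof_rad Dfin mU UD)// gt_enorm.
Qed.

Lemma superlevel_dist (U : V -> R) (t : R) : profile_ok U -> 0 <= t ->
  mu (B `&` [set x | t < prof U (enorm x)]) = dist U t.
Proof.
move=> Uok t0; have [mU U0 UD] := Uok; rewrite superlevel_ball// min_r.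
  by rewrite -(radE Dfin UD).
exact: (rad_le Dfin UD t0 rho0 Dle).
Qed.

Lemma superlevel_inter (U1 U2 : V -> R) (t1 t2 : R) : profile_ok U1 -> profile_ok U2 ->
  0 <= t1 -> 0 <= t2 ->
  mu (B `&` [set x | t1 < prof U1 (enorm x)] `&` [set x | t2 < prof U2 (enorm x)]) =
  (om * Num.min (rad U1 t1) (rad U2 t2) ^+ n)%:E.
Proof.
move=> U1ok U2ok t10 t20; have [mU U0 UD] := U1ok.
rewrite -(superlevel_ball U2ok (rad_ge0 U1 t1) t20).
have null : mu [set 0 : V] = 0%E by exact: lebesgue_point.
have rl : rad U1 t1 <= rho by exact: (rad_le Dfin UD t10 rho0 Dle).
apply/eqP; rewrite eq_le; apply/andP; split; apply: (le_mu_null null) => x.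
  move=> [[xB x1] x2]; have [->|x0] := eqVneq x 0; [by right|left].
  by split => //; rewrite /eball /= subr0 -(prof_rad Dfin mU UD)// gt_enorm.
move=> [x1 x2]; have [->|x0] := eqVneq x 0; [by right|left]; split => //; split.
  exact: lt_le_trans x1 rl.
by move: x1; rewrite /eball /= subr0 (prof_rad Dfin mU UD)// gt_enorm.
Qed.

Lemma inter_le (U1 U2 : V -> R) (t1 t2 : R) : profile_ok U1 -> profile_ok U2 ->
  0 <= t1 -> 0 <= t2 ->
  (mu (D `&` [set x | (t1 < U1 x)%R] `&` [set x | (t2 < U2 x)%R]) <=
   (om * Num.min (rad U1 t1) (rad U2 t2) ^+ n)%:E)%E.
Proof.
move=> [mU U0 UD] [mU' U0' UD'] t10 t20; rewrite /Num.min; case: ifP => _.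
  rewrite -(radE Dfin UD)//; apply: le_lebesgue_outer => x [[_ //]].
by rewrite -(radE Dfin UD')//; apply: le_lebesgue_outer => x [].
Qed.

Lemma equimeasurable (U : V -> R) (q : R) : profile_ok U -> 0 < q ->
  (\int[mu]_(x in B) (prof U (enorm x) `^ q)%:E = \int[mu]_(x in D) (U x `^ q)%:E)%E.
Proof.
move=> Uok q0; have [mU U0 UD] := Uok.
have mP := measurable_prof Dfin mU UD.
rewrite (layer_cake _ mB (measurable_powRf q mP)); last by move=> x; exact: powR_ge0.
rewrite (layer_cake _ mD (measurable_powRf q mU)); last by move=> x; exact: powR_ge0.
apply: eq_integral => t; rewrite inE/= in_itv/= andbT => t0.
have tq0 : 0 <= t `^ q^-1 by exact: powR_ge0.
have pw (y : R) : 0 <= y -> (t < y `^ q) = (t `^ q^-1 < y).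
  move=> y0; rewrite -[in LHS](powRr1 t0) -(mulVf (lt0r_neq0 q0)) powRrM.
  apply/idP/idP => [|h]; last by rewrite gt0_ltr_powR ?nnegrE.
  rewrite !ltNge; apply: contra => h.
  by rewrite ge0_ler_powR ?nnegrE ?(ltW q0).
transitivity (dist U (t `^ q^-1)).
  rewrite -(superlevel_dist Uok tq0); congr (mu (_ `&` _)).
  by apply/funext => x /=; rewrite pw ?prof_ge0.
apply/eqP; rewrite eq_le; apply/andP; split; apply: le_lebesgue_outer => x.
  by move=> /= tx; split => /=; [exact: gt_subD UD _ _ tq0 tx|rewrite pw].
by move=> [_] /=; rewrite pw.
Qed.

Let inner (U1 U2 : V -> R) t := (\int[mu]_(x in D `&` [set x | (t < U1 x)%R]) (U2 x)%:E)%E.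
Let innerS (U1 U2 : V -> R) t :=
  (\int[mu]_(x in B `&` [set x | (t < prof U1 (enorm x))%R]) (prof U2 (enorm x))%:E)%E.

Let measurable_psup (U : V -> R) t : profile_ok U ->
  measurable (B `&` [set x | t < prof U (enorm x)]).
Proof.
move=> [mU U0 UD]; apply: measurableI; first exact: mB.
rewrite (_ : mkset _ = (fun x => prof U (enorm x)) @^-1` `]t, +oo[); last first.
  by apply/seteqP; split => x /=; rewrite in_itv/= andbT.
by rewrite -[X in measurable X]setTI; apply: (measurable_prof Dfin mU UD).
Qed.

Let measurable_sup (U : V -> R) t : profile_ok U -> measurable (D `&` [set x | t < U x]).
Proof. by move=> [mU _ _]; apply: measurableI mD _; exact: measurable_gt. Qed.

Let innerE U1 U2 t : profile_ok U1 -> profile_ok U2 -> inner U1 U2 t =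
  (\int[leb]_(s in `[0%R, +oo[) mu (D `&` [set x | (t < U1 x)%R] `&` [set x | (s < U2 x)%R]))%E.
Proof.
move=> U1ok [mU2 U20 _]; exact: (layer_cake _ (measurable_sup t U1ok) mU2 U20).
Qed.

Let innerSE U1 U2 t : profile_ok U1 -> profile_ok U2 -> 0 <= t -> innerS U1 U2 t =
  (\int[leb]_(s in `[0%R, +oo[) (om * Num.min (rad U1 t) (rad U2 s) ^+ n)%:E)%E.
Proof.
move=> U1ok U2ok t0; have [mU2 U20 UD2] := U2ok.
rewrite /innerS (layer_cake _ (measurable_psup t U1ok) (measurable_prof Dfin mU2 UD2)); last first.
  by move=> x; exact: prof_ge0.
apply: eq_integral => s; rewrite inE/= in_itv/= andbT => s0.
exact: superlevel_inter.
Qed.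

Let mlev (A : set V) (U : V -> R) (I : set R) : measurable I -> measurable_fun I (fun s => mu (A `&` [set x | (s < U x)%R])).
Proof.
move=> mI; apply: measurable_funTS; apply: nonincreasing_emeasurable => x y xy.
by apply: le_lebesgue_outer => z [Az /= yz]; split => //=; exact: le_lt_trans yz.
Qed.

Let mI : measurable (`[0%R, +oo[%classic : set R). Proof. exact: measurable_itv. Qed.

Let mmin U1 U2 t : profile_ok U1 -> profile_ok U2 -> 0 <= t ->
  measurable_fun (`[0%R, +oo[%classic : set R)
    (fun s => (om * Num.min (rad U1 t) (rad U2 s) ^+ n)%:E).
Proof.
move=> U1ok U2ok t0.
have := mlev (B `&` [set x | t < prof U1 (enorm x)]) (fun x => prof U2 (enorm x)) mI.
apply: eq_measurable_fun => s; rewrite inE/= in_itv/= andbT => s0.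
by rewrite superlevel_inter.
Qed.

Let inner_le U1 U2 t : profile_ok U1 -> profile_ok U2 -> 0 <= t ->
  (inner U1 U2 t <= innerS U1 U2 t)%E.
Proof.
move=> U1ok U2ok t0; rewrite innerE// innerSE//.
apply: ge0_le_integral => //.
- exact: mlev.
- exact: mmin.
- by move=> s; rewrite /= in_itv/= andbT => s0; exact: inter_le.
Qed.

Let minner U1 U2 : profile_ok U1 -> profile_ok U2 -> measurable_fun (`[0%R, +oo[%classic : set R) (inner U1 U2).
Proof.
move=> U1ok [mU U0 UD]; apply: measurable_funTS; apply: nonincreasing_emeasurable => x y xy.
apply: int_subset => //.
- exact: measurable_sup.
- exact: measurable_sup.
- by move=> z [Dz /= yz]; split => //=; exact: le_lt_trans yz.
- exact: measurable_funTS.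
Qed.

Let minnerS U1 U2 : profile_ok U1 -> profile_ok U2 -> measurable_fun (`[0%R, +oo[%classic : set R) (innerS U1 U2).
Proof.
move=> U1ok [mU U0 UD]; apply: measurable_funTS; apply: nonincreasing_emeasurable => x y xy.
apply: int_subset.
- exact: measurable_psup.
- exact: measurable_psup.
- by move=> z [Dz /= yz]; split => //=; exact: le_lt_trans yz.
- by apply: measurable_funTS; exact: (measurable_prof Dfin mU UD).
- by move=> z; exact: prof_ge0.
Qed.

Let prodE U1 U2 : profile_ok U1 -> profile_ok U2 ->
  (\int[mu]_(x in D) (U1 x * U2 x)%:E = \int[leb]_(t in `[0%R, +oo[) inner U1 U2 t)%E.
Proof. by move=> [mU1 U10 _] [mU2 U20 _]; exact: (layer_cake_weighted _ mD). Qed.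

Let prodSE U1 U2 : profile_ok U1 -> profile_ok U2 ->
  (\int[mu]_(x in B) (prof U1 (enorm x) * prof U2 (enorm x))%:E =
   \int[leb]_(t in `[0%R, +oo[) innerS U1 U2 t)%E.
Proof.
move=> [mU1 U10 UD1] [mU2 U20 UD2]; apply: (layer_cake_weighted _ mB).
- exact: (measurable_prof Dfin mU1 UD1).
- exact: (measurable_prof Dfin mU2 UD2).
- by move=> x; exact: prof_ge0.
- by move=> x; exact: prof_ge0.
Qed.

(** Layer cake formula in both factors: two superlevel sets meet in at most the smaller of their
    measures, and for concentric balls this bound is attained. *)
Lemma hardy_littlewood U1 U2 : profile_ok U1 -> profile_ok U2 ->
  (\int[mu]_(x in D) (U1 x * U2 x)%:E <=
   \int[mu]_(x in B) (prof U1 (enorm x) * prof U2 (enorm x))%:E)%E.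
Proof.
move=> U1ok U2ok; rewrite prodE// prodSE//; apply: ge0_le_integral => //.
- by move=> t _; apply: integral_ge0 => x _; rewrite lee_fin; case: U2ok.
- exact: minner.
- exact: minnerS.
- by move=> t; rewrite /= in_itv/= andbT => t0; exact: inner_le.
Qed.

(** Equal integrals with ordered integrands force equality almost everywhere, first in the level t,
    then in the level s. Finiteness of the last integral is what allows the second step at each
    t. *)
Lemma hardy_littlewood_eq U1 U2 : profile_ok U1 -> profile_ok U2 ->
  (\int[mu]_(x in B) (prof U1 (enorm x) * prof U2 (enorm x))%:E <=
   \int[mu]_(x in D) (U1 x * U2 x)%:E)%E ->
  (\int[mu]_(x in B) (prof U1 (enorm x) * prof U2 (enorm x))%:E < +oo)%E ->
  (\int[mu]_(x in B) (prof U2 (enorm x))%:E < +oo)%E ->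
  {ae leb, forall t, 0 <= t -> {ae leb, forall s, 0 <= s ->
    mu (D `&` [set x | t < U1 x] `&` [set x | s < U2 x]) =
    (om * Num.min (rad U1 t) (rad U2 s) ^+ n)%:E}}.
Proof.
move=> U1ok U2ok; rewrite prodE// prodSE// => h fin fin2.
have [mU2 U20 UD2] := U2ok.
have i0 t : (0 <= inner U1 U2 t)%E by apply: integral_ge0 => x _; rewrite lee_fin.
have ile t : `[0, +oo[%classic t -> (inner U1 U2 t <= innerS U1 U2 t)%E.
  by rewrite /= in_itv/= andbT => t0; exact: inner_le.
have := @ae_eq_of_integral_le _ _ _ leb _ _ _ mI (minner U1ok U2ok) (minnerS U1ok U2ok) i0 ile h fin.
apply: filterS => t; rewrite /= in_itv/= andbT => ht t0; move/(_ t0): ht.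
have innerfin : (innerS U1 U2 t < +oo)%E.
  apply: le_lt_trans fin2; apply: int_subset.
  - exact: measurable_psup.
  - exact: mB.
  - by move=> x [].
  - by apply: measurable_funTS; exact: (measurable_prof Dfin mU2 UD2).
  - by move=> x; exact: prof_ge0.
rewrite innerE// innerSE// in innerfin * => e.
have ile' s : `[0, +oo[%classic s ->
    (mu (D `&` [set x | (t < U1 x)%R] `&` [set x | (s < U2 x)%R]) <=
     (om * Num.min (rad U1 t) (rad U2 s) ^+ n)%:E)%E.
  by rewrite /= in_itv/= andbT => s0; exact: inter_le.
have h' : (\int[leb]_(s in `[0%R, +oo[) (om * Num.min (rad U1 t) (rad U2 s) ^+ n)%:E <=
    \int[leb]_(s in `[0%R, +oo[) mu (D `&` [set x | (t < U1 x)%R] `&` [set x | (s < U2 x)%R]))%E.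
  by rewrite e.
have := @ae_eq_of_integral_le _ _ _ leb _ _ _ mI (mlev (D `&` [set x | t < U1 x]) U2 mI)
  (mmin U1ok U2ok t0) (fun=> measure_ge0 _ _) ile' h' innerfin.
by apply: filterS => s; rewrite /= in_itv/= andbT => hs s0; exact: hs.
Qed.

End hardy_littlewood.
End rearrangement.

(** * The energy deficit *)

Section real_integrals.
Context d (T : measurableType d) (R : realType) (m : {measure set T -> \bar R}).
Implicit Types (A B : set T) (f g : T -> R).

Lemma integrable_sub A B f : measurable A -> measurable B -> A `<=` B ->
  m.-integrable B (EFin \o f) -> m.-integrable A (EFin \o f).
Proof. by move=> mA mB AB; exact: integrableS. Qed.

Lemma fineRint A f : measurable A -> m.-integrable A (EFin \o f) ->
  (\int[m]_(x in A) (f x)%:E = (\int[m]_(x in A) f x)%:E)%E.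
Proof. by move=> mA iA; rewrite /Rintegral fineK//; exact: integrable_fin_num. Qed.

Lemma Rint_subset A B f : measurable A -> measurable B -> A `<=` B ->
  m.-integrable B (EFin \o f) -> (forall x, 0 <= f x) ->
  \int[m]_(x in A) f x <= \int[m]_(x in B) f x.
Proof.
move=> mA mB AB iB f0; rewrite -lee_fin -!fineRint//; last exact: integrable_sub iB.
apply: int_subset => //; apply/measurable_EFinP.
by case/integrableP: iB.
Qed.

Lemma Rint_sum_le (A : nat -> set T) B f k : (forall i, measurable (A i)) -> measurable B ->
  (forall i, (i < k)%N -> A i `<=` B) ->
  (forall i j, (i < j)%N -> (j < k)%N -> forall x, A i x -> ~ A j x) ->
  m.-integrable B (EFin \o f) -> (forall x, 0 <= f x) ->
  \sum_(i < k) \int[m]_(x in A i) f x <= \int[m]_(x in B) f x.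
Proof.
move=> mA; elim: k B => [|k ih] B mB AB dA iB f0.
  by rewrite big_ord0; apply: Rintegral_ge0 => x _; exact: f0.
rewrite big_ord_recr /=.
have BE : B = (B `\` A k) `|` A k by rewrite setUC setDUK//; exact: AB.
have mD : measurable (B `\` A k) by exact: measurableD.
rewrite [in leRHS]BE Rintegral_setU//; last 2 first.
- by rewrite -BE.
- by apply/disj_setPS => x [[_ h1] h2].
rewrite lerD2r; apply: ih => //.
- move=> i ik x Aix; split; first exact: AB (ltnW ik) _ Aix.
  exact: dA ik _ _ Aix.
- by move=> i j ij jk; exact: dA ij (ltnW jk).
- exact: integrable_sub iB.
Qed.

Lemma integrable_cst_fin A (c : R) : measurable A -> (m A < +oo)%E ->
  m.-integrable A (EFin \o cst c).
Proof.
move=> mA Afin; apply/integrableP; split; first exact/measurable_EFinP/measurable_cst.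
rewrite -[X in (X < _)%E]/(\int[m]_(x in A) cst `|c|%:E x)%E integral_cst//.
exact: lte_mul_pinfty.
Qed.

Lemma Rint_cover_le (A : nat -> set T) B N f k : (forall i, measurable (A i)) -> measurable B ->
  measurable N -> m N = 0%E -> B `<=` N `|` (\bigcup_(i in `I_k) A i) ->
  (forall i, (i < k)%N -> m.-integrable (A i) (EFin \o f)) ->
  m.-integrable B (EFin \o f) -> (forall x, 0 <= f x) ->
  \int[m]_(x in B) f x <= \sum_(i < k) \int[m]_(x in A i) f x.
Proof.
move=> mA + mN N0; elim: k B => [|k ih] B mB BA iA iB f0.
  rewrite big_ord0 /Rintegral (null_set_integral mB)//.
  - by case/integrableP: iB.
  - apply/eqP; rewrite eq_le measure_ge0 andbT -N0; apply: le_measure; rewrite ?inE//.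
    by apply: subset_trans BA _ => x [//|[i]].
rewrite big_ord_recr /=.
have mD : measurable (B `\` A k) by exact: measurableD.
have mI : measurable (B `&` A k) by exact: measurableI.
have BE : B = (B `\` A k) `|` (B `&` A k) by rewrite setUC setUIDK.
rewrite [in leLHS]BE Rintegral_setU//; last 2 first.
- by rewrite -BE.
- by apply/disj_setPS => x [[_ h1] [_ h2]].
apply: lerD; last by apply: Rint_subset => //; exact: iA.
apply: ih => //.
- move=> x [Bx nA]; have [|[i /= ik Aix]] := BA x Bx; [by left|right].
  exists i => //=; move: ik; rewrite ltnS leq_eqVlt => /predU1P[ik|//].
  by exfalso; apply: nA; rewrite -ik.
- by move=> i ik; apply: iA; exact: ltnW.
- exact: integrable_sub iB.
Qed.

End real_integrals.

(** * Bregman distance for the p-th power *)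

Section bregman.
Variables (R : realType) (p : R).
Hypothesis p1 : 1 < p.

(* The Bregman distance between g and k for the p-th power: nonnegative, by
   Young's inequality. *)
Definition breg (g k : R) : R := g `^ p - p * k `^ (p - 1) * g + (p - 1) * k `^ p.

Let p0 : 0 < p. Proof. exact: lt_trans p1. Qed.
Let q0 : 0 < p - 1. Proof. by rewrite subr_gt0. Qed.

Lemma breg_ge0 g k : 0 <= g -> 0 <= k -> 0 <= breg g k.
Proof. by move=> g0 k0; have := young_powR p1 k0 g0; rewrite /breg mulrA; lra. Qed.

(** Three-point identity of Bregman distances. Its last term has the sign of (h - k)(g - h), so it
    is nonnegative when h lies between g and k: the distance grows as k moves away from g. *)
Lemma bregE g h k : 0 <= h ->
  breg g k = breg g h + breg h k + p * ((h `^ (p - 1) - k `^ (p - 1)) * (g - h)).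
Proof.
move=> h0; have := mulr_powRB1 h0 p0; rewrite /breg.
by move: (_ `^ (p - 1)) (_ `^ p) (k `^ p) (k `^ (p - 1)) (g `^ p) => H1 H K K1 G <-; ring.
Qed.

Lemma powR1_le h k : 0 <= h -> h <= k -> h `^ (p - 1) <= k `^ (p - 1).
Proof. by move=> h0 hk; rewrite ge0_ler_powR ?nnegrE ?(ltW q0)// (le_trans h0). Qed.

Lemma breg_le_lo g h k : 0 <= g -> g <= h -> h <= k -> breg g h <= breg g k.
Proof.
move=> g0 gh hk; have h0 := le_trans g0 gh; rewrite (bregE g k h0).
have := breg_ge0 h0 (le_trans h0 hk).
suff : 0 <= p * ((h `^ (p - 1) - k `^ (p - 1)) * (g - h)) by lra.
by rewrite mulr_ge0 ?(ltW p0)// -mulrNN !opprB mulr_ge0// subr_ge0// powR1_le.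
Qed.

Lemma breg_le_hi g h k : 0 <= k -> h <= g -> k <= h -> breg g h <= breg g k.
Proof.
move=> k0 hg kh; have h0 := le_trans k0 kh; rewrite (bregE g k h0).
have := breg_ge0 h0 k0.
suff : 0 <= p * ((h `^ (p - 1) - k `^ (p - 1)) * (g - h)) by lra.
by rewrite mulr_ge0 ?(ltW p0)// mulr_ge0// subr_ge0// powR1_le.
Qed.

Lemma breg_id k : 0 <= k -> breg k k = 0.
Proof. by move=> k0; rewrite /breg -mulrA [_ * k]mulrC mulr_powRB1//; ring. Qed.

(** With the midpoint of g and k inserted in the three-point identity, the last term is positive
    unless g = k. *)
Lemma breg_eq0 g k : 0 <= g -> 0 <= k -> breg g k = 0 -> g = k.
Proof.
move=> g0 k0 bgk; pose h := (g + k) / 2.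
have h0 : 0 <= h by rewrite divr_ge0// addr_ge0.
move: bgk; rewrite (bregE g k h0).
have b1 := breg_ge0 g0 h0; have b2 := breg_ge0 h0 k0.
have pow x y : 0 <= x -> x < y -> x `^ (p - 1) < y `^ (p - 1).
  by move=> x0 xy; rewrite gt0_ltr_powR ?nnegrE// ltW// (le_lt_trans x0).
have [gk|kg|//] := ltgtP g k.
- have : 0 < p * ((h `^ (p - 1) - k `^ (p - 1)) * (g - h)).
    by rewrite mulr_gt0// -mulrNN !opprB mulr_gt0// subr_gt0 ?pow// /h; lra.
  lra.
- have : 0 < p * ((h `^ (p - 1) - k `^ (p - 1)) * (g - h)).
    by rewrite mulr_gt0// mulr_gt0// subr_gt0 ?pow// /h; lra.
  lra.
Qed.

Section integral.
Context d (T : measurableType d) (m : {measure set T -> \bar R}).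
Variables (A : set T) (g : T -> R) (k : R).
Hypotheses (mA : measurable A) (Afin : (m A < +oo)%E).
Hypotheses (ig : m.-integrable A (EFin \o g)).
Hypotheses (igp : m.-integrable A (EFin \o (fun x => g x `^ p))).

Let iB : m.-integrable A (EFin \o (fun x => g x `^ p - p * k `^ (p - 1) * g x)).
Proof. exact: (integrableB mA igp (integrableZl mA (p * k `^ (p - 1)) ig)). Qed.

Lemma integrable_breg : m.-integrable A (EFin \o (fun x => breg (g x) k)).
Proof. exact: (integrableD mA iB (integrable_cst_fin ((p - 1) * k `^ p) mA Afin)). Qed.

Lemma Rint_breg : \int[m]_(x in A) breg (g x) k = \int[m]_(x in A) (g x `^ p) -
  p * k `^ (p - 1) * \int[m]_(x in A) g x + (p - 1) * k `^ p * fine (m A).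
Proof.
rewrite /breg (RintegralD mA iB (integrable_cst_fin ((p - 1) * k `^ p) mA Afin)).
rewrite (RintegralB mA igp (integrableZl mA (p * k `^ (p - 1)) ig)).
by rewrite (RintegralZl _ mA ig) Rintegral_cst.
Qed.

End integral.

End bregman.

Lemma pow_diff_ge (R : realType) (a b : R) (m : nat) : 0 <= a -> a <= b ->
  m%:R * a ^+ m.-1 * (b - a) <= b ^+ m - a ^+ m.
Proof.
move=> a0 ab; have b0 := le_trans a0 ab.
rewrite subrXX mulrC ler_wpM2l ?subr_ge0//.
apply: (@le_trans _ _ (\sum_(i < m) a ^+ m.-1)); first by rewrite sumr_const card_ord mulr_natl.
apply: ler_sum => i _.
have -> : a ^+ m.-1 = a ^+ (m.-1 - i) * a ^+ i.
  by rewrite -exprD subnK// -ltnS (ltn_predK (ltn_ord i)).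
by rewrite ler_wpM2r ?exprn_ge0// lerXn2r ?nnegrE.
Qed.

Section deficit.
Context (R : realType) (n : nat).
Hypothesis n0 : (0 < n)%N.
Local Notation V := 'rV[R]_n.
Local Notation mu := (@lebesgue R n).
Local Notation om := (unit_ball_volume R n).

(** [W], [G] and [U] stand for |w|, |grad w| and |f| extended by zero, [E] for |grad z|^p and [e]
    for the integral of f^sharp z. The shell bound on [E] is provided by [flux_energy]. *)
Variables (D : set V) (rho p : R) (W G U E : V -> R) (e : R).
Local Notation B := (eball (0 : V) rho).
Local Notation Z := (prof W).
Local Notation Fs := (prof U).
Local Notation M a := (fine (\int[mu]_(x in eball (0 : V) a) (Fs (enorm x))%:E)).

Hypotheses (mD : measurable D) (rho0 : 0 < rho) (Drho : mu D = (om * rho ^+ n)%:E).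
Hypotheses (p1 : 1 < p) (WG : sobolev_limit D W G).
Hypotheses (okW : profile_ok D W) (okU : profile_ok D U) (Upos : dist U 0 = mu D).
Hypothesis GpE : (\int[mu]_x (G x `^ p)%:E <= e%:E)%E.
Hypothesis FZE : (\int[mu]_(x in B) (Fs (enorm x) * Z (enorm x))%:E = e%:E)%E.
Hypothesis Ffin : (\int[mu]_(x in B) (Fs (enorm x))%:E < +oo)%E.
Hypotheses (mE : measurable_fun B E) (E0 : forall x, 0 <= E x).
Hypothesis EE : (\int[mu]_(x in B) (E x)%:E <= e%:E)%E.
Hypothesis shellE : forall a b k, 0 < a -> a < b -> b <= rho -> 0 <= k ->
  k `^ (p - 1) * (n%:R * om * b ^+ n) <= M a * a ->
  ((om * (b ^+ n - a ^+ n) * k `^ p)%:E <= \int[mu]_(x in shell a b) (E x)%:E)%E.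

Let p0 : 0 < p. Proof. exact: lt_trans p1. Qed.
Let q0 : 0 < p - 1. Proof. by rewrite subr_gt0. Qed.
Let om0 : 0 < om. Proof. exact: unit_ball_volume_gt0. Qed.
Let n1 : 0 < n%:R :> R. Proof. by rewrite ltr0n. Qed.
Let Dfin : (mu D < +oo)%E. Proof. by rewrite Drho ltry. Qed.
Let Dle : (mu D <= (om * rho ^+ n)%:E)%E. Proof. by rewrite Drho. Qed.
Let mW : measurable_fun setT W. Proof. by case: okW. Qed.
Let W0 x : 0 <= W x. Proof. by case: okW. Qed.
Let WD x : ~ D x -> W x = 0. Proof. by case: okW => _ _; exact. Qed.
Let mU : measurable_fun setT U. Proof. by case: okU. Qed.
Let UD x : ~ D x -> U x = 0. Proof. by case: okU => _ _; exact. Qed.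
Let mG : measurable_fun setT G. Proof. by case: WG => _ _ [[]]. Qed.
Let G0 x : 0 <= G x. Proof. by case: WG => _ _ [[]]. Qed.
Let Gfin : (\int[mu]_x (G x)%:E < +oo)%E. Proof. by case: WG => _ _ []. Qed.
Let mB : measurable B. Proof. exact: measurable_eball. Qed.
Let mF : measurable_fun setT (fun x : V => Fs (enorm x)). Proof. exact: measurable_prof mU UD. Qed.
Let F0 (x : V) : 0 <= Fs (enorm x). Proof. exact: prof_ge0. Qed.
Let mball a : measurable (eball (0 : V) a). Proof. exact: measurable_eball. Qed.

Lemma Z_noninc a b : 0 < a -> a <= b -> Z b <= Z a.
Proof. by move=> a0 ab; exact: (prof_noninc Dfin mW WD). Qed.

Lemma Z_rho : Z rho = 0.
Proof. exact: (prof_eq0 Dfin mW WD). Qed.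

(** Positivity of f enters here: by [Upos], [U] is positive almost everywhere on [D], so its profile
    is positive up to radius rho. *)
Lemma F_gt0 a : 0 < a -> a < rho -> 0 < Fs a.
Proof.
move=> a0 ar; rewrite (profP Dfin mU UD)// Upos Drho lte_fin ltr_pM2l//.
by rewrite ltr_pXn2r ?nnegrE ?(ltW a0) ?(ltW rho0).
Qed.

Let Mfin a : a <= rho -> (\int[mu]_(x in eball (0%R : V) a) (Fs (enorm x))%:E = (M a)%:E)%E.
Proof.
move=> ar; rewrite fineK// ge0_fin_numE; last exact: int_ge0.
apply: le_lt_trans Ffin; apply: int_subset.
- exact: mball.
- exact: mB.
- by move=> x xa; exact: lt_le_trans xa ar.
- exact: measurable_funTS mF.
- exact: F0.
Qed.

Lemma M_ge0 a : 0 <= M a. Proof. by apply: fine_ge0; exact: int_ge0. Qed.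

Lemma M_mono a b : a <= b -> b <= rho -> M a <= M b.
Proof.
move=> ab br; rewrite -lee_fin -!Mfin//; last exact: le_trans br.
apply: int_subset.
- exact: mball.
- exact: mball.
- by move=> x xa; exact: lt_le_trans xa ab.
- exact: measurable_funTS mF.
- exact: F0.
Qed.

Lemma M_gt0 a : 0 < a -> a <= rho -> 0 < M a.
Proof.
move=> a0 ar; have a2 : 0 < a / 2 by rewrite divr_gt0.
have a2a : a / 2 <= a by lra.
have a2r : a / 2 < rho by lra.
apply: lt_le_trans (M_mono a2a ar).
apply: (@lt_le_trans _ _ (Fs (a / 2) * (om * (a / 2) ^+ n))).
  by rewrite !mulr_gt0 ?exprn_gt0 ?F_gt0.
rewrite -lee_fin -Mfin ?(ltW a2r)// EFinM -lebesgue_eball_ge0 ?(ltW a2)//.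
rewrite -integral_cst; last exact: mball.
have null : mu [set 0 : V] = 0%E by exact: lebesgue_point.
have m0 : measurable [set 0 : V] by exact: measurable_null.
apply: (@le_trans _ _ (\int[mu]_x (Fs (a / 2) * \1_(eball (0 : V) (a / 2)) x)%:E)%E).
  apply: lee_eq; rewrite (int_indicD mu (fun=> Fs (a / 2)) (mball (a / 2)) (@subsetT _ _)).
  by [].
rewrite -[leRHS](int_indicD mu _ (mball (a / 2)) (@subsetT _ _)).
apply: int_ae_le.
- by apply: measurable_funM; [exact: measurable_cst|exact: measurable_indic].
- by apply: measurable_funM mF _; exact: measurable_indic.
- by move=> x; rewrite mulr_ge0// prof_ge0.
- by move=> x; rewrite mulr_ge0.
exists [set 0]; split => // x /= h; apply: contrapT => x0; apply: h.
rewrite indicE; case: (boolP (x \in _)) => [|_]; last by rewrite !mulr0.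
move/set_mem; rewrite /eball /= subr0 => xa; rewrite !mulr1.
apply: (prof_noninc Dfin mU UD); last exact: ltW.
by apply: gt_enorm; apply/eqP.
Qed.

(* kap and kmax bound from below and above the slope -Z' on ]a, b[, since
   n om r^(n-1) |Z' r|^(p-1) = M r for the radial solution. *)
Definition kap (a b : R) : R := (M a * a / (n%:R * om * b ^+ n)) `^ (p - 1)^-1.
(** Isoperimetric lower bound for the integral of [G] over the band: area of the inner sphere times
    difference of levels. *)
Definition beta (a b : R) : R := n%:R * om * a ^+ n.-1 * (Z a - Z b).
Definition band (a b : R) : set V := [set x | Z b < W x < Z a].

Lemma kap_ge0 a b : 0 <= kap a b. Proof. exact: powR_ge0. Qed.

Lemma kapE a b : 0 < a -> 0 < b -> kap a b `^ (p - 1) = M a * a / (n%:R * om * b ^+ n).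
Proof.
move=> a0 b0; rewrite /kap -powRrM mulVf ?gt_eqF// powRr1//.
by rewrite divr_ge0 ?mulr_ge0 ?M_ge0 ?exprn_ge0 ?ltW.
Qed.

Lemma kap_pow a b : 0 < a -> 0 < b -> kap a b `^ (p - 1) * (n%:R * om * b ^+ n) = M a * a.
Proof. by move=> a0 b0; rewrite kapE// divfK// gt_eqF// !mulr_gt0 ?exprn_gt0. Qed.

Lemma kap_gt0 a b : 0 < a -> a <= rho -> 0 < b -> 0 < kap a b.
Proof.
by move=> a0 ar b0; rewrite powR_gt0// divr_gt0 ?mulr_gt0 ?M_gt0 ?exprn_gt0.
Qed.

(** Summed over a grid, the right-hand side is a Stieltjes sum for the integral of [M] against -dZ,
    that is, for the integral of Fs Z; the power of a / b tends to 1 with the mesh. *)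
Lemma kap_beta a b : 0 < a -> 0 < b ->
  kap a b `^ (p - 1) * beta a b = M a * (a / b) ^+ n * (Z a - Z b).
Proof.
move=> a0 b0; rewrite kapE// /beta expr_div_n.
have bn : b ^+ n != 0 by rewrite expf_neq0// gt_eqF.
have an : a ^+ n = a * a ^+ n.-1 by rewrite -exprS prednK.
by rewrite an; field; rewrite bn ?gt_eqF.
Qed.

Lemma measurable_band_ a b : measurable (band a b).
Proof.
rewrite (_ : band a b = W @^-1` `]Z b, Z a[); last first.
  by apply/seteqP; split => x /=; rewrite in_itv.
by rewrite -[X in measurable X]setTI; apply: mW.
Qed.

Lemma band_fin a b : (mu (band a b) < +oo)%E.
Proof.
apply: le_lt_trans Dfin; apply: le_lebesgue_outer => x /= /andP[h _].
by apply: (gt_subD WD (prof_ge0 W b) h).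
Qed.

Let iG A : measurable A -> mu.-integrable A (EFin \o G).
Proof.
move=> mA; apply: (integrable_sub mA measurableT (@subsetT _ _)).
exact: integrable_ge0.
Qed.

Let iGp A : measurable A -> mu.-integrable A (EFin \o (fun x => G x `^ p)).
Proof.
move=> mA; apply: (integrable_sub mA measurableT (@subsetT _ _)).
apply: integrable_ge0; first exact: measurable_powRf.
  by move=> x; exact: powR_ge0.
exact: le_lt_trans GpE (ltry _).
Qed.

Let ibreg k a b : mu.-integrable (band a b) (EFin \o (fun x => breg p (G x) k)).
Proof.
have mb := measurable_band_ a b.
exact: (integrable_breg _ mb (band_fin a b) (iG mb) (iGp mb)).
Qed.

Let Vb a b := fine (mu (band a b)).
Let al a b := \int[mu]_(x in band a b) G x.
Let En a b := \int[mu]_(x in band a b) (G x `^ p).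

(* Nonnegative on each band, as the sum of the Bregman, isoperimetric and volume
   gaps of deficitE, while its sum over fine bands is at most
   e + (p - 1) e - p e = 0 in the limit. *)
Definition deficit a b : R := En a b - p * kap a b `^ (p - 1) * beta a b +
  (p - 1) * kap a b `^ p * (om * (b ^+ n - a ^+ n)).

Lemma deficitE a b : deficit a b = \int[mu]_(x in band a b) breg p (G x) (kap a b) +
  p * kap a b `^ (p - 1) * (al a b - beta a b) +
  (p - 1) * kap a b `^ p * (om * (b ^+ n - a ^+ n) - Vb a b).
Proof.
have mb := measurable_band_ a b.
rewrite (Rint_breg _ mb (band_fin a b) (iG mb) (iGp mb)).
by rewrite /deficit /En /al /Vb; ring.
Qed.

Let mWge c : measurable [set x | c <= W x].
Proof.
rewrite (_ : mkset _ = W @^-1` `[c, +oo[); last first.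
  by apply/seteqP; split => x /=; rewrite in_itv/= andbT.
by rewrite -[X in measurable X]setTI; apply: mW.
Qed.

(** The closed superlevel set is the decreasing limit of open ones at levels below [Z a], each of
    measure at least om a^n. *)
Lemma closed_level_ge a : 0 < a -> 0 < Z a ->
  ((om * a ^+ n)%:E <= mu [set x | (Z a <= W x)%R])%E.
Proof.
move=> a0 Za; pose t (k : nat) := Z a * (1 - k.+2%:R^-1).
have tZ k : t k < Z a by rewrite gtr_pMr// gtrBl invr_gt0.
have t0 k : 0 <= t k.
  by rewrite mulr_ge0 ?(ltW Za)// subr_ge0 invf_le1 ?ler1n.
pose A k := [set x | t k < W x].
have mA k : measurable (A k) by exact: measurable_gt.
have AE : \bigcap_k A k = [set x | Z a <= W x].
  apply/seteqP; split => x /= h; last by move=> k _; exact: lt_le_trans (tZ k) h.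
  rewrite leNgt; apply/negP => hx.
  have pos : 0 < (Z a - W x) / Z a by rewrite divr_gt0// subr_gt0.
  have [k hk] := ltr_add_invr pos; rewrite add0r in hk.
  have := h k I; rewrite /A /= /t ltNge => /negP; apply.
  have h2 : k.+2%:R^-1 <= k.+1%:R^-1 :> R by rewrite lef_pV2 ?posrE// ler_nat.
  have := le_lt_trans h2 hk; rewrite ltr_pdivlMr// => h3.
  rewrite mulrBr mulr1 [Z a * _]mulrC; move: h3.
  by move: (k.+2%:R^-1 : R) (Z a) (W x) => u z y; lra.
have niA : nonincreasing_seq A.
  move=> i j ij; apply/subsetPset => x; apply: le_lt_trans.
  rewrite ler_wpM2l ?(ltW Za)// lerD2l lerN2 lef_pV2 ?posrE//.
  by rewrite ler_nat.
have mI : measurable (\bigcap_k A k) by rewrite AE; exact: mWge.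
have fin0 : (mu (A 0%N) < +oo)%E by exact: (dist_lty Dfin WD (t0 0%N)).
have cv : (fun k => mu (A k)) @ \oo --> mu (\bigcap_k A k).
  exact: (nonincreasing_cvg_mu fin0 mA mI niA).
rewrite -AE; apply: (cvge_ge _ cv); apply: nearW => k.
exact: (prof_dist Dfin mW WD a0 Za (tZ k)).
Qed.

(** The band is what {Z b < W}, of measure at most om b^n, leaves after removal of {Z a <= W}, of
    measure at least om a^n; it is empty where [Z] is constant. *)
Lemma band_measure_le a b : 0 < a -> a <= b ->
  Vb a b <= om * (b ^+ n - a ^+ n).
Proof.
move=> a0 ab; have b0 : 0 < b by exact: lt_le_trans ab.
have [ZZ|ZZ] := leP (Z a) (Z b).
  rewrite /Vb (_ : band a b = set0) ?measure0/=.
    by rewrite mulr_ge0 ?(ltW om0)// subr_ge0 lerXn2r ?nnegrE ?(ltW a0) ?(ltW b0).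
  by apply/seteqP; split => // x /= /andP[h1 /(lt_trans h1)]; rewrite ltNge ZZ.
have Za : 0 < Z a by apply: le_lt_trans ZZ; exact: prof_ge0.
have Zb0 : 0 <= Z b by exact: prof_ge0.
have bE : band a b = [set x | Z b < W x] `\` [set x | Z a <= W x].
  apply/seteqP; split => x /=; first by move=> /andP[? ?]; split => //; apply/negP; rewrite -ltNge.
  by move=> [h1 /negP]; rewrite -ltNge => h2; apply/andP.
have fb : (dist W (Z b) < +oo)%E by exact: (dist_lty Dfin WD Zb0).
have sub : [set x | Z a <= W x] `<=` [set x | Z b < W x] by move=> x; exact: lt_le_trans.
have fa : (mu [set x | (Z a <= W x)%R] < +oo)%E.
  by apply: le_lt_trans fb; exact: le_lebesgue_outer.
rewrite /Vb bE measureD; [|exact: (measurable_gt mW)|exact: mWge|exact: fb].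
rewrite setIidr// fineB; last 2 first.
- by rewrite ge0_fin_numE; [exact: fb|exact: lebesgue_outer_ge0].
- by rewrite ge0_fin_numE; [exact: fa|exact: lebesgue_outer_ge0].
rewrite mulrBr; apply: lerB.
  rewrite -lee_fin fineK; last by rewrite ge0_fin_numE; [exact: fb|exact: lebesgue_outer_ge0].
  exact: (dist_prof Dfin mW WD b0).
rewrite -lee_fin fineK ?ge0_fin_numE ?measure_ge0//.
exact: closed_level_ge.
Qed.

(** [limit_isoperimetric] concerns closed slabs; the open band is shrunk at both ends by a fraction
    u < 1/2, and u tends to 0. *)
Lemma beta_le a b : 0 < a -> a <= b -> beta a b <= al a b.
Proof.
move=> a0 ab; have b0 : 0 < b by exact: lt_le_trans ab.
have al0 : 0 <= al a b by apply: Rintegral_ge0 => x _; exact: G0.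
have [ZZ|ZZ] := leP (Z a) (Z b).
  rewrite /beta (_ : Z a = Z b) ?subrr ?mulr0//.
  by apply/eqP; rewrite eq_le ZZ Z_noninc.
have Za : 0 < Z a by apply: le_lt_trans ZZ; exact: prof_ge0.
have Zb0 : 0 <= Z b by exact: prof_ge0.
have mb := measurable_band_ a b.
have key (k : nat) : beta a b <= al a b + (2 * beta a b) * k.+3%:R^-1.
  have u0 : 0 < k.+3%:R^-1 :> R by rewrite invr_gt0.
  have u1 : 2 * k.+3%:R^-1 < 1 :> R.
    by rewrite -[ltRHS](mulVf (_ : k.+3%:R != 0))// mulrC ltr_pM2l// ltr_nat.
  move: (k.+3%:R^-1 : R) u0 u1 => u u0 u1.
  pose s' := Z b + u * (Z a - Z b); pose t' := Z a - u * (Z a - Z b).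
  have uZ : 0 < u * (Z a - Z b) by rewrite mulr_gt0// subr_gt0.
  have st : s' < t'.
    have : 0 < (1 - 2 * u) * (Z a - Z b) by rewrite mulr_gt0// subr_gt0.
    by rewrite /s' /t'; lra.
  have s0 : 0 <= s' by rewrite addr_ge0// ltW.
  have hr r : r < t' -> ((om * a ^+ n)%:E <= mu [set x | (r < W x)%R])%E.
    move=> rt; apply: (prof_dist Dfin mW WD a0 Za).
    by apply: lt_trans rt _; rewrite gtrBl.
  have := limit_isoperimetric n0 WG s0 st a0 hr.
  have sub : [set x | s' <= W x <= t'] `<=` band a b.
    move=> x /= /andP[h1 h2]; apply/andP; split.
      by apply: lt_le_trans h1; rewrite ltrDl.
    by apply: le_lt_trans h2 _; rewrite gtrBl.
  have mst : measurable [set x | s' <= W x <= t'] by exact: (measurable_band WG).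
  rewrite (int_indicD mu G mst (@subsetT _ _)) (fineRint mst (iG mst)) lee_fin => h.
  have := le_trans h (Rint_subset mst mb sub (iG mb) G0).
  rewrite -/(al a b) /s' /t' /beta.
  set c := n%:R * om * _.
  rewrite (_ : (_ - _) * c = c * (Z a - Z b) - 2 * (c * (Z a - Z b)) * u); last by ring.
  lra.
apply: ge0_cvg0_le key.
have := @cvg_harmonic R; rewrite -(cvg_shiftn 2).
by apply: cvg_trans; apply: near_eq_cvg; near=> k; rewrite /harmonic /= addn2.
Unshelve. all: by end_near.
Qed.

Lemma deficit_ge0 a b : 0 < a -> a <= b ->
  [/\ 0 <= \int[mu]_(x in band a b) breg p (G x) (kap a b),
      0 <= p * kap a b `^ (p - 1) * (al a b - beta a b) &
      0 <= (p - 1) * kap a b `^ p * (om * (b ^+ n - a ^+ n) - Vb a b)].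
Proof.
move=> a0 ab; split.
- by apply: Rintegral_ge0 => x _; apply: breg_ge0 => //; exact: kap_ge0.
- by rewrite !mulr_ge0 ?powR_ge0 ?(ltW p0) ?subr_ge0 ?beta_le.
- by rewrite !mulr_ge0 ?powR_ge0 ?(ltW q0) ?subr_ge0 ?band_measure_le.
Qed.

(** The energies of [G] on disjoint bands add up to at most the whole energy, and the volume terms
    are bounded by [shellE] on disjoint shells, hence by (p - 1) e in total. *)
Lemma sum_deficit_le (r : nat -> R) m : (forall i, 0 < r i) ->
  (forall i, r i < r i.+1) -> r m <= rho ->
  \sum_(i < m) deficit (r i) (r i.+1) <=
  fine (\int[mu]_x (G x `^ p)%:E) + (p - 1) * e -
  p * \sum_(i < m) kap (r i) (r i.+1) `^ (p - 1) * beta (r i) (r i.+1).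
Proof.
move=> r0 rS rm.
have rmono i j : (i <= j)%N -> r i <= r j.
  by apply: (@homo_leq _ r (fun x y => x <= y)) => // [x y z|k]; [exact: le_trans|exact: ltW].
rewrite /deficit big_split /= sumrB.
have SE : \sum_(i < m) En (r i) (r i.+1) <= fine (\int[mu]_x (G x `^ p)%:E).
  apply: (@Rint_sum_le _ _ _ mu (fun i => band (r i) (r i.+1)) setT).
  - by move=> i; exact: measurable_band_.
  - exact: measurableT.
  - by [].
  - move=> i j ij jm x /= /andP[h1 _] /andP[_ h2].
    have := lt_trans h1 h2; rewrite ltNge Z_noninc//; exact: rmono.
  - by apply: iGp; exact: measurableT.
  - by move=> x; exact: powR_ge0.
have Efin : (\int[mu]_(x in B) (E x)%:E < +oo)%E by exact: le_lt_trans EE (ltry _).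
have iE : mu.-integrable B (EFin \o E).
  apply/integrableP; split; first exact/measurable_EFinP.
  apply: le_lt_trans Efin; apply: lee_eq; apply: eq_integral => x _.
  by rewrite /= ger0_norm.
have SS : \sum_(i < m) (kap (r i) (r i.+1) `^ p * (om * (r i.+1 ^+ n - r i ^+ n))) <= e.
  apply: (@le_trans _ _ (\sum_(i < m) \int[mu]_(x in shell (r i) (r i.+1)) E x)).
    apply: ler_sum => i _.
    have rb : r i.+1 <= rho by apply: le_trans rm; apply: rmono; exact: ltn_ord.
    rewrite -lee_fin -fineRint; last 2 first.
    - exact: measurable_shell.
    - by apply: (integrable_sub (measurable_shell _ _) mB _ iE); exact: shell_sub.
    rewrite mulrC; apply: shellE; rewrite ?kap_ge0 ?r0//.
    by rewrite kap_pow ?r0.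
  apply: (@le_trans _ _ (\int[mu]_(x in B) E x)).
    apply: (@Rint_sum_le _ _ _ mu (fun i => shell (r i) (r i.+1))).
    - by move=> i; exact: measurable_shell.
    - exact: mB.
    - by move=> i im; apply: shell_sub; apply: le_trans rm; exact: rmono.
    - move=> i j ij jm x [h1 _] [_ h2]; apply: h2; apply: lt_le_trans h1 _; exact: rmono.
    - exact: iE.
    - exact: E0.
  by rewrite -lee_fin -fineRint.
have SS' : \sum_(i < m) ((p - 1) * kap (r i) (r i.+1) `^ p * (om * (r i.+1 ^+ n - r i ^+ n))) <= (p - 1) * e.
  under eq_bigr do rewrite -mulrA; rewrite -mulr_sumr ler_pM2l//.
rewrite lerBrDr.
set X := \sum_(i < m) (p * _ * _); set Y := p * _.
have -> : X = Y.
  by rewrite /X /Y mulr_sumr; apply: eq_bigr => i _; rewrite mulrA.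
have := SE; have := SS'; move: (\sum_(i < m) En _ _) (\sum_(i < m) _) => P1 P2; lra.
Qed.

Lemma telescope_ge (z : nat -> R) (P : nat -> bool) j m : (forall i, z i.+1 <= z i) ->
  (forall i, (j <= i)%N -> P i) -> (j <= m)%N ->
  z j - z m <= \sum_(i < m) (P i)%:R * (z i - z i.+1).
Proof.
move=> zS Pj; elim: m => [|m ih].
  by rewrite leqn0 => /eqP ->; rewrite subrr big_ord0.
rewrite leq_eqVlt ltnS => /predU1P[->|jm].
  by rewrite subrr; apply: sumr_ge0 => i _; rewrite mulr_ge0// subr_ge0.
by rewrite big_ord_recr /= Pj// mul1r; have := ih jm; lra.
Qed.

(** Uniform subdivision of step rho / (k+2). The origin is not a node: the profile may be infinite
    there, and [kap] requires positive radii. *)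
Let gr (k i : nat) : R := rho * (i.+1%:R / k.+2%:R).

Let gr_gt0 k i : 0 < gr k i. Proof. by rewrite !mulr_gt0 ?invr_gt0. Qed.
Let gr_ltS k i : gr k i < gr k i.+1.
Proof. by rewrite /gr ltr_pM2l// ltr_pM2r ?invr_gt0// ltr_nat. Qed.
Let gr_last k : gr k k.+1 = rho. Proof. by rewrite /gr divff ?mulr1. Qed.

Let ksum k := \sum_(i < k.+1) kap (gr k i) (gr k i.+1) `^ (p - 1) * beta (gr k i) (gr k i.+1).

Let q k i := (gr k i / gr k i.+1) ^+ n * (Z (gr k i) - Z (gr k i.+1)).
Let q_ge0 k i : 0 <= q k i.
Proof.
rewrite mulr_ge0 ?exprn_ge0 ?divr_ge0 ?(ltW (gr_gt0 _ _))// subr_ge0.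
by rewrite Z_noninc// ltW.
Qed.

(** Without the power of r_i / r_(i+1) in [q], the sum telescopes to the value of [Z] at the first
    node beyond |x|. Thus [approx k] is close to Fs Z, while its integral is exactly [ksum k]. *)
Let approx k (x : V) := Fs (enorm x) * \sum_(i < k.+1) q k i * \1_(eball (0 : V) (gr k i)) x.

Let sum_q_ge0 k x : 0 <= \sum_(i < k.+1) q k i * \1_(eball (0 : V) (gr k i)) x.
Proof. by apply: sumr_ge0 => i _; rewrite mulr_ge0. Qed.

Let int_approx k : (\int[mu]_x (approx k x)%:E = (ksum k)%:E)%E.
Proof.
have mb i : measurable_fun setT (fun x : V => Fs (enorm x) * \1_(eball (0 : V) (gr k i)) x).
  by apply: measurable_funM mF _; apply: measurable_indic; exact: mball.
transitivity (\int[mu]_x \sum_(i < k.+1) (q k i * (Fs (enorm x) * \1_(eball (0 : V) (gr k i)) x))%:E)%E.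
  apply: eq_integral => x _; rewrite sumEFin /approx mulr_sumr.
  by congr EFin; apply: eq_bigr => i _; rewrite mulrCA.
rewrite ge0_integral_sum; last 3 first.
- exact: measurableT.
- by move=> i; apply/measurable_EFinP; apply: measurable_funM; [exact: measurable_cst|exact: mb].
- move=> i x _; rewrite lee_fin; apply: mulr_ge0; first exact: q_ge0.
  by apply: mulr_ge0.
rewrite /ksum -sumEFin; apply: eq_bigr => i _.
rewrite intZ; [|exact: measurableT|exact: mb|by move=> x; rewrite mulr_ge0|exact: q_ge0].
rewrite (int_indicD mu _ (mball _) (@subsetT _ _)) Mfin; last first.
  rewrite -(gr_last k) /gr ler_pM2l// ler_pM2r ?invr_gt0// ler_nat ltnS.
  exact: ltnW.
by rewrite kap_beta// -EFinM /q; congr EFin; ring.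
Qed.

(** Right-continuity of the profile, needed because the first node beyond |x| lies to the right of
    |x|. *)
Let Z_rcont (r eps : R) : 0 < r -> r < rho -> 0 < eps ->
  exists2 r', r < r' < rho & Z r - eps <= Z r'.
Proof.
move=> r0 rr e0; have [t0|t0] := ltP (Z r - eps) 0.
  exists ((r + rho) / 2); first by apply/andP; split; lra.
  by rewrite (le_trans (ltW t0))// prof_ge0.
have : Z r - eps < Z r by rewrite gtrBl.
rewrite (prof_rad n0 Dfin mW WD t0 r0) => rt.
have rl : rad W (Z r - eps) <= rho by exact: (rad_le n0 Dfin WD t0 (ltW rho0) Dle).
pose r' := (r + rad W (Z r - eps)) / 2.
have r'0 : 0 < r' by rewrite /r'; lra.
exists r'; first by apply/andP; split; rewrite /r'; lra.
by apply/ltW; rewrite (prof_rad n0 Dfin mW WD t0 r'0) /r'; lra.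
Qed.

Let approx_liminf (x : V) : x != 0 -> enorm x < rho -> forall dl : R, 0 < dl ->
  exists N, forall k, (N <= k)%N -> Fs (enorm x) * Z (enorm x) <= approx k x + dl.
Proof.
move=> x0 xr dl dl0; set r := enorm x in xr *.
have r0 : 0 < r by exact: gt_enorm.
have Fr0 : 0 <= Fs r by exact: prof_ge0.
pose eps := dl / (Fs r + 1).
have F1 : 0 < Fs r + 1 by rewrite ltr_wpDl.
have eps0 : 0 < eps by rewrite divr_gt0.
suff [N HN] : exists N, forall k, (N <= k)%N ->
    Z r <= \sum_(i < k.+1) q k i * \1_(eball (0 : V) (gr k i)) x + eps.
  exists N => k /HN h; rewrite /approx -/r.
  have := ler_wpM2l Fr0 h; rewrite mulrDr.
  have : Fs r * eps <= dl.
    apply: (@le_trans _ _ ((Fs r + 1) * eps)); first by rewrite ler_wpM2r ?(ltW eps0)// lerDl.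
    by rewrite /eps mulrC divfK// gt_eqF.
  lra.
have e2 : 0 < eps / 2 by rewrite divr_gt0.
have [r' /andP[rr' r'rho] Zr'] := Z_rcont r0 xr e2.
have Zr0 : 0 <= Z r by exact: prof_ge0.
(* The first bound places the next node before r'; with v bounding 1 - (r_i / r_(i+1))^n beyond r,
   the second gives v <= 1 and the third v Z r <= eps / 2. *)
pose w := Num.min ((r' - r) / rho) (Num.min (r / (n%:R * rho)) (eps / 2 / (Z r + 1) * (r / (n%:R * rho)))).
have Z1 : 0 < Z r + 1 by rewrite ltr_wpDl.
have nr0 : 0 < r / (n%:R * rho) by rewrite divr_gt0// mulr_gt0.
have w0 : 0 < w by rewrite !lt_min !mulr_gt0 ?invr_gt0 ?subr_gt0// ?mulr_gt0.
have [N] := ltr_add_invr w0; rewrite add0r => Nw.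
exists N => k Nk.
pose u : R := k.+2%:R^-1.
have u0 : 0 < u by rewrite invr_gt0.
have uw : u < w.
  by apply: le_lt_trans Nw; rewrite lef_pV2 ?posrE// ler_nat; exact: (leq_trans _ (leqnSn _)).
have [uw1 uw2 uw3] : [/\ u < (r' - r) / rho, u < r / (n%:R * rho) &
    u < eps / 2 / (Z r + 1) * (r / (n%:R * rho))].
  by move: uw; rewrite /w !lt_min => /and3P[].
pose j := Num.truncn (r / (rho * u)).
have ru0 : 0 < rho * u by rewrite mulr_gt0.
have rru : 0 <= r / (rho * u) by rewrite divr_ge0 ?ltW.
have [jle jgt] : j%:R <= r / (rho * u) /\ r / (rho * u) < j.+1%:R.
  by split; [rewrite truncn_le|exact: truncnS_gt].
rewrite ler_pdivlMr// in jle; rewrite ltr_pdivrMr// in jgt.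
have grj : gr k j = j.+1%:R * (rho * u) by rewrite /gr -/u mulrCA.
have grr : r < gr k j by rewrite grj.
have grr' : gr k j < r'.
  rewrite grj -natr1 mulrDl mul1r.
  have : rho * u < r' - r by rewrite mulrC -ltr_pdivlMr.
  lra.
have jk : (j <= k)%N.
  have : gr k j < rho by exact: lt_trans grr' r'rho.
  rewrite -(gr_last k) /gr ltr_pM2l// ltr_pM2r ?invr_gt0// ltr_nat.
  by rewrite !ltnS.
have grmono a b : (a <= b)%N -> gr k a <= gr k b.
  by move=> ab; rewrite /gr ler_pM2l// ler_pM2r ?invr_gt0// ler_nat ltnS.
pose v := n%:R * (rho * u / r).
have v0 : 0 <= v by rewrite !mulr_ge0 ?invr_ge0 ?(ltW rho0) ?(ltW u0) ?(ltW r0) ?ler0n.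
have v1 : v <= 1.
  rewrite /v mulrA -/(_ / r) ler_pdivrMr// mul1r mulrA [_ * u]mulrC.
  by rewrite -ler_pdivlMr ?mulr_gt0// ltW.
have vE : v = u / (r / (n%:R * rho)).
  by rewrite /v; field; rewrite !gt_eqF.
have ve : v * Z r <= eps / 2.
  have h : v <= eps / 2 / (Z r + 1) by rewrite vE ler_pdivrMr// ltW.
  apply: (@le_trans _ _ (eps / 2 / (Z r + 1) * (Z r + 1))); last by rewrite divfK// gt_eqF.
  by apply: ler_pM; rewrite ?lerDl.
have ratio i : r < gr k i -> 1 - v <= (gr k i / gr k i.+1) ^+ n.
  move=> ri; have gS : gr k i.+1 = gr k i + rho * u.
    by rewrite /gr -/u -[i.+2%:R]natr1; ring.
  have g0 := gr_gt0 k i.+1.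
  pose y := rho * u / r.
  have y0 : 0 <= y by rewrite divr_ge0 ?ltW.
  have y1 : y <= 1.
    apply: le_trans v1; rewrite /v -/y -[leLHS]mul1r ler_wpM2r// ler1n//.
  apply: (le_trans (bernoulli1 n y0 y1)).
  rewrite lerXn2r ?nnegrE ?subr_ge0//; first by rewrite divr_ge0 ?ltW.
  rewrite ler_pdivlMr// mulrBl mul1r gS.
  have : rho * u <= y * (gr k i + rho * u).
    rewrite /y mulrAC ler_pdivlMr// ler_pM2l//.
    by rewrite ltW// (lt_le_trans ri)// lerDl ltW.
  lra.
have := @telescope_ge (fun i => Z (gr k i)) (fun i => r < gr k i) j k.+1
  (fun i => Z_noninc (gr_gt0 k i) (ltW (gr_ltS k i)))
  (fun i ji => lt_le_trans grr (grmono _ _ ji)) (leqW jk).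
rewrite gr_last Z_rho subr0 => tele.
have Sge : (1 - v) * \sum_(i < k.+1) (r < gr k i)%R%:R * (Z (gr k i) - Z (gr k i.+1)) <=
    \sum_(i < k.+1) q k i * \1_(eball (0 : V) (gr k i)) x.
  rewrite mulr_sumr; apply: ler_sum => i _; rewrite indicE.
  have dZ : 0 <= Z (gr k i) - Z (gr k i.+1).
    by rewrite subr_ge0; apply: Z_noninc => //; exact: ltW.
  have [ri|ri] := ltP r (gr k i); last by rewrite mul0r mulr0 mulr_ge0.
  rewrite mem_set; last by rewrite /eball /= subr0.
  by rewrite mul1r mulr1 /q ler_wpM2r// ratio.
have Zgj : Z r - eps / 2 <= Z (gr k j).
  by apply: le_trans Zr' _; apply: Z_noninc => //; exact: ltW.
have Zgr : Z (gr k j) <= Z r by apply: Z_noninc => //; exact: ltW.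
have v10 : 0 <= 1 - v by rewrite subr_ge0.
have h1 := ler_wpM2l v10 tele.
have h2 : v * Z (gr k j) <= v * Z r by rewrite ler_wpM2l.
rewrite mulrBl mul1r in h1; lra.
Qed.

Let ksum_liminf (c : R) : c < e -> exists N, forall k, (N <= k)%N -> c < ksum k.
Proof.
move=> ce; pose H (x : V) := Fs (enorm x) * Z (enorm x) * \1_B x.
have mZ : measurable_fun setT (fun x : V => Z (enorm x)) by exact: measurable_prof mW WD.
have mH : measurable_fun setT H.
  by apply: measurable_funM (measurable_funM mF mZ) _; exact: measurable_indic.
have H0 x : 0 <= H x by rewrite !mulr_ge0// prof_ge0.
have HE : (\int[mu]_x (H x)%:E = e%:E)%E.
  by rewrite -FZE; exact: (int_indicD mu (fun x => Fs (enorm x) * Z (enorm x)) mB (@subsetT _ _)).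
have mA k : measurable_fun setT (approx k).
  apply: measurable_funM mF _; apply: measurable_sum => i.
  by apply: measurable_funM; [exact: measurable_cst|apply: measurable_indic; exact: mball].
have [N hN] : exists N, forall k, (N <= k)%N -> (c%:E < \int[mu]_x (approx k x)%:E)%E.
  apply: (@int_liminf_gt _ _ _ mu approx H c mA mH).
  - by move=> k x; rewrite mulr_ge0 ?sum_q_ge0.
  - exact: H0.
  - by rewrite HE ltry.
  - have null : mu [set 0 : V] = 0%E by exact: lebesgue_point.
    have m0 : measurable [set 0 : V] by exact: measurable_null.
    exists [set 0]; split => // x /= nh; apply: contrapT => x0; apply: nh => dl dl0.
    rewrite /H indicE; case: (boolP (x \in B)) => xB.
      have xr : enorm x < rho by move/set_mem: xB; rewrite /eball /= subr0.
      have [N hN] := approx_liminf (introN eqP x0) xr dl0.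
      by exists N => k /hN; rewrite mulr1.
    by exists 0%N => k _; rewrite mulr0 addr_ge0 ?mulr_ge0 ?(ltW dl0).
  - by rewrite HE lte_fin.
by exists N => k /hN; rewrite int_approx lte_fin.
Qed.

Let S := fine (\int[mu]_x (G x `^ p)%:E).

Let S_le : S <= e.
Proof.
rewrite -lee_fin /S fineK// ge0_fin_numE; first exact: le_lt_trans GpE (ltry _).
by apply: int_ge0 => x; exact: powR_ge0.
Qed.

Let sum_deficit_ge0 (r : nat -> R) m : (forall i, 0 < r i) -> (forall i, r i < r i.+1) ->
  0 <= \sum_(i < m) deficit (r i) (r i.+1).
Proof.
move=> r0 rS; apply: sumr_ge0 => i _; rewrite deficitE.
by have [? ? ?] := deficit_ge0 (r0 i) (ltW (rS i)); rewrite !addr_ge0.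
Qed.

Let grid_deficit k : 0 <= \sum_(i < k.+1) deficit (gr k i) (gr k i.+1) <= S + (p - 1) * e - p * ksum k.
Proof.
rewrite sum_deficit_ge0//=; apply: (@sum_deficit_le (gr k)) => //.
by rewrite gr_last.
Qed.

(** If the energy [S] of [G] were below e, the sum of deficits, at most S + (p - 1) e - p ksum,
    would tend to at most S - e < 0, while every deficit is nonnegative. The margin (e - S) / (2p)
    keeps half of the gap. *)
Lemma energy_ge : (e%:E <= \int[mu]_x (G x `^ p)%:E)%E.
Proof.
rewrite -[leRHS]fineK; last first.
  rewrite ge0_fin_numE; first exact: le_lt_trans GpE (ltry _).
  by apply: int_ge0 => x; exact: powR_ge0.
rewrite lee_fin -/S leNgt; apply/negP => Se.
have c : e - (e - S) / (2 * p) < e by rewrite gtrBl divr_gt0 ?subr_gt0 ?mulr_gt0.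
have [N /(_ N (leqnn N)) h] := ksum_liminf c.
have /andP[h1 h2] := grid_deficit N.
have h3 : p * (e - (e - S) / (2 * p)) < p * ksum N by rewrite ltr_pM2l.
have h4 : p * (e - (e - S) / (2 * p)) = p * e - (e - S) / 2 by field; rewrite gt_eqF.
lra.
Qed.

Let deficit_limit eta : 0 < eta -> exists N, forall k, (N <= k)%N ->
  \sum_(i < k.+1) deficit (gr k i) (gr k i.+1) <= eta.
Proof.
move=> eta0; have pe : 0 < eta / p by rewrite divr_gt0.
have c : e - eta / p < e by rewrite gtrBl.
have [N hN] := ksum_liminf c; exists N => k /hN h.
have /andP[_ h2] := grid_deficit k; apply: le_trans h2 _.
have := h; rewrite -(ltr_pM2l p0) mulrBr [p * (_ / _)]mulrC divfK ?gt_eqF//.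
have := S_le; lra.
Qed.

(** The nodes of a fine grid that fall between a and b: since deficits are nonnegative, part of
    their sum is at most the whole. *)
Lemma fine_partition (a b eta : R) : 0 < a -> a < b -> b <= rho -> 0 < eta ->
  exists (r : nat -> R) (m : nat),
  [/\ forall i, 0 < r i /\ r i < r i.+1, a <= r 0%N < a + eta, b - eta < r m <= b &
      \sum_(i < m) deficit (r i) (r i.+1) <= eta].
Proof.
move=> a0 ab brho eta0; have [N hN] := deficit_limit eta0.
pose d := Num.min eta ((b - a) / 2).
have d0 : 0 < d by rewrite lt_min eta0/= divr_gt0// subr_gt0.
have dr : 0 < d / rho by rewrite divr_gt0.
have [N'] := ltr_add_invr dr; rewrite add0r => hN'.
pose k := maxn N N'; have hk := hN k (leq_maxl _ _).
pose u : R := rho * k.+2%:R^-1.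
have u0 : 0 < u by rewrite mulr_gt0// invr_gt0.
have ud : u < d.
  rewrite /u mulrC -ltr_pdivlMr//; apply: le_lt_trans hN'.
  rewrite lef_pV2 ?posrE// ler_nat ltnS; apply: leq_trans (leq_maxr N N') _; exact: leqnSn.
have uE : u < eta by apply: lt_le_trans ud _; rewrite ge_min lexx.
have uba : u < (b - a) / 2 by apply: lt_le_trans ud _; rewrite ge_min lexx orbT.
have grE i : gr k i = i.+1%:R * u by rewrite /gr /u mulrCA.
(* Node i is (i+1) u, so node i1 is the first one beyond a and node j - 1, equal to j u, is the last
   one not exceeding b. *)
pose i1 := Num.truncn (a / u); pose j := Num.truncn (b / u).
have [j1 j2] : j%:R * u <= b /\ b < j.+1%:R * u.
  rewrite -ler_pdivlMr// -ltr_pdivrMr//; split; last exact: truncnS_gt.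
  by rewrite truncn_le// divr_ge0 ?(ltW u0)// ltW// (lt_trans a0).
have [a1 a2] : i1%:R * u <= a /\ a < i1.+1%:R * u.
  rewrite -ler_pdivlMr// -ltr_pdivrMr//; split; last exact: truncnS_gt.
  by rewrite truncn_le// divr_ge0 ?ltW.
have ij : (i1.+1 < j)%N.
  rewrite -(@ltr_nat R) -(ltr_pM2r u0).
  by move: j2 a1; rewrite -!natr1 !mulrDl !mul1r; lra.
exists (fun l => gr k (i1 + l)), (j.-1 - i1)%N; split.
- by move=> i; rewrite addnS.
- by rewrite addn0 grE ltW//= -natr1 mulrDl mul1r; lra.
- rewrite subnKC; last by rewrite -ltnS prednK ?(ltn_trans _ ij)// ltnW.
  rewrite grE prednK ?(ltn_trans _ ij)// j1 andbT.
  by move: j2; rewrite -natr1 mulrDl mul1r; lra.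
apply: le_trans hk.
have jk : (j.-1 <= k.+1)%N.
  have : j%:R * u <= k.+2%:R * u.
    by apply: le_trans j1 (le_trans brho _); rewrite /u mulrCA divff ?mulr1.
  by rewrite ler_pM2r// ler_nat; case: (j).
rewrite -(big_mkord xpredT (fun i => deficit (gr k (i1 + i)) (gr k (i1 + i.+1)))).
rewrite -(big_mkord xpredT (fun i => deficit (gr k i) (gr k i.+1))).
have i1j : (i1 <= j.-1)%N by rewrite -ltnS prednK ?(ltn_trans _ ij)// ltnW.
have dge i : 0 <= deficit (gr k i) (gr k i.+1).
  rewrite deficitE.
  by have [? ? ?] := deficit_ge0 (gr_gt0 k i) (ltW (gr_ltS k i)); rewrite !addr_ge0.
rewrite (@big_cat_nat _ _ _ i1 0%N k.+1)//=; last exact: leq_trans jk.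
rewrite (@big_cat_nat _ _ _ j.-1 i1 k.+1)//=.
have -> : \sum_(i1 <= i < j.-1) deficit (gr k i) (gr k i.+1) =
    \sum_(0 <= i < j.-1 - i1) deficit (gr k (i1 + i)) (gr k (i1 + i.+1)).
  rewrite -{1}[i1]add0n big_addn; apply: eq_bigr => i _.
  by rewrite addnS (addnC i).
rewrite addrCA lerDl addr_ge0//; apply: sumr_ge0 => i _; exact: dge.
Qed.

Definition kmax (a b : R) : R := (M b / (n%:R * om * a ^+ n.-1)) `^ (p - 1)^-1.

Let powq x y : 0 <= x -> x <= y -> x `^ (p - 1)^-1 <= y `^ (p - 1)^-1.
Proof.
move=> x0 xy; rewrite ge0_ler_powR ?nnegrE ?invr_ge0 ?(ltW q0)//.
exact: le_trans xy.
Qed.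

Let den_gt0 a k : 0 < a -> 0 < n%:R * om * a ^+ k.
Proof. by move=> a0; rewrite !mulr_gt0 ?exprn_gt0. Qed.

Let frac_ge0 a b k : 0 < a -> 0 < b -> 0 <= M a * a / (n%:R * om * b ^+ k).
Proof.
move=> a0 b0; apply: divr_ge0; last by rewrite ltW// den_gt0.
by rewrite mulr_ge0 ?M_ge0 ?(ltW a0).
Qed.

Lemma kap_lo a b r r' : 0 < a -> a <= r -> r < r' -> r' <= b -> b <= rho ->
  kap a b <= kap r r'.
Proof.
move=> a0 ar rr' r'b brho.
have r0 : 0 < r by exact: lt_le_trans ar.
have r'0 : 0 < r' by exact: lt_trans rr'.
have b0 : 0 < b by exact: lt_le_trans r'b.
have rrho : r <= rho by rewrite (le_trans _ brho)// (le_trans _ r'b)// ltW.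
apply: powq; first exact: frac_ge0.
apply: ler_pM.
- by rewrite mulr_ge0 ?M_ge0 ?(ltW a0).
- by rewrite invr_ge0 ltW// den_gt0.
- by apply: ler_pM; rewrite ?M_ge0 ?(ltW a0) ?M_mono.
- rewrite lef_pV2 ?posrE ?den_gt0// ler_pM2l ?mulr_gt0//.
  by rewrite lerXn2r ?nnegrE ?(ltW b0) ?(ltW r'0).
Qed.

Lemma kap_hi a b r r' : 0 < a -> a <= r -> r < r' -> r' <= b -> b <= rho ->
  kap r r' <= kmax a b.
Proof.
move=> a0 ar rr' r'b brho.
have r0 : 0 < r by exact: lt_le_trans ar.
have r'0 : 0 < r' by exact: lt_trans rr'.
have rb : r <= b by rewrite (le_trans _ r'b)// ltW.
apply: powq.
  exact: frac_ge0.
rewrite ler_pdivrMr ?den_gt0//.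
have -> : r' ^+ n = r' * r' ^+ n.-1 by rewrite -exprS prednK.
rewrite [leRHS](_ : _ = M b * r' * (n%:R * om * r' ^+ n.-1 / (n%:R * om * a ^+ n.-1))); last by ring.
apply: (@le_trans _ _ (M b * r')).
  by apply: ler_pM; rewrite ?M_ge0 ?(ltW r0) ?(ltW rr') ?M_mono.
rewrite -[leLHS]mulr1 ler_wpM2l ?mulr_ge0 ?M_ge0 ?(ltW r'0)//.
rewrite ler_pdivlMr ?den_gt0// mul1r ler_pM2l ?mulr_gt0//.
by rewrite lerXn2r ?nnegrE ?(ltW a0) ?(ltW r'0)// (le_trans ar) ?ltW.
Qed.

Lemma le_of_small (x y C : R) : (forall eta, 0 < eta -> x <= y + C * eta) -> x <= y.
Proof.
move=> h; apply/ler_addgt0Pr => d d0.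
have C1 : 0 < `|C| + 1 by rewrite ltr_wpDl.
have := h (d / (`|C| + 1)) (divr_gt0 d0 C1).
have : C * (d / (`|C| + 1)) <= d.
  rewrite mulrCA -[leRHS]mulr1 ler_pM2l// ler_pdivrMr// mul1r.
  by apply: le_trans (ler_norm _) _; rewrite lerDl.
lra.
Qed.

(** The deficit is a sum of three nonnegative gaps with coefficients bounded below by those of
    [kap a b] > 0, so each gap is bounded separately. The constant collects the inverses of these
    coefficients and the volume lost between a and the first node and between the last node and
    b. *)
Lemma partition_terms (a b : R) : 0 < a -> a < b -> b <= rho -> exists C : R, forall eta, 0 < eta ->
  exists (r : nat -> R) (m : nat),
  [/\ (forall i, 0 < r i /\ r i < r i.+1) /\ (a <= r 0%N /\ r m <= b),
      om * (b ^+ n - a ^+ n) <= \sum_(i < m) Vb (r i) (r i.+1) + C * eta,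
      \sum_(i < m) (al (r i) (r i.+1) - beta (r i) (r i.+1)) <= C * eta &
      \sum_(i < m) \int[mu]_(x in band (r i) (r i.+1)) breg p (G x) (kap (r i) (r i.+1)) <= eta].
Proof.
move=> a0 ab brho; have b0 : 0 < b by exact: lt_trans ab.
have arho : a <= rho by rewrite (le_trans _ brho)// ltW.
have k0 : 0 < kap a b by exact: kap_gt0.
set km := kap a b in k0.
have c1 : 0 < (p - 1) * km `^ p by rewrite mulr_gt0// powR_gt0.
have c2 : 0 < p * km `^ (p - 1) by rewrite mulr_gt0// powR_gt0.
pose C := om * (n%:R * b ^+ n.-1 * 2) + ((p - 1) * km `^ p)^-1 + (p * km `^ (p - 1))^-1.
have C0 : 0 <= om * (n%:R * b ^+ n.-1 * 2).
  by rewrite !mulr_ge0 ?exprn_ge0 ?(ltW om0) ?(ltW b0).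
exists C => eta eta0.
have [r [m [rP /andP[r0a r0e] /andP[rme rmb] sumD]]] := fine_partition a0 ab brho eta0.
have r0 i : 0 < r i by case: (rP i).
have rS i : r i < r i.+1 by case: (rP i).
have rmono i j : (i <= j)%N -> r i <= r j.
  by apply: (@homo_leq _ r (fun x y => x <= y)) => // [x y z|k]; [exact: le_trans|exact: ltW].
exists r, m.
have kl i : (i < m)%N -> km <= kap (r i) (r i.+1).
  move=> im; apply: kap_lo => //; first by rewrite (le_trans r0a)// rmono.
  by rewrite (le_trans _ rmb)// rmono.
have sum3 : \sum_(i < m) \int[mu]_(x in band (r i) (r i.+1)) breg p (G x) (kap (r i) (r i.+1)) +
    p * km `^ (p - 1) * \sum_(i < m) (al (r i) (r i.+1) - beta (r i) (r i.+1)) +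
    (p - 1) * km `^ p * \sum_(i < m) (om * (r i.+1 ^+ n - r i ^+ n) - Vb (r i) (r i.+1)) <= eta.
  apply: le_trans sumD; rewrite !mulr_sumr -!big_split /=; apply: ler_sum => i _.
  rewrite deficitE; have kli := kl i (ltn_ord i).
  have rr := ltW (rS i).
  apply: lerD; first (apply: lerD; first exact: lexx).
    apply: ler_wpM2r; first by rewrite subr_ge0; exact: beta_le (r0 i) rr.
    rewrite ler_pM2l; last exact: p0.
    by apply: (powR1_le p1 (ltW k0)).
  apply: ler_wpM2r; first by rewrite subr_ge0; exact: band_measure_le (r0 i) rr.
  rewrite ler_pM2l; last exact: q0.
  by apply: ge0_ler_powR; rewrite ?nnegrE ?(ltW p0) ?kap_ge0 ?(ltW k0).
have s1 : 0 <= \sum_(i < m) \int[mu]_(x in band (r i) (r i.+1)) breg p (G x) (kap (r i) (r i.+1)).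
  by apply: sumr_ge0 => i _; have [] := deficit_ge0 (r0 i) (ltW (rS i)).
have s2 : 0 <= \sum_(i < m) (al (r i) (r i.+1) - beta (r i) (r i.+1)).
  by apply: sumr_ge0 => i _; rewrite subr_ge0 beta_le// ltW.
have s3 : 0 <= \sum_(i < m) (om * (r i.+1 ^+ n - r i ^+ n) - Vb (r i) (r i.+1)).
  by apply: sumr_ge0 => i _; rewrite subr_ge0 band_measure_le// ltW.
have t2 := mulr_ge0 (ltW c2) s2; have t3 := mulr_ge0 (ltW c1) s3.
have u2 : \sum_(i < m) (al (r i) (r i.+1) - beta (r i) (r i.+1)) <= (p * km `^ (p - 1))^-1 * eta.
  by rewrite mulrC ler_pdivlMr// mulrC; lra.
have u3 : \sum_(i < m) (om * (r i.+1 ^+ n - r i ^+ n) - Vb (r i) (r i.+1)) <= ((p - 1) * km `^ p)^-1 * eta.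
  by rewrite mulrC ler_pdivlMr// mulrC; lra.
have i1 : 0 <= ((p - 1) * km `^ p)^-1 * eta by rewrite mulr_ge0 ?invr_ge0 ?(ltW c1) ?(ltW eta0).
have i2 : 0 <= (p * km `^ (p - 1))^-1 * eta by rewrite mulr_ge0 ?invr_ge0 ?(ltW c2) ?(ltW eta0).
have i3 : 0 <= om * (n%:R * b ^+ n.-1 * 2) * eta by rewrite mulr_ge0// ltW.
split => //.
- have tele : \sum_(i < m) (om * (r i.+1 ^+ n - r i ^+ n)) = om * (r m ^+ n - r 0%N ^+ n).
    rewrite -mulr_sumr; congr (_ * _).
    by rewrite -(big_mkord xpredT (fun i => r i.+1 ^+ n - r i ^+ n)) telescope_sumr.
  rewrite sumrB tele in u3.
  have rm0 : r 0%N <= r m by exact: rmono.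
  have d1 := pow_diff_le n (ltW (r0 m)) rmb.
  have d2 := pow_diff_le n (ltW a0) r0a.
  have nb : 0 <= n%:R * b ^+ n.-1 by rewrite mulr_ge0 ?exprn_ge0 ?(ltW b0).
  have d1' : b ^+ n - r m ^+ n <= n%:R * b ^+ n.-1 * eta.
    by apply: le_trans d1 _; rewrite ler_wpM2l//; lra.
  have d2' : r 0%N ^+ n - a ^+ n <= n%:R * b ^+ n.-1 * eta.
    apply: le_trans d2 _; apply: ler_pM; rewrite ?subr_ge0 ?mulr_ge0 ?exprn_ge0 ?(ltW (r0 _))//; last lra.
    by rewrite ler_pM2l// lerXn2r ?nnegrE ?(ltW b0) ?(ltW (r0 _))// (le_trans rm0).
  have := ler_wpM2l (ltW om0) (lerD d1' d2'); rewrite /C; lra.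
- by rewrite /C; lra.
- by lra.
Qed.

Let sub_band a b (r : nat -> R) m : 0 < a -> (forall i, 0 < r i /\ r i < r i.+1) ->
  a <= r 0%N -> r m <= b ->
  [/\ forall i, (i < m)%N -> band (r i) (r i.+1) `<=` band a b,
      forall i j, (i < j)%N -> (j < m)%N -> forall x, band (r i) (r i.+1) x -> ~ band (r j) (r j.+1) x &
      forall i, (i < m)%N -> a <= r i /\ r i.+1 <= b].
Proof.
move=> a0 rP r0a rmb.
have r0 i : 0 < r i by case: (rP i).
have rmono i j : (i <= j)%N -> r i <= r j.
  by apply: (@homo_leq _ r (fun x y => x <= y)) => // [x y z|k]; [exact: le_trans|apply: ltW; case: (rP k)].
have bnd i : (i < m)%N -> a <= r i /\ r i.+1 <= b.
  by move=> im; split; [rewrite (le_trans r0a)// rmono|rewrite (le_trans _ rmb)// rmono].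
split => //.
- move=> i /bnd[h1 h2] x /= /andP[h3 h4]; apply/andP; split.
    by apply: le_lt_trans h3; exact: Z_noninc.
  by apply: lt_le_trans h4 _; exact: Z_noninc.
- move=> i j ij jm x /= /andP[h1 _] /andP[_ h2].
  by have := lt_trans h1 h2; rewrite ltNge Z_noninc// rmono.
Qed.

Let Vb1 a b : Vb a b = \int[mu]_(x in band a b) 1.
Proof. by rewrite Rintegral_cst ?mul1r//; exact: measurable_band_. Qed.

(** The fine bands are disjoint, lie in the band, and miss at most C eta of the volume of the
    shell. *)
Lemma band_measure a b : 0 < a -> a < b -> b <= rho -> Vb a b = om * (b ^+ n - a ^+ n).
Proof.
move=> a0 ab brho; apply/eqP; rewrite eq_le band_measure_le ?(ltW ab)//=.
have [C hC] := partition_terms a0 ab brho.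
apply: (@le_of_small _ _ C) => eta /hC[r [m [[rP [r0a rmb]] h _ _]]].
apply: le_trans h _; rewrite lerD2r.
have [sub dis _] := sub_band a0 rP r0a rmb.
rewrite Vb1; under eq_bigr do rewrite Vb1.
apply: (@Rint_sum_le _ _ _ mu (fun i => band (r i) (r i.+1))) => //.
- by move=> i; exact: measurable_band_.
- exact: measurable_band_.
- by apply: integrable_cst_fin; [exact: measurable_band_|exact: band_fin].
Qed.

(* The Bregman terms of fine bands are bounded by the total deficit, which tends
   to 0: whatever lies below all of them vanishes. *)
Let penalty (L : R -> R) a b : 0 < a -> a < b -> b <= rho ->
  measurable_fun setT (fun x => L (G x)) -> (forall g, 0 <= g -> 0 <= L g <= 1) ->
  (forall g k, 0 <= g -> kap a b <= k <= kmax a b -> L g <= breg p g k) ->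
  {ae mu, forall x, band a b x -> L (G x) = 0}.
Proof.
move=> a0 ab brho mL L01 Lb.
have [C hC] := partition_terms a0 ab brho.
have mb := measurable_band_ a b.
have L0 x : 0 <= L (G x) by case/andP: (L01 _ (G0 x)).
have L1 x : L (G x) <= 1 by case/andP: (L01 _ (G0 x)).
have iL A : measurable A -> (mu A < +oo)%E -> mu.-integrable A (EFin \o (fun x => L (G x))).
  move=> mA fA; apply: le_integrable (integrable_cst_fin 1 mA fA) => //.
    by apply/measurable_EFinP; exact: measurable_funTS.
  by move=> x _; rewrite /= lee_fin normr1 ger0_norm.
have zero : \int[mu]_(x in band a b) L (G x) <= 0.
  apply: (@le_of_small _ _ (1 + C)) => eta eta0.
  have [r [m [[rP [r0a rmb]] hV _ hB]]] := hC _ eta0.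
  have [sub dis bnd] := sub_band a0 rP r0a rmb.
  pose A i := band (r i) (r i.+1).
  have mA i : measurable (A i) by exact: measurable_band_.
  pose Un := \bigcup_(i in `I_m) A i.
  have mUn : measurable Un by apply: bigcup_measurable => i _; exact: mA.
  have UnS : Un `<=` band a b by move=> x [i /= im]; exact: sub.
  have Unfin : (mu Un < +oo)%E by apply: le_lt_trans (band_fin a b); exact: le_lebesgue_outer.
  have mr : measurable (band a b `\` Un) by exact: measurableD.
  have rfin : (mu (band a b `\` Un) < +oo)%E.
    by apply: le_lt_trans (band_fin a b); apply: le_lebesgue_outer => x [].
  have BE : band a b = (band a b `\` Un) `|` Un by rewrite setUC setDUK.
  have dj : [disjoint band a b `\` Un & Un] by apply/disj_setPS => x [[_ h1] h2].
  have iLb : mu.-integrable ((band a b `\` Un) `|` Un) (EFin \o (fun x => L (G x))).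
    by rewrite -BE; apply: iL => //; exact: band_fin.
  rewrite [in leLHS]BE (Rintegral_setU mr mUn iLb dj).
  (* Off the fine bands only L <= 1 is available, but what they miss of the band has measure at most
     C eta. *)
  have p1_ : \int[mu]_(x in band a b `\` Un) L (G x) <= C * eta.
    apply: (@le_trans _ _ (\int[mu]_(x in band a b `\` Un) 1)).
      apply: le_Rintegral; [exact: mr|exact: iL|exact: (integrable_cst_fin 1 mr rfin)|].
      by move=> x _; exact: L1.
    have i1 : mu.-integrable ((band a b `\` Un) `|` Un) (EFin \o (fun x => 1)).
      by rewrite -BE; apply: (integrable_cst_fin 1 mb); exact: band_fin.
    have := Rintegral_setU mr mUn i1 dj; rewrite -BE -Vb1 band_measure//.
    have : \sum_(i < m) Vb (r i) (r i.+1) <= \int[mu]_(x in Un) 1.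
      under eq_bigr do rewrite Vb1.
      apply: (@Rint_sum_le _ _ _ mu A) => //.
      - by move=> i im x Ax; exists i.
      - exact: (integrable_cst_fin 1 mUn).
    lra.
  have p2 : \int[mu]_(x in Un) L (G x) <= eta.
    apply: le_trans hB.
    apply: (@le_trans _ _ (\sum_(i < m) \int[mu]_(x in A i) L (G x))).
      apply: (@Rint_cover_le _ _ _ mu A Un set0 (fun x => L (G x)) m mA mUn).
      - exact: measurable0.
      - exact: measure0.
      - by rewrite set0U.
      - by move=> i _; apply: iL; [exact: mA|exact: band_fin].
      - exact: iL mUn Unfin.
      - exact: L0.
    apply: ler_sum => i _; have [h1 h2] := bnd i (ltn_ord i).
    apply: le_Rintegral; first exact: mA.
    - by apply: iL; [exact: mA|exact: band_fin].
    - exact: ibreg.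
    - move=> x _; apply: Lb; first exact: G0.
      have [ri0 riS] := rP i.
      by apply/andP; split; [exact: kap_lo|exact: kap_hi].
  lra.
have mL1 : measurable_fun setT (fun x => L (G x) * \1_(band a b) x).
  by apply: measurable_funM mL _; exact: measurable_indic.
have LL x : 0 <= L (G x) * \1_(band a b) x by rewrite mulr_ge0.
have := int0_ae mL1 LL (_ : (\int[mu]_x _ <= 0)%E).
rewrite (int_indicD mu (fun x => L (G x)) mb (@subsetT _ _)) fineRint//; last first.
  by apply: iL => //; exact: band_fin.
rewrite lee_fin => /(_ zero); apply: filterS => x /= h bx; move: h.
by rewrite indicE mem_set// mulr1.
Qed.

Lemma kmax_gt0 a b : 0 < a -> 0 < b -> b <= rho -> 0 < kmax a b.
Proof.
by move=> a0 b0 br; rewrite powR_gt0// divr_gt0// ?M_gt0// den_gt0.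
Qed.

Let min_measurable (L : R -> R) : measurable_fun setT (fun x => L (G x)) ->
  measurable_fun setT (fun x => Num.min 1 (L (G x))).
Proof. by move=> mL; apply: measurable_minr => //; exact: measurable_cst. Qed.

Let breg_measurable (h : V -> R) k : measurable_fun setT h ->
  measurable_fun setT (fun x => breg p (h x) k).
Proof.
move=> mh; apply: measurable_funD; last exact: measurable_cst.
apply: measurable_funB; first exact: measurable_powRf.
by apply: measurable_funM mh; exact: measurable_cst.
Qed.

(** The two penalties are the Bregman distance from [G] to the bounds [kap] and [kmax], kept only
    where the bound is violated; there monotonicity of the distance puts them below the distance to
    any slope in between. The minimum with 1 makes them bounded. *)
Lemma grad_bounds a b : 0 < a -> a < b -> b <= rho ->
  {ae mu, forall x, band a b x -> kap a b <= G x <= kmax a b}.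
Proof.
move=> a0 ab brho; have b0 : 0 < b by exact: lt_trans ab.
have k0 := kap_ge0 a b; have K0 := ltW (kmax_gt0 a0 b0 brho).
pose Ll g := Num.min 1 (breg p (Num.min g (kap a b)) (kap a b)).
pose Lu g := Num.min 1 (breg p (Num.max g (kmax a b)) (kmax a b)).
have ll : {ae mu, forall x, band a b x -> Ll (G x) = 0}.
  apply: (penalty a0 ab brho).
  - apply: (@min_measurable (fun g => breg p (Num.min g (kap a b)) (kap a b))).
    apply: breg_measurable; apply: measurable_minr => //; exact: measurable_cst.
  - move=> g g0; rewrite /Ll le_min ler01/= breg_ge0// ?ge_min ?lexx//.
    by rewrite le_min g0.
  - move=> g k g0 /andP[hk _]; rewrite /Ll ge_min; apply/orP; right.
    rewrite /Num.min; case: ifP => [gk|_].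
      by apply: breg_le_lo => //; exact: ltW.
    by rewrite breg_id// breg_ge0// (le_trans k0).
have lu : {ae mu, forall x, band a b x -> Lu (G x) = 0}.
  apply: (penalty a0 ab brho).
  - apply: (@min_measurable (fun g => breg p (Num.max g (kmax a b)) (kmax a b))).
    apply: breg_measurable; apply: measurable_maxr => //; exact: measurable_cst.
  - move=> g g0; rewrite /Lu le_min ler01/= breg_ge0// ?ge_min ?lexx//.
    by rewrite le_max g0.
  - move=> g k g0 /andP[k1 k2]; have kk : 0 <= k by exact: le_trans k1.
    rewrite /Lu ge_min; apply/orP; right.
    rewrite /Num.max; case: ifP => [gk|/negbT].
      by rewrite breg_id// breg_ge0.
    by rewrite -leNgt => Kg; exact: breg_le_hi.
apply: filterS2 ll lu => x h1 h2 bx; move: (h1 bx) (h2 bx); rewrite /Ll /Lu.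
have min1 (y : R) : 0 <= y -> Num.min 1 y = 0 -> y = 0.
  by move=> y0; rewrite /Num.min; case: ifP => // _ /eqP; rewrite oner_eq0.
have n1_ : 0 <= Num.min (G x) (kap a b) by rewrite le_min G0.
have n2_ : 0 <= Num.max (G x) (kmax a b) by rewrite le_max G0.
move=> /(min1 _ (breg_ge0 p1 n1_ k0))/(breg_eq0 p1 n1_ k0) e1.
move=> /(min1 _ (breg_ge0 p1 n2_ K0))/(breg_eq0 p1 n2_ K0) e2.
by apply/andP; split; [rewrite -e1 ge_min lexx|rewrite -e2 le_max lexx].
Qed.

Let Rint_ae_ge (c : R) (A : set V) a b : measurable A -> A `<=` band a b -> 0 <= c ->
  {ae mu, forall x, band a b x -> c <= G x} -> c * fine (mu A) <= \int[mu]_(x in A) G x.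
Proof.
move=> mA Ab c0 h; have fA : (mu A < +oo)%E.
  by apply: le_lt_trans (band_fin a b); exact: le_lebesgue_outer.
rewrite -lee_fin -(fineRint mA (iG mA)) EFinM fineK ?ge0_fin_numE ?measure_ge0//.
rewrite -(int_cst_indic mu c mA) -(int_indicD mu G mA (@subsetT _ _)).
apply: int_ae_le.
- by apply: measurable_funM; [exact: measurable_cst|exact: measurable_indic].
- by apply: measurable_funM mG _; exact: measurable_indic.
- by move=> x; rewrite mulr_ge0.
- by move=> x; rewrite mulr_ge0.
apply: filterS h => x h; rewrite indicE; case: (boolP (x \in A)) => [/set_mem/Ab/h|_].
  by rewrite !mulr1.
by rewrite !mulr0.
Qed.

(** The isoperimetric gap is small in total, so the sum of the [beta] terms is nearly the integral
    of [G], which is at least [kap a b] times the volume of the shell. The [beta] terms are in turn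
    at most n om b^(n-1) times the drops of [Z]. *)
Lemma drop_lo a b : 0 < a -> a < b -> b <= rho ->
  kap a b * (a ^+ n.-1 * (b - a)) <= b ^+ n.-1 * (Z a - Z b).
Proof.
move=> a0 ab brho; have b0 : 0 < b by exact: lt_trans ab.
have k0 := kap_ge0 a b.
have no : 0 < n%:R * om by rewrite mulr_gt0.
have key : kap a b * (om * (b ^+ n - a ^+ n)) <= n%:R * om * b ^+ n.-1 * (Z a - Z b).
  have [C hC] := partition_terms a0 ab brho.
  apply: (@le_of_small _ _ (kap a b * C + C)) => eta eta0.
  have [r [m [[rP [r0a rmb]] hV hal _]]] := hC _ eta0.
  have [sub dis bnd] := sub_band a0 rP r0a rmb.
  have r0 i : 0 < r i by case: (rP i).
  have a1 : kap a b * \sum_(i < m) Vb (r i) (r i.+1) <= \sum_(i < m) al (r i) (r i.+1).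
    rewrite mulr_sumr; apply: ler_sum => i _.
    apply: (Rint_ae_ge (measurable_band_ _ _) (sub i (ltn_ord i)) k0).
    by apply: filterS (grad_bounds a0 ab brho) => x h /h/andP[].
  have b1 : \sum_(i < m) beta (r i) (r i.+1) <= n%:R * om * b ^+ n.-1 * (Z a - Z b).
    apply: (@le_trans _ _ (\sum_(i < m) n%:R * om * b ^+ n.-1 * (Z (r i) - Z (r i.+1)))).
      apply: ler_sum => i _; have [h1 h2] := bnd i (ltn_ord i).
      rewrite ler_wpM2r ?subr_ge0 ?Z_noninc//; first by apply: ltW; case: (rP i).
      rewrite ler_pM2l// lerXn2r ?nnegrE ?(ltW (r0 _)) ?(ltW b0)//.
      by rewrite (le_trans _ h2)// ltW//; case: (rP i).
    rewrite -mulr_sumr ler_wpM2l ?mulr_ge0 ?exprn_ge0 ?(ltW om0) ?(ltW b0)//.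
    have -> : \sum_(i < m) (Z (r i) - Z (r i.+1)) = Z (r 0%N) - Z (r m).
      rewrite -(big_mkord xpredT (fun i => Z (r i) - Z (r i.+1))).
      under eq_bigr do rewrite -opprB.
      by rewrite sumrN telescope_sumr// opprB.
    have := Z_noninc a0 r0a; have := Z_noninc (r0 m) rmb; lra.
  rewrite sumrB in hal.
  have := ler_wpM2l k0 hV; lra.
rewrite -(ler_pM2l no) [leRHS]mulrA; apply: le_trans key.
rewrite [leLHS](_ : _ = kap a b * (om * (n%:R * a ^+ n.-1 * (b - a)))); last by ring.
apply: ler_wpM2l => //; rewrite ler_pM2l//.
exact: pow_diff_ge (ltW a0) (ltW ab).
Qed.

Lemma Z_gt0 a : 0 < a -> a < rho -> 0 < Z a.
Proof.
move=> a0 ar; have := drop_lo a0 ar (lexx _); rewrite Z_rho subr0.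
have : 0 < kap a rho * (a ^+ n.-1 * (rho - a)).
  by rewrite !mulr_gt0 ?exprn_gt0 ?subr_gt0// kap_gt0// ltW.
move=> h1 h2; have := lt_le_trans h1 h2.
by rewrite pmulr_rgt0// exprn_gt0.
Qed.

(** The set {0 < W} has measure at most om rho^n, of which the band between a and rho takes exactly
    om (rho^n - a^n). *)
Lemma level_ge a : 0 < a -> a < rho -> mu [set x | Z a <= W x] = (om * a ^+ n)%:E.
Proof.
move=> a0 ar; apply/eqP; rewrite eq_le closed_level_ge ?Z_gt0// andbT.
have U_ : mu [set x | 0 < W x] = (mu (band a rho) + mu [set x | (Z a <= W x)%R])%E.
  rewrite -measureU; [|exact: measurable_band_|exact: mWge|].
    congr (mu _); apply/seteqP; split => x /=; rewrite /band/= Z_rho.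
      by move=> h; have [ZW|WZ] := leP (Z a) (W x); [right|left; rewrite h].
    by case=> [/andP[]//|]; apply: lt_le_trans; exact: Z_gt0.
  apply/seteqP; split => // x [/= /andP[_ h]]; rewrite leNgt h//.
have h0 : (mu [set x | (0 < W x)%R] <= (om * rho ^+ n)%:E)%E.
  by have := dist_prof Dfin mW WD rho0; rewrite Z_rho.
have bm := band_measure a0 ar (lexx _).
have bE : mu (band a rho) = (om * (rho ^+ n - a ^+ n))%:E.
  by rewrite -bm fineK// ge0_fin_numE ?measure_ge0// band_fin.
rewrite U_ bE in h0; rewrite -(@leeD2lE _ (om * (rho ^+ n - a ^+ n))%:E)//.
by apply: (le_trans h0); rewrite -EFinD lee_fin; lra.
Qed.

Lemma level_gt a : 0 < a -> a < rho -> mu [set x | Z a < W x] = (om * a ^+ n)%:E.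
Proof.
move=> a0 ar; have a2 : 0 < a / 2 by lra.
have a2a : a / 2 < a by lra.
apply/eqP; rewrite eq_le (dist_prof Dfin mW WD a0)/=.
have bm := band_measure a2 a2a (ltW ar).
have bE : mu (band (a / 2) a) = (om * (a ^+ n - (a / 2) ^+ n))%:E.
  by rewrite -bm fineK// ge0_fin_numE ?measure_ge0// band_fin.
have -> : (om * a ^+ n)%:E = (mu (band (a / 2)%R a) + mu [set x | (Z (a / 2) <= W x)%R])%E.
  by rewrite bE level_ge ?(lt_trans a2a)// -EFinD; congr EFin; ring.
rewrite -measureU; [|exact: measurable_band_|exact: mWge|].
  apply: le_lebesgue_outer => x [/= /andP[]//|/=]; apply: lt_le_trans.
  have := drop_lo a2 a2a (ltW ar).
  have : 0 < kap (a / 2) a * ((a / 2) ^+ n.-1 * (a - a / 2)).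
    rewrite !mulr_gt0 ?exprn_gt0 ?subr_gt0// kap_gt0// ltW//; exact: lt_trans ar.
  move=> h1 h2; have := lt_le_trans h1 h2.
  by rewrite pmulr_rgt0 ?exprn_gt0// subr_gt0.
by apply/seteqP; split => // x [/= /andP[_ h]]; rewrite leNgt h.
Qed.

Lemma level_null a : 0 < a -> a < rho -> mu [set x | W x = Z a] = 0%E.
Proof.
move=> a0 ar.
have -> : [set x | W x = Z a] = [set x | Z a <= W x] `\` [set x | Z a < W x].
  apply/seteqP; split => x /=; first by move=> ->; rewrite lexx ltxx.
  by move=> [h1 /negP]; rewrite -leNgt => h2; apply/le_anti; rewrite h1 h2.
rewrite measureD; [|exact: mWge|exact: (measurable_gt mW)|exact: le_lt_trans (lee_eq (level_ge a0 ar)) (ltry _)].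
rewrite setIidr; last by move=> x; exact: ltW.
have -> : (mu [set x | (Z a <= W x)%R] - mu [set x | (Z a < W x)%R] = 0)%E.
  by rewrite level_ge// level_gt// subee.
by [].
Qed.

Lemma M_growth a r r' : 0 < a -> a <= r -> r <= r' -> r' <= rho ->
  M r' <= M r + Fs a * (om * (r' ^+ n - r ^+ n)).
Proof.
move=> a0 ar rr' r'rho.
have r0 : 0 < r by exact: lt_le_trans ar.
have r'0 : 0 < r' by exact: lt_le_trans rr'.
have Fa : 0 <= Fs a by exact: prof_ge0.
rewrite -lee_fin EFinD -!Mfin//; last exact: le_trans r'rho.
have mS := measurable_shell r r' : measurable (shell r r' : set V).
have sub : eball (0 : V) r `<=` eball 0 r' by move=> x xr; exact: lt_le_trans xr rr'.
have -> : eball (0 : V) r' = eball 0 r `|` shell r r' by rewrite setDUK.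
rewrite ge0_integral_setU; last 5 first.
- exact: mball.
- exact: mS.
- by apply/measurable_EFinP; exact: measurable_funTS mF.
- by move=> x _; rewrite lee_fin.
- by apply/disj_setPS => x [h1 [_ h2]].
rewrite leeD2l//.
have vS : mu (shell r r') = (om * (r' ^+ n - r ^+ n))%:E.
  rewrite /shell measureD; [|exact: mball|exact: mball|exact: lebesgue_eball_lty].
  rewrite setIidr; last exact: sub.
  rewrite mulrBr EFinB; congr (_ - _)%E; exact: lebesgue_eball.
rewrite EFinM -vS -integral_cst; last exact: mS.
apply: (int_leD mu mS (f := fun x => Fs (enorm x)) (g := fun=> Fs a)).
- exact: measurable_funTS mF.
- exact: measurable_cst.
- exact: F0.
move=> x [_]; rewrite /eball /= subr0 => /negP; rewrite -leNgt => rx.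
by apply: (prof_noninc Dfin mU UD a0); exact: le_trans rx.
Qed.

(** The ratio of the (p-1)-th powers of [kmax] and [kap] is (M r' / M r) (r' / r)^n, which has n + 1
    factors bounded by x. *)
Lemma kmax_kap r r' x : 0 < r -> r < r' -> r' <= rho -> 1 <= x ->
  M r' <= M r * x -> r' <= r * x ->
  kmax r r' <= kap r r' * (x ^+ n.+1) `^ (p - 1)^-1.
Proof.
move=> r0 rr' r'rho x1 Mx rx; have r'0 : 0 < r' by exact: lt_trans rr'.
have x0 : 0 <= x by exact: le_trans x1.
rewrite /kap -powRM; [|exact: frac_ge0|exact: exprn_ge0].
apply: powq; first by rewrite divr_ge0 ?M_ge0 ?ltW ?den_gt0.
rewrite ler_pdivrMr ?den_gt0//; apply: (le_trans Mx).
have rn : r ^+ n = r * r ^+ n.-1 by rewrite -exprS prednK.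
have dn : r' ^+ n != 0 by rewrite expf_neq0// gt_eqF.
have non : n%:R * om != 0 by rewrite gt_eqF// mulr_gt0.
have E1 : M r * r / (n%:R * om * r' ^+ n) * x ^+ n.+1 * (n%:R * om * r ^+ n.-1) =
    M r * x * ((r * x) ^+ n / r' ^+ n).
  rewrite exprMn rn exprS; move: (n%:R * om) non => no non.
  move: (fine _) (r ^+ n.-1) (x ^+ n) (r' ^+ n) dn => m1 a1 a2 a3 d3.
  by field; rewrite d3 non.
rewrite E1 -[leLHS]mulr1 ler_wpM2l ?mulr_ge0 ?M_ge0//.
rewrite ler_pdivlMr ?exprn_gt0// mul1r lerXn2r ?nnegrE ?(ltW r'0)//.
by rewrite mulr_ge0// ltW.
Qed.

(** The total exponent of x is K = (n+1)/(p-1) + (n-1); with x = th^(-1/(2K)) the product equals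
    th^(1/2) < 1. *)
Let exists_x th : 0 < th < 1 -> exists2 x, 1 < x &
  th * ((x ^+ n.+1) `^ (p - 1)^-1 * x ^+ n.-1) < 1.
Proof.
move=> /andP[t0 t1]; pose K : R := n.+1%:R * (p - 1)^-1 + n.-1%:R.
have K0 : 0 < K by rewrite ltr_pwDl// mulr_gt0// invr_gt0.
have c0 : 0 < (2 * K)^-1 by rewrite invr_gt0 mulr_gt0.
have pos : 0 < th `^ (- (2 * K)^-1) by exact: powR_gt0.
have lt1 c : 0 < c -> th `^ c < 1.
  move=> c0'; have := @gt0_ltr_powR _ c c0' th 1.
  by rewrite !nnegrE ltW// ler01 powR1; apply.
set y := th `^ _ in pos; have y0 := ltW pos.
have thn : th != 0 by rewrite gt_eqF.
exists y; first by rewrite /y powRN invf_gt1 ?powR_gt0// lt1.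
have -> : (y ^+ n.+1) `^ (p - 1)^-1 = th `^ (- (2 * K)^-1 * n.+1%:R * (p - 1)^-1).
  by rewrite -powR_mulrn// /y -!powRrM !mulrA.
have -> : y ^+ n.-1 = th `^ (- (2 * K)^-1 * n.-1%:R).
  by rewrite -powR_mulrn// /y -powRrM.
rewrite -powRD ?thn ?implybT// -mulrA -mulrDr -/K.
have -> : - (2 * K)^-1 * K = - 2^-1 by field; rewrite gt_eqF.
have s1 : th `^ 2^-1 < 1 by rewrite lt1 ?invr_gt0.
have ss : th = th `^ 2^-1 * th `^ 2^-1.
  rewrite -powRD ?thn ?implybT//.
  by rewrite [X in _ `^ X](_ : _ = 1) ?powRr1 ?(ltW t0)//; field.
rewrite powRN {1}ss mulfK ?gt_eqF ?powR_gt0//.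
Qed.

(** The translation is split into steps of length th0 d, one for each shell of width d, with th0 <
    1. On a short band the truncation of [W] is Lipschitz with constant [kmax], while [Z] drops by
    at least about [kap] d. As th0 leaves room for the ratio of the two, one step cannot lead from
    {W >= Z r} across the whole next band, since the truncation would jump by the full drop. *)
Lemma chain a b (h : V) : 0 < a -> a < b -> b < rho -> enorm h < b - a ->
  {ae mu, forall x, Z a <= W x -> Z b <= W (x + h)}.
Proof.
move=> a0 ab brho hab.
have ba0 : 0 < b - a by rewrite subr_gt0.
have b0 : 0 < b by exact: lt_trans ab.
have arho : a < rho by exact: lt_trans brho.
pose th0 := enorm h / (b - a).
have th00 : 0 <= th0 by rewrite divr_ge0 ?enorm_ge0 ?ltW.
have th01 : th0 < 1 by rewrite ltr_pdivrMr// mul1r.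
pose th := (1 + th0) / 2.
have th_ : 0 < th < 1 by apply/andP; split; rewrite /th; lra.
have th0th : th0 <= th by rewrite /th; lra.
have [x x1 hx] := exists_x th_.
have x0 : 0 < x by exact: lt_trans x1.
pose C := Fs a * om * (n%:R * b ^+ n.-1).
have C0 : 0 < C by rewrite !mulr_gt0 ?exprn_gt0// F_gt0.
have Ma : 0 < M a by apply: M_gt0 => //; exact: ltW.
have x10 : 0 < x - 1 by rewrite subr_gt0.
(* The two bounds on the width d ensure that the radius and the mass [M] grow at most by the factor
   x over one step; C bounds the growth rate of [M] on [a, b]. *)
pose w := Num.min ((x - 1) * a) ((x - 1) * M a / C).
have w0 : 0 < w by rewrite lt_min mulr_gt0//= divr_gt0// mulr_gt0.
have [N] := ltr_add_invr (divr_gt0 w0 ba0); rewrite add0r ltr_pdivlMr// => hN.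
pose d := (b - a) / N.+1%:R.
have d0 : 0 < d by rewrite divr_gt0.
have dw : d < w by rewrite /d mulrC.
have [dw1 dw2] : d < (x - 1) * a /\ d < (x - 1) * M a / C.
  by move: dw; rewrite lt_min => /andP[].
pose r (l : nat) : R := a + l%:R * d.
have r0E : r 0%N = a by rewrite /r mul0r addr0.
have rN : r N.+1 = b by rewrite /r /d mulrC divfK// addrC subrK.
have rS l : r l.+1 = r l + d by rewrite /r -natr1 mulrDl mul1r addrA.
have ra l : a <= r l by rewrite lerDl mulr_ge0 ?(ltW d0).
have rb l : (l <= N.+1)%N -> r l <= b.
  by move=> lN; rewrite -rN /r lerD2l ler_pM2r// ler_nat.
have r0 l : 0 < r l by exact: lt_le_trans (ra l).
pose h' : V := N.+1%:R^-1 *: h.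
have eh' : enorm h' = th0 * d.
  rewrite /h' enormZ ger0_norm ?invr_ge0// /th0 /d.
  by field; rewrite gt_eqF//= ?gt_eqF.
have step l : (l <= N)%N -> kmax (r l) (r l.+1) * enorm h' < Z (r l) - Z (r l.+1).
  move=> lN; have rlS : r l < r l.+1 by rewrite rS ltrDl.
  have rlb : r l.+1 <= b by exact: rb.
  have rlrho : r l.+1 <= rho by apply: le_trans rlb (ltW brho).
  have lr : r l.+1 <= r l * x.
    rewrite rS -lerBrDl.
    have : (x - 1) * a <= (x - 1) * r l by rewrite ler_pM2l.
    lra.
  have lM : M (r l.+1) <= M (r l) * x.
    apply: (le_trans (M_growth a0 (ra l) (ltW rlS) rlrho)).
    have Ml : M a <= M (r l).
      by apply: M_mono => //; apply: le_trans rlrho; exact: ltW.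
    have pd := pow_diff_le n (ltW (r0 l)) (ltW rlS).
    have e1 : r l.+1 ^+ n - r l ^+ n <= n%:R * b ^+ n.-1 * d.
      have dd : r l.+1 - r l = d by rewrite rS addrAC subrr add0r.
      apply: (le_trans pd); rewrite dd ler_pM2r// ler_pM2l//.
      by rewrite lerXn2r ?nnegrE ?(ltW (r0 _)) ?(ltW b0).
    have Fo : 0 < Fs a * om by rewrite mulr_gt0// F_gt0.
    have e2 : Fs a * (om * (r l.+1 ^+ n - r l ^+ n)) <= C * d.
      by rewrite mulrA /C -[leRHS]mulrA ler_pM2l.
    have e3 : C * d <= (x - 1) * M a by rewrite mulrC -ler_pdivlMr// ltW.
    have e4 : (x - 1) * M a <= (x - 1) * M (r l) by rewrite ler_pM2l.
    lra.
  have kk := kmax_kap (r0 l) rlS rlrho (ltW x1) lM lr.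
  have kp : 0 < kap (r l) (r l.+1).
    by apply: kap_gt0 => //; apply: le_trans rlrho; exact: ltW.
  have dl := drop_lo (r0 l) rlS rlrho.
  have dd : r l.+1 - r l = d by rewrite rS addrAC subrr add0r.
  rewrite dd in dl.
  set Q := (x ^+ n.+1) `^ _ in hx kk.
  have Q0 : 0 <= Q by exact: powR_ge0.
  have rn : 0 < r l.+1 ^+ n.-1 by rewrite exprn_gt0.
  rewrite -(ltr_pM2l rn); apply: lt_le_trans dl.
  rewrite eh'.
  apply: (@le_lt_trans _ _ ((r l * x) ^+ n.-1 * (kap (r l) (r l.+1) * Q * (th * d)))).
    have t0d : 0 <= th0 * d by rewrite mulr_ge0// ltW.
    have km0 : 0 <= kmax (r l) (r l.+1) by exact: powR_ge0.
    apply: ler_pM.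
    - by rewrite exprn_ge0// ltW.
    - exact: mulr_ge0.
    - by rewrite lerXn2r ?nnegrE ?(ltW (r0 _))// mulr_ge0 ?(ltW (r0 _)) ?(ltW x0).
    - apply: ler_pM => //; first by rewrite ler_pM2r.
  rewrite exprMn.
  rewrite [ltLHS](_ : _ = kap (r l) (r l.+1) * (r l ^+ n.-1 * d) * (th * (Q * x ^+ n.-1))); last by ring.
  by rewrite gtr_pMr// !mulr_gt0 ?exprn_gt0.
have inc l : (l <= N)%N -> {ae mu, forall y,
    `|clamp (Z (r l.+1)) (Z (r l)) (W (y + h')) - clamp (Z (r l.+1)) (Z (r l)) (W y)| <=
    kmax (r l) (r l.+1) * enorm h'}.
  move=> lN; have rlS : r l < r l.+1 by rewrite rS ltrDl.
  have rlb : r l.+1 <= b by exact: rb.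
  have rlrho : r l.+1 <= rho by apply: le_trans rlb (ltW brho).
  have K0 := kmax_gt0 (r0 l) (r0 l.+1) rlrho.
  have zz : Z (r l.+1) < Z (r l).
    by rewrite -subr_gt0; apply: le_lt_trans (step l lN); rewrite mulr_ge0 ?enorm_ge0 ?ltW.
  apply: (limit_defect WG h' (prof_ge0 W (r l.+1)) zz (ltW K0)).
  (* [limit_defect] asks for the gradient bound on the closed band and [grad_bounds] gives it on the
     open one; the two end levels are null by [level_null]. *)
  have nul t : mu [set y | W y = t] = 0%E -> {ae mu, forall y, W y <> t}.
    move=> mt; exists [set y | W y = t]; split => //; first exact: measurable_null.
    by move=> y /= /contrapT.
  have n1_ := nul _ (level_null (r0 l.+1) (le_lt_trans rlb brho)).
  have n2_ := nul _ (level_null (r0 l) (lt_trans rlS (le_lt_trans rlb brho))).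
  move: (grad_bounds (r0 l) rlS rlrho) n1_ n2_; apply: filterS3 => y hy ne1 ne2 /andP[y1 y2].
  suff : band (r l) (r l.+1) y by move=> /hy/andP[].
  apply/andP; split; rewrite lt_neqAle ?y1 ?y2 ?andbT; apply/eqP.
    by move=> e1; apply: ne1.
  exact: ne2.
have all_l : {ae mu, forall y, forall l, (l <= N)%N ->
    `|clamp (Z (r l.+1)) (Z (r l)) (W (y + l%:R *: h' + h')) -
      clamp (Z (r l.+1)) (Z (r l)) (W (y + l%:R *: h'))| <= kmax (r l) (r l.+1) * enorm h'}.
  apply/ae_foralln => l; have [lN|lN] := leqP l N; last by apply: aeW => y.
  by move: (ae_translate (l%:R *: h') (inc l lN)); apply: filterS => y hy _.
move: all_l; apply: filterS => y hy Wa.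
have ind l : (l <= N.+1)%N -> Z (r l) <= W (y + l%:R *: h').
  elim: l => [|l ih] lN; first by rewrite scale0r addr0 r0E.
  have lN' : (l <= N)%N by [].
  have rlS : r l < r l.+1 by rewrite rS ltrDl.
  have zz : Z (r l.+1) <= Z (r l) by apply: Z_noninc => //; exact: ltW.
  have := hy l lN'; rewrite (clamp_hi zz (ih (ltnW lN))) => hc.
  have yE : y + l.+1%:R *: h' = y + l%:R *: h' + h' by rewrite -natr1 scalerDl scale1r addrA.
  rewrite yE leNgt; apply/negP => Wl; move: hc; rewrite (clamp_lo zz (ltW Wl)) sub0r normrN.
  by rewrite ger0_norm ?subr_ge0// leNgt step.
have := ind N.+1 (leqnn _); rewrite rN.
by rewrite /h' scalerA divff ?scale1r.
Qed.

End deficit.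

(** * Concentric level sets *)

Section steinhaus.
Context (R : realType) (n : nat).
Hypothesis n0 : (0 < n)%N.
Local Notation V := 'rV[R]_n.
Local Notation mu := (@lebesgue R n).
Local Notation om := (unit_ball_volume R n).

Lemma open_obox (q : V * V) : open (obox q).
Proof.
apply/open_eballP => x xq.
pose d := \big[Num.min/1]_i Num.min (x ord0 i - q.1 ord0 i) (q.2 ord0 i - x ord0 i).
exists d.
  rewrite /d; elim/big_ind: _ => // [a b a0 b0|i _]; first by rewrite lt_min a0 b0.
  by rewrite lt_min !subr_gt0; exact: xq.
move=> y xy i; have di : d <= Num.min (x ord0 i - q.1 ord0 i) (q.2 ord0 i - x ord0 i).
  exact: bigmin_le.
have := coord_le_enorm (y - x) i; rewrite !mxE => h.
have := lt_le_trans (le_lt_trans h xy) di; rewrite lt_min ltr_norml -ltr_norml => /andP[].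
by rewrite !ltr_norml => /andP[h1 h2] /andP[h3 h4]; apply/andP; split; lra.
Qed.

Lemma measurable_cbox (q : V * V) : measurable (box (Some q)).
Proof.
have -> : box (Some q) = \bigcap_(i in [set: 'I_n])
    ([set x : V | x ord0 i <= q.2 ord0 i] `\` [set x : V | x ord0 i < q.1 ord0 i]).
  apply/seteqP; split => x /= h i.
    by move=> _; have /andP[h1 h2] := h i; split => //; apply/negP; rewrite -leNgt.
  by have [//|h1 /negP] := h i; rewrite -leNgt h1 andbT.
apply: fin_bigcap_measurable => // i _; apply: measurableD.
  exact: measurable_halfspace.
exact: measurable_coord_lt.
Qed.

Lemma box_obox_null (q : V * V) : mu (box (Some q) `\` obox q) = 0%E.
Proof.
have mo : measurable (obox q) by apply: measurable_open; exact: open_obox.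
have mb : measurable (box (Some q)) by exact: measurable_cbox.
have bE : mu (box (Some q)) = (bvol q)%:E by case: q {mo mb} => a b; rewrite lebesgue_box.
apply/eqP; rewrite eq_le lebesgue_outer_ge0 andbT.
have [nd|nd] := boolP (ndg q); last first.
  have <- : mu (box (Some q)) = 0%E by rewrite bE bvol_ndg0.
  by apply: le_lebesgue_outer => x [].
have sub : obox q `<=` box (Some q).
  by move=> x xq i; have /andP[h1 h2] := xq i; rewrite !ltW.
rewrite [X in (X <= _)%E]measureD//; last by rewrite [X in (X < _)%E]bE ltry.
rewrite setIidr// leeBlDr ?add0e; last first.
  rewrite ge0_fin_numE; last exact: measure_ge0.
  by apply: (le_lt_trans (le_lebesgue_outer sub)); rewrite [X in (X < _)%E]bE ltry.
rewrite [X in (X <= _)%E]bE; exact: lebesgue_obox_ge.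
Qed.

(** The closed boxes of an almost optimal cover are replaced by their interiors; their boundaries
    are null, so [A] is still covered up to a null set. *)
Lemma outer_open (A : set V) (m e : R) : mu A = m%:E -> 0 < e ->
  exists2 O, open O & mu (A `\` O) = 0%E /\ (mu O <= (m + e)%:E)%E.
Proof.
move=> Am e0.
have fin : lebesgue_outer A \is a fin_num by rewrite -[lebesgue_outer A]/(mu A) Am.
have [_ [F AF <-] hF] := lb_ereal_inf_adherent e0 fin.
pose Ok k := if F k is Some q then obox q else set0.
exists (\bigcup_k Ok k).
  by apply: bigcup_open => k _; rewrite /Ok; case: (F k) => [q|]; [exact: open_obox|exact: open0].
split.
  apply/eqP; rewrite eq_le lebesgue_outer_ge0 andbT.
  pose Nk k := box (F k) `\` Ok k.
  have Nk0 k : mu (Nk k) = 0%E.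
    by rewrite /Nk /Ok; case: (F k) => [q|]; [exact: box_obox_null|rewrite set0D measure0].
  apply: (@le_trans _ _ (mu (\bigcup_k Nk k))).
    apply: le_lebesgue_outer => x [Ax nO]; have [k _ xk] := AF x Ax.
    by exists k => //; split => // xO; apply: nO; exists k.
  apply: (le_trans (lebesgue_outer_sigma_subadditive Nk)).
  by rewrite eseries0// => k _ _; exact: Nk0.
apply: (@le_trans _ _ (\sum_(k <oo) box_vol (F k))%E).
  apply: ereal_inf_lbound; exists F => // x [k _]; rewrite /Ok.
  case Fk : (F k) => [q|//] xq; exists k => //; rewrite Fk => i.
  by have /andP[h1 h2] := xq i; rewrite !ltW.
by rewrite EFinD; apply: ltW; move: hF; rewrite -Am.
Qed.

Lemma gcell_disj k (j j' : gidx n k) (x : V) : gcell j x -> gcell j' x -> j = j'.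
Proof.
move=> h h'; apply/ffunP => i; apply/val_inj.
have K0 : 0 < k.+1%:R :> R by rewrite ltr0n.
have := h i; have := h' i; rewrite !mxE => /andP[a b] /andP[c d].
have [||//] := ltngtP (j i) (j' i); rewrite -(ler_nat R) => hlt; exfalso.
  have : (j i).+1%:R / k.+1%:R <= (j' i)%:R / k.+1%:R :> R by rewrite ler_pM2r ?invr_gt0.
  move: b c a d; generalize ((j i).+1%:R / k.+1%:R : R) ((j' i)%:R / k.+1%:R : R) => u v; lra.
have : (j' i).+1%:R / k.+1%:R <= (j i)%:R / k.+1%:R :> R by rewrite ler_pM2r ?invr_gt0.
move: b c a d; generalize ((j' i).+1%:R / k.+1%:R : R) ((j i)%:R / k.+1%:R : R) => u v; lra.
Qed.

(** If [A] filled at most half of every cell inside an open set [O] of measure at most 5m/4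
    containing almost all of [A], with the cells missing less than m/4 of [O], then [A] would have
    measure below 3m/4. All large [k] are needed so that two sets can share one grid. *)
Lemma dense_cell (A : set V) (m : R) : measurable A -> mu A = m%:E -> 0 < m ->
  exists k0, forall k, (k0 <= k)%N -> exists j : gidx n k,
    (mu (gcell j) < mu (A `&` gcell j) + mu (A `&` gcell j))%E.
Proof.
move=> mA Am m0; have m4 : 0 < m / 4 by rewrite divr_gt0.
have [/= O oO [AO hO]] := outer_open Am m4.
have mO := measurable_open oO.
have Ofin : (mu O < +oo)%E by exact: le_lt_trans hO (ltry _).
have OE : mu O = (fine (mu O))%:E by rewrite fineK// ge0_fin_numE// measure_ge0.
have [k0 hk0] : exists N, forall k, (N <= k)%N ->
    ((fine (mu O) - m / 4)%:E < \int[mu]_x (\1_(ginner O k) x)%:E)%E.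
  apply: (@int_liminf_gt _ _ _ mu (fun k => \1_(ginner O k)) (\1_O)).
  - by move=> k; apply: measurable_indic; exact: measurable_ginner.
  - exact: measurable_indic.
  - by move=> k x; rewrite indicE.
  - by move=> x; rewrite indicE.
  - by rewrite integral_indic// setIT.
  - apply: aeW => x dl dl0; have [xO|xO] := pselect (O x); last first.
      by exists 0%N => k _; rewrite indicE memNset// addr_ge0// ltW.
    have [N hN] := ginner_ex oO xO; exists N => k /hN xk.
    by rewrite !indicE !mem_set// lerDl ltW.
  - by rewrite integral_indic// setIT [X in (_ < X)%E]OE lte_fin gtrBl.
exists k0 => k /hk0; rewrite integral_indic; [|exact: measurableT|exact: measurable_ginner].
rewrite setIT => hk; apply: contrapT => nex.
have mcell (j : gidx n k) : measurable (gcell j : set V) by exact: measurable_gcell.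
have half (j : gidx n k) : (mu (A `&` gcell j) + mu (A `&` gcell j) <= mu (gcell j))%E.
  by rewrite leNgt; apply/negP => h; apply: nex; exists j.
pose J := [set j : gidx n k | gcell j `<=` O].
have fJ : finite_set J by exact: finite_finset.
have tJ : trivIset J (fun j => gcell j : set V).
  by move=> j j' _ _ [x [h h']]; exact: gcell_disj h h'.
have tJ' : trivIset J (fun j => A `&` gcell j).
  by move=> j j' _ _ [x [[_ h] [_ h']]]; exact: gcell_disj h h'.
have e1 : mu (ginner O k) = (\sum_(j \in J) mu (gcell j))%E.
  by rewrite -measure_fin_bigcup.
have e2 : mu (A `&` ginner O k) = (\sum_(j \in J) mu (A `&` gcell j))%E.
  rewrite -measure_fin_bigcup//; first by rewrite setI_bigcupr.
  by move=> j _; exact: measurableI.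
have hh : (mu (A `&` ginner O k) + mu (A `&` ginner O k) <= mu (ginner O k))%E.
  rewrite e1 e2 -fsbig_split//=; apply: lee_fsum => // j _; exact: half.
have mI : measurable (ginner O k) by exact: measurable_ginner.
have Isub : ginner O k `<=` O by exact: ginner_sub.
have Ifin : (mu (ginner O k) < +oo)%E by apply: le_lt_trans Ofin; exact: le_lebesgue_outer.
have IE : mu (ginner O k) = (fine (mu (ginner O k)))%:E by rewrite fineK// ge0_fin_numE// measure_ge0.
have AIfin : (mu (A `&` ginner O k) < +oo)%E.
  by apply: le_lt_trans Ifin; apply: le_lebesgue_outer => x [].
have AIE : mu (A `&` ginner O k) = (fine (mu (A `&` ginner O k)))%:E.
  by rewrite fineK// ge0_fin_numE// measure_ge0.
have rest : mu (O `\` ginner O k) = (fine (mu O) - fine (mu (ginner O k)))%:E.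
  by rewrite measureD// setIidr// EFinB -OE -IE.
have cover : (mu A <= mu (A `&` ginner O k) + mu (O `\` ginner O k))%E.
  apply: (@le_trans _ _ (mu ((A `&` ginner O k) `|` (O `\` ginner O k)))).
    apply: (le_mu_null AO) => x Ax.
    have [xO|xO] := pselect (O x); [left|by right].
    by have [xI|xI] := pselect (ginner O k x); [left|right].
  exact: (outer_measureU2 (@lebesgue_outer R n)).
move: cover; rewrite [X in (X <= _)%E]Am rest AIE -EFinD lee_fin => c1.
move: hh; rewrite AIE [X in (_ <= X)%E]IE -EFinD lee_fin => c2.
move: hk; rewrite [X in (_ < X)%E]IE lte_fin => c3.
move: hO; rewrite OE lee_fin; lra.
Qed.

(** [h] translates a cell more than half filled by [A] onto a cell of the same grid more than half
    filled by [N]; two subsets that each fill more than half of a cell overlap in positive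
    measure. *)
Lemma steinhaus (A N : set V) (a b : R) : measurable A -> measurable N ->
  mu A = a%:E -> mu N = b%:E -> 0 < a -> 0 < b ->
  exists h : V, (0 < mu [set x | A x /\ N (x + h)%R])%E.
Proof.
move=> mA mN Aa Nb a0 b0.
have [k1 h1] := dense_cell mA Aa a0.
have [k2 h2] := dense_cell mN Nb b0.
pose k := maxn k1 k2.
have [j hj] := h1 k (leq_maxl _ _).
have [j' hj'] := h2 k (leq_maxr _ _).
pose h : V := glo R j' - glo R j.
have K0 : 0 < k.+1%:R :> R by rewrite ltr0n.
have cellE x : gcell j x <-> gcell j' (x + h).
  have E (q : gidx n k) i : ghi R q ord0 i = glo R q ord0 i + k.+1%:R^-1.
    by rewrite !mxE -[(q i).+1%:R]natr1 mulrDl mul1r addrAC.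
  have xhE i : (x + h) ord0 i = x ord0 i + (glo R j' ord0 i - glo R j ord0 i).
    by rewrite [LHS]mxE /h [X in _ + X]mxE [X in _ + (_ + X)]mxE.
  split => hx i; have := hx i; rewrite !E !xhE; move: (glo R j ord0 i) (glo R j' ord0 i) => u v;
    move: (_^-1) => d /andP[c c']; apply/andP; split; lra.
have preN : (fun x => x + h) @^-1` (N `&` gcell j') = [set x | N (x + h) /\ gcell j x].
  apply/seteqP; split => x /= [Nx cx]; split => //; exact/cellE.
have mpre : measurable [set x | N (x + h) /\ gcell j x].
  rewrite -preN -[X in measurable X]setTI; apply: measurable_fun_translate => //.
  by apply: measurableI => //; exact: measurable_gcell.
have preE : mu [set x | N (x + h) /\ gcell j x] = mu (N `&` gcell j').
  by rewrite -preN lebesgue_preimage_translate.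
have cE : mu (gcell j') = mu (gcell j).
  rewrite -(lebesgue_preimage_translate (gcell j') h); congr (mu _).
  by apply/seteqP; split => x /=; [move/cellE|move/cellE].
exists h; rewrite lt_neqAle measure_ge0 andbT; apply/eqP => z0.
have mj : measurable (gcell j : set V) by exact: measurable_gcell.
have cfin : (mu (gcell j) < +oo)%E.
  apply: le_lt_trans (lebesgue_box_fin (glo R j) (ghi R j)).
  by apply: le_lebesgue_outer => x xj i; have /andP[c /ltW d] := xj i; rewrite c d.
have mAj : measurable (A `&` gcell j) by exact: measurableI.
have U_ : (mu (A `&` gcell j) + mu [set x | N (x + h)%R /\ gcell j x] <= mu (gcell j))%E.
  apply: (@le_trans _ _ (mu (A `&` gcell j) + mu ([set x | N (x + h)%R /\ gcell j x] `\` A))%E).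
    rewrite leeD2l//; apply: (le_mu_null (esym z0)) => x [Nx cx].
    by have [Ax|Ax] := pselect (A x); [right|left].
  rewrite -measureU; [|exact: mAj|exact: measurableD|].
    by apply: le_lebesgue_outer => x [[]//|[[]]].
  by apply/seteqP; split => // x [[Ax _] [_ nA]].
move: hj hj' U_; rewrite cE preE.
have fI (S : set V) : mu (S `&` gcell j) = (fine (mu (S `&` gcell j)))%:E.
  rewrite fineK// ge0_fin_numE ?measure_ge0//; apply: le_lt_trans cfin.
  by apply: le_lebesgue_outer => x [].
have fN : mu (N `&` gcell j') = (fine (mu (N `&` gcell j')))%:E.
  rewrite fineK// ge0_fin_numE ?measure_ge0//; apply: le_lt_trans (_ : mu (gcell j') < +oo)%E.
    by apply: le_lebesgue_outer => x [].
  by rewrite cE.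
have fc : mu (gcell j) = (fine (mu (gcell j)))%:E by rewrite fineK// ge0_fin_numE ?measure_ge0.
rewrite (fI A) fN fc -!EFinD !lte_fin lee_fin; lra.
Qed.

End steinhaus.

Section ball_comparison.
Context (R : realType) (n : nat).
Hypothesis n0 : (0 < n)%N.
Local Notation V := 'rV[R]_n.
Local Notation mu := (@lebesgue R n).
Local Notation om := (unit_ball_volume R n).

Lemma ball_exhaust (x0 : V) (S : set V) (r : R) :
  (forall b, 0 < b -> b < r -> mu (eball x0 b `\` S) = 0%E) -> mu (eball x0 r `\` S) = 0%E.
Proof.
move=> step; have [r0|r0] := leP r 0.
  rewrite (_ : _ `\` _ = set0) ?measure0//; apply/seteqP; split => // x [xr _].
  by have := le_lt_trans (enorm_ge0 _) (lt_le_trans xr r0); rewrite ltxx.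
pose c k : R := r / k.+2%:R.
have c0 k : 0 < c k by rewrite divr_gt0.
have cr k : c k < r by rewrite gtr_pMr// invf_lt1 ?ltr1n.
apply/eqP; rewrite eq_le lebesgue_outer_ge0 andbT.
apply: (@le_trans _ _ (mu (\bigcup_k (eball x0 (r - c k) `\` S)))).
  apply: le_lebesgue_outer => x [xr nS].
  have d0 : 0 < r - enorm (x - x0) by rewrite subr_gt0.
  have hk := truncnS_gt (r / (r - enorm (x - x0))).
  set k := Num.truncn _ in hk; exists k => //; split => //; rewrite /eball /= ltrBrDr addrC -ltrBrDr.
  rewrite /c ltr_pdivrMr// mulrC -ltr_pdivrMr//; apply: lt_trans hk _.
  by rewrite ltr_nat.
apply: (le_trans (lebesgue_outer_sigma_subadditive _)).
rewrite eseries0// => k _ _; apply: step; rewrite ?subr_gt0//.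
by rewrite ltrBlDr ltrDl.
Qed.

Lemma null_setD_sym (A B : set V) : measurable A -> measurable B -> (mu B < +oo)%E ->
  mu A = mu B -> mu (A `\` B) = 0%E -> mu (B `\` A) = 0%E.
Proof.
move=> mA mB Bfin AB N0.
have IE : mu (B `&` A) = mu B.
  apply/eqP; rewrite eq_le; apply/andP; split; first by apply: le_lebesgue_outer => x [].
  rewrite -{1}AB; apply: (le_mu_null N0) => x Ax.
  by have [xB|xB] := pselect (B x); [left|right].
rewrite measureD//; rewrite [X in (_ - X)%E]IE subee//.
by rewrite ge0_fin_numE// measure_ge0.
Qed.

Lemma mu_setI_null (A B : set V) : mu (A `\` B) = 0%E -> mu (A `&` B) = mu A.
Proof.
move=> N0; apply/eqP; rewrite eq_le; apply/andP; split; first by apply: le_lebesgue_outer => x [].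
by apply: (le_mu_null N0) => x Ax; have [xB|xB] := pselect (B x); [left|right].
Qed.

Lemma null_setD_trans (A B C : set V) : mu (A `\` B) = 0%E -> mu (B `\` C) = 0%E ->
  mu (A `\` C) = 0%E.
Proof.
move=> AB BC; apply/eqP; rewrite eq_le lebesgue_outer_ge0 andbT -BC.
apply: (le_mu_null AB) => x [Ax nC].
by have [xB|xB] := pselect (B x); [left|right].
Qed.

Lemma null_sub (A B : set V) : A `<=` B -> mu B = 0%E -> mu A = 0%E.
Proof. by move=> AB B0; apply/eqP; rewrite eq_le lebesgue_outer_ge0 andbT -B0 le_lebesgue_outer. Qed.

End ball_comparison.

(** * Existence of a common centre *)

Section center.
Context (R : realType) (n : nat) (rho : R).
Hypotheses (n0 : (0 < n)%N) (rho0 : 0 < rho).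
Local Notation V := 'rV[R]_n.
Local Notation mu := (@lebesgue R n).
Local Notation om := (unit_ball_volume R n).
Variables (D : set V) (A : R -> set V).
Hypothesis bD : bounded_set D.
Hypothesis mA : forall r, 0 < r -> r < rho -> measurable (A r).
Hypothesis AD : forall r, 0 < r -> r < rho -> A r `<=` D.
Hypothesis AE : forall r, 0 < r -> r < rho -> mu (A r) = (om * r ^+ n)%:E.
Hypothesis A_incr : forall r s, 0 < r -> r <= s -> s < rho -> A r `<=` A s.
Hypothesis A_chain : forall a b h, 0 < a -> a < b -> b < rho -> enorm h < b - a ->
  {ae mu, forall x, A a x -> A b (x + h)}.

Lemma mu_setD0_neq0 (S : set V) r : 0 < r -> r < rho -> mu (A r `\` S) = 0%E ->
  A r `&` S !=set0.
Proof.
move=> r0 rrho AS; apply: contrapT => ne.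
have : (mu (A r) <= mu (A r `\` S))%E.
  by apply: le_lebesgue_outer => x Ax; split => // Sx; apply: ne; exists x.
rewrite [X in (_ <= X)%E]AS AE// lee_fin leNgt.
by rewrite mulr_gt0 ?exprn_gt0 ?unit_ball_volume_gt0.
Qed.

(** The sets that contain almost all of some [A a] form a proper filter, which has a cluster point
    because [D] is bounded. If a ball about it met some [A a] in a null set, the complement of the
    ball would belong to the filter. *)
Lemma density_point_ex : exists x0 : V, forall a e, 0 < a -> a < rho -> 0 < e ->
  (0 < mu (A a `&` eball x0 e))%E.
Proof.
pose F : set_system V := [set S | exists2 a, 0 < a < rho & mu (A a `\` S) = 0%E].
have h0 : 0 < rho / 2 by rewrite divr_gt0.
have h1 : rho / 2 < rho by rewrite gtr_pMr// invf_lt1 ?ltr1n.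
have PF : ProperFilter F.
  apply: Build_ProperFilter_ex => [S [a /andP[a0 ar] aS]|].
    by have [x [_ Sx]] := mu_setD0_neq0 a0 ar aS; exists x.
  split.
  - exists (rho / 2); first by rewrite h0.
    by rewrite setDT measure0.
  - move=> S T [a /andP[a0 ar] aS] [b /andP[b0 br] bT].
    have m0 : 0 < Num.min a b by rewrite lt_min a0 b0.
    exists (Num.min a b); first by rewrite m0 gt_min ar.
    apply/eqP; rewrite eq_le lebesgue_outer_ge0 andbT -aS.
    apply: (le_mu_null bT) => x [Ax /not_andP[nS|nT]]; [left|right]; split => //.
      by apply: A_incr Ax => //; rewrite ge_min lexx.
    by apply: A_incr Ax => //; rewrite ge_min lexx orbT.
  - move=> S T ST [a ha aS]; exists a => //.
    apply/eqP; rewrite eq_le lebesgue_outer_ge0 andbT -aS.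
    by apply: le_lebesgue_outer => x [Ax nT]; split => // /ST.
have [M [_ hM]] := bD.
pose K := [set x : V | `|x| <= M + 1].
have cK : compact K.
  apply: bounded_closed_compact.
    exists (M + 1); split; first exact: num_real.
    by move=> y My x /= xK; exact: le_trans xK (ltW My).
  exact: (@closed_comp V R (fun x : V => `|x|) [set y | y <= M + 1]
    (fun x _ => @norm_continuous R V x) (@closed_le R (M + 1))).
have FK : F K.
  exists (rho / 2); first by rewrite h0.
  rewrite (_ : _ `\` _ = set0) ?measure0//; apply/seteqP; split => // x [Ax].
  by apply; apply: (hM (M + 1)); [rewrite ltrDl|exact: AD Ax].
have [x0 [_ clx]] := cK F PF FK.
exists x0 => a e a0 ar e0; rewrite lt_neqAle measure_ge0 andbT; apply/eqP => z0.
have [] := clx (~` eball x0 e) (eball x0 e).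
- by exists a; rewrite ?a0// setDE setCK; exact: esym.
- apply: open_nbhs_nbhs; split; first exact: open_eball.
  by rewrite /eball /= subrr enorm0.
- by move=> x [].
Qed.

(* A set in eball x0 (b - c) `\` A b of positive measure would, by Steinhaus, be
   met by a translate, by less than b - a, of the part of A a near x0: such a
   translate lies in A b. *)
Lemma center_ex : exists x0 : V, forall b, 0 < b -> b < rho ->
  mu (eball x0 b `\` A b) = 0%E.
Proof.
have [x0 hx] := density_point_ex; exists x0 => b b0 brho.
have mAb := mA b0 brho.
have step (c : R) : 0 < c -> c < b -> mu (eball x0 (b - c) `\` A b) = 0%E.
  move=> c0 cb; apply/eqP; rewrite eq_le lebesgue_outer_ge0 andbT leNgt; apply/negP => N0.
  have c20 : 0 < c / 2 by rewrite divr_gt0.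
  have c2c : c / 2 < c by rewrite gtr_pMr// invf_lt1 ?ltr1n.
  have c2b := lt_trans c2c cb; have c2r := lt_trans c2b brho.
  have E0 := hx _ _ c20 c2r c20.
  set E := A (c / 2) `&` _ in E0; set N := _ `\` _ in N0.
  have ball_fin (r : R) (S : set V) : S `<=` eball x0 r -> mu S = (fine (mu S))%:E.
    move=> Sr; rewrite fineK// ge0_fin_numE ?measure_ge0//.
    by apply: le_lt_trans (lebesgue_eball_lty x0 r); exact: le_lebesgue_outer.
  have Ef : mu E = (fine (mu E))%:E by apply: (ball_fin (c / 2)) => x [].
  have Nf : mu N = (fine (mu N))%:E by apply: (ball_fin (b - c)) => x [].
  have mE : measurable E by apply: measurableI; [exact: mA|exact: measurable_eball].
  have mN : measurable N by apply: measurableD => //; exact: measurable_eball.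
  have Ef0 : 0 < fine (mu E) by rewrite -lte_fin -Ef.
  have Nf0 : 0 < fine (mu N) by rewrite -lte_fin -Nf.
  have [h hpos] := steinhaus n0 mE mN Ef Nf Ef0 Nf0.
  have [x [[_ xc] [xb _]]] : [set x | E x /\ N (x + h)] !=set0.
    apply: contrapT => ne; move: hpos; rewrite (_ : [set x | _] = set0) ?measure0 ?ltxx//.
    by apply/seteqP; split => // x hxx; apply: ne; exists x.
  (* x is within c / 2 of x0 and x + h within b - c: this is just the room that [A_chain] allows
     between the radii c / 2 and b. *)
  have hlt : enorm h < b - c / 2.
    have -> : h = (x + h - x0) - (x - x0) by rewrite opprB addrA subrK addrAC subrr add0r.
    apply: le_lt_trans (enormD _ _) _; rewrite enormN; move: xc xb; rewrite /eball /=.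
    move: (enorm _) (enorm _) => u v; lra.
  have /negligible_null ch := A_chain c20 c2b brho hlt.
  move: hpos; rewrite ltNge => /negP; apply; rewrite -ch.
  by apply: le_lebesgue_outer => y [[Ay _] [_ nA]] /(_ Ay).
apply: ball_exhaust => r r0 rb.
by rewrite -(subKr b r); apply: step; rewrite ?subr_gt0 ?ltrBlDr ?ltrDl.
Qed.

End center.

Section prof_translate.
Context (R : realType) (n : nat).
Hypothesis n0 : (0 < n)%N.
Local Notation V := 'rV[R]_n.
Local Notation mu := (@lebesgue R n).
Local Notation om := (unit_ball_volume R n).
Local Notation leb := (@lebesgue_measure R).
Variables (D : set V) (U : V -> R) (x0 : V).
Hypotheses (mD : measurable D) (Dfin : (mu D < +oo)%E) (okU : profile_ok D U).
Hypothesis Ufin : (\int[mu]_(x in D) (U x)%:E < +oo)%E.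
Hypothesis balls : {ae leb, forall t, 0 <= t ->
  mu (eball x0 (rad U t) `\` [set x | t < U x]) = 0%E}.

Let mU : measurable_fun setT U. Proof. by case: okU. Qed.
Let U0 x : 0 <= U x. Proof. by case: okU. Qed.
Let UD x : ~ D x -> U x = 0. Proof. by case: okU => _ _; exact. Qed.

Let P (x : V) := prof U (enorm (x - x0)).

Let mP : measurable_fun setT P.
Proof.
have mt : measurable_fun setT (fun x : V => x - x0) by exact: measurable_fun_translate.
have mp : measurable_fun setT (fun x : V => prof U (enorm x)) := measurable_prof n0 Dfin mU UD.
exact: (measurableT_comp mp mt).
Qed.

Let P0 x : 0 <= P x. Proof. exact: prof_ge0. Qed.

Let m x := Num.min (U x) (P x).

Let mm : measurable_fun setT m. Proof. exact: measurable_minr. Qed.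

Let m0 x : 0 <= m x. Proof. by rewrite le_min U0 P0. Qed.

Let msup (u : V -> R) t : measurable_fun setT u -> measurable [set x | t < u x].
Proof.
move=> mu_; have := mu_ measurableT _ (measurable_itv `]t, +oo[).
by rewrite setTI; congr (measurable _); apply/seteqP; split => x /=; rewrite in_itv/= andbT.
Qed.

Let mdist (u : V -> R) (A : set R) : measurable_fun A (fun t : R => mu [set x | t < u x]).
Proof.
apply: measurable_funTS; apply: nonincreasing_emeasurable => s t st.
by apply: le_lebesgue_outer => x /=; exact: le_lt_trans.
Qed.

Let Psup t : 0 <= t -> mu [set x | t < P x] = (om * rad U t ^+ n)%:E /\
  mu (eball x0 (rad U t) `\` [set x | t < P x]) = 0%E.
Proof.
move=> t0; have pt : mu [set x0] = 0%E by exact: lebesgue_point.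
have e1 : mu (eball x0 (rad U t)) = (om * rad U t ^+ n)%:E.
  have [r0|r0] := ltP 0 (rad U t); first exact: lebesgue_eball.
  have -> : rad U t = 0 by apply/eqP; rewrite eq_le r0 rad_ge0.
  rewrite expr0n gtn_eqF// mulr0 (_ : eball x0 0 = set0) ?measure0//.
  by apply/seteqP; split => // x; rewrite /eball /= ltNge enorm_ge0.
have h x : x != x0 -> (t < P x) = (enorm (x - x0) < rad U t).
  by move=> xx0; rewrite /P (prof_rad n0 Dfin mU UD)// gt_enorm// subr_eq0.
have sub1 : eball x0 (rad U t) `<=` [set x | t < P x] `|` [set x0].
  by move=> x xr; have [->|xx0] := eqVneq x x0; [right|left; rewrite /= h].
have sub2 : [set x | t < P x] `<=` eball x0 (rad U t) `|` [set x0].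
  by move=> x /= xr; have [->|xx0] := eqVneq x x0; [right|left; rewrite /eball/= -h].
split.
  rewrite -e1; apply/eqP; rewrite eq_le; apply/andP; split.
    exact: (le_mu_null pt).
  exact: (le_mu_null pt).
by apply: null_sub pt => x [xr nx]; have [//|] := sub1 x xr.
Qed.

Let dists : {ae leb, forall t, 0 <= t -> mu [set x | t < m x] = (om * rad U t ^+ n)%:E}.
Proof.
move: balls; apply: (@filterS _ _ (ae_filter_ringOfSetsType leb)) => t ht t0; move/(_ t0): ht => ht.
have [Pm Pb] := Psup t0.
have Um : mu [set x | t < U x] = (om * rad U t ^+ n)%:E := radE n0 Dfin UD t0.
have mPt := msup t mP; have mUt := msup t mU; have mBt := @measurable_eball R n x0 (rad U t).
have e1 : mu (eball x0 (rad U t)) = (om * rad U t ^+ n)%:E.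
  have [r0|r0] := ltP 0 (rad U t); first exact: lebesgue_eball.
  have -> : rad U t = 0 by apply/eqP; rewrite eq_le r0 rad_ge0.
  rewrite expr0n gtn_eqF// mulr0 (_ : eball x0 0 = set0) ?measure0//.
  by apply/seteqP; split => // x; rewrite /eball /= ltNge enorm_ge0.
have Pfin : (mu [set x | (t < P x)%R] < +oo)%E by rewrite [X in (X < _)%E]Pm ltry.
have PB := null_setD_sym mBt mPt Pfin (etrans e1 (esym Pm)) Pb.
have PU := null_setD_trans PB ht.
rewrite -Pm -(mu_setI_null PU); congr (mu _).
by apply/seteqP; split => x /=; rewrite lt_min; [move=> /andP[]|case=> -> ->].
Qed.

Let cake (u : V -> R) : measurable_fun setT u -> (forall x, 0 <= u x) ->
  {ae leb, forall t, 0 <= t -> mu [set x | t < u x] = (om * rad U t ^+ n)%:E} ->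
  (\int[mu]_x (u x)%:E = \int[leb]_(t in `[0%R, +oo[) mu [set x | (t < m x)%R])%E.
Proof.
move=> mu_ u0 hu; rewrite (layer_cake _ measurableT mu_ u0).
apply: ae_eq_integral.
- exact: measurable_itv.
- rewrite (_ : (fun t => _) = (fun t : R => mu [set x | t < u x])); first exact: mdist.
  by apply/funext => t; rewrite setTI.
- exact: mdist.
apply: (@filterS2 _ _ (ae_filter_ringOfSetsType leb) _ _ _ _ hu dists) => t h1 h2; rewrite /= in_itv/= andbT => t0.
by rewrite setTI h1// h2.
Qed.

(** [U] and its profile recentred at x0 have the same distribution, and almost nested superlevel
    sets give their minimum that distribution too. The three integrals agree, so both functions
    coincide almost everywhere with the minimum. *)
Lemma prof_translate_eq : {ae mu, forall x, U (x + x0) = prof U (enorm x)}.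
Proof.
have UT : (\int[mu]_x (U x)%:E < +oo)%E.
  rewrite -(_ : (\int[mu]_(x in D) (U x)%:E = \int[mu]_x (U x)%:E)%E)//.
  rewrite integral_mkcond; apply: eq_integral => x _; rewrite patchE; case: ifPn => //.
  by rewrite notin_setE => /UD ->.
have dU : {ae leb, forall t, 0 <= t -> mu [set x | t < U x] = (om * rad U t ^+ n)%:E}.
  by apply: aeW => t t0; exact: (radE n0 Dfin UD t0).
have dP : {ae leb, forall t, 0 <= t -> mu [set x | t < P x] = (om * rad U t ^+ n)%:E}.
  by apply: aeW => t t0; have [] := Psup t0.
have cU := cake mU U0 dU; have cP := cake mP P0 dP; have cm := cake mm m0 dists.
have eM (u : V -> R) : measurable_fun setT u -> measurable_fun setT (EFin \o u).
  by move=> h; apply/measurable_EFinP.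
have E1 := @ae_eq_of_integral_le _ _ _ mu setT (EFin \o m) (EFin \o U) measurableT (eM _ mm) (eM _ mU).
have E2 := @ae_eq_of_integral_le _ _ _ mu setT (EFin \o m) (EFin \o P) measurableT (eM _ mm) (eM _ mP).
have {}E1 : {ae mu, forall x, setT x -> (m x)%:E = (U x)%:E}.
  apply: E1 => //.
  - by move=> x _; rewrite lee_fin /m ge_min lexx.
  - by rewrite [leLHS]cU [leRHS]cm.
have {}E2 : {ae mu, forall x, setT x -> (m x)%:E = (P x)%:E}.
  apply: E2 => //.
  - by move=> x _; rewrite lee_fin /m ge_min lexx orbT.
  - by rewrite [leLHS]cP [leRHS]cm.
  - by rewrite [ltLHS]cP -cU.
have E : {ae mu, forall x, U x = P x}.
  apply: filterS2 E1 E2 => x /(_ I) h1 /(_ I); rewrite h1 => -[]; exact.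
by apply: filterS (ae_translate x0 E) => x; rewrite /P addrK.
Qed.

End prof_translate.
Lemma ae_itv_ex (R : realType) (a b : R) (P : R -> Prop) : a < b ->
  {ae @lebesgue_measure R, forall t, P t} -> exists t, a < t < b /\ P t.
Proof.
move=> ab [N [mN N0 PN]]; apply: contrapT => ne.
have : (@lebesgue_measure R `]a, b[%classic <= @lebesgue_measure R N)%E.
  apply: le_measure; rewrite ?inE//.
  by move=> t /=; rewrite in_itv/= => tab; apply: PN => Pt; apply: ne; exists t.
by rewrite N0 lebesgue_measure_itv/= lte_fin ab -EFinD lee_fin leNgt subr_gt0 ab.
Qed.

Section rigidity.
Context (R : realType) (n : nat).
Hypothesis n0 : (0 < n)%N.
Local Notation V := 'rV[R]_n.
Local Notation mu := (@lebesgue R n).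
Local Notation om := (unit_ball_volume R n).
Variables (D : set V) (rho p : R) (W G U E : V -> R) (e : R).
Local Notation B := (eball (0 : V) rho).
Local Notation Z := (prof W).
Local Notation Fs := (prof U).
Local Notation M a := (fine (\int[mu]_(x in eball (0 : V) a) (Fs (enorm x))%:E)).

Hypotheses (mD : measurable D) (rho0 : 0 < rho) (Drho : mu D = (om * rho ^+ n)%:E).
Hypotheses (p1 : 1 < p) (WG : sobolev_limit D W G).
Hypotheses (okW : profile_ok D W) (okU : profile_ok D U) (Upos : dist U 0 = mu D).
Hypothesis GpE : (\int[mu]_x (G x `^ p)%:E <= e%:E)%E.
Hypothesis FZE : (\int[mu]_(x in B) (Fs (enorm x) * Z (enorm x))%:E = e%:E)%E.
Hypothesis Ffin : (\int[mu]_(x in B) (Fs (enorm x))%:E < +oo)%E.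
Hypotheses (mE : measurable_fun B E) (E0 : forall x, 0 <= E x).
Hypothesis EE : (\int[mu]_(x in B) (E x)%:E <= e%:E)%E.
Hypothesis shellE : forall a b k, 0 < a -> a < b -> b <= rho -> 0 <= k ->
  k `^ (p - 1) * (n%:R * om * b ^+ n) <= M a * a ->
  ((om * (b ^+ n - a ^+ n) * k `^ p)%:E <= \int[mu]_(x in shell a b) (E x)%:E)%E.
Hypotheses (bD : bounded_set D) (Wfin : (\int[mu]_(x in D) (W x)%:E < +oo)%E).
Hypothesis UWe : (e%:E <= \int[mu]_(x in D) (U x * W x)%:E)%E.

Let Dfin : (mu D < +oo)%E. Proof. by rewrite Drho ltry. Qed.
Let Dle : (mu D <= (om * rho ^+ n)%:E)%E. Proof. by rewrite Drho. Qed.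
Let mW : measurable_fun setT W. Proof. by case: okW. Qed.
Let WD x : ~ D x -> W x = 0. Proof. by case: okW => _ _; exact. Qed.
Let mU : measurable_fun setT U. Proof. by case: okU. Qed.
Let UD x : ~ D x -> U x = 0. Proof. by case: okU => _ _; exact. Qed.

Let A r : set V := [set x | Z r <= W x].

Let mA r : measurable (A r).
Proof.
have := mW measurableT (measurable_itv `[Z r, +oo[).
by rewrite setTI; congr (measurable _); apply/seteqP; split => x /=; rewrite in_itv/= andbT.
Qed.

Let Zpos a : 0 < a -> a < rho -> 0 < Z a.
Proof. exact: (Z_gt0 n0 rho0 Drho p1 WG okW okU Upos GpE FZE Ffin mE E0 EE shellE). Qed.

Let lge a : 0 < a -> a < rho -> mu (A a) = (om * a ^+ n)%:E.
Proof. exact: (level_ge n0 rho0 Drho p1 WG okW okU Upos GpE FZE Ffin mE E0 EE shellE). Qed.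

Let AD r : 0 < r -> r < rho -> A r `<=` D.
Proof.
move=> r0 rr x; rewrite /A /= => Zx; apply: contrapT => /WD h; move: Zx; rewrite h leNgt.
by rewrite Zpos.
Qed.

Let Z_decr a b : 0 < a -> a < b -> b < rho -> Z b < Z a.
Proof.
move=> a0 ab brho; have b0 := lt_trans a0 ab; have arho := lt_trans ab brho.
rewrite ltNge; apply/negP => Zab.
have : (mu (A b) <= mu (A a))%E.
  by apply: le_lebesgue_outer => x /=; exact: le_trans.
rewrite [X in (X <= _)%E]lge// [X in (_ <= X)%E]lge// lee_fin.
rewrite ler_pM2l ?unit_ball_volume_gt0// leNgt => /negP; apply.
by rewrite ltr_pXn2r// nnegrE ltW.
Qed.

Let Zcontra a b : 0 < a -> a <= b -> Z b <= Z a.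
Proof. exact: (prof_noninc Dfin mW WD). Qed.

(** The sets {Z r <= W} contain almost all of the balls about x0. For [U], equality in
    Hardy-Littlewood says that two superlevel sets of [U] and [W] meet in the smaller of their
    measures, hence that the smaller is almost contained in the larger. *)
Lemma common_center : exists x0 : V,
  [/\ {ae mu, forall x, W (x + x0) = prof W (enorm x)},
      {ae mu, forall x, U (x + x0) = prof U (enorm x)} &
      mu (eball x0 rho `\` D) = 0%E].
Proof.
have [||x0 hx] := @center_ex R n rho n0 rho0 D A bD (fun r _ _ => mA r) AD lge.
- move=> r s r0 rs sr x /= Zx; exact: le_trans (Zcontra r0 rs) Zx.
- move=> a b h a0 ab brho hab.
  exact: (chain n0 rho0 Drho p1 WG okW okU Upos GpE FZE Ffin mE E0 EE shellE).
have levelW t : 0 <= t -> mu (eball x0 (rad W t) `\` [set x | t < W x]) = 0%E.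
  move=> t0; apply: ball_exhaust => b b0 br.
  have brho : b < rho by apply: lt_le_trans br _; apply: (rad_le n0 Dfin WD t0 (ltW rho0) Dle).
  apply: null_sub (hx b b0 brho) => x [xb nt]; split => // Ax; apply: nt => /=.
  by apply: lt_le_trans Ax; rewrite (prof_rad n0 Dfin mW WD).
have Zfin : (\int[mu]_(x in B) (Z (enorm x))%:E < +oo)%E.
  have h := equimeasurable n0 mD (ltW rho0) Drho okW ltr01.
  rewrite (_ : (\int[mu]_(x in B) _)%E = (\int[mu]_(x in B) (Z (enorm x) `^ 1)%:E)%E).
    rewrite h (_ : (\int[mu]_(x in D) _)%E = (\int[mu]_(x in D) (W x)%:E)%E); first exact: Wfin.
    by apply: eq_integral => x _; rewrite powRr1; [|case: okW].
  by apply: eq_integral => x _; rewrite powRr1; [|exact: prof_ge0].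
have Ufin : (\int[mu]_(x in D) (U x)%:E < +oo)%E.
  have h := equimeasurable n0 mD (ltW rho0) Drho okU ltr01.
  rewrite (_ : (\int[mu]_(x in D) _)%E = (\int[mu]_(x in D) (U x `^ 1)%:E)%E).
    rewrite -h (_ : (\int[mu]_(x in B) _)%E = (\int[mu]_(x in B) (Fs (enorm x))%:E)%E); first exact: Ffin.
    by apply: eq_integral => x _; rewrite powRr1; [|exact: prof_ge0].
  by apply: eq_integral => x _; rewrite powRr1; [|case: okU].
exists x0; split.
- by apply: (prof_translate_eq n0 Dfin okW Wfin); apply: aeW => t; exact: levelW.
- apply: (prof_translate_eq n0 Dfin okU Ufin).
  have hl : (\int[mu]_(x in B) (prof U (enorm x) * prof W (enorm x))%:E <=
      \int[mu]_(x in D) (U x * W x)%:E)%E by rewrite FZE.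
  have hlf : (\int[mu]_(x in B) (prof U (enorm x) * prof W (enorm x))%:E < +oo)%E.
    by rewrite FZE ltry.
  have := hardy_littlewood_eq n0 mD (ltW rho0) Drho okU okW hl hlf Zfin.
  apply: (@filterS _ _ (ae_filter_ringOfSetsType (@lebesgue_measure R))) => s hs s0.
  move/(_ s0): hs => hs; apply: ball_exhaust => b b0 br.
  have rrho : rad U s <= rho by exact: (rad_le n0 Dfin UD s0 (ltW rho0) Dle).
  have [b' [bb' b'r]] : exists b', b < b' /\ b' < rad U s by exists ((b + rad U s) / 2); lra.
  have b'0 := lt_trans b0 bb'; have b'rho := lt_le_trans b'r rrho.
  have brho := lt_trans bb' b'rho.
  (* Equality holds only for almost every level t, so t is taken in the nonempty interval between
     [Z b'] and [Z b]: then {Z b <= W} lies in {t < W}, which is smaller than {s < U}. *)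
  have [t [/andP[Zt tZ] ht]] := ae_itv_ex (Z_decr b0 bb' b'rho) hs.
  have t0 : 0 <= t by rewrite (le_trans _ (ltW Zt))// prof_ge0.
  move/(_ t0): ht => ht.
  have rt : rad W t <= b'.
    by rewrite leNgt -(prof_rad n0 Dfin mW WD t0 b'0) -leNgt ltW.
  rewrite min_r in ht; last exact: ltW (le_lt_trans rt b'r).
  have mWt : measurable [set x | t < W x].
    have := mW measurableT (measurable_itv `]t, +oo[).
    by rewrite setTI; congr (measurable _); apply/seteqP; split => x /=; rewrite in_itv/= andbT.
  have mUs : measurable (D `&` [set x | s < U x]).
    apply: measurableI => //.
    have := mU measurableT (measurable_itv `]s, +oo[).
    by rewrite setTI; congr (measurable _); apply/seteqP; split => x /=; rewrite in_itv/= andbT.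
  have Wt : mu [set x | t < W x] = (om * rad W t ^+ n)%:E := radE n0 Dfin WD t0.
  have null : mu ([set x | t < W x] `\` (D `&` [set x | s < U x])) = 0%E.
    rewrite measureD//; last by rewrite [X in (X < _)%E]Wt ltry.
    by rewrite [X in (X - _)%E]Wt setIC [X in (_ - X)%E]ht subee.
  have n1 : mu (A b `\` (D `&` [set x | s < U x])) = 0%E.
    by apply: null_sub null => x [Ax nx]; split => //=; exact: lt_le_trans tZ Ax.
  have n2 := null_setD_trans (hx b b0 brho) n1.
  by apply: null_sub n2 => x [xb nx]; split => // -[].
- apply: ball_exhaust => b b0 br; apply: null_sub (hx b b0 br) => x [xb nD].
  by split => // Ax; apply: nD; exact: AD Ax.
Qed.

End rigidity.

(** * Lipschitz domains *)
Section domains.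
Context (R : realType) (n : nat).
Local Notation V := 'rV[R]_n.
Local Notation mu := (@lebesgue R n).

Lemma enorm_orthogonal (Q : 'M[R]_n) (v : V) : Q *m Q^T = 1%:M -> enorm (v *m Q) = enorm v.
Proof.
move=> QQ; have dE (u : V) : dotv u u = (u *m u^T) ord0 ord0.
  by rewrite mxE; apply: eq_bigr => i _; rewrite mxE.
by rewrite /enorm !dE trmx_mul mulmxA -(mulmxA v) QQ mulmx1.
Qed.

(* Moving from y by a small multiple of the epigraph direction leaves the
   epigraph, together with a small ball. *)
Lemma lipschitz_exterior (Omega : set V) (y : V) (d : R) : lipschitz_domain Omega ->
  (closure Omega `\` interior Omega) y -> ~ Omega y -> 0 < d ->
  (0 < mu (eball y d `\` Omega))%E.
Proof.
move=> lip cy ny d0; have [r [Q [i [gamma [r0 QQ lg gE]]]]] := lip y cy.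
have [K K0 hK] := pinfty_ex_gt0 lg.
have gK u v : `|gamma u - gamma v| <= K * `|u - v| by exact: (hK (u, v)).
have QQ' : Q^T *m Q = 1%:M by exact: mulmx1C.
pose m := Num.min r d; have m0 : 0 < m by rewrite lt_min r0.
pose t := m / 2; have t0 : 0 < t by rewrite divr_gt0.
have K1 : 0 < K + 1 by rewrite addr_gt0.
pose dl := t / (K + 1); have dl0 : 0 < dl by rewrite divr_gt0.
have dlE : K * dl + dl = t by rewrite -[X in _ + X]mul1r -mulrDl mulrC divfK ?gt_eqF.
have dlt : dl <= t by rewrite -dlE lerDr mulr_ge0// ltW.
pose v : V := t *: (delta_mx ord0 i *m Q^T); pose q := y - v.
have vQ : v *m Q = t *: delta_mx ord0 i by rewrite -scalemxAl -mulmxA QQ' mulmx1.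
have ev : enorm v = t.
  rewrite -(enorm_orthogonal v QQ) vQ enormZ gtr0_norm// /enorm /dotv (bigD1 i)//= big1 ?addr0.
    by rewrite !mxE !eqxx mulr1 sqrtr1 mulr1.
  by move=> j ji; rewrite !mxE (negbTE ji) andbF mulr0.
apply: lt_le_trans (lebesgue_eball_gt0 q dl0) _; apply: le_lebesgue_outer => x xq.
have xy : enorm (x - y) < m.
  apply: le_lt_trans (enormB_le x q y) _.
  have -> : q - y = - v by rewrite /q addrAC subrr add0r.
  rewrite enormN ev [m](_ : _ = t + t); last by rewrite /t; lra.
  by rewrite ltr_leD//; exact: lt_le_trans xq dlt.
split; first by apply: lt_le_trans xy _; rewrite /m ge_min lexx orbT.
have xr : eball y r x by apply: lt_le_trans xy _; rewrite /m ge_min lexx.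
have yr : eball y r y by rewrite /eball /= subrr enorm0.
move/(gE x xr); apply/negP; rewrite -leNgt.
have gy : (y *m Q) ord0 i <= gamma (col' i (y *m Q)).
  by rewrite leNgt; apply/negP => /(gE y yr).
have xE : x *m Q = y *m Q - t *: delta_mx ord0 i + (x - q) *m Q.
  by rewrite -vQ -mulmxBl -mulmxDl -/q addrC subrK.
have eQ : enorm ((x - q) *m Q) < dl by rewrite enorm_orthogonal.
have c1 : (x *m Q) ord0 i <= (y *m Q) ord0 i - t + dl.
  have := le_lt_trans (coord_le_enorm ((x - q) *m Q) i) eQ; rewrite ltr_norml => /andP[_ h].
  suff -> : (x *m Q) ord0 i = (y *m Q) ord0 i - t + ((x - q) *m Q) ord0 i by rewrite lerD2l ltW.
  rewrite xE [LHS]mxE [X in X + _ = _]mxE [X in _ + X + _ = _]mxE [X in _ - X + _ = _]mxE.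
  suff -> : (delta_mx ord0 i : V) ord0 i = 1 by rewrite mulr1.
  by rewrite mxE !eqxx.
have c2 : gamma (col' i (y *m Q)) - K * dl <= gamma (col' i (x *m Q)).
  have : `|gamma (col' i (y *m Q)) - gamma (col' i (x *m Q))| <= K * dl.
    apply: le_trans (gK _ _) _; rewrite ler_pM2l//.
    rewrite [leLHS]mx_normrE; apply/bigmax_leP; split => [|[a j] _ /=]; first exact: ltW.
    have cE (C : V) : (col' i C) a j = C ord0 (lift i j) by rewrite mxE (ord1 a).
    have L : (x *m Q) ord0 (lift i j) = (y *m Q) ord0 (lift i j) + ((x - q) *m Q) ord0 (lift i j).
      rewrite xE [LHS]mxE [X in X + _ = _]mxE [X in _ + X + _ = _]mxE [X in _ - X + _ = _]mxE.
      suff -> : (delta_mx ord0 i : V) ord0 (lift i j) = 0 by rewrite mulr0 subr0.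
      by rewrite mxE (eq_sym _ i) (negbTE (neq_lift i j)) andbF.
    rewrite [X in `|X|]mxE [X in _ + X]mxE !cE L opprD addrA subrr sub0r normrN.
    exact: le_trans (coord_le_enorm ((x - q) *m Q) (lift i j)) (ltW eQ).
  by rewrite ler_norml => /andP[_]; lra.
have : K * dl + dl = t by []. lra.
Qed.

(** A point of [Omega] outside the ball, pushed outwards by half of a radius available in [Omega],
    is the centre of a small ball of positive measure in the difference. A point of the ball missing
    from [Omega] is a limit of points of [Omega], hence a boundary point, near which
    [lipschitz_exterior] finds positive measure outside [Omega]; this excludes slits and
    punctures. *)
Lemma open_lipschitz_eball (Omega : set V) (x0 : V) (rho : R) : 0 < rho -> open Omega ->
  lipschitz_domain Omega -> mu (Omega `\` eball x0 rho) = 0%E ->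
  mu (eball x0 rho `\` Omega) = 0%E -> Omega = eball x0 rho.
Proof.
move=> rho0 oO lip n1 n2; apply/seteqP; split => x.
  move=> Ox; apply: contrapT => nx.
  have N1 : rho <= enorm (x - x0) by rewrite leNgt; apply/negP.
  have N0 := lt_le_trans rho0 N1.
  have [e e0 eO] := (open_eballP Omega).1 oO x Ox.
  have e2 : 0 < e / 2 by rewrite divr_gt0.
  pose s := e / 2 / enorm (x - x0); have s0 : 0 < s by rewrite divr_gt0.
  pose x' := x + s *: (x - x0).
  have xx' : enorm (x' - x) = e / 2.
    by rewrite /x' addrAC subrr add0r enormZ gtr0_norm// divfK ?gt_eqF.
  have x'0 : enorm (x' - x0) = enorm (x - x0) + e / 2.
    have -> : x' - x0 = (1 + s) *: (x - x0) by rewrite scalerDl scale1r /x' addrAC.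
    by rewrite enormZ gtr0_norm ?addr_gt0// mulrDl mul1r divfK ?gt_eqF.
  have : (mu (eball x' (e / 2)) <= mu (Omega `\` eball x0 rho))%E.
    apply: le_lebesgue_outer => y yx'; split.
      apply: eO; apply: le_lt_trans (enormB_le y x' x) _.
      by rewrite xx' [ltRHS](splitr e) ltrD2r.
    apply/negP; rewrite -leNgt; apply: le_trans N1 _.
    have := enormB_le x' y x0; rewrite x'0 (enormBC x'); move: yx'; rewrite /eball /=; lra.
  by rewrite [X in (_ <= X)%E]n1 leNgt lebesgue_eball_gt0.
move=> xb; apply: contrapT => nx.
have [d d0 dB] := (open_eballP _).1 (@open_eball R n x0 rho) x xb.
have sub e : e <= d -> (mu (eball x e `\` Omega) = 0)%E.
  by move=> ed; apply: null_sub n2 => y [ye yO]; split => //; apply: dB; exact: lt_le_trans ye ed.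
have cx : closure Omega x.
  move=> S /nbhs_ballP[e /= e0 eS].
  apply: contrapT => ne; pose e' := Num.min e d.
  have e'0 : 0 < e' by rewrite lt_min e0.
  have : (mu (eball x e') <= mu (eball x e' `\` Omega))%E.
    apply: le_lebesgue_outer => y ye; split => // yO; apply: ne; exists y; split => //.
    apply: eS; apply: eball_sub_ball => //; apply: lt_le_trans ye _.
    by rewrite ge_min lexx.
  by rewrite [X in (_ <= X)%E]sub ?ge_min ?lexx ?orbT// leNgt lebesgue_eball_gt0.
have := lipschitz_exterior lip (conj cx _) nx d0; rewrite [X in (_ < X)%E]sub// ltxx => h.
by have [] // := notF; apply: h => /interior_subset.
Qed.

End domains.

Section equality_cases.
Context d (T : measurableType d) (R : realType) (m : {measure set T -> \bar R}).

Lemma young_mul (p a k : R) : 1 < p -> 0 <= a -> 0 <= k ->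
  p * (a * k) <= (p - 1) * a `^ (p / (p - 1)) + k `^ p.
Proof.
move=> p1 a0 k0; have p1n : p - 1 != 0 by rewrite subr_eq0 gt_eqF.
have := young_powR p1 (powR_ge0 a (p - 1)^-1) k0.
by rewrite -!powRrM mulVf// powRr1// [_^-1 * p]mulrC.
Qed.

Lemma int_mul_lty (D : set T) (p : R) (f g : T -> R) : 1 < p -> measurable D ->
  measurable_fun D f -> measurable_fun D g ->
  (forall x, 0 <= f x) -> (forall x, 0 <= g x) ->
  (\int[m]_(x in D) (f x `^ (p / (p - 1)))%:E < +oo)%E ->
  (\int[m]_(x in D) (g x `^ p)%:E < +oo)%E ->
  (\int[m]_(x in D) (f x * g x)%:E < +oo)%E.
Proof.
move=> p1 mD mf mg f0 g0 ff gf; have p0 : 0 < p by lra.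
have p10 : 0 <= p - 1 by lra.
have mfp := measurable_powRf (p / (p - 1)) mf; have mgp := measurable_powRf p mg.
have mfp' : measurable_fun D (fun x => (p - 1) * f x `^ (p / (p - 1))).
  exact: measurable_funM (measurable_cst _) mfp.
apply: (@le_lt_trans _ _ (\int[m]_(x in D) ((p - 1) * f x `^ (p / (p - 1)) + g x `^ p)%:E)%E).
  apply: int_leD.
  - exact: mD.
  - exact: measurable_funM mf mg.
  - exact: measurable_funD mfp' mgp.
  - by move=> x; rewrite mulr_ge0.
  - move=> x _; apply: le_trans (young_mul p1 (f0 x) (g0 x)).
    by rewrite ler_peMl ?mulr_ge0// ltW.
rewrite intDD.
- rewrite intZD; [|exact: mD|exact: mfp|by move=> x; exact: powR_ge0|exact: p10].
  by apply: lte_add_pinfty; [apply: lte_mul_pinfty; [rewrite lee_fin|exact: fin_numE|exact: ff]|exact: gf].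
- exact: mD.
- exact: mfp'.
- exact: mgp.
- by move=> x; rewrite mulr_ge0 ?powR_ge0.
- by move=> x; exact: powR_ge0.
Qed.

(** The positive part of h lies below |h| and its integral is at least that of |h|, so the two agree
    almost everywhere. *)
Lemma ae_ge0_of_integral (D : set T) (h : T -> R) : measurable D -> measurable_fun D h ->
  (\int[m]_(x in D) `|h x|%:E <= (\int[m]_(x in D) h x)%:E)%E ->
  {ae m, forall x, D x -> 0 <= h x}.
Proof.
move=> mD mh hle; have mh' : measurable_fun D (fun x => `|h x|) := measurable_normf mh.
have hfin : (\int[m]_(x in D) `|h x|%:E < +oo)%E := le_lt_trans hle (ltry _).
have ih : m.-integrable D (EFin \o h) by apply/integrableP; split => //; exact/measurable_EFinP.
pose k x := Num.max (h x) 0.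
have mk : measurable_fun D k by exact: measurable_maxr mh (measurable_cst _).
have k0 x : 0 <= k x by rewrite /k le_max lexx orbT.
have kh x : k x <= `|h x| by rewrite /k ge_max ler_norm normr_ge0.
have hk : (\int[m]_(x in D) `|h x|%:E <= \int[m]_(x in D) (k x)%:E)%E.
  apply: le_trans hle _; rewrite -fineRint//.
  apply: le_integral => //; last by move=> x _; rewrite lee_fin /k le_max lexx.
  apply: le_integrable ih => //; first exact/measurable_EFinP.
  by move=> x _; rewrite /= lee_fin (ger0_norm (k0 x)).
have := @ae_eq_of_integral_le _ _ _ m D (EFin \o k) (fun x => `|h x|%:E) mD.
have mkE : measurable_fun D (EFin \o k) by exact/measurable_EFinP.
have mhE : measurable_fun D (fun x => `|h x|%:E) by exact/measurable_EFinP.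
move=> /(_ mkE mhE _ _ hk hfin) H.
have {}H := H (fun x => k0 x) (fun x _ => kh x).
apply: filterS H => x hx Dx; have := hx Dx => -[].
rewrite /k; case: (leP (h x) 0) => [_ /esym/eqP|/ltW//].
by rewrite normr_eq0 => /eqP ->.
Qed.

Lemma profile_abs n (D : set 'rV[R]_n) (h : 'rV[R]_n -> R) : measurable D ->
  measurable_fun D h -> profile_ok D ((fun x => `|h x|) \_ D).
Proof.
move=> mD mh; split.
- exact: measurable_restrictf mD (measurable_normf mh).
- by move=> x; rewrite patchE; case: ifP.
- by move=> x Dx; rewrite patchE memNset.
Qed.

End equality_cases.

Lemma enorm_dotv_powR (R : realType) (n : nat) (p : R) (g : 'rV[R]_n) : 1 < p ->
  enorm g `^ (p - 2) * dotv g g = enorm g `^ p.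
Proof.
move=> p1; rewrite -sqr_enorm; have [->|g0] := eqVneq (enorm g) 0.
  by rewrite expr0n mulr0 powR0// gt_eqF//; lra.
rewrite -powR_mulrn ?enorm_ge0// -powRD ?subrK//.
by rewrite g0 implybT.
Qed.

Lemma eball_bounded (R : realType) (n : nat) (r : R) : bounded_set (eball (0 : 'rV[R]_n) r).
Proof.
exists r; split; first exact: num_real.
move=> M rM x; rewrite /eball /= subr0 => xr; rewrite [leLHS]mx_normrE.
apply/bigmax_leP; split => [|[k i] _ /=].
  by rewrite ltW// (le_lt_trans (enorm_ge0 x))// (lt_trans xr).
by rewrite (ord1 k) (le_trans (coord_le_enorm x i))// ltW// (lt_trans xr).
Qed.

(** * Weak solutions *)
Section solutions.
Context (R : realType) (n : nat).
Local Notation V := 'rV[R]_n.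
Local Notation mu := (@lebesgue R n).

Lemma solution_energy (Omega : set V) (p : R) (F u : V -> R) (g : V -> V) :
  1 < p -> measurable Omega -> W1p0 Omega p u g ->
  (forall phi psi, W1p0 Omega p phi psi ->
      \int[mu]_(x in Omega) (enorm (g x) `^ (p - 2) * dotv (g x) (psi x)) =
      \int[mu]_(x in Omega) (F x * phi x)) ->
  (\int[mu]_(x in Omega) (enorm (g x) `^ p)%:E = (\int[mu]_(x in Omega) (F x * u x))%:E)%E.
Proof.
move=> p1 mO Wu /(_ u g Wu) <-; have [[_ Lg _] _] := Wu.
have p0 : 0 < p by exact: lt_trans p1.
have gf := Lp_enorm p0 mO Lg.
rewrite /Rintegral; have -> : (fun x => (enorm (g x) `^ (p - 2) * dotv (g x) (g x))%:E) =
    (fun x => (enorm (g x) `^ p)%:E).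
  by apply/funext => x; rewrite enorm_dotv_powR.
by rewrite fineK// ge0_fin_numE// int_ge0// => x; exact: powR_ge0.
Qed.

Lemma Lp_integral_lty (Omega : set V) (p : R) (u : V -> R) : 1 < p -> measurable Omega ->
  (mu Omega < +oo)%E -> Lp Omega p u -> (\int[mu]_(x in Omega) `|u x|%:E < +oo)%E.
Proof.
move=> p1 mO Ofin [mu_ uf].
apply: le_lt_trans (int_le_powR mO p1 ltr01 (measurable_normf mu_)
  (fun x => normr_ge0 (u x)) (lexx _)) _.
rewrite powR1 !mul1e; exact: lte_add_pinfty.
Qed.

End solutions.

Section rigid_solutions.
Context (R : realType) (n : nat).
Hypothesis n0 : (0 < n)%N.
Local Notation V := 'rV[R]_n.
Local Notation mu := (@lebesgue R n).
Local Notation om := (unit_ball_volume R n).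
Variables (p : R) (Omega : set V) (rho : R) (f w z : V -> R).
Local Notation B := (eball (0 : V) rho).
Hypotheses (p1 : 1 < p) (oO : open Omega) (bO : bounded_set Omega) (rho0 : 0 < rho).
Hypotheses (BO : mu B = mu Omega) (Lf : Lp Omega (p / (p - 1)) f).
Hypotheses (fpos : {ae mu, forall x, Omega x -> 0 < f x}).
Hypotheses (sw : weak_solution Omega p f w) (sz : weak_solution B p (schwarz Omega f) z).
Hypothesis wz : forall x, B x -> schwarz Omega w x = z x.

Local Notation W := ((fun x => `|w x|) \_ Omega).
Local Notation U := ((fun x => `|f x|) \_ Omega).

Let mO : measurable Omega. Proof. exact: measurable_open. Qed.
Let mB : measurable B. Proof. exact: measurable_eball. Qed.
Let Drho : mu Omega = (om * rho ^+ n)%:E. Proof. by rewrite -BO lebesgue_eball. Qed.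
Let Ofin : (mu Omega < +oo)%E. Proof. exact: bounded_lty. Qed.
Let p0 : 0 < p. Proof. exact: lt_trans p1. Qed.
Let q1 : 1 < p / (p - 1).
Proof. by rewrite ltr_pdivlMr ?subr_gt0// mul1r gtrBl. Qed.
Let mf : measurable_fun Omega f. Proof. by case: Lf. Qed.
Let Lw : Lp Omega p w. Proof. by case: sw => g [[]]. Qed.
Let mw : measurable_fun Omega w. Proof. by case: Lw. Qed.
Let okW : profile_ok Omega W. Proof. exact: profile_abs. Qed.
Let okU : profile_ok Omega U. Proof. exact: profile_abs. Qed.
Let mW : measurable_fun setT W. Proof. by case: okW. Qed.
Let mU : measurable_fun setT U. Proof. by case: okU. Qed.
Let WD x : ~ Omega x -> W x = 0. Proof. by case: okW => _ _; exact. Qed.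
Let UD x : ~ Omega x -> U x = 0. Proof. by case: okU => _ _; exact. Qed.

Let onO (h : V -> R) x : Omega x -> ((fun x => `|h x|) \_ Omega) x = `|h x|.
Proof. by move=> Ox; rewrite patchE mem_set. Qed.

Let fE : schwarz Omega f = fun x => prof U (enorm x).
Proof. by apply/funext => x; exact: schwarzE. Qed.

Let zE x : B x -> z x = prof W (enorm x).
Proof. by move=> Bx; rewrite -wz// schwarzE. Qed.

Let mPU : measurable_fun B (fun x => prof U (enorm x)).
Proof. by apply: measurable_funTS; exact: (measurable_prof n0 Ofin mU UD). Qed.

Let mPW : measurable_fun B (fun x => prof W (enorm x)).
Proof. by apply: measurable_funTS; exact: (measurable_prof n0 Ofin mW WD). Qed.

Let intU : (\int[mu]_(x in Omega) (U x)%:E < +oo)%E.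
Proof.
rewrite (eq_integral (fun x => `|f x|%:E)); first exact: Lp_integral_lty q1 mO Ofin Lf.
by move=> x; rewrite inE => /onO ->.
Qed.

Let intW : (\int[mu]_(x in Omega) (W x)%:E < +oo)%E.
Proof.
rewrite (eq_integral (fun x => `|w x|%:E)); first exact: Lp_integral_lty p1 mO Ofin Lw.
by move=> x; rewrite inE => /onO ->.
Qed.

Let intPU : (\int[mu]_(x in B) (prof U (enorm x))%:E < +oo)%E.
Proof.
have h := equimeasurable n0 mO (ltW rho0) Drho okU ltr01.
rewrite (eq_integral (fun x => (prof U (enorm x) `^ 1)%:E)); last first.
  by move=> x _; rewrite powRr1; [|exact: prof_ge0].
rewrite h (eq_integral (fun x => (U x)%:E)); first exact: intU.
by move=> x _; rewrite powRr1; [|case: okU].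
Qed.

Let PUW_lty : (\int[mu]_(x in B) (prof U (enorm x) * prof W (enorm x))%:E < +oo)%E.
Proof.
apply: (int_mul_lty p1 mB mPU mPW).
- by move=> x; exact: prof_ge0.
- by move=> x; exact: prof_ge0.
- have h := equimeasurable n0 mO (ltW rho0) Drho okU (lt_trans ltr01 q1).
  rewrite h (eq_integral (fun x => (`|f x| `^ (p / (p - 1)))%:E)); first by case: Lf.
  by move=> x; rewrite inE => /onO ->.
- have h := equimeasurable n0 mO (ltW rho0) Drho okW p0.
  rewrite h (eq_integral (fun x => (`|w x| `^ p)%:E)); first by case: Lw.
  by move=> x; rewrite inE => /onO ->.
Qed.

Let e := fine (\int[mu]_(x in B) (prof U (enorm x) * prof W (enorm x))%:E).

Let PUW : (\int[mu]_(x in B) (prof U (enorm x) * prof W (enorm x))%:E = e%:E)%E.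
Proof.
rewrite fineK// ge0_fin_numE; first exact: PUW_lty.
by apply: int_ge0 => x; rewrite mulr_ge0 ?prof_ge0.
Qed.

Let UWE : (\int[mu]_(x in Omega) (U x * W x)%:E = \int[mu]_(x in Omega) `|f x * w x|%:E)%E.
Proof. by apply: eq_integral => x; rewrite inE => Ox; rewrite !onO// normrM. Qed.

Let UW_le : (\int[mu]_(x in Omega) `|f x * w x|%:E <= e%:E)%E.
Proof. by rewrite -UWE -PUW; exact: (hardy_littlewood n0 mO (ltW rho0) Drho okU okW). Qed.

Let Upos : dist U 0 = mu Omega.
Proof.
apply/eqP; rewrite eq_le; apply/andP; split; first exact: (dist_leD UD (lexx _)).
have /negligible_null := fpos => /le_mu_null; apply => x Ox.
have [fx|fx] := pselect (0 < f x).
  by left; rewrite /= onO// normr_gt0 gt_eqF.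
by right => /(_ Ox).
Qed.

(** The solutions used as their own test functions give the energies: that of w is the integral of f
    w, hence at most that of |f w|, hence at most e; that of z is e, z being the profile of |w| on
    the ball. *)
Lemma solution_rigidity : exists x0 : V,
  [/\ {ae mu, forall x, B x -> Omega (x + x0) -> w (x + x0) = z x},
      {ae mu, forall x, B x -> Omega (x + x0) -> f (x + x0) = schwarz Omega f x} &
      mu (eball x0 rho `\` Omega) = 0%E].
Proof.
have [gw Ww wweak] := sw; have [gz Wz zweak] := sz.
pose G := (fun x => enorm (gw x)) \_ Omega.
pose E x := enorm (gz x) `^ p.
have WG := W1p0_sobolev_limit p1 oO bO Ww.
have [[_ Lgz _] _] := Wz.
have Ew := solution_energy p1 mO Ww wweak.
have GE : (\int[mu]_x (G x `^ p)%:E = (\int[mu]_(x in Omega) (f x * w x))%:E)%E.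
  rewrite -Ew [RHS]int_restrict; apply: eq_integral => x _; rewrite /G !patchE.
  by case: ifP => // _; rewrite powR0// gt_eqF.
have mfw : measurable_fun Omega (fun x => f x * w x) by exact: measurable_funM mf mw.
have GpE : (\int[mu]_x (G x `^ p)%:E <= e%:E)%E.
  by rewrite GE lee_fin; exact: fine_int_le_norm mO mfw UW_le.
have mE : measurable_fun B E.
  by apply: measurable_powRf; apply: measurable_enorm => i; case: (Lgz i).
have E0 x : 0 <= E x by exact: powR_ge0.
have EE : (\int[mu]_(x in B) (E x)%:E <= e%:E)%E.
  rewrite /E (solution_energy p1 mB Wz zweak) lee_fin /e /Rintegral.
  rewrite (eq_integral (fun x => (prof U (enorm x) * prof W (enorm x))%:E))//.
  by move=> x; rewrite inE => Bx; rewrite fE zE.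
have weak phi : test_function B phi ->
    \int[mu]_(x in B) (enorm (gz x) `^ (p - 2) * dotv (gz x) (grad phi x)) =
    \int[mu]_(x in B) (prof U (enorm x) * phi x).
  move=> tphi; have := zweak _ _ (test_W1p0 p1 (@open_eball R n 0 rho) (@eball_bounded R n rho) tphi).
  by rewrite fE.
have shellE a b k : 0 < a -> a < b -> b <= rho -> 0 <= k ->
    k `^ (p - 1) * (n%:R * om * b ^+ n) <=
      fine (\int[mu]_(x in eball (0 : V) a) (prof U (enorm x))%:E) * a ->
    ((om * (b ^+ n - a ^+ n) * k `^ p)%:E <= \int[mu]_(x in shell a b) (E x)%:E)%E.
  move=> a0 ab br k0 hk.
  by apply: (flux_energy n0 p1 Lgz mPU _ intPU weak a0 ab br k0 hk) => x; exact: prof_ge0.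
(* This closes the chain of inequalities. The integrals of f w and |f w| coincide, which gives the
   sign of w where f is positive, and Hardy-Littlewood is an equality. *)
have ege := energy_ge n0 rho0 Drho p1 WG okW okU GpE PUW intPU mE E0 EE shellE.
have wpos : {ae mu, forall x, Omega x -> 0 <= w x}.
  have h : (\int[mu]_(x in Omega) `|f x * w x|%:E <= (\int[mu]_(x in Omega) (f x * w x))%:E)%E.
    by apply: le_trans UW_le _; rewrite -GE.
  have := ae_ge0_of_integral mO mfw h.
  by apply: filterS2 fpos => x fx fwx Ox; have := fwx Ox; rewrite pmulr_rge0// fx.
have UWe : (e%:E <= \int[mu]_(x in Omega) (U x * W x)%:E)%E.
  have fin : (\int[mu]_(x in Omega) `|f x * w x|%:E)%E =
      (fine (\int[mu]_(x in Omega) `|f x * w x|%:E))%:E.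
    rewrite fineK// ge0_fin_numE; first exact: le_lt_trans UW_le (ltry _).
    by apply: int_ge0.
  apply: le_trans ege _; rewrite UWE GE fin lee_fin.
  by apply: fine_int_le_norm mO mfw _; rewrite -fin.
have [x0 [hW hU hB]] := common_center n0 mO rho0 Drho p1 WG okW okU Upos GpE PUW intPU
  mE E0 EE shellE bO intW UWe.
exists x0; split => //.
- have := ae_translate x0 wpos; apply: filterS2 hW => x hx wx Bx Ox.
  by rewrite zE// -hx onO// ger0_norm// wx.
- have := ae_translate x0 fpos; apply: filterS2 hU => x hx fx Bx Ox.
  by rewrite fE -hx onO// gtr0_norm// fx.
Qed.

End rigid_solutions.
Theorem corollary3p3 (R : realType) (n : nat) (p : R) (Omega : set 'rV[R]_n)
    (rho : R) (f w z : 'rV[R]_n -> R) :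
  (2 <= n)%N -> 1 < p ->
  open Omega -> bounded_set Omega -> lipschitz_domain Omega ->
  let Omega_sharp := eball (0 : 'rV[R]_n) rho in
  lebesgue Omega_sharp = lebesgue Omega ->
  Lp Omega (p / (p - 1)) f ->
  {ae lebesgue, forall x, Omega x -> 0 < f x} ->
  weak_solution Omega p f w ->
  weak_solution Omega_sharp p (schwarz Omega f) z ->
  (forall x, Omega_sharp x -> schwarz Omega w x = z x) ->
  exists x0 : 'rV[R]_n,
    [/\ Omega = [set x + x0 | x in Omega_sharp],
        {ae lebesgue, forall x, Omega_sharp x -> w (x + x0) = z x} &
        {ae lebesgue, forall x, Omega_sharp x ->
                        f (x + x0) = schwarz Omega f x}].
Proof.
move=> n2 p1 oO bO lO B BO Lf fpos sw sz wz.
have n0 : (0 < n)%N by exact: ltn_trans n2.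
(* If rho <= 0 the ball is empty, and the open set [Omega], being null, is empty too. *)
have [rho0|rho0] := leP rho 0.
  have B0 : B = set0.
    apply/seteqP; split => // x Bx.
    by have := le_lt_trans (enorm_ge0 _) (lt_le_trans Bx rho0); rewrite ltxx.
  have O0 : Omega = set0.
    apply/seteqP; split => // x Ox; have := lebesgue_open_gt0 oO (ex_intro _ x Ox).
    by rewrite [X in (_ < X)%E](esym BO) B0 measure0 ltxx.
  exists 0; rewrite B0 image_set0; split => //; by apply: aeW.
have [x0 [hw hf null]] := solution_rigidity n0 p1 oO bO rho0 BO Lf fpos sw sz wz.
have Bx0 : lebesgue (eball x0 rho) = lebesgue Omega by rewrite -BO !lebesgue_eball.
have mO := measurable_open oO.
have null' := null_setD_sym (measurable_eball x0 rho) mO (bounded_lty bO) Bx0 null.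
have OE := open_lipschitz_eball rho0 oO lO null' null.
have Oshift x : B x -> Omega (x + x0) by rewrite OE /B /eball /= subr0 addrK.
exists x0; split.
- by rewrite OE /B eball_translate add0r.
- by apply: filterS hw => x hx Bx; exact: hx Bx (Oshift x Bx).
- by apply: filterS hf => x hx Bx; exact: hx Bx (Oshift x Bx).
Qed.
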